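(* Let $G$ be an infinite residually finite countable discrete group with Kazhdan's property $(T)$. Suppose that $(\pi_k,H_k)_{k\ge 0}$ lists every equivalence class of finite-dimensional irreducible unitary representations of $G$ exactly once. Write $d_k=\dim H_k$, and assume $$\pi_0=1_G,\qquad 1=d_0\le d_1\le d_2\le\cdots,\qquad d_k\to\infty,\qquad R_0:=\sup_{k\ge1}\frac{d_k}{d_{k-1}}<\infty.$$ Then for every integer $b>R_0$ and every choice of Hilbert-space isometries $J_k:H_{k-1}\to H_k$ ($k\ge1$; not assumed to be intertwining maps), the $C^*$-algebra $A$ constructed from the data $\bigl(G,(\pi_k,H_k)_{k\ge0},(J_k)_{k\ge1},b\bigr)$ as described in the context is separable, unital and residually finite-dimensional. It admits a faithful quasidiagonal tracial state $\tau$ and tracial states $\mu_1,\mu_2$ such that $$\tau=\tfrac14\mu_1+\tfrac34\mu_2,\qquad \mu_1\notin T_{\mathrm{qd}}(A).$$ Consequently $T_{\mathrm{qd}}(A)$ is not a face of $T(A)$.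
   Context: Conventions. $M_n=B(\mathbb C^n)$; $\operatorname{tr}_n$ is the normalized trace on $M_n$. For a unital $C^*$-algebra $B$, $T(B)$ is the set of tracial states. A trace $\lambda\in T(B)$ is quasidiagonal, written $\lambda\in T_{\mathrm{qd}}(B)$, if there are unital completely positive maps $\psi_j:B\to M_{N_j}$ ($j\in\mathbb N$) such that $\|\psi_j(ab)-\psi_j(a)\psi_j(b)\|\to0$ (operator norm) and $\operatorname{tr}_{N_j}(\psi_j(a))\to\lambda(a)$ for all $a,b\in B$. A $C^*$-algebra is residually finite-dimensional (RFD) if its finite-dimensional representations separate points. A convex subset $F\subseteq T(B)$ is a face if $t\lambda_1+(1-t)\lambda_2\in F$ with $\lambda_1,\lambda_2\in T(B)$ and $0<t<1$ implies $\lambda_1,\lambda_2\in F$. $1_G$ is the trivial one-dimensional representation. An overline denotes the conjugate Hilbert space, conjugate representation or conjugate operator: $\overline H$ is the conjugate of $H$, $\overline\pi(g)\overline\xi=\overline{\pi(g)\xi}$, $\overline J\,\overline\xi=\overline{J\xi}$. Construction of $A$. Put $V_\ell=(\mathbb C^b)^{\otimes\ell}$ with $V_0=\mathbb C$, so $V_{\ell+1}=\mathbb C^b\otimes V_\ell$, and let $(\delta_j)_{j=1}^b$ be the standard basis of $\mathbb C^b$. For $1\le i\le b$ define $\Delta_{\ell,i}:V_{\ell+1}\to V_\ell$ by $\Delta_{\ell,i}(\delta_j\otimes v)=\delta_{ij}v$ (Kronecker delta on the right). For $m\ge0$ let $$L_m=\bigoplus_{k=0}^m\overline H_k\otimes V_{m-k},\qquad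 E_m=L_m^{(0)}\oplus L_m^{(1)},$$ where $L_m^{(0)},L_m^{(1)}$ are two copies of $L_m$. For $\varepsilon\in\{0,1\}$ define the following operators in $B(E_m)$: - $e_m^\varepsilon$ is the orthogonal projection onto $L_m^{(\varepsilon)}$; - $F_m^\varepsilon$ is the orthogonal projection onto the top summand ($k=m$), $\overline H_m\otimes V_0$, of $L_m^{(\varepsilon)}$; - $\sigma_m(g)=\bigoplus_{\varepsilon=0}^1\bigoplus_{k=0}^m\overline\pi_k(g)\otimes1_{V_{m-k}}$ for $g\in G$; - $T_{m,i}^\varepsilon$ ($1\le i\le b$) is zero on the other copy $L_m^{(1-\varepsilon)}$ and on the top summand of $L_m^{(\varepsilon)}$, and for $1\le k\le m$ its restriction to the summand $\overline H_{k-1}\otimes V_{m-k+1}$ of $L_m^{(\varepsilon)}$ is $\overline J_k\otimes\Delta_{m-k,i}$, with values in the summand $\overline H_k\otimes V_{m-k}$ of $L_m^{(\varepsilon)}$; - $s_m$ is the canonical identity map from the top summand of copy $1$ onto the top summand of copy $0$, extended by zero (so $s_m^*s_m=F_m^1$ and $s_ms_m^*=F_m^0$). Dropping the subscript $m$ denotes the corresponding sequence in $\prod_{m\ge0}B(E_m)$ (the $C^*$-algebra of bounded sequences), e.g. $e^\varepsilon=(e_m^\varepsilon)_m$, $\sigma(g)=(\sigma_m(g))_m$. Let $\mathcal K=\bigoplus_{m\ge0}B(E_m)$ be the $c_0$-direct sum (sequences with norms tending to $0$). Then $$A=C^*\bigl(1,\mathcal K,e^\varepsilon,F^\varepsilon,T_i^\varepsilon,\sigma(g),s:\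 \varepsilon\in\{0,1\},\,1\le i\le b,\,g\in G\bigr)\subseteq\prod_{m=0}^\infty B(E_m).$$ *)

(* Defs.v *)
From HB Require Import structures.
From mathcomp Require Import all_boot all_order all_algebra all_fingroup.
From mathcomp Require Import sesquilinear spectral.
From mathcomp Require Import complex.
From mathcomp Require Import all_classical all_reals all_analysis.
From mathcomp Require Import ring.

Set Implicit Arguments.
Unset Strict Implicit.
Unset Printing Implicit Defensive.

Import Order.TTheory GRing.Theory Num.Theory Num.Def.
Import numFieldNormedType.Exports.

Local Open Scope classical_set_scope.
Local Open Scope sesquilinear_scope.
Local Open Scope ring_scope.

Notation cabs := ComplexField.Normc.normc.

(* Unital C*-algebras over R[i]; 1 = 0 is allowed. MathComp's algType excludes
   the zero ring, hence also 'M_n for a general n, so the scalar multiplication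
   is part of this mixin and the lmodType structure is derived from it. *)
HB.mixin Record isCStarAlgebra (R : realType) A of GRing.PzRing A := {
  cscale : R[i] -> A -> A;
  star : A -> A;
  cnorm : A -> R;
  cscalerA : forall a b (x : A), cscale a (cscale b x) = cscale (a * b) x;
  cscale1r : left_id 1 cscale;
  cscalerDr : right_distributive cscale +%R;
  cscalerDl : forall x, {morph cscale^~ x : a b / a + b};
  cscalerAl : forall a (x y : A), cscale a (x * y) = cscale a x * y;
  cscalerAr : forall a (x y : A), cscale a (x * y) = x * cscale a y;
  starK : involutive star;
  starD : {morph star : x y / x + y};
  starM : forall x y, star (x * y) = star y * star x;
  starZ : forall a x, star (cscale a x) = cscale a^* (star x);
  cnorm_eq0 : forall x, cnorm x = 0 -> x = 0;
  cnormD : forall x y, cnorm (x + y) <= cnorm x + cnorm y;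
  cnormZ : forall a x, cnorm (cscale a x) = cabs a * cnorm x;
  cnormM : forall x y, cnorm (x * y) <= cnorm x * cnorm y;
  cnorm_cstar : forall x, cnorm (star x * x) = cnorm x ^+ 2;
  cnorm_complete : forall u : nat -> A,
    (forall eps : R, 0 < eps -> exists N, forall m n, (N <= m)%N -> (N <= n)%N ->
       cnorm (u m - u n) < eps) ->
    exists l, forall eps : R, 0 < eps -> exists N, forall n, (N <= n)%N ->
       cnorm (u n - l) < eps
}.

#[short(type="cstarAlgType")]
HB.structure Definition CStarAlgebra (R : realType) :=
  {A of isCStarAlgebra R A & GRing.PzRing A}.

HB.instance Definition _ (R : realType) (A : cstarAlgType R) :=
  GRing.Zmodule_isLmodule.Build R[i] (CStarAlgebra.sort A)
    (@cscalerA R A) (@cscale1r R A) (@cscalerDr R A) (@cscalerDl R A).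

Section CStarTheory.
Variables (R : realType) (B : cstarAlgType R).
Implicit Types x y : B.

Lemma cnorm0 : cnorm (0 : B) = 0.
Proof.
rewrite -(scale0r (0 : B)) [cnorm _]cnormZ (_ : cabs 0 = 0) ?mul0r //.
exact: ComplexField.Normc.normc0.
Qed.

Lemma cnormN x : cnorm (- x) = cnorm x.
Proof.
rewrite -scaleN1r [cnorm _]cnormZ (_ : cabs (-1) = 1) ?mul1r //.
by rewrite normcN ComplexField.Normc.normc1.
Qed.

Lemma cnorm_ge0 x : 0 <= cnorm x.
Proof.
by have := cnormD x (- x); rewrite subrr cnorm0 cnormN -mulr2n pmulrn_lge0.
Qed.

Lemma cnormB x y : cnorm (x - y) = cnorm (y - x).
Proof. by rewrite -cnormN opprB. Qed.

Lemma cnormBD y x z : cnorm (x - z) <= cnorm (x - y) + cnorm (y - z).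
Proof. by rewrite -[x in x - z](subrK y) -addrA cnormD. Qed.

Lemma cnorm_leD x y : cnorm x <= cnorm y + cnorm (x - y).
Proof. by rewrite addrC -[x in X in X <= _](subrK y) cnormD. Qed.

Lemma star0 : star (0 : B) = 0.
Proof.
rewrite -[X in star X](scale0r (0 : B)) [LHS]starZ rmorph0.
exact: scale0r.
Qed.

Lemma starN x : star (- x) = - star x.
Proof.
rewrite -scaleN1r [LHS]starZ rmorphN rmorph1.
exact: scaleN1r.
Qed.

Lemma star1 : star (1 : B) = 1.
Proof. by rewrite -[LHS]mulr1 -[X in _ * X]starK -starM mulr1 starK. Qed.

Lemma cnorm_starE x : cnorm (star x) = cnorm x.
Proof.
suff le y : cnorm y <= cnorm (star y).
  by apply/eqP; rewrite eq_le le andbT; have := le (star x); rewrite starK.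
have [->|y0] := eqVneq (cnorm y) 0; first exact: cnorm_ge0.
have yp : 0 < cnorm y by rewrite lt_def y0 cnorm_ge0.
by rewrite -(ler_pM2r yp) -expr2 -cnorm_cstar cnormM.
Qed.

End CStarTheory.

Section MatrixCStar.
Variable R : realType.

Definition vnorm n (v : 'cV[R[i]]_n) : R := Num.sqrt (\sum_i cabs (v i 0) ^+ 2).

Definition opnorm n (M : 'M[R[i]]_n) : R :=
  sup [set vnorm (M *m v) | v in [set v : 'cV[R[i]]_n | vnorm v <= 1]].


Lemma cabsE (z : R[i]) : `|z| = (cabs z)%:C%C.
Proof. by rewrite normc_def; case: z. Qed.

Lemma cabs_ge0 (z : R[i]) : 0 <= cabs z.
Proof. by case: z => a b; exact: sqrtr_ge0. Qed.

Lemma cabsM (x y : R[i]) : cabs (x * y) = cabs x * cabs y.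
Proof. exact: ComplexField.Normc.normcM. Qed.

Lemma cabsJ (z : R[i]) : cabs z^* = cabs z.
Proof. by apply: complexI; rewrite -!cabsE norm_conjC. Qed.

Lemma cabs_conjM (z : R[i]) : z^* * z = (cabs z ^+ 2)%:C%C.
Proof. by rewrite mulrC -normCK cabsE rmorphXn. Qed.

Lemma cabs_real (r : R) : cabs r%:C%C = `|r|.
Proof. by rewrite /= expr0n addr0 sqrtr_sqr. Qed.

Lemma cabs0 : cabs (0 : R[i]) = 0.
Proof. exact: ComplexField.Normc.normc0. Qed.

Lemma cabs_sum (I : Type) (r : seq I) (P : pred I) (F : I -> R[i]) :
  cabs (\sum_(i <- r | P i) F i) <= \sum_(i <- r | P i) cabs (F i).
Proof.
elim/big_rec2: _ => [|i x y _ le]; first by rewrite cabs0.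
by apply: le_trans (le_normcD _ _) _; rewrite lerD2l.
Qed.

Lemma ler_sumM_sqrt (I : finType) (a b : I -> R) :
  \sum_i a i * b i
    <= Num.sqrt (\sum_i a i ^+ 2) * Num.sqrt (\sum_i b i ^+ 2).
Proof.
set A := \sum_i a i ^+ 2; set B := \sum_i b i ^+ 2; set S := \sum_i a i * b i.
have A0 : 0 <= A by apply: sumr_ge0 => i _; exact: sqr_ge0.
have B0 : 0 <= B by apply: sumr_ge0 => i _; exact: sqr_ge0.
suff SAB : S ^+ 2 <= A * B.
  by apply: le_trans (ler_norm _) _; rewrite -sqrtr_sqr -sqrtrM // ler_wsqrtr.
have [A00|An0] := eqVneq A 0.
  have a0 i : a i = 0.
    apply/eqP; rewrite -sqrf_eq0; move/eqP: A00.
    rewrite psumr_eq0 => [|j _]; last exact: sqr_ge0.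
    by move=> /allP/(_ i); rewrite mem_index_enum => /(_ isT).
  rewrite /S big1 => [|i _]; last by rewrite a0 mul0r.
  by rewrite expr0n mulr_ge0.
have Ap : 0 < A by rewrite lt_def An0.
have : 0 <= \sum_i (A * b i - S * a i) ^+ 2.
  by apply: sumr_ge0 => i _; exact: sqr_ge0.
have -> : \sum_i (A * b i - S * a i) ^+ 2 = A * (A * B - S ^+ 2).
  rewrite (eq_bigr (fun i => A ^+ 2 * b i ^+ 2 - (2 * A * S) * (a i * b i)
             + S ^+ 2 * a i ^+ 2)); last by move=> i _; ring.
  by rewrite big_split sumrB -!mulr_sumr -/A -/B -/S /=; ring.
by rewrite pmulr_rge0 // subr_ge0.
Qed.

Lemma vnorm_ge0 n (v : 'cV[R[i]]_n) : 0 <= vnorm v.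
Proof. exact: sqrtr_ge0. Qed.

Lemma vnorm_sqr n (v : 'cV[R[i]]_n) : vnorm v ^+ 2 = \sum_i cabs (v i 0) ^+ 2.
Proof. by rewrite sqr_sqrtr // sumr_ge0 // => i _; exact: sqr_ge0. Qed.

Lemma vnormD n (u v : 'cV[R[i]]_n) : vnorm (u + v) <= vnorm u + vnorm v.
Proof.
rewrite -(@ler_pXn2r _ 2) ?nnegrE ?addr_ge0 ?vnorm_ge0 //.
rewrite sqrrD !vnorm_sqr.
apply: (@le_trans _ _ (\sum_i (cabs (u i 0) + cabs (v i 0)) ^+ 2)).
  apply: ler_sum => i _; rewrite mxE ler_pXn2r ?nnegrE ?addr_ge0 ?cabs_ge0 //.
  exact: le_normcD.
rewrite (eq_bigr _ (fun i _ => sqrrD _ _)) !big_split /= lerD2r lerD2l.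
by rewrite -mulr2n lerMn2r ler_sumM_sqrt ?orbT.
Qed.

Lemma vnormZ n k (v : 'cV[R[i]]_n) : vnorm (k *: v) = cabs k * vnorm v.
Proof.
rewrite /vnorm -[X in X * _]ger0_norm ?cabs_ge0 // -sqrtr_sqr -sqrtrM ?sqr_ge0 //.
congr (Num.sqrt _); rewrite mulr_sumr; apply: eq_bigr => i _.
by rewrite mxE cabsM exprMn.
Qed.

Lemma vnorm0 n : vnorm (0 : 'cV[R[i]]_n) = 0.
Proof. by rewrite -(scale0r 0) vnormZ cabs0 mul0r. Qed.

Lemma vnorm_eq0 n (v : 'cV[R[i]]_n) : vnorm v = 0 -> v = 0.
Proof.
move=> v0; apply/matrixP => i j; rewrite !ord1 mxE.
have /eqP : \sum_i cabs (v i 0) ^+ 2 = 0 by rewrite -vnorm_sqr v0 expr0n.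
rewrite psumr_eq0 => [|k _]; last exact: sqr_ge0.
move=> /allP/(_ i); rewrite mem_index_enum => /(_ isT) /=.
rewrite sqrf_eq0 => /eqP.
exact: ComplexField.Normc.eq0_normc.
Qed.

Lemma cabs_dot n (u v : 'cV[R[i]]_n) :
  cabs (\sum_i (u i 0)^* * v i 0) <= vnorm u * vnorm v.
Proof.
apply: le_trans (cabs_sum _ _ _) _.
rewrite (eq_bigr (fun i => cabs (u i 0) * cabs (v i 0))) ?ler_sumM_sqrt //.
by move=> i _; rewrite cabsM cabsJ.
Qed.

(* The Hilbert-Schmidt bound; it shows that the supremum in opnorm is finite. *)
Definition hsnorm n (M : 'M[R[i]]_n) : R :=
  Num.sqrt (\sum_i \sum_j cabs (M i j) ^+ 2).

Lemma vnorm_mul_hs n (M : 'M[R[i]]_n) v : vnorm (M *m v) <= hsnorm M * vnorm v.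
Proof.
have S0 i : 0 <= \sum_j cabs (M i j) ^+ 2.
  by apply: sumr_ge0 => j _; exact: sqr_ge0.
rewrite -(@ler_pXn2r _ 2) ?nnegrE ?mulr_ge0 ?vnorm_ge0 ?sqrtr_ge0 //.
rewrite vnorm_sqr exprMn sqr_sqrtr ?sumr_ge0 // mulr_suml; apply: ler_sum => i _.
rewrite -[X in _ <= X * _]sqr_sqrtr // -exprMn.
rewrite ler_pXn2r ?nnegrE ?cabs_ge0 ?mulr_ge0 ?vnorm_ge0 ?sqrtr_ge0 //.
rewrite mxE; apply: le_trans (cabs_sum _ _ _) _.
rewrite (eq_bigr (fun j => cabs (M i j) * cabs (v j 0))) ?ler_sumM_sqrt //.
by move=> j _; rewrite cabsM.
Qed.

Lemma opnorm_has_sup n (M : 'M[R[i]]_n) :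
  has_sup [set vnorm (M *m v) | v in [set v : 'cV[R[i]]_n | vnorm v <= 1]].
Proof.
split; first by exists (vnorm (M *m 0)), 0 => //=; rewrite vnorm0 ler01.
exists (hsnorm M) => _ [v /= v1 <-]; apply: le_trans (vnorm_mul_hs _ _) _.
by rewrite ler_piMr ?sqrtr_ge0.
Qed.

Lemma opnorm_ge0 n (M : 'M[R[i]]_n) : 0 <= opnorm M.
Proof.
apply: (@le_trans _ _ (vnorm (M *m 0))); first exact: vnorm_ge0.
apply: ub_le_sup; first by have [] := opnorm_has_sup M.
by exists 0 => //=; rewrite vnorm0 ler01.
Qed.

Lemma vnorm_mul n (M : 'M[R[i]]_n) v : vnorm (M *m v) <= opnorm M * vnorm v.
Proof.
have [/eqP v0|v0] := eqVneq (vnorm v) 0.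
  by rewrite (vnorm_eq0 (eqP v0)) mulmx0 !vnorm0 mulr0.
have vp : 0 < vnorm v by rewrite lt_def v0 vnorm_ge0.
pose w := ((vnorm v)^-1)%:C%C *: v.
have cV : cabs ((vnorm v)^-1)%:C%C = (vnorm v)^-1.
  by rewrite cabs_real ger0_norm // invr_ge0 vnorm_ge0.
have -> : vnorm (M *m v) = vnorm (M *m w) * vnorm v.
  by rewrite -scalemxAr vnormZ cV mulrAC mulVf ?mul1r.
rewrite ler_pM2r //; apply: ub_le_sup; first by have [] := opnorm_has_sup M.
by exists w => //=; rewrite vnormZ cV mulVf.
Qed.

Lemma opnorm_le n (M : 'M[R[i]]_n) c : 0 <= c ->
  (forall v, vnorm (M *m v) <= c * vnorm v) -> opnorm M <= c.
Proof.
move=> c0 le; apply: ge_sup; first by have [] := opnorm_has_sup M.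
by move=> _ [v /= v1 <-]; apply: le_trans (le v) _; rewrite ler_piMr.
Qed.

Lemma opnorm_hs n (M : 'M[R[i]]_n) : opnorm M <= hsnorm M.
Proof. by apply: opnorm_le; [exact: sqrtr_ge0 | exact: vnorm_mul_hs]. Qed.

Lemma entry_le_opnorm n (M : 'M[R[i]]_n) i j : cabs (M i j) <= opnorm M.
Proof.
have := vnorm_mul M (delta_mx j 0).
have -> : vnorm (delta_mx j 0 : 'cV[R[i]]_n) = 1.
  rewrite /vnorm (bigD1 j) //= big1 => [|k /negPf kj].
    by rewrite mxE !eqxx ComplexField.Normc.normc1 expr1n addr0 sqrtr1.
  by rewrite mxE kj cabs0 expr0n.
rewrite mulr1; apply: le_trans; rewrite -colE.
rewrite -[leLHS]ger0_norm ?cabs_ge0 // -sqrtr_sqr ler_wsqrtr //.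
rewrite (bigD1 i) //= mxE lerDl sumr_ge0 // => k _; exact: sqr_ge0.
Qed.

Lemma opnorm_eq0 n (M : 'M[R[i]]_n) : opnorm M = 0 -> M = 0.
Proof.
move=> M0; apply/matrixP => i j; rewrite mxE.
apply: ComplexField.Normc.eq0_normc; apply/eqP.
by rewrite eq_le cabs_ge0 -M0 entry_le_opnorm.
Qed.

Lemma opnormD n (M N : 'M[R[i]]_n) : opnorm (M + N) <= opnorm M + opnorm N.
Proof.
apply: opnorm_le => [|v]; first by rewrite addr_ge0 ?opnorm_ge0.
rewrite mulmxDl mulrDl; apply: le_trans (vnormD _ _) _.
by rewrite lerD ?vnorm_mul.
Qed.

Lemma opnormM n (M N : 'M[R[i]]_n) : opnorm (M *m N) <= opnorm M * opnorm N.
Proof.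
apply: opnorm_le => [|v]; first by rewrite mulr_ge0 ?opnorm_ge0.
rewrite -mulmxA; apply: le_trans (vnorm_mul _ _) _.
by rewrite -mulrA ler_wpM2l ?opnorm_ge0 ?vnorm_mul.
Qed.

Lemma opnormZ n k (M : 'M[R[i]]_n) : opnorm (k *: M) = cabs k * opnorm M.
Proof.
have le (c : R[i]) (N : 'M[R[i]]_n) : opnorm (c *: N) <= cabs c * opnorm N.
  apply: opnorm_le => [|v]; first by rewrite mulr_ge0 ?cabs_ge0 ?opnorm_ge0.
  by rewrite -scalemxAl vnormZ -mulrA ler_wpM2l ?cabs_ge0 ?vnorm_mul.
apply/eqP; rewrite eq_le le /=.
have [->|k0] := eqVneq k 0; first by rewrite cabs0 mul0r opnorm_ge0.
have kp : 0 < cabs k.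
  rewrite lt_def cabs_ge0 andbT; apply: contra_neq k0.
  exact: ComplexField.Normc.eq0_normc.
rewrite -ler_pdivlMl // -ComplexField.Normc.normcV.
by rewrite -[X in opnorm X <= _](scalerK k0) le.
Qed.

Lemma dot_adj n (M : 'M[R[i]]_n) (u v : 'cV[R[i]]_n) :
  \sum_i (u i 0)^* * (M *m v) i 0 = \sum_i ((M ^t* *m u) i 0)^* * v i 0.
Proof.
under eq_bigr => i _ do rewrite mxE mulr_sumr.
rewrite exchange_big /=; apply: eq_bigr => j _.
rewrite mxE rmorph_sum mulr_suml; apply: eq_bigr => i _.
by rewrite rmorphM /= !mxE conjCK; ring.
Qed.

Lemma vnorm_sqr_dot n (v : 'cV[R[i]]_n) :
  (vnorm v ^+ 2)%:C%C = \sum_i (v i 0)^* * v i 0.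
Proof.
rewrite vnorm_sqr rmorph_sum; apply: eq_bigr => i _.
by rewrite cabs_conjM.
Qed.

Lemma opnorm_star_le n (M : 'M[R[i]]_n) : opnorm M ^+ 2 <= opnorm (M ^t* *m M).
Proof.
set c := opnorm (M ^t* *m M).
have c0 : 0 <= c by exact: opnorm_ge0.
rewrite -[leRHS]sqr_sqrtr // ler_pXn2r ?nnegrE ?opnorm_ge0 ?sqrtr_ge0 //.
apply: opnorm_le => [|v]; first exact: sqrtr_ge0.
rewrite -(@ler_pXn2r _ 2) ?nnegrE ?mulr_ge0 ?sqrtr_ge0 ?vnorm_ge0 //.
rewrite exprMn [Num.sqrt c ^+ 2]sqr_sqrtr //.
have -> : vnorm (M *m v) ^+ 2 = cabs (\sum_i (v i 0)^* * (M^t* *m M *m v) i 0).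
  rewrite -mulmxA dot_adj trmxCK -vnorm_sqr_dot cabs_real.
  by rewrite ger0_norm ?sqr_ge0.
apply: le_trans (cabs_dot _ _) _.
by rewrite mulrC expr2 mulrA ler_wpM2r ?vnorm_ge0 ?vnorm_mul.
Qed.

Lemma opnorm_star n (M : 'M[R[i]]_n) : opnorm (M ^t*) = opnorm M.
Proof.
suff le (N : 'M[R[i]]_n) : opnorm N <= opnorm (N ^t*).
  by apply/eqP; rewrite eq_le le andbT; have := le (M ^t*); rewrite trmxCK.
have [->|N0] := eqVneq (opnorm N) 0; first exact: opnorm_ge0.
have Np : 0 < opnorm N by rewrite lt_def N0 opnorm_ge0.
rewrite -(ler_pM2r Np) -expr2; apply: le_trans (opnorm_star_le _) _.
exact: opnormM.
Qed.

Lemma opnorm_cstar n (M : 'M[R[i]]_n) : opnorm (M ^t* *m M) = opnorm M ^+ 2.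
Proof.
apply/eqP; rewrite eq_le opnorm_star_le andbT.
by apply: le_trans (opnormM _ _) _; rewrite opnorm_star expr2.
Qed.


Lemma real_cauchy (x : nat -> R) :
  (forall eps : R, 0 < eps -> exists N, forall p q, (N <= p)%N -> (N <= q)%N ->
     `|x p - x q| < eps) ->
  exists l, forall eps : R, 0 < eps -> exists N, forall p, (N <= p)%N ->
     `|x p - l| < eps.
Proof.
move=> xC; have /cvg_ex[l /cvgrPdist_lt xl] : cvg (x @ \oo).
  apply: cauchy_cvg; apply: cauchy_exP => eps eps0.
  have [N xN] := xC _ eps0; exists (x N); exists N => // p /= Np.
  exact: xN.
exists l => eps eps0; have [N _ xN] := xl _ eps0.
by exists N => p Np; rewrite distrC; exact: xN.
Qed.

Lemma cabs_le (z : R[i]) : cabs z <= `|complex.Re z| + `|complex.Im z|.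
Proof.
case: z => a b /=; rewrite -[leRHS]ger0_norm ?addr_ge0 // -sqrtr_sqr ler_wsqrtr //.
rewrite sqrrD !real_normK ?num_real // lerD2r lerDl.
by rewrite mulrn_wge0 ?mulr_ge0.
Qed.

Lemma Re_le_cabs (z : R[i]) : `|complex.Re z| <= cabs z.
Proof. by case: z => a b /=; rewrite -sqrtr_sqr ler_wsqrtr // lerDl sqr_ge0. Qed.

Lemma Im_le_cabs (z : R[i]) : `|complex.Im z| <= cabs z.
Proof. by case: z => a b /=; rewrite -sqrtr_sqr ler_wsqrtr // lerDr sqr_ge0. Qed.

Lemma complex_cauchy (x : nat -> R[i]) :
  (forall eps : R, 0 < eps -> exists N, forall p q, (N <= p)%N -> (N <= q)%N ->
     cabs (x p - x q) < eps) ->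
  exists l, forall eps : R, 0 < eps -> exists N, forall p, (N <= p)%N ->
     cabs (x p - l) < eps.
Proof.
move=> xC.
have [|a xa] := @real_cauchy (fun n => complex.Re (x n)).
  move=> eps /xC[N xN]; exists N => p q Np Nq.
  apply: le_lt_trans (xN p q Np Nq); apply: le_trans (Re_le_cabs _).
  by case: (x p); case: (x q).
have [|b xb] := @real_cauchy (fun n => complex.Im (x n)).
  move=> eps /xC[N xN]; exists N => p q Np Nq.
  apply: le_lt_trans (xN p q Np Nq); apply: le_trans (Im_le_cabs _).
  by case: (x p); case: (x q).
exists (a +i* b)%C => eps eps0.
have [|N xN] := xa (eps / 2); first by rewrite divr_gt0.
have [|M xM] := xb (eps / 2); first by rewrite divr_gt0.
exists (maxn N M) => p; rewrite geq_max => /andP[Np Mp].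
apply: le_lt_trans (cabs_le _) _; rewrite [ltRHS]splitr.
have -> : complex.Re (x p - (a +i* b)%C) = complex.Re (x p) - a by case: (x p).
have -> : complex.Im (x p - (a +i* b)%C) = complex.Im (x p) - b by case: (x p).
by rewrite ltrD ?xN ?xM.
Qed.

Lemma hsnorm_le n (M : 'M[R[i]]_n) :
  hsnorm M <= \sum_(k : 'I_n * 'I_n) cabs (M k.1 k.2).
Proof.
rewrite /hsnorm pair_bigA /=.
have S0 (r : seq ('I_n * 'I_n)) : 0 <= \sum_(k <- r) cabs (M k.1 k.2).
  by apply: sumr_ge0 => k _; exact: cabs_ge0.
rewrite -[leRHS]ger0_norm // -sqrtr_sqr ler_wsqrtr //.
elim: (index_enum _) => [|k r IHr]; first by rewrite !big_nil expr0n.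
rewrite !big_cons sqrrD lerD ?(le_trans IHr) //.
by rewrite lerDl mulrn_wge0 ?mulr_ge0 ?cabs_ge0.
Qed.

Lemma opnorm_complete n (u : nat -> 'M[R[i]]_n) :
  (forall eps : R, 0 < eps -> exists N, forall p q, (N <= p)%N -> (N <= q)%N ->
     opnorm (u p - u q) < eps) ->
  exists l, forall eps : R, 0 < eps -> exists N, forall p, (N <= p)%N ->
     opnorm (u p - l) < eps.
Proof.
move=> uC.
have /choice[l ul] : forall k : 'I_n * 'I_n, exists l, forall eps : R, 0 < eps ->
    exists N, forall p, (N <= p)%N -> cabs (u p k.1 k.2 - l) < eps.
  move=> k; apply: complex_cauchy => eps /uC[N uN]; exists N => p q Np Nq.
  apply: le_lt_trans (uN p q Np Nq).
  by have := entry_le_opnorm (u p - u q) k.1 k.2; rewrite !mxE.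
exists (\matrix_(i, j) l (i, j)) => eps eps0.
set c := #|{: 'I_n * 'I_n}|.
have e0 : 0 < eps / c.+1%:R by rewrite divr_gt0 ?ltr0n.
have /choice[N uN] := fun k => ul k _ e0.
exists (\max_k N k) => p Np.
apply: le_lt_trans (opnorm_hs _) _; apply: le_lt_trans (hsnorm_le _) _.
apply: (@le_lt_trans _ _ (\sum_(k : 'I_n * 'I_n) eps / c.+1%:R)).
  apply: ler_sum => -[i j] _; rewrite !mxE ltW // (uN (i, j)) //.
  exact: leq_trans (leq_bigmax _) Np.
rewrite sumr_const -[ltLHS]mulr_natr mulrAC -mulrA gtr_pMr //.
by rewrite ltr_pdivrMr ?ltr0n // mul1r ltr_nat.
Qed.

End MatrixCStar.


Section MatrixInstance.
Variables (R : realType) (n : nat).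
Implicit Types M N : 'M[R[i]]_n.

Let adjD M N : (M + N) ^t* = M ^t* + N ^t*.
Proof. by rewrite linearD map_mxD. Qed.

Let adjM M N : (M *m N) ^t* = N ^t* *m M ^t*.
Proof. by rewrite trmx_mul map_mxM. Qed.

Let adjZ (a : R[i]) M : (a *: M) ^t* = a^* *: M ^t*.
Proof. by rewrite linearZ /= map_mxZ. Qed.

Let scaleMr (a : R[i]) M N : a *: (M *m N) = M *m (a *: N).
Proof. exact: scalemxAr. Qed.

HB.instance Definition _ := @isCStarAlgebra.Build R 'M[R[i]]_n
  *:%R (fun M => M ^t*) (@opnorm R n)
  (@scalerA _ _) (@scale1r _ _) (@scalerDr _ _) (fun M a b => scalerDl M a b)
  (@scalemxAl _ n n n) scaleMr (@trmxCK _ n n) adjD adjM adjZ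
  (@opnorm_eq0 R n) (@opnormD R n) (@opnormZ R n) (@opnormM R n)
  (@opnorm_cstar R n) (@opnorm_complete R n).

End MatrixInstance.

Section Linfty.
Variables (R : realType) (B : nat -> cstarAlgType R).

Record linfty := Linfty {
  lseq :> forall m, B m;
  lseq_bounded : exists c : R, forall m, cnorm (lseq m) <= c
}.

Implicit Types x y z : linfty.

Lemma linftyP x y : (forall m, x m = y m) -> x = y.
Proof.
case: x y => [x xb] [y yb] /= xy.
have {}xy : x = y by exact: functional_extensionality_dep.
by subst y; congr Linfty; exact: Prop_irrelevance.
Qed.

HB.instance Definition _ := gen_eqMixin linfty.
HB.instance Definition _ := gen_choiceMixin linfty.

Let bound0 : exists c : R, forall m, cnorm (0 : B m) <= c.
Proof. by exists 0 => m; rewrite cnorm0. Qed.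

Let bound1 : exists c : R, forall m, cnorm (1 : B m) <= c.
Proof.
exists 1 => m; have := cnorm_cstar (1 : B m).
rewrite star1 mulr1 => c1; have [->//|c0] := eqVneq (cnorm (1 : B m)) 0.
suff -> : cnorm (1 : B m) = 1 by [].
by apply: (mulfI c0); rewrite mulr1 -expr2 -c1.
Qed.

Let boundN x : exists c : R, forall m, cnorm (- x m) <= c.
Proof. by have [c xc] := lseq_bounded x; exists c => m; rewrite cnormN. Qed.

Let boundD x y : exists c : R, forall m, cnorm (x m + y m) <= c.
Proof.
have [c xc] := lseq_bounded x; have [d yd] := lseq_bounded y.
exists (c + d) => m; apply: le_trans (cnormD _ _) _; exact: lerD.
Qed.

Let boundM x y : exists c : R, forall m, cnorm (x m * y m) <= c.
Proof.
have [c xc] := lseq_bounded x; have [d yd] := lseq_bounded y.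
exists (c * d) => m; apply: le_trans (cnormM _ _) _.
by apply: ler_pM => //; exact: cnorm_ge0.
Qed.

Let boundZ (a : R[i]) x : exists c : R, forall m, cnorm (a *: x m) <= c.
Proof.
have [c xc] := lseq_bounded x; exists (cabs a * c) => m.
by rewrite [cnorm _]cnormZ ler_wpM2l ?cabs_ge0.
Qed.

Let boundS x : exists c : R, forall m, cnorm (star (x m)) <= c.
Proof. by have [c xc] := lseq_bounded x; exists c => m; rewrite cnorm_starE. Qed.

Let ladd x y := Linfty (boundD x y).
Let lopp x := Linfty (boundN x).
Let lmul x y := Linfty (boundM x y).

Fact laddA : associative ladd.
Proof. by move=> x y z; apply: linftyP => m; exact: addrA. Qed.
Fact laddC : commutative ladd.
Proof. by move=> x y; apply: linftyP => m; exact: addrC. Qed.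
Fact ladd0 : left_id (Linfty bound0) ladd.
Proof. by move=> x; apply: linftyP => m; exact: add0r. Qed.
Fact laddN : left_inverse (Linfty bound0) lopp ladd.
Proof. by move=> x; apply: linftyP => m; exact: addNr. Qed.

HB.instance Definition _ :=
  GRing.isZmodule.Build linfty laddA laddC ladd0 laddN.

Fact lmulA : associative lmul.
Proof. by move=> x y z; apply: linftyP => m; exact: mulrA. Qed.
Fact lmul1 : left_id (Linfty bound1) lmul.
Proof. by move=> x; apply: linftyP => m; exact: mul1r. Qed.
Fact lmulr1 : right_id (Linfty bound1) lmul.
Proof. by move=> x; apply: linftyP => m; exact: mulr1. Qed.
Fact lmulDl : left_distributive lmul +%R.
Proof. by move=> x y z; apply: linftyP => m; exact: mulrDl. Qed.
Fact lmulDr : right_distributive lmul +%R.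
Proof. by move=> x y z; apply: linftyP => m; exact: mulrDr. Qed.

HB.instance Definition _ := GRing.Zmodule_isPzRing.Build linfty
  lmulA lmul1 lmulr1 lmulDl lmulDr.

Let lscale a x := Linfty (boundZ a x).
Let lstar x := Linfty (boundS x).

Definition lnorm x : R := sup (range (fun m => cnorm (x m))).

Lemma lnorm_ge x m : cnorm (x m) <= lnorm x.
Proof.
have [c xc] := lseq_bounded x; apply: ub_le_sup; last by exists m.
by exists c => _ [k _ <-].
Qed.

Lemma lnorm_le x c : (forall m, cnorm (x m) <= c) -> lnorm x <= c.
Proof.
move=> xc; apply: ge_sup; first by exists (cnorm (x 0%N)), 0%N.
by move=> _ [m _ <-].
Qed.

Lemma lnorm_ge0 x : 0 <= lnorm x.
Proof. exact: le_trans (cnorm_ge0 (x 0%N)) (lnorm_ge x 0%N). Qed.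

Fact lscaleA a b x : lscale a (lscale b x) = lscale (a * b) x.
Proof. by apply: linftyP => m; exact: scalerA. Qed.
Fact lscale1 : left_id 1 lscale.
Proof. by move=> x; apply: linftyP => m; exact: scale1r. Qed.
Fact lscaleDr : right_distributive lscale +%R.
Proof. by move=> a x y; apply: linftyP => m; exact: scalerDr. Qed.
Fact lscaleDl x : {morph lscale^~ x : a b / a + b}.
Proof. by move=> a b; apply: linftyP => m; exact: scalerDl. Qed.
Fact lscaleAl a x y : lscale a (x * y) = lscale a x * y.
Proof. by apply: linftyP => m; exact: cscalerAl. Qed.
Fact lscaleAr a x y : lscale a (x * y) = x * lscale a y.
Proof. by apply: linftyP => m; exact: cscalerAr. Qed.
Fact lstarK : involutive lstar.
Proof. by move=> x; apply: linftyP => m; exact: starK. Qed.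
Fact lstarD : {morph lstar : x y / x + y}.
Proof. by move=> x y; apply: linftyP => m; exact: starD. Qed.
Fact lstarM x y : lstar (x * y) = lstar y * lstar x.
Proof. by apply: linftyP => m; exact: starM. Qed.
Fact lstarZ a x : lstar (lscale a x) = lscale a^* (lstar x).
Proof. by apply: linftyP => m; exact: starZ. Qed.

Fact lnorm_eq0 x : lnorm x = 0 -> x = 0.
Proof.
move=> x0; apply: linftyP => m; apply: cnorm_eq0; apply/eqP.
by rewrite eq_le cnorm_ge0 -x0 lnorm_ge.
Qed.
Fact lnormD x y : lnorm (x + y) <= lnorm x + lnorm y.
Proof.
apply: lnorm_le => m; apply: le_trans (cnormD _ _) _.
by rewrite lerD ?lnorm_ge.
Qed.
Fact lnormM x y : lnorm (x * y) <= lnorm x * lnorm y.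
Proof.
apply: lnorm_le => m; apply: le_trans (cnormM _ _) _.
by rewrite ler_pM ?lnorm_ge ?cnorm_ge0.
Qed.
Fact lnormZ a x : lnorm (lscale a x) = cabs a * lnorm x.
Proof.
apply/eqP; rewrite eq_le; apply/andP; split.
  apply: lnorm_le => m; rewrite [cnorm _]cnormZ.
  by rewrite ler_wpM2l ?cabs_ge0 ?lnorm_ge.
have [->|a0] := eqVneq a 0; first by rewrite cabs0 mul0r lnorm_ge0.
have ap : 0 < cabs a.
  rewrite lt_def cabs_ge0 andbT; apply: contra_neq a0.
  exact: ComplexField.Normc.eq0_normc.
rewrite mulrC -ler_pdivlMr //; apply: lnorm_le => m.
by rewrite ler_pdivlMr // mulrC -[leLHS]cnormZ; exact: (lnorm_ge (lscale a x)).
Qed.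
Fact lnorm_cstar x : lnorm (lstar x * x) = lnorm x ^+ 2.
Proof.
apply/eqP; rewrite eq_le; apply/andP; split.
  apply: lnorm_le => m; rewrite [cnorm _]cnorm_cstar.
  by rewrite ler_pXn2r ?nnegrE ?cnorm_ge0 ?lnorm_ge0 ?lnorm_ge.
rewrite -[leRHS]sqr_sqrtr ?lnorm_ge0 //.
rewrite ler_pXn2r ?nnegrE ?lnorm_ge0 ?sqrtr_ge0 //; apply: lnorm_le => m.
rewrite -[leLHS]ger0_norm ?cnorm_ge0 // -sqrtr_sqr ler_wsqrtr //.
by rewrite -[leLHS]cnorm_cstar; exact: (lnorm_ge (lstar x * x)).
Qed.
Fact lnorm_complete (u : nat -> linfty) :
  (forall eps : R, 0 < eps -> exists N, forall p q, (N <= p)%N -> (N <= q)%N ->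
     lnorm (u p - u q) < eps) ->
  exists l, forall eps : R, 0 < eps -> exists N, forall p, (N <= p)%N ->
     lnorm (u p - l) < eps.
Proof.
move=> uC.
have ex_l m : exists l : B m, forall eps : R, 0 < eps -> exists N, forall p,
    (N <= p)%N -> cnorm (u p m - l) < eps.
  apply: cnorm_complete => eps /uC[N uN]; exists N => p q Np Nq.
  exact: le_lt_trans (lnorm_ge (u p - u q) m) (uN p q Np Nq).
pose l m := projT1 (cid (ex_l m)).
have lP m : forall eps : R, 0 < eps -> exists N, forall p,
    (N <= p)%N -> cnorm (u p m - l m) < eps by exact: projT2 (cid (ex_l m)).
have unif (eps : R) : 0 < eps -> exists N, forall p m, (N <= p)%N ->
    cnorm (u p m - l m) <= eps.
  move=> /uC[N uN]; exists N => p m Np; apply/ler_addgt0Pr => e /(lP m)[M uM].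
  pose q := maxn N M.
  apply: le_trans (cnormBD (u q m) _ _) _; rewrite lerD //; last first.
    by rewrite ltW // uM // leq_maxr.
  apply: le_trans (lnorm_ge (u p - u q) m) _.
  by rewrite ltW // uN // leq_maxl.
have lb : exists c : R, forall m, cnorm (l m) <= c.
  have [N uN] := unif 1 ltr01; have [c uc] := lseq_bounded (u N).
  exists (c + 1) => m; apply: le_trans (cnorm_leD _ (u N m)) _.
  by rewrite lerD ?uc // cnormB uN.
exists (Linfty lb) => eps eps0.
have [|N uN] := unif (eps / 2); first by rewrite divr_gt0.
exists N => p Np; apply: (@le_lt_trans _ _ (eps / 2)).
  by apply: lnorm_le => m; exact: uN.
by rewrite ltr_pdivrMr // ltr_pMr // ltr1n.
Qed.

HB.instance Definition _ := isCStarAlgebra.Build R linfty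
  lscaleA lscale1 lscaleDr lscaleDl lscaleAl lscaleAr lstarK lstarD lstarM
  lstarZ lnorm_eq0 lnormD lnormZ lnormM lnorm_cstar lnorm_complete.

End Linfty.

(* C^*(1, X): the smallest norm-closed unital *-subalgebra containing X *)
Section Generated.
Variables (R : realType) (B : cstarAlgType R).

Definition cstar_subalg (S : set B) : Prop :=
  [/\ S 1,
      forall x y, S x -> S y -> S (x - y),
      forall x y, S x -> S y -> S (x * y),
      forall (a : R[i]) x, S x -> S (a *: x) &
      (forall x, S x -> S (star x)) /\
      (forall (u : nat -> B) l, (forall n, S (u n)) ->
         cnorm (u n - l) @[n --> \oo] --> (0 : R) -> S l)].

Definition cstar_gen (X : set B) : set B :=
  [set x | forall S, cstar_subalg S -> X `<=` S -> S x].

Lemma cstar_gen_subalg X : cstar_subalg (cstar_gen X).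
Proof.
split=> [S [] //|x y Xx Xy S SA XS|x y Xx Xy S SA XS|a x Xx S SA XS|].
- by have [_ + _ _ _] := SA; apply; [exact: Xx|exact: Xy].
- by have [_ _ + _ _] := SA; apply; [exact: Xx|exact: Xy].
- by have [_ _ _ + _] := SA; apply; exact: Xx.
split=> [x Xx S SA XS|u l Xu ul S SA XS].
- by have [_ _ _ _ [+ _]] := SA; apply; exact: Xx.
- by have [_ _ _ _ [_ +]] := SA; apply; [move=> n; exact: (Xu n) | exact: ul].
Qed.

Variable X : set B.

Definition cstar_alg : Type := {x : B | x \in cstar_gen X}.

HB.instance Definition _ := SubChoice.on cstar_alg.

Fact cstar_gen_subring :
  subring_closed (fun x : B => x \in cstar_gen X).
Proof.
have [X1 XB XM _ _] := cstar_gen_subalg X.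
split=> [|x y Xx Xy|x y Xx Xy]; first exact: mem_set X1.
  exact: (mem_set (XB _ _ (set_mem Xx) (set_mem Xy))).
exact: (mem_set (XM _ _ (set_mem Xx) (set_mem Xy))).
Qed.

HB.instance Definition _ :=
  GRing.SubChoice_isSubPzRing.Build B _ cstar_alg cstar_gen_subring.

Implicit Types x y : cstar_alg.

Let in_gen x : cstar_gen X (val x). Proof. exact: set_mem (valP x). Qed.

Fact cstar_genZ (a : R[i]) x : cstar_gen X (a *: val x).
Proof. by have [_ _ _ XZ _] := cstar_gen_subalg X; exact: XZ (in_gen x). Qed.

Fact cstar_genS x : cstar_gen X (star (val x)).
Proof.
by have [_ _ _ _ [XS _]] := cstar_gen_subalg X; exact: XS (in_gen x).
Qed.

Let gscale (a : R[i]) x : cstar_alg := Sub (a *: val x) (mem_set (cstar_genZ a x)).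

Let gstar x : cstar_alg := Sub (star (val x)) (mem_set (cstar_genS x)).

Let gnorm x : R := cnorm (val x).

Let val_scale a x : val (gscale a x) = a *: val x.
Proof. by rewrite SubK. Qed.

Let val_star x : val (gstar x) = star (val x).
Proof. by rewrite SubK. Qed.

Let valD x y : val (x + y) = val x + val y. Proof. exact: rmorphD. Qed.
Let valM x y : val (x * y) = val x * val y. Proof. exact: rmorphM. Qed.

Let gscaleA a b x : gscale a (gscale b x) = gscale (a * b) x.
Proof. by apply: val_inj; rewrite !val_scale scalerA. Qed.
Let gscale1 : left_id 1 gscale.
Proof. by move=> x; apply: val_inj; rewrite val_scale scale1r. Qed.
Let gscaleDr : right_distributive gscale +%R.
Proof.
by move=> a x y; apply: val_inj; rewrite val_scale !valD !val_scale scalerDr.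
Qed.
Let gscaleDl x : {morph gscale^~ x : a b / a + b}.
Proof.
by move=> a b; apply: val_inj; rewrite val_scale valD !val_scale scalerDl.
Qed.
Let gscaleAl a x y : gscale a (x * y) = gscale a x * y.
Proof.
by apply: val_inj; rewrite val_scale !valM val_scale; exact: cscalerAl.
Qed.
Let gscaleAr a x y : gscale a (x * y) = x * gscale a y.
Proof.
by apply: val_inj; rewrite val_scale !valM val_scale; exact: cscalerAr.
Qed.
Let gstarK : involutive gstar.
Proof. by move=> x; apply: val_inj; rewrite !val_star starK. Qed.
Let gstarD : {morph gstar : x y / x + y}.
Proof.
by move=> x y; apply: val_inj; rewrite val_star !valD !val_star starD.
Qed.
Let gstarM x y : gstar (x * y) = gstar y * gstar x.
Proof. by apply: val_inj; rewrite val_star !valM !val_star starM. Qed.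
Let gstarZ a x : gstar (gscale a x) = gscale a^* (gstar x).
Proof. by apply: val_inj; rewrite val_star !val_scale val_star; exact: starZ. Qed.
Let gnorm_eq0 x : gnorm x = 0 -> x = 0.
Proof. by move=> /cnorm_eq0 x0; apply: val_inj; rewrite x0 rmorph0. Qed.
Let gnormD x y : gnorm (x + y) <= gnorm x + gnorm y.
Proof. by rewrite /gnorm valD cnormD. Qed.
Let gnormM x y : gnorm (x * y) <= gnorm x * gnorm y.
Proof. by rewrite /gnorm valM cnormM. Qed.
Let gnormZ a x : gnorm (gscale a x) = cabs a * gnorm x.
Proof. by rewrite /gnorm val_scale; exact: cnormZ. Qed.
Let gnorm_cstar x : gnorm (gstar x * x) = gnorm x ^+ 2.
Proof. by rewrite /gnorm valM val_star cnorm_cstar. Qed.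
Let gnorm_complete (u : nat -> cstar_alg) :
  (forall eps : R, 0 < eps -> exists N, forall p q, (N <= p)%N -> (N <= q)%N ->
     gnorm (u p - u q) < eps) ->
  exists l, forall eps : R, 0 < eps -> exists N, forall p, (N <= p)%N ->
     gnorm (u p - l) < eps.
Proof.
rewrite /gnorm => uC; have [|l ul] := @cnorm_complete R B (fun n => val (u n)).
  move=> eps /uC[N uN]; exists N => p q Np Nq.
  by have := uN p q Np Nq; rewrite rmorphB.
have Xl : cstar_gen X l.
  have [_ _ _ _ [_ cl]] := cstar_gen_subalg X.
  apply: (cl (fun n => val (u n))) => [n|]; first exact: in_gen.
  apply/cvgrPdist_lt => eps /ul[N uN]; exists N => // p /= Np.
  by rewrite sub0r normrN ger0_norm ?cnorm_ge0 ?uN.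
exists (Sub l (mem_set Xl)) => eps /ul[N uN]; exists N => p Np.
by rewrite rmorphB; exact: uN.
Qed.

HB.instance Definition _ := isCStarAlgebra.Build R cstar_alg
  gscaleA gscale1 gscaleDr gscaleDl gscaleAl gscaleAr gstarK gstarD gstarM
  gstarZ gnorm_eq0 gnormD gnormZ gnormM gnorm_cstar gnorm_complete.

End Generated.

Section Traces.
Variable R : realType.

(* Positivity in the C*-algebra M_n(B), namely a = y^* y; for B = M_N it is
   positivity of n x n block matrices with N x N blocks. *)
Definition mxpos (B : cstarAlgType R) n (a : 'M[B]_n) : Prop :=
  exists y : 'M[B]_n, a = (map_mx star y)^T *m y.

Definition ucp (B D : cstarAlgType R) (psi : B -> D) : Prop :=
  [/\ linear psi, psi 1 = 1 &
      forall n (a : 'M[B]_n), mxpos a -> mxpos (map_mx psi a)].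

Definition ntr n (M : 'M[R[i]]_n) : R[i] := n%:R^-1 * \tr M.

Variable B : cstarAlgType R.

(* In R[i], 0 <= z says that z is real and nonnegative. *)
Definition tracial_state : set (B -> R[i]) :=
  [set tau | [/\ scalar tau, forall a, 0 <= tau (star a * a), tau 1 = 1 &
                 forall a c, tau (a * c) = tau (c * a)]].

Definition faithful_trace (tau : B -> R[i]) : Prop :=
  forall a, tau (star a * a) = 0 -> a = 0.

Definition qd_trace : set (B -> R[i]) :=
  [set lam | tracial_state lam /\
     exists (N : nat -> nat) (psi : forall j, B -> 'M[R[i]]_(N j)),
       [/\ forall j, (0 < N j)%N,
           forall j, ucp (psi j),
           forall a c, cnorm (psi j (a * c) - psi j a * psi j c)
             @[j --> \oo] --> (0 : R) &
           forall a, cabs (ntr (psi j a) - lam a) @[j --> \oo] --> (0 : R)]].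

Definition is_face (F : set (B -> R[i])) : Prop :=
  [/\ F `<=` tracial_state,
      forall (t : R) l1 l2, 0 < t < 1 -> F l1 -> F l2 ->
        F (fun a => t%:C%C * l1 a + (1 - t)%:C%C * l2 a) &
      forall (t : R) l1 l2, 0 < t < 1 -> tracial_state l1 -> tracial_state l2 ->
        F (fun a => t%:C%C * l1 a + (1 - t)%:C%C * l2 a) -> F l1 /\ F l2].

Definition norm_separable : Prop :=
  exists2 D : set B, countable D &
    forall (a : B) (eps : R), 0 < eps -> exists2 x, D x & cnorm (a - x) < eps.

Definition fd_representation n (phi : B -> 'M[R[i]]_n) : Prop :=
  [/\ linear phi, forall a c, phi (a * c) = phi a * phi c &
      forall a, phi (star a) = star (phi a)].

Definition residually_finite_dimensional : Prop :=
  forall a c : B, a <> c ->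
    exists n (phi : B -> 'M[R[i]]_n), fd_representation phi /\ phi a <> phi c.

End Traces.

Section Groups.
Variables (R : realType) (G : groupType).

Definition residually_finite : Prop :=
  forall g : G, g <> 1%g ->
    exists (H : finGroupType) (f : G -> H),
      (forall x y, f (x * y)%g = (f x * f y)%g) /\ f g <> 1%g.

Section Hilbert.
Variables (V : lmodType R[i]) (form : {dot V for (@conjC R[i])}).

Definition hnorm (v : V) : R := Num.sqrt (complex.Re (form v v)).

Definition hilbert_complete : Prop :=
  forall u : nat -> V,
    (forall eps : R, 0 < eps -> exists N, forall m n, (N <= m)%N -> (N <= n)%N ->
       hnorm (u m - u n) < eps) ->
    exists l, hnorm (u n - l) @[n --> \oo] --> (0 : R).

Definition unitary_rep (rho : G -> V -> V) : Prop :=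
  [/\ forall g, linear (rho g),
      forall v, rho 1%g v = v,
      forall g h v, rho (g * h)%g v = rho g (rho h v) &
      forall g u v, form (rho g u) (rho g v) = form u v].

End Hilbert.

(* G is discrete, so Kazhdan sets are finite; (K, eps) is a Kazhdan pair. *)
Definition property_T : Prop :=
  exists (K : seq G) (eps : R), 0 < eps /\
    forall (V : lmodType R[i]) (form : {dot V for (@conjC R[i])})
           (rho : G -> V -> V),
      hilbert_complete form -> unitary_rep form rho ->
      (exists v, hnorm form v = 1 /\
         forall g, g \in K -> hnorm form (rho g v - v) < eps) ->
      exists v, v <> 0 /\ forall g, rho g v = v.

Definition unitary_mxrep n (pi : G -> 'M[R[i]]_n) : Prop :=
  [/\ forall g, pi g \is unitarymx, pi 1%g = 1%:M &
      forall g h, pi (g * h)%g = pi g *m pi h].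

Definition irreducible_mxrep n (pi : G -> 'M[R[i]]_n) : Prop :=
  (0 < n)%N /\
  forall U : {vspace 'cV[R[i]]_n},
    (forall g v, v \in U -> pi g *m v \in U) -> U = 0%VS \/ U = fullv.

Definition unitarily_equivalent n1 n2 (pi1 : G -> 'M[R[i]]_n1)
    (pi2 : G -> 'M[R[i]]_n2) : Prop :=
  exists U : 'M[R[i]]_(n2, n1),
    [/\ U^t* *m U = 1%:M, U *m U^t* = 1%:M & forall g, U *m pi1 g = pi2 g *m U].

Definition lists_irreps (d : nat -> nat) (pi : forall k, G -> 'M[R[i]]_(d k))
    : Prop :=
  [/\ forall k, unitary_mxrep (pi k) /\ irreducible_mxrep (pi k),
      forall k l, k <> l -> ~ unitarily_equivalent (pi k) (pi l) &
      forall n (rho : G -> 'M[R[i]]_n), unitary_mxrep rho ->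
        irreducible_mxrep rho -> exists k, unitarily_equivalent rho (pi k)].

End Groups.

(* The algebra A. H_k is C^(d k); conj H_k is again C^(d k), its basis being
   the conjugates of the standard basis of H_k, so that conjugate operators are
   entrywise conjugate matrices. J k is the isometry from H_k to H_(k+1). *)
Section Construction.
Variables (R : realType) (G : groupType) (d : nat -> nat).
Variables (pi : forall k, G -> 'M[R[i]]_(d k)).
Variables (J : forall k, 'M[R[i]]_(d k.+1, d k)) (b : nat).

(* An orthonormal basis of E_m: (eps, (k, (a, w))) stands for the tensor of the
   a-th basis vector of conj H_k with the word w = w_1 ... w_(m-k), i.e. with
   delta_(w_1) (x) ... (x) delta_(w_(m-k)) in V_(m-k), in copy eps of L_m
   (copy 0 is false, copy 1 is true). *)
Definition Eidx m : finType :=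
  (bool * {k : 'I_m.+1 & ('I_(d k) * (m - k).-tuple 'I_b)%type})%type.

Definition Ecopy m (x : Eidx m) : bool := x.1.
Definition Elevel m (x : Eidx m) : nat := tag x.2.
Definition Ehcoord m (x : Eidx m) : 'I_(d (Elevel x)) := (tagged x.2).1.
Definition Eword m (x : Eidx m) : seq 'I_b := (tagged x.2).2.

(* the operator on E_m with matrix f in this basis *)
Definition Eop m (f : Eidx m -> Eidx m -> R[i]) : 'M[R[i]]_#|Eidx m| :=
  \matrix_(i, j) f (enum_val i) (enum_val j).

Definition e_op (eps : bool) m :=
  @Eop m (fun x y => ((x == y) && (Ecopy y == eps))%:R).

Definition F_op (eps : bool) m :=
  @Eop m (fun x y => [&& x == y, Ecopy y == eps & Elevel y == m]%:R).

(* In sigma_op and T_op, conform_mx only transports along the equation between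
   Elevel x and Elevel y that has just been tested. *)
Definition sigma_op (g : G) m :=
  @Eop m (fun x y =>
    if [&& Ecopy x == Ecopy y, Elevel x == Elevel y & Eword x == Eword y]
    then (conform_mx (0 : 'M[R[i]]_(d (Elevel x), d (Elevel y))) (pi (Elevel y) g)
            (Ehcoord x) (Ehcoord y))^*
    else 0).

Definition T_op (eps : bool) (i : 'I_b) m :=
  @Eop m (fun x y =>
    if [&& Ecopy x == eps, Ecopy y == eps, Elevel x == (Elevel y).+1 &
           Eword y == i :: Eword x]
    then (conform_mx (0 : 'M[R[i]]_(d (Elevel x), d (Elevel y))) (J (Elevel y))
            (Ehcoord x) (Ehcoord y))^*
    else 0).

Definition s_op m :=
  @Eop m (fun x y => [&& ~~ Ecopy x, Ecopy y, Elevel y == m & x.2 == y.2]%:R).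

(* the bounded sequences in prod_m B(E_m), and their c_0-direct sum *)
Definition prodE := linfty (fun m => 'M[R[i]]_#|Eidx m|).

Definition c0_sum : set prodE :=
  [set x | cnorm (x m) @[m --> \oo] --> (0 : R)].

Definition generators : set prodE :=
  c0_sum `|`
  [set x | exists eps, forall m, x m = e_op eps m] `|`
  [set x | exists eps, forall m, x m = F_op eps m] `|`
  [set x | exists eps i, forall m, x m = T_op eps i m] `|`
  [set x | exists g, forall m, x m = sigma_op g m] `|`
  [set x | forall m, x m = s_op m].

Definition algA : cstarAlgType R := cstar_alg generators.

End Construction.

(* The generating sequences do lie in prodE: each of them consists of partial
   isometries as soon as the pi k are unitary and the J k are isometric. *)
Section GeneratorsBounded.
Variables (R : realType) (G : groupType) (d : nat -> nat).
Variables (pi : forall k, G -> 'M[R[i]]_(d k)).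
Variables (J : forall k, 'M[R[i]]_(d k.+1, d k)) (b : nat).
Hypothesis pi_unitary : forall k, unitary_mxrep (pi k).
Hypothesis J_isometry : forall k, (J k)^t* *m J k = 1%:M.

Lemma Eop_norm_le1 m (f : Eidx d b m -> Eidx d b m -> R[i]) (p : pred (Eidx d b m)) :
  (forall y y', \sum_x (f x y)^* * f x y' = ((y == y') && p y)%:R) ->
  opnorm (Eop f) <= 1.
Proof.
move=> ff; set P := (Eop f)^t* *m Eop f.
have PE i j : P i j = ((i == j) && p (enum_val i))%:R.
  rewrite -(inj_eq enum_val_inj) -ff mxE (reindex_onto enum_rank enum_val) /=.
    apply: eq_big => [x|x _]; first by rewrite enum_rankK eqxx.
    by rewrite !mxE enum_rankK.
  by move=> k _; rewrite enum_valK.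
have PSE i j : (P^t*) i j = (P j i)^* by rewrite 2!mxE.
have PP : P^t* *m P = P.
  apply/matrixP => i j; rewrite mxE (bigD1 i) //= big1 => [|k /negPf ki].
    rewrite PSE !PE eqxx /= conjC_nat -natrM mulnb andbCA addr0.
    by case: eqP => [->|]; rewrite ?andbb //= andbF.
  by rewrite PSE PE ki /= conjC_nat mul0r.
have P1 : opnorm P <= 1.
  have [->|P0] := eqVneq (opnorm P) 0; first exact: ler01.
  suff -> : opnorm P = 1 by [].
  by apply: (mulfI P0); rewrite mulr1 -expr2 -opnorm_cstar PP.
by rewrite -(@ler_pXn2r _ 2) ?nnegrE ?opnorm_ge0 // expr1n -opnorm_cstar.
Qed.

Let ex m (c : bool) (k : 'I_m.+1) (a : 'I_(d k)) (w : (m - k).-tuple 'I_b) :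
  Eidx d b m := (c, existT _ k (a, w)).

Lemma sum_Eidx m (F : Eidx d b m -> R[i]) :
  \sum_x F x = \sum_c \sum_(k < m.+1) \sum_(a < d k) \sum_w F (ex c a w).
Proof.
rewrite (eq_bigr (fun x => F (x.1, x.2))) => [|[] //].
rewrite -(pair_bigA _ (fun c z => F (c, z))) /=; apply: eq_bigr => c _.
under [RHS]eq_bigr => k _ do
  rewrite (pair_bigA _ (fun a w => F (ex c a w))) /=.
rewrite (sig_big_dep predT (fun=> predT)
  (fun (k : 'I_m.+1) (z : 'I_(d k) * (m - k).-tuple 'I_b) => F (ex c z.1 z.2))) /=.
by apply: eq_bigr => -[k [a w]] _.
Qed.

Let ex_eq m c k a w c' k' a' w' : @ex m c k a w = @ex m c' k' a' w' ->
  [/\ c = c', val k = val k', val a = val a' & val w = val w'].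
Proof.
move=> E; split.
- exact: (congr1 (fun z => Ecopy z) E).
- exact: (congr1 (fun z => Elevel z) E).
- exact: (congr1 (fun z => val (Ehcoord z)) E).
- exact: (congr1 (fun z => Eword z) E).
Qed.

Let sum0 (I : finType) (F : I -> R[i]) (q : bool) : (forall i, F i = 0) -> ~~ q ->
  \sum_i F i = q%:R.
Proof. by move=> F0 /negPf->; rewrite big1. Qed.

Lemma e_op_le1 eps m : opnorm (e_op R d b eps m) <= 1.
Proof.
apply: (@Eop_norm_le1 _ _ (fun y => Ecopy y == eps)) => y y'.
rewrite (bigD1 y) //= big1 => [|x /negPf xy]; last by rewrite xy conjC_nat mul0r.
rewrite eqxx /= conjC_nat -natrM mulnb addr0; congr (_%:R).
by have [->|] := eqVneq y y'; rewrite /= ?andbb ?andbF.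
Qed.

Lemma F_op_le1 eps m : opnorm (F_op R d b eps m) <= 1.
Proof.
apply: (@Eop_norm_le1 _ _ (fun y => (Ecopy y == eps) && (Elevel y == m))) => y y'.
rewrite (bigD1 y) //= big1 => [|x /negPf xy]; last by rewrite xy conjC_nat mul0r.
rewrite eqxx /= conjC_nat -natrM mulnb addr0; congr (_%:R).
by have [->|] := eqVneq y y'; rewrite /= ?andbb ?andbF.
Qed.

Lemma s_op_le1 m : opnorm (s_op R d b m) <= 1.
Proof.
apply: (@Eop_norm_le1 _ _ (fun y => Ecopy y && (Elevel y == m))) => -[c z] [c' z'].
rewrite (bigD1 (false, z)) //= big1 => [|[c1 z1]]; last first.
  rewrite xpair_eqE /Ecopy /= conjC_nat -natrM mulnb.
  by case: c1 => //= /negPf -> /=; rewrite !andbF.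
rewrite /Ecopy /Elevel /= eqxx andbT conjC_nat -natrM mulnb addr0 xpair_eqE.
congr ((nat_of_bool _)%:R); have [<-|_] := eqVneq z z'; last by rewrite !andbF.
by case: c c' => -[]; rewrite /= ?andbT ?andbb ?andbF.
Qed.

Lemma sigma_op_le1 g m : opnorm (sigma_op pi b g m) <= 1.
Proof.
apply: (@Eop_norm_le1 _ _ xpredT) => y y'; rewrite andbT.
case: y => c [k [a w]]; case: y' => c' [k' [a' w']].
rewrite -/(ex c a w) -/(ex c' a' w').
have [kk|kk] := eqVneq k k'; last first.
  apply: sum0 => [x|]; last by apply: contra_neqN kk => /eqP/ex_eq[_ /val_inj].
  case: ifP => [/and3P[_ /eqP e0 _]|_]; last by rewrite rmorph0 mul0r.
  case: ifP => [/and3P[_ /eqP e _]|_]; last by rewrite mulr0.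
  by case/negP: kk; apply/eqP/val_inj; exact: (etrans (esym e0) e).
subst k'; have [ww|ww] := eqVneq w w'; last first.
  apply: sum0 => [x|]; last by apply: contra_neqN ww => /eqP/ex_eq[_ _ _ /val_inj].
  case: ifP => [/and3P[_ _ /eqP ->]|_]; last by rewrite rmorph0 mul0r.
  case: ifP => [/and3P[_ _ /eqP e]|_]; last by rewrite mulr0.
  by case/negP: ww; apply/eqP/val_inj; exact: e.
subst w'; have [cc|cc] := eqVneq c c'; last first.
  apply: sum0 => [x|]; last by apply: contra_neqN cc => /eqP/ex_eq[].
  case: ifP => [/and3P[/eqP -> _ _]|_]; last by rewrite rmorph0 mul0r.
  case: ifP => [/and3P[/eqP e _ _]|_]; last by rewrite mulr0.
  by case/negP: cc; apply/eqP; exact: e.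
subst c'; rewrite sum_Eidx (bigD1 c) //= [X in _ + X]big1 => [|c1 /negPf c1c]; last first.
  by do 3![rewrite big1 // => ? _]; rewrite /Ecopy /= c1c rmorph0 mul0r.
rewrite addr0 (bigD1 k) //= [X in _ + X]big1 => [|k1 /negPf k1k]; last first.
  do 2![rewrite big1 // => ? _]; rewrite /Ecopy /Elevel /= eqxx /=.
  by rewrite -(inj_eq val_inj) /= in k1k; rewrite k1k rmorph0 mul0r.
have [piU _ _] := pi_unitary k.
transitivity (((pi k g)^t* *m pi k g) a' a); last first.
  have /unitarymxP/mulmx1C-> := piU g; rewrite mxE eq_sym; congr ((nat_of_bool _)%:R).
  by apply/eqP/eqP => [->//|/ex_eq[_ _ /val_inj]].
rewrite addr0 mxE; apply: eq_bigr => a1 _.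
rewrite (bigD1 w) //= big1 => [|w1 /negPf w1w]; last first.
  rewrite /Ecopy /Elevel /Eword /= !eqxx /=.
  by rewrite -(inj_eq val_inj) /= in w1w; rewrite w1w rmorph0 mul0r.
by rewrite /Ecopy /Elevel /Eword /Ehcoord /= !eqxx /= !conform_mx_id !mxE conjCK addr0 mulrC.
Qed.

Lemma T_op_le1 eps (i : 'I_b) m : opnorm (T_op J eps i m) <= 1.
Proof.
apply: (@Eop_norm_le1 _ _ (fun y => (Ecopy y == eps) && (ohead (Eword y) == Some i))).
move=> y y'; case: y => c [k [a w]]; case: y' => c' [k' [a' w']].
rewrite -/(ex c a w) -/(ex c' a' w') /Ecopy /Eword /=.
have [ce|ce] := eqVneq c eps; last first.
  by apply: sum0 => [x|]; rewrite ?andbF // rmorph0 mul0r.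
subst c; have [ce|ce] := eqVneq c' eps; last first.
  apply: sum0 => [x|]; rewrite ?andbF ?mulr0 // negb_and.
  by apply/orP; left; apply: contra_neqN ce => /eqP/ex_eq[].
subst c'; have [kk|kk] := eqVneq k k'; last first.
  apply: sum0 => [x|]; last first.
    by rewrite negb_and (contra_neqN _ kk) // => /eqP/ex_eq[_ /val_inj].
  case: ifP => [/and4P[_ _ /eqP e0 _]|_]; last by rewrite rmorph0 mul0r.
  case: ifP => [/and4P[_ _ /eqP e _]|_]; last by rewrite mulr0.
  by case/negP: kk; apply/eqP/val_inj; exact: (succn_inj (etrans (esym e0) e)).
subst k'; have [ww|ww] := eqVneq w w'; last first.
  apply: sum0 => [x|]; last first.
    by rewrite negb_and (contra_neqN _ ww) // => /eqP/ex_eq[_ _ _ /val_inj].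
  case: ifP => [/and4P[_ _ _ /eqP e]|_]; last by rewrite rmorph0 mul0r.
  case: ifP => [/and4P[_ _ _ /eqP e']|_]; last by rewrite mulr0.
  case/negP: ww; apply/eqP/val_inj; exact: (etrans e (esym e')).
subst w'; have [/eqP wi|wi] := boolP (ohead w == Some i); last first.
  apply: sum0 => [x|]; rewrite ?andbF //.
  case: ifP => [/and4P[_ _ _ /eqP e]|_]; last by rewrite rmorph0 mul0r.
  by move: wi; rewrite e eqxx.
have [t wE] : exists t, tval w = i :: t.
  by case: (tval w) wi => //= i0 t [->]; exists t.
have sz : (size t).+1 = (m - k)%N by rewrite -(size_tuple w) wE.
have km : (k.+1 < m.+1)%N by rewrite ltnS -subn_gt0 -sz.
have tz : size t == (m - k.+1)%N by rewrite subnS -sz.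
pose k1 : 'I_m.+1 := Ordinal km; pose w1 : (m - k1).-tuple 'I_b := Tuple tz.
rewrite sum_Eidx (bigD1 eps) //= [X in _ + X]big1 => [|c1 /negPf c1c]; last first.
  by do 3![rewrite big1 // => ? _]; rewrite c1c rmorph0 mul0r.
rewrite addr0 (bigD1 k1) //= [X in _ + X]big1 => [|k2 /negPf k2k]; last first.
  do 2![rewrite big1 // => ? _]; rewrite /Elevel /= !eqxx /=.
  by rewrite -(inj_eq val_inj) /= in k2k; rewrite k2k rmorph0 mul0r.
transitivity (((J k)^t* *m J k) a' a); last first.
  rewrite J_isometry mxE eq_sym andbT; congr ((nat_of_bool _)%:R).
  by apply/eqP/eqP => [->//|/ex_eq[_ _ /val_inj]].
rewrite addr0 mxE; apply: eq_bigr => a1 _.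
rewrite (bigD1 w1) //= big1 => [|w2 /negPf w2w]; last first.
  rewrite /Elevel /= !eqxx /= wE eqseq_cons eqxx /=.
  by rewrite -(inj_eq val_inj) /= eq_sym in w2w; rewrite w2w rmorph0 mul0r.
rewrite /Elevel /Ehcoord /= !eqxx /= wE eqxx /=.
by rewrite !conform_mx_id !mxE conjCK addr0 mulrC.
Qed.

Lemma generators_bounded :
  [/\ forall eps, exists x : prodE R d b, forall m, x m = e_op R d b eps m,
      forall eps, exists x : prodE R d b, forall m, x m = F_op R d b eps m,
      forall eps i, exists x : prodE R d b, forall m, x m = T_op J eps i m,
      forall g, exists x : prodE R d b, forall m, x m = sigma_op pi b g m &
      exists x : prodE R d b, forall m, x m = s_op R d b m].
Proof.
have ex_bounded (f : forall m, 'M[R[i]]_#|Eidx d b m|) :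
    (forall m, opnorm (f m) <= 1) -> exists x : prodE R d b, forall m, x m = f m.
  move=> f1; have fb : exists c : R, forall m, cnorm (f m) <= c by exists 1.
  by exists (Linfty fb).
split=> [eps|eps|eps i|g|]; apply: ex_bounded => m.
- exact: e_op_le1.
- exact: F_op_le1.
- exact: T_op_le1.
- exact: sigma_op_le1.
- exact: s_op_le1.
Qed.

End GeneratorsBounded.

(* Main.v *)
(** The trace [mu1] is an ultralimit over m of the normalized traces of the
    copy-0 corners of B(E_m); [tau] is an ultralimit of averages of traces of
    finite-dimensional representations of A, hence quasidiagonal, weighted so
    that it is faithful and dominates [mu1 / 4].

    Suppose that [mu1] is quasidiagonal via maps psi : A -> M_N and put, for a
    finite Kazhdan set K,
      D_k(eps) = sum_(g in K) (2 - sigma(g) (x) pi_k(g)^T - adjoint) + (1 - e^eps).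
    By property (T) and Schur's lemma, D_k(eps) has in every E_m a spectral gap
    uniform in m, and its kernel consists of the invariant vectors of copy eps.
    Unital completely positive maps preserve inequalities between quadratic
    forms, so the image of D_k(eps) under psi has the gap too; let n_k(eps) be
    the number of its eigenvalues near 0.  An invariant vector at level k of
    copy 0 is seen by s^* or by one of the T_i^0, which lead to level k of copy 1
    and to level k + 1 of copy 0; in copy 1 the ranges of s^* and of the b
    operators (T_i^1)^* are orthogonal inside level k.  Transported through psi
    this reads
      n_k(0) <= r + b n_(k+1)(0)   and   r + b n_(k+1)(1) <= n_k(1)
    with the same rank r, so that n_(k+1)(0) <= n_(k+1)(1) implies
    n_k(0) <= n_k(1).  As n_k(0) = 0 once d_k >= 4 N, descent yields
    n_0(0) <= n_0(1).  But n_0(1) <= 2 Tr psi(e^1) = o(N) because mu1(e^1) = 0,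
    whereas mu1((1 - D_0(0)/L)^(2j)) is bounded below for all j by the proportion
    of invariant vectors in copy 0, so that n_0(0) is at least a fixed multiple
    of N: a contradiction. *)
Require Import Defs.
From HB Require Import structures.
From mathcomp Require Import all_boot all_order all_algebra all_fingroup.
From mathcomp Require Import sesquilinear spectral complex.
From mathcomp Require Import all_classical all_reals all_analysis.
From mathcomp Require Import ring lra.
Import Order.TTheory GRing.Theory Num.Theory Num.Def.
Import numFieldNormedType.Exports.
Local Open Scope classical_set_scope.
Local Open Scope sesquilinear_scope.
Local Open Scope ring_scope.

Set Implicit Arguments.
Unset Strict Implicit.
Unset Printing Implicit Defensive.

(** * Hilbert-Schmidt geometry of matrix spaces *)

Section InnerProduct.
Context {R : realType}.
Local Notation C := R[i].

(** The number of descent steps is not known in advance: it depends on the size N of the matrices,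
    and psi is chosen only after the finite list of products on which it has to be almost
    multiplicative. Hence every estimate must be uniform in k. At all levels D_k(eps) is built from
    the same elements 1, sigma(g), e^eps of A; only the coefficient matrices pi_k(g)^T change, and
    these act as contractions. Errors do not pile up along the descent, since each step compares
    integers. The rank r is never formed: one step glues s^*, the T_i^0 and the adjoints of the
    T_i^1 into a single map between the two near-kernels at level k. The adjoint of T_i^1 preserves
    invariance, but T_i^0 turns a scalar block into a multiple of a projection of rank d_k. Its
    values are therefore cut down to the near-kernel of D_(k+1)(0) by powers of 1 - D/L, which can
    be written in A; the bound on d_(k+1)/d_k ensures that a fixed proportion survives. Order
    relations in M_n(A) are tested in the algebras B(E_m); a square root obtained by iteration makes
    them accessible to complete positivity. *)

Definition cip {p q} (x y : 'M[C]_(p, q)) : C := \tr (x *m y^t*).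
Definition rdot {p q} (x y : 'M[C]_(p, q)) : R := complex.Re (cip x y).
Definition nsq {p q} (x : 'M[C]_(p, q)) : R := rdot x x.
Definition nrm {p q} (x : 'M[C]_(p, q)) : R := Num.sqrt (nsq x).

Lemma ReD (z w : C) : complex.Re (z + w) = complex.Re z + complex.Re w.
Proof. by case: z w => [a b] [c d]. Qed.

Lemma ReN (z : C) : complex.Re (- z) = - complex.Re z.
Proof. by case: z. Qed.

Lemma Re_sum (I : Type) (r : seq I) (P : pred I) (F : I -> C) :
  complex.Re (\sum_(i <- r | P i) F i) = \sum_(i <- r | P i) complex.Re (F i).
Proof. by apply: (big_morph _ ReD). Qed.

Lemma ReMr (r : R) (z : C) : complex.Re (r%:C%C * z) = r * complex.Re z.
Proof. by case: z => a b /=; rewrite mul0r subr0. Qed.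

Lemma Re_conj (z : C) : complex.Re z^* = complex.Re z.
Proof. by case: z. Qed.

Lemma conjR (r : R) : (r%:C%C : C)^* = r%:C%C.
Proof. exact: conjc_real. Qed.

Lemma cipE p q (x y : 'M[C]_(p, q)) : cip x y = \sum_i \sum_j x i j * (y i j)^*.
Proof.
by apply: eq_bigr => i _; rewrite mxE; apply: eq_bigr => j _; rewrite !mxE.
Qed.

Lemma cipC p q (x y : 'M[C]_(p, q)) : cip y x = (cip x y)^*.
Proof.
rewrite !cipE rmorph_sum; apply: eq_bigr => i _; rewrite rmorph_sum.
by apply: eq_bigr => j _; rewrite rmorphM /= conjCK mulrC.
Qed.

Lemma cipDl p q (x y z : 'M[C]_(p, q)) : cip (x + y) z = cip x z + cip y z.
Proof. by rewrite /cip mulmxDl mxtraceD. Qed.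

Lemma cipZl p q c (x z : 'M[C]_(p, q)) : cip (c *: x) z = c * cip x z.
Proof. by rewrite /cip -scalemxAl mxtraceZ. Qed.

Lemma cipDr p q (x y z : 'M[C]_(p, q)) : cip z (x + y) = cip z x + cip z y.
Proof. by rewrite cipC cipDl [cip z x]cipC [cip z y]cipC rmorphD. Qed.

Lemma cipZr p q c (x z : 'M[C]_(p, q)) : cip z (c *: x) = c^* * cip z x.
Proof. by rewrite cipC cipZl [cip z x]cipC rmorphM. Qed.

Lemma cip_suml p q (I : Type) (r : seq I) (P : pred I) F (z : 'M[C]_(p, q)) :
  cip (\sum_(i <- r | P i) F i) z = \sum_(i <- r | P i) cip (F i) z.
Proof.
apply: (big_morph (fun x => cip x z) (fun x y => cipDl x y z)).
by rewrite /cip mul0mx mxtrace0.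
Qed.

Lemma cip_sumr p q (I : Type) (r : seq I) (P : pred I) F (z : 'M[C]_(p, q)) :
  cip z (\sum_(i <- r | P i) F i) = \sum_(i <- r | P i) cip z (F i).
Proof. by rewrite cipC cip_suml rmorph_sum; apply: eq_bigr => i _; rewrite [RHS]cipC. Qed.

Lemma cip_mull p q r (a : 'M[C]_(p, q)) (x : 'M[C]_(q, r)) y :
  cip (a *m x) y = cip x (a^t* *m y).
Proof.
by rewrite /cip trmx_mul map_mxM trmxCK -mulmxA mxtrace_mulC -mulmxA.
Qed.

Lemma cip_mulr p q r (a : 'M[C]_(q, r)) (x : 'M[C]_(p, q)) y :
  cip (x *m a) y = cip x (y *m a^t*).
Proof. by rewrite /cip trmx_mul map_mxM trmxCK mulmxA. Qed.

Lemma rdotC p q (x y : 'M[C]_(p, q)) : rdot x y = rdot y x.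
Proof. by rewrite /rdot cipC Re_conj. Qed.

Lemma rdotDl p q (x y z : 'M[C]_(p, q)) : rdot (x + y) z = rdot x z + rdot y z.
Proof. by rewrite /rdot cipDl ReD. Qed.

Lemma rdotDr p q (x y z : 'M[C]_(p, q)) : rdot z (x + y) = rdot z x + rdot z y.
Proof. by rewrite /rdot cipDr ReD. Qed.

Lemma rdotNl p q (x z : 'M[C]_(p, q)) : rdot (- x) z = - rdot x z.
Proof. by rewrite /rdot -scaleN1r cipZl mulN1r ReN. Qed.

Lemma rdotNr p q (x z : 'M[C]_(p, q)) : rdot z (- x) = - rdot z x.
Proof. by rewrite rdotC rdotNl rdotC. Qed.

Lemma rdotBl p q (x y z : 'M[C]_(p, q)) : rdot (x - y) z = rdot x z - rdot y z.
Proof. by rewrite rdotDl rdotNl. Qed.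

Lemma rdotBr p q (x y z : 'M[C]_(p, q)) : rdot z (x - y) = rdot z x - rdot z y.
Proof. by rewrite rdotDr rdotNr. Qed.

Lemma rdotZl p q (r : R) (x z : 'M[C]_(p, q)) : rdot (r%:C%C *: x) z = r * rdot x z.
Proof. by rewrite /rdot cipZl ReMr. Qed.

Lemma rdotZr p q (r : R) (x z : 'M[C]_(p, q)) : rdot z (r%:C%C *: x) = r * rdot z x.
Proof. by rewrite rdotC rdotZl rdotC. Qed.

Lemma rdot0l p q (z : 'M[C]_(p, q)) : rdot 0 z = 0.
Proof. by rewrite -(scale0r z) -(rmorph0 (real_complex R)) rdotZl mul0r. Qed.

Lemma rdot0r p q (z : 'M[C]_(p, q)) : rdot z 0 = 0.
Proof. by rewrite rdotC rdot0l. Qed.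

Lemma rdot_suml p q (I : Type) (r : seq I) (P : pred I) F (z : 'M[C]_(p, q)) :
  rdot (\sum_(i <- r | P i) F i) z = \sum_(i <- r | P i) rdot (F i) z.
Proof. by rewrite /rdot cip_suml Re_sum. Qed.

Lemma rdot_sumr p q (I : Type) (r : seq I) (P : pred I) F (z : 'M[C]_(p, q)) :
  rdot z (\sum_(i <- r | P i) F i) = \sum_(i <- r | P i) rdot z (F i).
Proof. by rewrite /rdot cip_sumr Re_sum. Qed.

Lemma rdot_mull p q r (a : 'M[C]_(p, q)) (x : 'M[C]_(q, r)) y :
  rdot (a *m x) y = rdot x (a^t* *m y).
Proof. by rewrite /rdot cip_mull. Qed.

Lemma rdot_mulr p q r (a : 'M[C]_(q, r)) (x : 'M[C]_(p, q)) y :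
  rdot (x *m a) y = rdot x (y *m a^t*).
Proof. by rewrite /rdot cip_mulr. Qed.

Lemma nsqE p q (x : 'M[C]_(p, q)) : nsq x = \sum_i \sum_j cabs (x i j) ^+ 2.
Proof.
rewrite /nsq /rdot cipE Re_sum; apply: eq_bigr => i _; rewrite Re_sum.
by apply: eq_bigr => j _; rewrite mulrC cabs_conjM.
Qed.

Lemma nsq_ge0 p q (x : 'M[C]_(p, q)) : 0 <= nsq x.
Proof. by rewrite nsqE; do 2!apply: sumr_ge0 => ? _; exact: sqr_ge0. Qed.

Lemma cip_nsq p q (x : 'M[C]_(p, q)) : cip x x = (nsq x)%:C%C.
Proof.
rewrite nsqE cipE rmorph_sum; apply: eq_bigr => i _; rewrite rmorph_sum.
by apply: eq_bigr => j _; rewrite mulrC cabs_conjM.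
Qed.

Lemma nsq_eq0 p q (x : 'M[C]_(p, q)) : nsq x = 0 -> x = 0.
Proof.
move=> x0; apply/matrixP => i j; rewrite mxE; apply: ComplexField.Normc.eq0_normc.
move/eqP: x0; rewrite nsqE psumr_eq0 => [/allP/(_ i)|k _]; last first.
  by apply: sumr_ge0 => ? _; exact: sqr_ge0.
rewrite mem_index_enum => /(_ isT) /=; rewrite psumr_eq0 => [/allP/(_ j)|k _].
  by rewrite mem_index_enum => /(_ isT) /=; rewrite sqrf_eq0 => /eqP.
exact: sqr_ge0.
Qed.

Lemma nsq0 p q : nsq (0 : 'M[C]_(p, q)) = 0.
Proof. exact: rdot0l. Qed.

Lemma nsqZ p q c (x : 'M[C]_(p, q)) : nsq (c *: x) = cabs c ^+ 2 * nsq x.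
Proof.
rewrite !nsqE mulr_sumr; apply: eq_bigr => i _; rewrite mulr_sumr.
by apply: eq_bigr => j _; rewrite mxE cabsM exprMn.
Qed.

Lemma nsqN p q (x : 'M[C]_(p, q)) : nsq (- x) = nsq x.
Proof. by rewrite /nsq rdotNl rdotNr opprK. Qed.

Lemma nsqD p q (x y : 'M[C]_(p, q)) : nsq (x + y) = nsq x + 2 * rdot x y + nsq y.
Proof. by rewrite /nsq rdotDl !rdotDr (rdotC y x); ring. Qed.

Lemma nsqB p q (x y : 'M[C]_(p, q)) : nsq (x - y) = nsq x - 2 * rdot x y + nsq y.
Proof. by rewrite nsqD nsqN rdotNr; ring. Qed.

Lemma nsqD_le p q (x y : 'M[C]_(p, q)) : nsq (x + y) <= 2 * nsq x + 2 * nsq y.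
Proof. by have := nsq_ge0 (x - y); rewrite nsqB nsqD; lra. Qed.

Lemma rdot_amgm p q (t : R) (x y : 'M[C]_(p, q)) :
  2 * t * rdot x y <= nsq x + t ^+ 2 * nsq y.
Proof.
have := nsq_ge0 (x - t%:C%C *: y); rewrite nsqB rdotZr nsqZ cabs_real.
by rewrite real_normK ?num_real //; lra.
Qed.

(** The inequality 2<x, y> <= |x|^2 + |y|^2 is summed over all pairs of terms. *)
Lemma nsq_sum_le p q (I : finType) (F : I -> 'M[C]_(p, q)) :
  nsq (\sum_i F i) <= #|I|%:R * \sum_i nsq (F i).
Proof.
rewrite /nsq rdot_suml.
under eq_bigr do rewrite rdot_sumr.
apply: (@le_trans _ _ (\sum_i \sum_j (nsq (F i) + nsq (F j)) / 2)).
  apply: ler_sum => i _; apply: ler_sum => j _; rewrite ler_pdivlMr // mulrC.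
  by have := @rdot_amgm _ _ 1 (F i) (F j); rewrite mulr1 expr1n mul1r.
pose a i := nsq (F i).
have -> : \sum_i \sum_j (a i + a j) / 2 = \sum_i \sum_(j : I) a i / 2 + \sum_(i : I) \sum_j a j / 2.
  by rewrite -big_split; apply: eq_bigr => i _; rewrite -big_split; apply: eq_bigr => j _ /=; ring.
rewrite [X in X + _]exchange_big /= !sumr_const -mulrnDl -mulr_suml -splitr.
by rewrite mulrC mulr_natr.
Qed.

Lemma nrm_ge0 p q (x : 'M[C]_(p, q)) : 0 <= nrm x.
Proof. exact: sqrtr_ge0. Qed.

Lemma nrm_sqr p q (x : 'M[C]_(p, q)) : nrm x ^+ 2 = nsq x.
Proof. by rewrite sqr_sqrtr ?nsq_ge0. Qed.

Lemma nrm0 p q : nrm (0 : 'M[C]_(p, q)) = 0.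
Proof. by rewrite /nrm nsq0 sqrtr0. Qed.

Lemma nrm_le p q p' q' (x : 'M[C]_(p, q)) (y : 'M[C]_(p', q')) (c : R) : 0 <= c ->
  (nrm x <= c * nrm y) = (nsq x <= c ^+ 2 * nsq y).
Proof.
move=> c0; rewrite -(@ler_pXn2r _ 2) ?nnegrE ?nrm_ge0 ?mulr_ge0 ?nrm_ge0 //.
by rewrite exprMn !nrm_sqr.
Qed.

Lemma rdot_cs p q (x y : 'M[C]_(p, q)) : rdot x y <= nrm x * nrm y.
Proof.
have [y0|yn] := eqVneq (nsq y) 0.
  by rewrite (nsq_eq0 y0) rdot0r nrm0 mulr0.
have yp : 0 < nsq y by rewrite lt_def yn nsq_ge0.
have [xy|xy] := leP (rdot x y) 0.
  by apply: (le_trans xy); rewrite mulr_ge0 ?nrm_ge0.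
rewrite -(@ler_pXn2r _ 2) ?nnegrE ?mulr_ge0 ?nrm_ge0 //; last exact: ltW.
rewrite exprMn !nrm_sqr.
pose t := rdot x y / nsq y.
have ty : t * nsq y = rdot x y by rewrite divfK.
have h := ler_wpM2r (ltW yp) (rdot_amgm t x y).
have e1 : t ^+ 2 * nsq y * nsq y = rdot x y ^+ 2 by rewrite -ty; ring.
have e2 : t * rdot x y * nsq y = rdot x y ^+ 2 by rewrite -ty; ring.
by lra.
Qed.

Lemma rdot_cs_abs p q (x y : 'M[C]_(p, q)) : `|rdot x y| <= nrm x * nrm y.
Proof.
rewrite ler_norml rdot_cs andbT lerNl -rdotNl.
by apply: (le_trans (rdot_cs _ _)); rewrite /nrm nsqN.
Qed.

Lemma nrmD p q (x y : 'M[C]_(p, q)) : nrm (x + y) <= nrm x + nrm y.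
Proof.
rewrite -(@ler_pXn2r _ 2) ?nnegrE ?addr_ge0 ?nrm_ge0 // sqrrD !nrm_sqr nsqD.
rewrite lerD2r lerD2l.
by have := rdot_cs x y; lra.
Qed.

Lemma nrmB_trans p q (y x z : 'M[C]_(p, q)) : nrm (x - z) <= nrm (x - y) + nrm (y - z).
Proof. by apply: le_trans (nrmD _ _); rewrite addrA subrK. Qed.

Lemma nrm_sum p q (I : Type) (r : seq I) (P : pred I) (F : I -> 'M[C]_(p, q)) :
  nrm (\sum_(i <- r | P i) F i) <= \sum_(i <- r | P i) nrm (F i).
Proof.
elim/big_rec2: _ => [|i x y _ le]; first by rewrite nrm0.
by apply: (le_trans (nrmD _ _)); rewrite lerD2l.
Qed.

Lemma nrmZ p q c (x : 'M[C]_(p, q)) : nrm (c *: x) = cabs c * nrm x.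
Proof.
by rewrite /nrm nsqZ sqrtrM ?sqr_ge0 // sqrtr_sqr ger0_norm ?cabs_ge0.
Qed.

Lemma nsq_vnorm n (v : 'cV[C]_n) : nsq v = vnorm v ^+ 2.
Proof. by rewrite nsqE vnorm_sqr; apply: eq_bigr => i _; rewrite big_ord1. Qed.

Lemma nsq_cols p q (x : 'M[C]_(p, q)) : nsq x = \sum_j nsq (col j x).
Proof.
rewrite nsqE exchange_big; apply: eq_bigr => j _.
by rewrite nsqE; apply: eq_bigr => i _; rewrite big_ord1 mxE.
Qed.

Lemma nrm_mull p q (a : 'M[C]_p) (x : 'M[C]_(p, q)) : nrm (a *m x) <= opnorm a * nrm x.
Proof.
rewrite nrm_le ?opnorm_ge0 // (nsq_cols x) nsq_cols mulr_sumr.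
apply: ler_sum => j _; rewrite !colE -mulmxA -colE !nsq_vnorm -exprMn.
by rewrite ler_pXn2r ?nnegrE ?mulr_ge0 ?vnorm_ge0 ?opnorm_ge0 ?vnorm_mul.
Qed.

Lemma opnorm_le_nrm p (a : 'M[C]_p) (c : R) : 0 <= c ->
  (forall v : 'cV[C]_p, nrm (a *m v) <= c * nrm v) -> opnorm a <= c.
Proof.
move=> c0 le; apply: opnorm_le => // v; have := le v.
by rewrite /nrm !nsq_vnorm !sqrtr_sqr !ger0_norm ?vnorm_ge0.
Qed.

End InnerProduct.

(** * Matrix-valued elements acting on matrices *)

Section Forms.
Context {R : realType}.
Local Notation C := R[i].
Variable B : cstarAlgType R.

Definition matrix_rep e (phi : B -> 'M[C]_e) : Prop :=
  [/\ forall (c : C) a a', phi (c *: a + a') = c *: phi a + phi a',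
      forall a a', phi (a * a') = phi a *m phi a',
      forall a, phi (star a) = (phi a)^t* &
      phi 1 = 1%:M].

Section LinearPhi.
Variables (e : nat) (phi : B -> 'M[C]_e).
Hypothesis phi_lin : forall (c : C) a a', phi (c *: a + a') = c *: phi a + phi a'.

Lemma lin0 : phi 0 = 0.
Proof.
have := phi_lin 1 0 0; rewrite scale1r addr0 scale1r => /eqP.
by rewrite -subr_eq subrr eq_sym => /eqP.
Qed.

Lemma linZ c a : phi (c *: a) = c *: phi a.
Proof. by have := phi_lin c a 0; rewrite lin0 !addr0. Qed.

Lemma linD a a' : phi (a + a') = phi a + phi a'.
Proof. by have := phi_lin 1 a a'; rewrite !scale1r. Qed.

Lemma linN a : phi (- a) = - phi a.
Proof. by rewrite -scaleN1r linZ scaleN1r. Qed.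

Lemma linB a a' : phi (a - a') = phi a - phi a'.
Proof. by rewrite linD linN. Qed.

Lemma lin_sum (I : Type) (r : seq I) (P : pred I) F :
  phi (\sum_(i <- r | P i) F i) = \sum_(i <- r | P i) phi (F i).
Proof. exact: (big_morph _ linD lin0). Qed.

End LinearPhi.

(* A pair (X, a) stands for X^T (x) a in M_(n1, n2) (x) B, and C^n (x) C^e is
   identified with the e x n matrices. *)
Definition ev e (phi : B -> 'M[C]_e) n2 n1 (l : seq ('M[C]_(n2, n1) * B))
    (x : 'M[C]_(e, n2)) : 'M[C]_(e, n1) :=
  \sum_(t <- l) phi t.2 *m x *m t.1.

(** The coefficient matrices act from the right, so their product is taken in the reverse order. *)
Definition fmul n1 n2 n3 (l1 : seq ('M[C]_(n2, n3) * B))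
    (l2 : seq ('M[C]_(n1, n2) * B)) : seq ('M[C]_(n1, n3) * B) :=
  [seq (t2.1 *m t1.1, t1.2 * t2.2) | t1 <- l1, t2 <- l2].

Definition fstar n1 n2 (l : seq ('M[C]_(n1, n2) * B)) : seq ('M[C]_(n2, n1) * B) :=
  [seq (t.1^t*, star t.2) | t <- l].

(** The scalar goes to the algebra component, so that coefficient matrices which are contractions
    remain so for every [r]. *)
Definition fscale n1 n2 (r : R) (l : seq ('M[C]_(n1, n2) * B)) :=
  [seq (t.1, r%:C%C *: t.2) | t <- l].

Section Ev.
Variables (e : nat) (phi : B -> 'M[C]_e).

Lemma ev_nil n1 n2 (x : 'M[C]_(e, n1)) : ev phi ([::] : seq ('M[C]_(n1, n2) * B)) x = 0.
Proof. by rewrite /ev big_nil. Qed.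

Lemma ev_cat n1 n2 (l l' : seq ('M[C]_(n1, n2) * B)) x :
  ev phi (l ++ l') x = ev phi l x + ev phi l' x.
Proof. by rewrite /ev big_cat. Qed.

Lemma ev_cons n1 n2 (t : 'M[C]_(n1, n2) * B) l x :
  ev phi (t :: l) x = phi t.2 *m x *m t.1 + ev phi l x.
Proof. by rewrite /ev big_cons. Qed.

Lemma ev1 n1 n2 (X : 'M[C]_(n1, n2)) a x : ev phi [:: (X, a)] x = phi a *m x *m X.
Proof. by rewrite /ev big_seq1. Qed.

Lemma evD n1 n2 (l : seq ('M[C]_(n1, n2) * B)) x y :
  ev phi l (x + y) = ev phi l x + ev phi l y.
Proof. by rewrite /ev -big_split; apply: eq_bigr => t _; rewrite mulmxDr mulmxDl. Qed.

Lemma evZ n1 n2 (l : seq ('M[C]_(n1, n2) * B)) c x :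
  ev phi l (c *: x) = c *: ev phi l x.
Proof. by rewrite /ev scaler_sumr; apply: eq_bigr => t _; rewrite -scalemxAr -scalemxAl. Qed.

Lemma ev_fscale n1 n2 (r : R) (l : seq ('M[C]_(n1, n2) * B)) x :
  (forall (c : C) a a', phi (c *: a + a') = c *: phi a + phi a') ->
  ev phi (fscale r l) x = r%:C%C *: ev phi l x.
Proof.
move=> lin; rewrite /ev big_map scaler_sumr; apply: eq_bigr => t _ /=.
by rewrite linZ // -!scalemxAl.
Qed.

Lemma ev_fmul n1 n2 n3 (l1 : seq ('M[C]_(n2, n3) * B)) (l2 : seq ('M[C]_(n1, n2) * B)) x :
  (forall a a', phi (a * a') = phi a *m phi a') ->
  ev phi (fmul l1 l2) x = ev phi l1 (ev phi l2 x).
Proof.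
move=> mul; rewrite /ev big_allpairs_dep /=; apply: eq_bigr => t1 _.
rewrite mulmx_sumr mulmx_suml; apply: eq_bigr => t2 _.
by rewrite mul !mulmxA.
Qed.

Lemma rdot_ev n1 n2 (l : seq ('M[C]_(n1, n2) * B)) x y :
  (forall a, phi (star a) = (phi a)^t*) ->
  rdot (ev phi l x) y = rdot x (ev phi (fstar l) y).
Proof.
move=> st; rewrite /ev big_map rdot_suml rdot_sumr; apply: eq_bigr => t _ /=.
by rewrite rdot_mulr rdot_mull st mulmxA.
Qed.

End Ev.

(** The transposed indices agree with reading (X, a) as X^T (x) a. *)
Definition tomx n (l : seq ('M[C]_n * B)) : 'M[B]_n :=
  \matrix_(i, j) \sum_(t <- l) t.1 j i *: t.2.

Definition sta (D : cstarAlgType R) n (a : 'M[D]_n) : 'M[D]_n := (map_mx star a)^T.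

End Forms.

Section Mact.
Context {R : realType}.
Local Notation C := R[i].

(** The amplification of [phi] to n x n matrices over B, acting on C^n (x) C^e in the same
    identification as [ev]: column i of the result is the sum over j of [phi (a i j)] applied to
    column j. *)
Definition mact (B : cstarAlgType R) e (phi : B -> 'M[C]_e) n (a : 'M[B]_n)
    (x : 'M[C]_(e, n)) : 'M[C]_(e, n) :=
  \matrix_(r, i) \sum_j (phi (a i j) *m x) r j.

Variable B : cstarAlgType R.

Lemma starB (D : cstarAlgType R) (x y : D) : star (x - y) = star x - star y.
Proof. by rewrite starD starN. Qed.

Lemma star_sum (D : cstarAlgType R) (I : Type) (r : seq I) (P : pred I) (F : I -> D) :
  star (\sum_(i <- r | P i) F i) = \sum_(i <- r | P i) star (F i).
Proof. exact: (big_morph _ (@starD R D) (@star0 R D)). Qed.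

Lemma staE (D : cstarAlgType R) n (a : 'M[D]_n) i j : sta a i j = star (a j i).
Proof. by rewrite !mxE. Qed.

Lemma staM (D : cstarAlgType R) n (a b : 'M[D]_n) : sta (a *m b) = sta b *m sta a.
Proof.
apply/matrixP => i j; rewrite !mxE star_sum; apply: eq_bigr => k _.
by rewrite !mxE starM.
Qed.

Lemma staD (D : cstarAlgType R) n (a b : 'M[D]_n) : sta (a + b) = sta a + sta b.
Proof. by apply/matrixP => i j; rewrite !mxE starD. Qed.

Lemma staB (D : cstarAlgType R) n (a b : 'M[D]_n) : sta (a - b) = sta a - sta b.
Proof. by apply/matrixP => i j; rewrite !mxE starB. Qed.

Lemma staK (D : cstarAlgType R) n (a : 'M[D]_n) : sta (sta a) = a.
Proof. by apply/matrixP => i j; rewrite !mxE starK. Qed.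

Lemma sta1 (D : cstarAlgType R) n : sta (1%:M : 'M[D]_n) = 1%:M.
Proof.
apply/matrixP => i j; rewrite !mxE eq_sym.
by case: (i == j); rewrite ?mulr1n ?mulr0n ?star1 ?star0.
Qed.

Section LinearPhi.
Variables (e : nat) (phi : B -> 'M[C]_e).
Hypothesis phi_lin : forall (c : C) a a', phi (c *: a + a') = c *: phi a + phi a'.

Lemma mact_tomx n (l : seq ('M[C]_n * B)) x : mact phi (tomx l) x = ev phi l x.
Proof.
apply/matrixP => r i; rewrite mxE /ev summxE.
under eq_bigr => j _ do rewrite [tomx _ _ _]mxE (lin_sum phi_lin) mulmx_suml summxE.
rewrite exchange_big; apply: eq_bigr => t _; rewrite mxE; apply: eq_bigr => j _.
by rewrite (linZ phi_lin) -scalemxAl mxE mulrC.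
Qed.

Lemma mactD n (a b : 'M[B]_n) x : mact phi (a + b) x = mact phi a x + mact phi b x.
Proof.
apply/matrixP => r i; rewrite !mxE -big_split; apply: eq_bigr => j _.
by rewrite [(a + b) _ _]mxE (linD phi_lin) mulmxDl mxE.
Qed.

Lemma mactB n (a b : 'M[B]_n) x : mact phi (a - b) x = mact phi a x - mact phi b x.
Proof.
apply/matrixP => r i; rewrite !mxE -sumrB; apply: eq_bigr => j _.
by rewrite [(a - b) _ _]mxE [(- b) _ _]mxE (linB phi_lin) mulmxBl [LHS]mxE [(- (_ *m x)) _ _]mxE.
Qed.

Lemma mact1 n x : phi 1 = 1%:M -> mact phi (1%:M : 'M[B]_n) x = x.
Proof.
move=> phi1; apply/matrixP => r i; rewrite mxE (bigD1 i) //= big1 => [|j ji].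
  by rewrite [1%:M _ _]mxE eqxx mulr1n phi1 mul1mx addr0.
by rewrite [1%:M _ _]mxE eq_sym (negbTE ji) mulr0n (lin0 phi_lin) mul0mx mxE.
Qed.

Lemma mactM n (a b : 'M[B]_n) x : (forall a a', phi (a * a') = phi a *m phi a') ->
  mact phi (a *m b) x = mact phi a (mact phi b x).
Proof.
move=> mul; apply/matrixP => r i; rewrite !mxE.
under eq_bigr => j _ do rewrite [(a *m b) _ _]mxE (lin_sum phi_lin) mulmx_suml summxE.
rewrite exchange_big; apply: eq_bigr => k _; rewrite [RHS]mxE.
under [RHS]eq_bigr => s _ do rewrite mxE mulr_sumr.
rewrite exchange_big; apply: eq_bigr => j _.
by rewrite mul -mulmxA mxE.
Qed.

End LinearPhi.

Lemma col_mact e (phi : B -> 'M[C]_e) n (a : 'M[B]_n) x i :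
  col i (mact phi a x) = \sum_j phi (a i j) *m col j x.
Proof.
apply/matrixP => r k; rewrite !mxE summxE; apply: eq_bigr => j _.
by rewrite !mxE; apply: eq_bigr => s _; rewrite !mxE.
Qed.

Lemma rdot_cols p q (x y : 'M[C]_(p, q)) : rdot x y = \sum_j rdot (col j x) (col j y).
Proof.
rewrite /rdot cipE exchange_big /= Re_sum; apply: eq_bigr => j _.
rewrite cipE !Re_sum; apply: eq_bigr => i _; rewrite big_ord1 !mxE //.
Qed.

Lemma rdot_mact e (phi : B -> 'M[C]_e) n (a : 'M[B]_n) x y :
  (forall a, phi (star a) = (phi a)^t*) ->
  rdot (mact phi a x) y = rdot x (mact phi (sta a) y).
Proof.
move=> st; rewrite rdot_cols.
under eq_bigr => i _ do rewrite col_mact rdot_suml.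
rewrite exchange_big [RHS]rdot_cols; apply: eq_bigr => j _.
rewrite col_mact rdot_sumr; apply: eq_bigr => i _.
by rewrite rdot_mull !mxE st.
Qed.

End Mact.

(** * Square roots in matrix algebras over a C*-algebra *)

Section SquareRoot.
Context {R : realType}.
Local Notation C := R[i].
Variables (B : cstarAlgType R) (e : nat -> nat) (phi : forall m, B -> 'M[C]_(e m)).

(** A family of finite-dimensional representations that computes the norm of B. It stands in for a
    C*-norm and a functional calculus on M_n(B): bounds and signs there are always tested in the
    matrices [phi m]. *)
Definition norming_reps : Prop :=
  [/\ forall m, matrix_rep (@phi m),
      forall m a, opnorm (phi m a) <= cnorm a &
      forall a (c : R), (forall m, opnorm (phi m a) <= c) -> cnorm a <= c].

Hypothesis phiN : norming_reps.

Let lin m : forall (c : C) a a', phi m (c *: a + a') = c *: phi m a + phi m a'.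
Proof. by have [/(_ m) []] := phiN. Qed.
Let mul m a a' : phi m (a * a') = phi m a *m phi m a'.
Proof. by have [/(_ m) []] := phiN. Qed.
Let phist m a : phi m (star a) = (phi m a)^t*.
Proof. by have [/(_ m) []] := phiN. Qed.
Let phi1 m : phi m 1 = 1%:M.
Proof. by have [/(_ m) []] := phiN. Qed.

Definition opb n (a : 'M[B]_n) (c : R) : Prop :=
  forall m x, nrm (mact (phi m) a x) <= c * nrm x.

Lemma opbD n (a b : 'M[B]_n) c d : opb a c -> opb b d -> opb (a + b) (c + d).
Proof.
move=> ac bd m x; rewrite mactD //; apply: (le_trans (nrmD _ _)).
by rewrite mulrDl lerD.
Qed.

Lemma opbM n (a b : 'M[B]_n) c d : 0 <= c -> opb a c -> opb b d -> opb (a *m b) (c * d).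
Proof.
move=> c0 ac bd m x; rewrite mactM //; apply: (le_trans (ac _ _)).
by rewrite -mulrA ler_wpM2l.
Qed.

Lemma opb0 n : opb (0 : 'M[B]_n) 0.
Proof. by move=> m x; rewrite -(subrr (0 : 'M[B]_n)) mactB // subrr nrm0 mul0r. Qed.

Lemma opb_le n (a : 'M[B]_n) c d : c <= d -> opb a c -> opb a d.
Proof. by move=> cd ac m x; apply: (le_trans (ac m x)); rewrite ler_wpM2r ?nrm_ge0. Qed.

(** Testing on matrices whose only nonzero column is the j-th isolates one entry. This converts
    bounds on M_n(B) into Cauchy estimates in B, where completeness is available. *)
Lemma opb_entry n (a : 'M[B]_n) c i j : 0 <= c -> opb a c -> cnorm (a i j) <= c.
Proof.
move=> c0 ac; have [_ _ N] := phiN; apply: N => m.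
apply: opnorm_le_nrm => // v; have := ac m (v *m delta_mx 0 j).
have cE k : col k (v *m delta_mx 0 j : 'M[C]_(e m, n)) = if k == j then v else 0.
  apply/matrixP => p s; rewrite mxE mxE big_ord1 !mxE eqxx (ord1 s) /=.
  by case: eqP => _; [rewrite mulr1|rewrite mulr0 [RHS]mxE].
have -> : nrm (v *m delta_mx 0 j : 'M[C]_(e m, n)) = nrm v.
  rewrite /nrm; congr Num.sqrt; rewrite nsq_cols (bigD1 j) //= cE eqxx big1 ?addr0 //.
  by move=> k /negbTE kj; rewrite cE kj nsq0.
apply: le_trans; rewrite /nrm ler_wsqrtr // [leRHS]nsq_cols (bigD1 i) //= col_mact.
rewrite [X in nsq X + _](bigD1 j) //= cE eqxx [X in _ *m v + X]big1 ?addr0 => [|k /negbTE kj].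
  by rewrite lerDl sumr_ge0 // => k _; exact: nsq_ge0.
by rewrite cE kj mulmx0.
Qed.

Variables (n : nat) (h : 'M[B]_n) (r : R).
Hypotheses (h_sym : sta h = h) (hr : opb h r).

(** The iteration for v = h + v^2. A solution satisfies (1 - 2v)^2 = 1 - 4v + 4v^2 = 1 - 4h, so 1 -
    2v is the square root sought. *)
Let u := fix u s := if s is s'.+1 then h + u s' *m u s' else 0.

Variable rho : R.
Hypotheses (rho_ge0 : 0 <= rho) (rho_lt : rho < 1 / 2) (rho_r : r + rho ^+ 2 <= rho).

Let u_opb s : opb (u s) rho.
Proof.
elim: s => [|s IH] /=; first exact: opb_le rho_ge0 (@opb0 n).
have := opbD hr (opbM rho_ge0 IH IH); apply: opb_le.
by rewrite -expr2.
Qed.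

Let u_sym s : sta (u s) = u s.
Proof.
elim: s => [|s IH] /=; last by rewrite staD staM h_sym IH.
by rewrite -(subrr (0 : 'M[B]_n)) staB !subrr.
Qed.

(** The Lipschitz constant of v |-> h + v^2 on the ball of radius [rho], because v^2 - w^2 = v (v -
    w) + (v - w) w. *)
Let lam := 2 * rho.
Let lam_ge0 : 0 <= lam. Proof. by rewrite mulr_ge0. Qed.
Let lam_lt1 : lam < 1. Proof. by rewrite /lam; have := rho_lt; lra. Qed.

Let u_step s : opb (u s.+1 - u s) (lam ^+ s * rho).
Proof.
elim: s => [|s IH].
  rewrite /= expr0 mul1r subr0 mul0mx addr0; apply: opb_le hr.
  by apply: le_trans rho_r; rewrite lerDl sqr_ge0.
have -> : u s.+2 - u s.+1 = u s.+1 *m (u s.+1 - u s) + (u s.+1 - u s) *m u s.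
  rewrite mulmxBr mulmxBl [in LHS]/= -/(u s.+1) opprD addrACA subrr add0r.
  by rewrite addrA subrK.
have lr : 0 <= lam ^+ s * rho by rewrite mulr_ge0 ?exprn_ge0.
have := opbD (opbM rho_ge0 (@u_opb s.+1) IH) (opbM lr IH (@u_opb s)).
by apply: opb_le; rewrite exprS /lam; lra.
Qed.

Let K := rho / (1 - lam).

(** The bound is the exact sum of the t geometric terms of [u_step] starting at q; in this closed
    form the induction goes through. *)
Let u_cauchy q t : opb (u (q + t)%N - u q) (lam ^+ q * K * (1 - lam ^+ t)).
Proof.
elim: t => [|t IH].
  by rewrite addn0 subrr expr0 subrr mulr0; exact: opb0.
have -> : u (q + t.+1)%N - u q = (u (q + t).+1 - u (q + t)%N) + (u (q + t)%N - u q).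
  by rewrite addnS addrA subrK.
have := opbD (u_step (q + t)) IH; apply: opb_le.
rewrite exprD exprS /K le_eqVlt; apply/orP; left; apply/eqP; field.
by rewrite subr_eq0 eq_sym lt_eqF.
Qed.

Let K_ge0 : 0 <= K.
Proof. by rewrite divr_ge0 // subr_ge0 ltW. Qed.

Let u_small (eps : R) : 0 < eps -> exists N, forall p q i j, (N <= p)%N -> (N <= q)%N ->
  cnorm (u p i j - u q i j) < eps.
Proof.
move=> eps0; have e2 : 0 < eps / (K + 1) by rewrite divr_gt0 // ltr_wpDl.
have /cvgrPdist_lt /(_ _ e2) [N _ NP] : (fun s => lam ^+ s) @ \oo --> (0 : R).
  by apply: cvg_expr; rewrite ger0_norm.
exists N.
have main p q i j : (N <= q)%N -> (q <= p)%N -> cnorm (u p i j - u q i j) < eps.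
  move=> Nq qp; have := u_cauchy q (p - q); rewrite subnKC // => ub.
  have l0 t : 0 <= lam ^+ t by exact: exprn_ge0.
  have lK : lam ^+ q * K * (1 - lam ^+ (p - q)) <= lam ^+ q * K.
    by apply: ler_piMr; [exact: mulr_ge0|rewrite gerBl].
  have := opb_entry i j (mulr_ge0 (l0 q) K_ge0) (opb_le lK ub); rewrite mxE [X in _ + X]mxE.
  move=> /le_lt_trans; apply; have := NP q Nq; rewrite /= sub0r normrN ger0_norm //.
  move=> lq; apply: (@le_lt_trans _ _ (lam ^+ q * (K + 1))).
    by rewrite ler_wpM2l // lerDl.
  by rewrite -ltr_pdivlMr // ltr_wpDl.
move=> p q i j Np Nq; case/orP: (leq_total q p) => qp; first exact: main.
by rewrite cnormB main.
Qed.

(** The limit v of the iteration is taken entry by entry. Both its self-adjointness and the fixed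
    point equation survive the limit, and then y = 1 - 2v works. *)
Lemma one_sub_square_root_rho : exists y : 'M[B]_n,
  1%:M - (h + h + h + h) = sta y *m y.
Proof.
have /choice[l ul] : forall k : 'I_n * 'I_n, exists l : B, forall eps : R, 0 < eps ->
    exists N, forall p, (N <= p)%N -> cnorm (u p k.1 k.2 - l) < eps.
  move=> k; apply: cnorm_complete => eps /u_small[N uN]; exists N => p q Np Nq.
  exact: uN.
pose v : 'M[B]_n := \matrix_(i, j) l (i, j).
have uv (eps : R) : 0 < eps -> exists s, forall i j,
    cnorm (u s i j - v i j) < eps /\ cnorm (u s.+1 i j - v i j) < eps.
  move=> eps0; have /choice[N uN] := fun k => ul k _ eps0.
  exists (\max_k N k) => i j; rewrite mxE.
  have le := @leq_bigmax _ N (i, j).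
  by split; apply: (uN (i, j)) => //; exact: leqW.
have us i j s : cnorm (u s i j) <= 1.
  apply: (le_trans (opb_entry i j rho_ge0 (@u_opb s))); have := rho_lt; lra.
have v2 i j : cnorm (v i j) <= 2.
  have [s /(_ i j) [uvs _]] := uv 1 ltr01.
  have := cnorm_leD (v i j) (u s i j); rewrite cnormB.
  by have := us i j s; lra.
have v_sym : sta v = v.
  apply/matrixP => i j; apply/eqP; rewrite -subr_eq0; apply/eqP; apply: cnorm_eq0.
  apply/eqP; rewrite eq_le cnorm_ge0 andbT; apply/ler_addgt0Pr => eps eps0; rewrite add0r.
  have [|s uvs] := uv (eps / 2); first by rewrite divr_gt0.
  have := cnormBD (u s i j) (sta v i j) (v i j).
  have [ij _] := uvs i j; have [ji _] := uvs j i.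
  have -> : sta v i j - u s i j = star (v j i - u s j i).
    by rewrite starB staE -[u s in LHS]u_sym staE.
  by rewrite cnorm_starE (cnormB (v j i)); lra.
have v_eq : v = h + v *m v.
  apply/matrixP => i j; apply/eqP; rewrite -subr_eq0; apply/eqP; apply: cnorm_eq0.
  apply/eqP; rewrite eq_le cnorm_ge0 andbT; apply/ler_addgt0Pr => eps eps0; rewrite add0r.
  have n0 : (0 : R) < 3 * n%:R + 1 by rewrite ltr_wpDl // mulr_ge0.
  have [|s uvs] := uv (eps / (3 * n%:R + 1)); first by rewrite divr_gt0.
  set d := eps / _ in uvs.
  have := cnormBD (u s.+1 i j) (v i j) ((h + v *m v) i j).
  have [_ ij] := uvs i j; rewrite (cnormB (v i j) (u s.+1 i j)).
  have -> : u s.+1 i j - (h + v *m v) i j =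
     \sum_k ((u s i k - v i k) * v k j + u s i k * (u s k j - v k j)).
    rewrite [in LHS]/= 2!mxE [X in _ - X]mxE [X in _ - (_ + X)]mxE opprD addrACA subrr add0r -sumrB.
    apply: eq_bigr => k _; by rewrite mulrBl mulrBr [RHS]addrC addrA subrK.
  have le : cnorm (\sum_k ((u s i k - v i k) * v k j + u s i k * (u s k j - v k j)))
      <= \sum_(k < n) (3 * d).
    have cs (F : 'I_n -> B) : cnorm (\sum_k F k) <= \sum_k cnorm (F k).
      elim/big_rec2: _ => [|k x y _ xy]; first by rewrite cnorm0.
      by apply: (le_trans (cnormD _ _)); rewrite lerD2l.
    apply: (le_trans (cs _)); apply: ler_sum => k _.
    apply: (le_trans (cnormD _ _)).
    have -> : 3 * d = d * 2 + 1 * d by ring.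
    have [/ltW ik _] := uvs i k; have [/ltW kj _] := uvs k j.
    by rewrite lerD // (le_trans (cnormM _ _)) // ler_pM ?cnorm_ge0.
  move: le; rewrite sumr_const card_ord -mulr_natr.
  have : d * (3 * n%:R + 1) = eps by rewrite divfK // gt_eqF.
  by rewrite mulrDr; lra.
exists (1%:M - v - v).
have hE : h = v - v *m v by apply/eqP; rewrite eq_sym subr_eq; apply/eqP.
rewrite !staB sta1 v_sym -!addrA -opprD -mulr2n.
rewrite mulmxBr !mulmxBl !mul1mx mulmx1.
have -> : h + (h + (h + h)) = h *+ 4 by rewrite -mulr2n -!mulrS.
rewrite hE mulrnBl opprB.
have -> : (v *+ 2) *m (v *+ 2) = (v *m v) *+ 4.
  by rewrite !mulr2n mulmxDr !mulmxDl -!mulr2n -mulrnA.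
have -> : 1%:M - v *+ 2 - (v *+ 2 - (v *m v) *+ 4) = 1%:M + ((v *m v) *+ 4 - (v *+ 2 + v *+ 2)).
  by move: (v *+ 2) (_ *+ 4) => a q; rewrite opprB opprD -addrA; congr (_ + _); exact: addrCA.
by rewrite -mulrnDr.
Qed.

End SquareRoot.

Lemma one_sub_square_root {R : realType} (B : cstarAlgType R) (e : nat -> nat)
    (phi : forall m, B -> 'M[R[i]]_(e m)) n (h : 'M[B]_n) (r : R) :
  norming_reps phi -> sta h = h -> 0 <= r -> r < 1 / 4 -> opb phi h r ->
  exists y : 'M[B]_n, 1%:M - (h + h + h + h) = sta y *m y.
Proof.
move=> phiN h_sym r0 r4 hr.
(* With d^2 = 1/4 - r, the number 1/2 - d is the smaller root of rho = r + rho^2. *)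
have [d [d0 dd]] : exists d : R, 0 < d /\ d ^+ 2 = 1 / 4 - r.
  exists (Num.sqrt (1 / 4 - r)); rewrite sqrtr_gt0 subr_gt0; split=> //.
  by rewrite sqr_sqrtr // subr_ge0 ltW.
have d2 : d <= 1 / 2 by rewrite -(@ler_pXn2r _ 2) ?nnegrE ?dd //; lra.
by apply: (@one_sub_square_root_rho _ _ _ _ phiN _ h r h_sym hr (1 / 2 - d)); lra.
Qed.

(** * Completely positive maps preserve inequalities between quadratic forms *)

Section Ucp.
Context {R : realType}.
Local Notation C := R[i].
Variables (B : cstarAlgType R) (e : nat -> nat) (phi : forall m, B -> 'M[C]_(e m)).
Hypothesis phiN : norming_reps phi.

Let lin m : forall (c : C) a a', phi m (c *: a + a') = c *: phi m a + phi m a'.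
Proof. by have [/(_ m) []] := phiN. Qed.
Let mul m a a' : phi m (a * a') = phi m a *m phi m a'.
Proof. by have [/(_ m) []] := phiN. Qed.
Let phist m a : phi m (star a) = (phi m a)^t*.
Proof. by have [/(_ m) []] := phiN. Qed.
Let phi1 m : phi m 1 = 1%:M.
Proof. by have [/(_ m) []] := phiN. Qed.

Variables (N : nat) (psi : B -> 'M[C]_N).
Hypothesis psi_ucp : ucp psi.

Lemma ucp_linear (c : C) a a' : psi (c *: a + a') = c *: psi a + psi a'.
Proof. by have [+ _ _] := psi_ucp; apply. Qed.

Lemma ucp1 : psi 1 = 1%:M.
Proof. by have [_ + _] := psi_ucp. Qed.

Lemma ucp_mxpos n (y : 'M[B]_n) :
  exists z : 'M['M[C]_N]_n, map_mx psi (sta y *m y) = sta z *m z.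
Proof. by have [_ _ P] := psi_ucp; apply: P; exists y. Qed.

(* [1 a; a^* a^* a] is positive, hence so is its image, which is therefore
   self-adjoint. *)
Lemma ucp_star a : psi (star a) = (psi a)^t*.
Proof.
pose y : 'M[B]_2 := \matrix_(i, j) if i == 0 then (if j == 0 then 1 else a) else 0.
have [z zE] := ucp_mxpos y.
have : sta (map_mx psi (sta y *m y)) = map_mx psi (sta y *m y) by rewrite zE staM staK.
move=> /matrixP/(_ 1 0); rewrite staE [_ 0 1]mxE [_ 1 0]mxE.
have -> : (sta y *m y) 0 1 = a.
  by rewrite mxE big_ord_recl big_ord1 !staE !mxE /= star1 star0 mul1r mul0r addr0.
have -> : (sta y *m y) 1 0 = star a.
  by rewrite mxE big_ord_recl big_ord1 !staE !mxE /= star0 mulr1 mul0r addr0.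
by move=> <-.
Qed.

Lemma ucp_gram n (y : 'M[B]_n) x : 0 <= rdot (mact psi (sta y *m y) x) x.
Proof.
have [z zE] := ucp_mxpos y.
have -> : mact psi (sta y *m y) x = mact id (sta z *m z) x.
  rewrite -zE; apply/matrixP => i j; rewrite !mxE; apply: eq_bigr => k _.
  by rewrite [map_mx _ _ _ _]mxE.
rewrite (mactM (phi := id)) // (rdot_mact (phi := id)) // staK; exact: nsq_ge0.
Qed.

(** Positivity of T is used at x - T x / r, and T <= r at T x; together they give |T x|^2 / r <= <T
    x, x> <= r |x|^2. *)
Lemma psd_nrm p q (T : 'M[C]_(p, q) -> 'M[C]_(p, q)) (r : R) :
  (forall x y, T (x + y) = T x + T y) -> (forall (c : C) x, T (c *: x) = c *: T x) ->
  (forall x y, rdot (T x) y = rdot x (T y)) ->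
  0 < r -> (forall x, 0 <= rdot (T x) x <= r * nsq x) ->
  forall x, nrm (T x) <= r * nrm x.
Proof.
move=> TD TZ Tsym r0 Tr x; rewrite nrm_le; last exact: ltW.
have /andP[+ _] := Tr (x + (- r^-1)%:C%C *: T x).
rewrite TD TZ rdotDl !rdotDr !rdotZl !rdotZr (Tsym (T x) x) -/(nsq (T x)).
have /andP[_ T1] := Tr x; have /andP[_ T2] := Tr (T x) => h.
have T3 : r^-1 ^+ 2 * rdot (T (T x)) (T x) <= r^-1 * nsq (T x).
  apply: (le_trans (ler_wpM2l (sqr_ge0 _) T2)).
  by rewrite le_eqVlt; apply/orP; left; apply/eqP; field; rewrite gt_eqF.
have h2 : r^-1 * nsq (T x) <= r * nsq x by lra.
have := ler_wpM2l (ltW r0) h2; rewrite mulrA divff ?gt_eqF // mul1r.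
by rewrite mulrA expr2.
Qed.

Lemma nrm_adj p q (x : 'M[C]_(p, q)) : nrm (x^t*) = nrm x.
Proof.
rewrite /nrm !nsqE exchange_big; congr Num.sqrt; apply: eq_bigr => i _.
by apply: eq_bigr => j _; rewrite !mxE cabsJ.
Qed.

Lemma nrm_mulr p q (x : 'M[C]_(p, q)) (a : 'M[C]_q) :
  nrm (x *m a) <= opnorm (a^t*) * nrm x.
Proof. by rewrite -nrm_adj trmx_mul map_mxM (le_trans (nrm_mull _ _)) // nrm_adj. Qed.

Lemma fstarK n1 n2 (l : seq ('M[C]_(n1, n2) * B)) : fstar (fstar l) = l.
Proof.
rewrite /fstar -map_comp -[RHS]map_id; apply: eq_map => -[X a] /=.
by rewrite trmxCK starK.
Qed.

Lemma tomx_cat n (l l' : seq ('M[C]_n * B)) : tomx (l ++ l') = tomx l + tomx l'.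
Proof. by apply/matrixP => i j; rewrite !mxE big_cat. Qed.

Lemma sta_tomx n (l : seq ('M[C]_n * B)) : sta (tomx l) = tomx (fstar l).
Proof.
apply/matrixP => i j; rewrite staE !mxE star_sum big_map; apply: eq_bigr => t _ /=.
by rewrite [LHS]starZ !mxE.
Qed.

(** This is what carries every model inequality over to [psi]. The symmetrised list Q satisfies 0 <=
    Q <= L in all representations. For d > 0 a positive multiple of Q + d has the form 1 - 4h with 0
    <= h <= r < 1/4, hence equals y^* y in M_n(B), and complete positivity applies to it. Finally d
    tends to 0. *)
Lemma ucp_form n (l : seq ('M[C]_n * B)) :
  (forall m x, 0 <= rdot (ev (phi m) l x) x) -> forall x, 0 <= rdot (ev psi l x) x.
Proof.
move=> lpos x.
pose Q := l ++ fstar l.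
have QE e' (f : B -> 'M[C]_e') y : (forall a, f (star a) = (f a)^t*) ->
    rdot (ev f Q y) y = 2 * rdot (ev f l y) y.
  move=> fs; rewrite ev_cat rdotDl rdotC [X in _ + X]rdotC -rdot_ev //.
  by rewrite rdotC [X in X + _]rdotC mulrDl mul1r rdotC.
have Qsym : sta (tomx Q) = tomx Q.
  by rewrite sta_tomx /Q /fstar map_cat -/(fstar l) -/(fstar (fstar l)) fstarK !tomx_cat addrC.
pose L := 1 + \sum_(t <- l) 2 * (cnorm t.2 * opnorm (t.1^t*)).
have L0 : 0 < L.
  rewrite ltr_wpDr // sumr_ge0 // => t _.
  by rewrite !mulr_ge0 ?cnorm_ge0 ?opnorm_ge0.
have QL m y : rdot (ev (phi m) Q y) y <= L * nsq y.
  rewrite QE // -nrm_sqr /ev rdot_suml mulr_sumr /L [X in _ <= X]mulrDl mul1r.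
  apply: ler_wpDl; first exact: sqr_ge0.
  rewrite mulr_suml; apply: ler_sum => t _; rewrite -mulrA ler_wpM2l //.
  apply: (le_trans (rdot_cs _ _)); rewrite expr2 mulrA ler_wpM2r ?nrm_ge0 //.
  apply: (le_trans (nrm_mulr _ _)); rewrite [X in _ <= X * _]mulrC -mulrA ler_wpM2l ?opnorm_ge0 //.
  apply: (le_trans (nrm_mull _ _)); rewrite ler_wpM2r ?nrm_ge0 //.
  by have [_ + _] := phiN; apply.
suff main (d : R) : 0 < d -> - d * nsq x <= rdot (ev psi Q x) x.
  rewrite -(pmulr_rge0 _ (ltr0n _ 2)) -QE; last exact: ucp_star.
  apply/ler_addgt0Pr => eps eps0.
  have := main (eps / (nsq x + 1)) (divr_gt0 eps0 (ltr_wpDl (nsq_ge0 x) ltr01)).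
  suff : eps / (nsq x + 1) * nsq x <= eps by lra.
  rewrite mulrAC ler_pdivrMr ?ltr_wpDl ?nsq_ge0 //.
  by rewrite ler_wpM2l ?lerDl // ltW.
move=> d0.
pose s := (L + d)^-1.
have s0 : 0 < s by rewrite invr_gt0 addr_gt0.
have sE : s * (L + d) = 1 by rewrite mulVf // gt_eqF // addr_gt0.
pose r := (1 - s * d) / 4.
have rE : r = s * L / 4 by rewrite /r -sE; ring.
have r0 : 0 < r by rewrite rE divr_gt0 ?mulr_gt0.
have sd : 0 < s * d by rewrite mulr_gt0.
have r4 : r < 1 / 4 by rewrite /r; lra.
pose hl := [:: (1%:M : 'M[C]_n, r%:C%C *: (1 : B))] ++ fscale (- (s / 4)) Q.
have hE e' (f : B -> 'M[C]_e') y :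
    (forall (c : C) a a', f (c *: a + a') = c *: f a + f a') -> f 1 = 1%:M ->
    rdot (mact f (tomx hl) y) y = r * nsq y - s / 4 * rdot (ev f Q y) y.
  move=> fl f1; rewrite mact_tomx // ev_cat ev1 linZ // f1 -!scalemxAl mul1mx mulmx1.
  by rewrite ev_fscale // rdotDl !rdotZl mulNr.
have hsym : sta (tomx hl) = tomx hl.
  rewrite tomx_cat staD; congr (_ + _).
    apply/matrixP => i j; rewrite staE !mxE !big_seq1 /= [star _]starZ [star _]starZ.
    by rewrite star1 !mxE conjC_nat conjR eq_sym.
  apply/matrixP => i j; rewrite staE !mxE !big_map star_sum.
  have := congr1 (fun M : 'M[B]_n => M i j) Qsym; rewrite staE !mxE star_sum.
  move=> /(congr1 (fun z => (- (s / 4))%:C%C *: z)).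
  rewrite !scaler_sumr => qq.
  have st (t : 'M[C]_n * B) : star (t.1 i j *: ((- (s / 4))%:C%C *: t.2)) =
      (- (s / 4))%:C%C *: star (t.1 i j *: t.2).
    rewrite [LHS]starZ [star (_ *: t.2)]starZ [in RHS]starZ conjR.
    by rewrite [LHS]scalerA [RHS]scalerA mulrC.
  rewrite (eq_bigr _ (fun t _ => st t)) qq; apply: eq_bigr => t _ /=.
  by rewrite [LHS]scalerA [RHS]scalerA mulrC.
have hr : opb phi (tomx hl) r.
  move=> m y; apply: psd_nrm => //.
  - by move=> u v; rewrite !mact_tomx // evD.
  - by move=> c u; rewrite !mact_tomx // evZ.
  - by move=> u v; rewrite (rdot_mact _ _ _ (@phist m)) hsym.
  move=> u; rewrite hE //.
  have h1 := QL m u; have h2 := lpos m u; have h3 := nsq_ge0 u.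
  have h4 : 0 <= rdot (ev (phi m) Q u) u by rewrite QE // mulr_ge0.
  have h5 := ler_wpM2l (ltW s0) h1; have h6 := mulr_ge0 (ltW s0) h4.
  by apply/andP; split; rewrite ?rE; lra.
have [y yE] := one_sub_square_root phiN hsym (ltW r0) r4 hr.
have := ucp_gram y x.
rewrite -yE mactB; last exact: ucp_linear.
rewrite !mactD; try exact: ucp_linear.
rewrite mact1 //; [|exact: ucp_linear|exact: ucp1].
rewrite rdotBl !rdotDl !hE; [|exact: ucp_linear|exact: ucp1].
rewrite -/(nsq x) => h.
have h2 : 0 <= s * (d * nsq x + rdot (ev psi Q x) x).
  by move: h; rewrite /r; lra.
by move: h2; rewrite pmulr_rge0 //; lra.
Qed.

(** The positive 2 x 2 matrix with rows (1, a) and (a^*, a^* a) is mapped by [psi] and evaluated at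
    the pair consisting of - psi(a) v and v. *)
Lemma ucp_schwarz a (v : 'cV[C]_N) : nsq (psi a *m v) <= rdot (psi (star a * a) *m v) v.
Proof.
pose y : 'M[B]_2 := \matrix_(i, j) if i == 0 then (if j == 0 then 1 else a) else 0.
pose w := psi a *m v.
pose x : 'M[C]_(N, 2) := \matrix_(i, j) if j == 0 then - w i 0 else v i 0.
have x0 : col 0 x = - w by apply/matrixP => i j; rewrite !mxE ord1.
have x1 : col 1 x = v by apply/matrixP => i j; rewrite !mxE ord1.
have := ucp_gram y x; rewrite rdot_cols big_ord_recl big_ord1.
rewrite (_ : lift ord0 ord0 = 1); last exact: val_inj.
rewrite (_ : ord0 = 0) // !col_mact !big_ord_recl !big_ord0.
rewrite (_ : lift ord0 ord0 = 1); last exact: val_inj.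
rewrite (_ : ord0 = 0) // x0 x1.
have yE i j : (sta y *m y) i j = star (y 0 i) * y 0 j.
  by rewrite mxE big_ord_recl big_ord1 !staE !mxE /= star0 mul0r addr0.
rewrite !yE !mxE /= star1 !mul1r mulr1 ucp1 ucp_star !addr0 !mul1mx -/w.
rewrite [_ + w]addrC subrr rdot0l add0r rdotDl mulmxN rdotNl [X in - X + _]rdot_mull.
by rewrite trmxCK -/(nsq w) addrC subr_ge0.
Qed.

(** The Schwarz inequality reduces the claim to the image of |a|^2 - a^* a, which is positive in
    every representation. *)
Lemma ucp_opnorm a : opnorm (psi a) <= cnorm a.
Proof.
apply: opnorm_le_nrm => [|v]; first exact: cnorm_ge0.
rewrite nrm_le ?cnorm_ge0 //; apply: (le_trans (ucp_schwarz _ _)).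
pose l := [:: (1%:M : 'M[C]_1, (cnorm a ^+ 2)%:C%C *: (1 : B)); (1%:M, - (star a * a))].
have lE e' (f : B -> 'M[C]_e') u :
    (forall (c : C) a a', f (c *: a + a') = c *: f a + f a') -> f 1 = 1%:M ->
    rdot (ev f l u) u = cnorm a ^+ 2 * nsq u - rdot (f (star a * a) *m u) u.
  move=> fl f1; rewrite ev_cons ev1 /= linZ // f1 linN // !mulmx1 -scalemxAl mul1mx.
  by rewrite mulNmx rdotDl rdotZl rdotNl.
have := @ucp_form 1 l _ v; rewrite lE; [|exact: ucp_linear|exact: ucp1].
rewrite subr_ge0; apply => m u; rewrite lE // subr_ge0 mul phist -mulmxA rdot_mull trmxCK.
rewrite -/(nsq _) -nrm_le ?cnorm_ge0 //; apply: (le_trans (nrm_mull _ _)).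
by rewrite ler_wpM2r ?nrm_ge0 //; have [_ + _] := phiN; apply.
Qed.

End Ucp.

(** * Almost multiplicative maps *)

Section AlmostMultiplicative.
Context {R : realType}.
Local Notation C := R[i].

Definition contr n2 n1 (X : 'M[C]_(n2, n1)) : Prop :=
  forall p (x : 'M[C]_(p, n2)), nrm (x *m X) <= nrm x.

Lemma contrM n1 n2 n3 (X : 'M[C]_(n1, n2)) (Y : 'M[C]_(n2, n3)) :
  contr X -> contr Y -> contr (X *m Y).
Proof. by move=> cX cY p x; rewrite mulmxA; apply: (le_trans (cY _ _)); exact: cX. Qed.

Lemma contr1 n : contr (1%:M : 'M[C]_n).
Proof. by move=> p x; rewrite mulmx1. Qed.

(** For y = x X^* one has |y|^2 = <y X, x> <= |y| |x|. *)
Lemma contr_adj n1 n2 (X : 'M[C]_(n1, n2)) : contr X -> contr (X^t*).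
Proof.
move=> cX p x; set y := x *m _.
have h : nsq y <= nrm y * nrm x.
  rewrite /nsq {1}/y rdot_mulr trmxCK rdotC.
  by apply: (le_trans (rdot_cs _ _)); rewrite ler_wpM2r ?nrm_ge0 // cX.
have [->|y0] := eqVneq (nrm y) 0; first exact: nrm_ge0.
have yp : 0 < nrm y by rewrite lt_def y0 nrm_ge0.
by rewrite -(ler_pM2l yp) -expr2 nrm_sqr.
Qed.

Lemma contr_coisometry n1 n2 (X : 'M[C]_(n1, n2)) : X *m X^t* = 1%:M -> contr X.
Proof.
by move=> XX p x; rewrite /nrm /nsq rdot_mulr -mulmxA XX mulmx1.
Qed.

Variable B : cstarAlgType R.

Definition good n1 n2 (l : seq ('M[C]_(n1, n2) * B)) : Prop :=
  forall t, t \in l -> contr t.1.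

Lemma good_cat n1 n2 (l l' : seq ('M[C]_(n1, n2) * B)) :
  good l -> good l' -> good (l ++ l').
Proof. by move=> gl gl' t; rewrite mem_cat => /orP[/gl|/gl']. Qed.

Lemma good_cons n1 n2 X a (l : seq ('M[C]_(n1, n2) * B)) :
  contr X -> good l -> good ((X, a) :: l).
Proof. by move=> cX gl t; rewrite inE => /orP[/eqP->//|/gl]. Qed.

Lemma good_nil n1 n2 : good ([::] : seq ('M[C]_(n1, n2) * B)).
Proof. by []. Qed.

Lemma good_fstar n1 n2 (l : seq ('M[C]_(n1, n2) * B)) : good l -> good (fstar l).
Proof. by move=> gl _ /mapP[t tl ->]; apply: contr_adj (gl t tl). Qed.

Lemma good_fscale n1 n2 r (l : seq ('M[C]_(n1, n2) * B)) : good l -> good (fscale r l).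
Proof. by move=> gl _ /mapP[t tl ->]; exact: (gl t tl). Qed.

Lemma good_fmul n1 n2 n3 (l1 : seq ('M[C]_(n2, n3) * B)) (l2 : seq ('M[C]_(n1, n2) * B)) :
  good l1 -> good l2 -> good (fmul l1 l2).
Proof.
move=> g1 g2 _ /allpairsP[[t1 t2] /= [i1 i2 ->]].
by apply: contrM; [exact: g2|exact: g1].
Qed.

(** For lists with contractive coefficients ([good]) the error estimates below depend on these
    algebra components alone. They are the same at all levels k, which is the source of uniformity
    in k. *)
Definition shape n1 n2 (l : seq ('M[C]_(n1, n2) * B)) : seq B := map snd l.

Definition smul (s1 s2 : seq B) : seq B := [seq a * c | a <- s1, c <- s2].

Lemma shape_fmul n1 n2 n3 (l1 : seq ('M[C]_(n2, n3) * B)) (l2 : seq ('M[C]_(n1, n2) * B)) :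
  shape (fmul l1 l2) = smul (shape l1) (shape l2).
Proof.
by rewrite /shape /fmul /smul map_allpairs allpairs_mapl allpairs_mapr.
Qed.

Lemma shape_fstar n1 n2 (l : seq ('M[C]_(n1, n2) * B)) :
  shape (fstar l) = map star (shape l).
Proof. by rewrite /shape /fstar -!map_comp. Qed.

Lemma shape_fscale n1 n2 r (l : seq ('M[C]_(n1, n2) * B)) :
  shape (fscale r l) = map (fun a => r%:C%C *: a) (shape l).
Proof. by rewrite /shape /fscale -!map_comp. Qed.

Definition weight (s : seq B) : R := \sum_(a <- s) cnorm a.

Section Psi.
Variables (N : nat) (psi : B -> 'M[C]_N).
Hypothesis psi_star : forall a, psi (star a) = (psi a)^t*.
Hypothesis psi_norm : forall a, opnorm (psi a) <= cnorm a.

(** The total multiplicativity defect of [psi] on the products of two finite families; it tends to 0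
    along a sequence of maps that witnesses quasidiagonality. *)
Definition errs (s1 s2 : seq B) : R :=
  \sum_(a <- s1) \sum_(c <- s2) opnorm (psi (a * c) - psi a *m psi c).

Lemma errs_ge0 s1 s2 : 0 <= errs s1 s2.
Proof. by apply: sumr_ge0 => a _; apply: sumr_ge0 => c _; exact: opnorm_ge0. Qed.

Lemma ev_bound n1 n2 (l : seq ('M[C]_(n1, n2) * B)) x : good l ->
  nrm (ev psi l x) <= weight (shape l) * nrm x.
Proof.
move=> gl; rewrite /weight big_map mulr_suml /ev.
apply: (le_trans (nrm_sum _ _ _)).
rewrite big_seq [leRHS]big_seq; apply: ler_sum => t tl.
apply: (le_trans (gl t tl _ _)); apply: (le_trans (nrm_mull _ _)).
by rewrite ler_wpM2r ?nrm_ge0.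
Qed.

Lemma ev_fmul_err n1 n2 n3 (l1 : seq ('M[C]_(n2, n3) * B)) (l2 : seq ('M[C]_(n1, n2) * B)) x :
  good l1 -> good l2 ->
  nrm (ev psi (fmul l1 l2) x - ev psi l1 (ev psi l2 x)) <=
    errs (shape l1) (shape l2) * nrm x.
Proof.
move=> g1 g2; rewrite /ev big_allpairs_dep /= /errs big_map mulr_suml.
rewrite -sumrB; apply: (le_trans (nrm_sum _ _ _)).
rewrite big_seq [leRHS]big_seq; apply: ler_sum => t1 i1.
rewrite mulmx_sumr mulmx_suml -sumrB big_map mulr_suml.
apply: (le_trans (nrm_sum _ _ _)).
rewrite big_seq [leRHS]big_seq; apply: ler_sum => t2 i2.
have -> : psi (t1.2 * t2.2) *m x *m (t2.1 *m t1.1) -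
    psi t1.2 *m (psi t2.2 *m x *m t2.1) *m t1.1 =
    (psi (t1.2 * t2.2) - psi t1.2 *m psi t2.2) *m x *m (t2.1 *m t1.1).
  by rewrite !mulmxBl !mulmxA.
apply: (le_trans (contrM (g2 _ i2) (g1 _ i1) _)).
exact: nrm_mull.
Qed.

Lemma ev_fmul_rdot n1 n2 n3 (l1 : seq ('M[C]_(n2, n3) * B)) (l2 : seq ('M[C]_(n1, n2) * B)) x y :
  good l1 -> good l2 ->
  `|rdot (ev psi (fmul l1 l2) x) y - rdot (ev psi l1 (ev psi l2 x)) y| <=
    errs (shape l1) (shape l2) * (nrm x * nrm y).
Proof.
move=> g1 g2; rewrite -rdotBl; apply: (le_trans (rdot_cs_abs _ _)).
by rewrite mulrA ler_wpM2r ?nrm_ge0 // ev_fmul_err.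
Qed.

Lemma ev_sq_rdot n1 n2 (w : seq ('M[C]_(n1, n2) * B)) x : good w ->
  `|rdot (ev psi (fmul (fstar w) w) x) x - nsq (ev psi w x)| <=
    errs (map star (shape w)) (shape w) * nsq x.
Proof.
move=> gw; have := ev_fmul_rdot x x (good_fstar gw) gw.
rewrite shape_fstar -[nrm x * nrm x]expr2 nrm_sqr.
suff -> : rdot (ev psi (fstar w) (ev psi w x)) x = nsq (ev psi w x) by [].
by rewrite rdotC -rdot_ev.
Qed.

(** Two products are split: first w^* from l w, then l from w. The second error is paired with
    psi(w) x, which accounts for the factor [weight]. *)
Lemma ev_conj_rdot n1 n2 (w : seq ('M[C]_(n1, n2) * B)) (l : seq ('M[C]_n2 * B)) x :
  good w -> good l ->
  `|rdot (ev psi (fmul (fstar w) (fmul l w)) x) x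
     - rdot (ev psi l (ev psi w x)) (ev psi w x)| <=
    (errs (map star (shape w)) (smul (shape l) (shape w))
     + errs (shape l) (shape w) * weight (shape w)) * nsq x.
Proof.
move=> gw gl.
have h1 := ev_fmul_rdot x x (good_fstar gw) (good_fmul gl gw).
have h2 := ev_fmul_rdot x (ev psi w x) gl gw.
move: h1; rewrite shape_fstar shape_fmul -[nrm x * nrm x]expr2 nrm_sqr => h1.
have h3 : errs (shape l) (shape w) * (nrm x * nrm (ev psi w x)) <=
    errs (shape l) (shape w) * weight (shape w) * nsq x.
  rewrite -mulrA ler_wpM2l ?errs_ge0 // -nrm_sqr expr2 mulrCA ler_wpM2l ?nrm_ge0 //.
  exact: ev_bound.
have e : rdot (ev psi (fstar w) (ev psi (fmul l w) x)) x =
    rdot (ev psi (fmul l w) x) (ev psi w x) by rewrite rdotC -rdot_ev // rdotC.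
move: h1; rewrite e mulrDl => h1.
by apply: (le_trans (ler_distD _ _ _)); apply: lerD h1 (le_trans h2 h3).
Qed.

Fixpoint fpow n (l : seq ('M[C]_n * B)) (j : nat) : seq ('M[C]_n * B) :=
  if j is j'.+1 then fmul l (fpow l j') else [:: (1%:M, 1)].

Fixpoint spow (s : seq B) (j : nat) : seq B :=
  if j is j'.+1 then smul s (spow s j') else [:: 1].

Lemma shape_fpow n (l : seq ('M[C]_n * B)) j : shape (fpow l j) = spow (shape l) j.
Proof. by elim: j => //= j IH; rewrite shape_fmul IH. Qed.

Lemma good_fpow n (l : seq ('M[C]_n * B)) j : good l -> good (fpow l j).
Proof.
move=> gl; elim: j => [|j IH] /=; first exact: good_cons (@contr1 n) (@good_nil _ _).
exact: good_fmul.
Qed.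

Definition perrs (s : seq B) (j : nat) : R := \sum_(i < j) errs s (spow s i).

(** Factors are split off one at a time; as the image of l is contractive, earlier errors are not
    magnified and the total is a plain sum. *)
Lemma ev_fpow_err n (l : seq ('M[C]_n * B)) j x : good l -> psi 1 = 1%:M ->
  (forall y, nrm (ev psi l y) <= nrm y) ->
  nrm (ev psi (fpow l j) x - iter j (ev psi l) x) <= perrs (shape l) j * nrm x.
Proof.
move=> gl psi1 lc; rewrite /perrs; elim: j => [|j IH].
  by rewrite /= ev1 psi1 mul1mx mulmx1 subrr nrm0 big_ord0 mul0r.
rewrite big_ord_recr /= mulrDl [leRHS]addrC.
apply: (le_trans (nrmB_trans (ev psi l (ev psi (fpow l j) x)) _ _)).
apply: lerD; first by rewrite -shape_fpow ev_fmul_err //; exact: good_fpow.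
have -> : ev psi l (ev psi (fpow l j) x) - ev psi l (iter j (ev psi l) x) =
    ev psi l (ev psi (fpow l j) x - iter j (ev psi l) x).
  by rewrite evD -scaleN1r -[- iter _ _ _]scaleN1r evZ.
exact: le_trans (lc _) IH.
Qed.

End Psi.
End AlmostMultiplicative.

(** * Spectral subspaces and the descent step *)

Section Spectral.
Context {R : realType}.
Local Notation C := R[i].

Lemma cip_mxvec p q (x y : 'M[C]_(p, q)) : cip x y = (mxvec x *m (mxvec y)^t*) 0 0.
Proof.
rewrite cipE pair_bigA mxE (reindex _ (curry_mxvec_bij _ _)) /=.
by apply: eq_bigr => -[i j] _ /=; rewrite !mxE !mxvecE.
Qed.

Definition orthobasis p q (u : 'I_(p * q) -> 'M[C]_(p, q)) : Prop :=
  (forall i j, cip (u i) (u j) = (i == j)%:R) /\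
  (forall x, x = \sum_i cip x (u i) *: u i).

Definition eigbasis p q (T : 'M[C]_(p, q) -> 'M[C]_(p, q)) u (lam : 'I_(p * q) -> R) : Prop :=
  orthobasis u /\ forall i, T (u i) = (lam i)%:C%C *: u i.

(** Through [mxvec] the operator becomes a Hermitian matrix acting on row vectors; the rows of its
    diagonalising unitary, folded back into matrices, are the eigenvectors. *)
Lemma eigbasis_exists p q (T : 'M[C]_(p, q) -> 'M[C]_(p, q)) :
  (forall x y, T (x + y) = T x + T y) -> (forall c x, T (c *: x) = c *: T x) ->
  (forall x y, cip (T x) y = cip x (T y)) ->
  exists u lam, eigbasis T u lam.
Proof.
move=> TD TZ Tsym.
have Tlin : linear T by move=> c x y; rewrite TD TZ.
pose f : {linear 'M[C]_(p, q) -> 'M[C]_(p, q)} :=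
  HB.pack T (GRing.isLinear.Build _ _ _ _ T Tlin).
have [M ME'] : exists M : 'M[C]_(p * q), forall A, mxvec A *m M = mxvec (T A).
  by exists (lin_mx f) => A; rewrite mul_vec_lin.
have ME (v : 'rV[C]_(p * q)) : v *m M = mxvec (T (vec_mx v)).
  by rewrite -{1}(vec_mxK v) ME'.
have Mij i j : M i j = cip (T (vec_mx (delta_mx 0 i))) (vec_mx (delta_mx 0 j)).
  rewrite cip_mxvec vec_mxK -ME -rowE mxE (bigD1 j) //= big1 => [|k /negbTE kj].
    by rewrite !mxE !eqxx conjC1 mulr1 addr0.
  by rewrite !mxE eqxx kj conjC0 mulr0.
have Mherm : M \is hermsymmx.
  apply/is_hermitianmxP; rewrite expr0 scale1r; apply/matrixP => i j.
  by rewrite 2!mxE !Mij -cipC Tsym.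
have /hermitian_normalmx /orthomx_spectralP := Mherm.
set P := spectralmx M; set sp := spectral_diag M => Meq.
have Pu : P \is unitarymx by exact: spectral_unitarymx.
have PPt : P *m P^t* = 1%:M by apply/unitarymxP.
have PtP : P^t* *m P = 1%:M by apply: mulmx1C.
have spr i : (complex.Re (sp 0 i))%:C%C = sp 0 i.
  have /mxOverP/(_ 0 i) := hermitian_spectral_diag_real Mherm.
  by move=> /Creal_ReP; rewrite complexRe.
exists (fun i => vec_mx (row i P)), (fun i => complex.Re (sp 0 i)); split; first split.
- move=> i j; rewrite cip_mxvec !vec_mxK.
  have /matrixP/(_ i j) := PPt; rewrite !mxE => <-.
  by apply: eq_bigr => k _; rewrite !mxE.
- move=> x; apply: (can_inj mxvecK); rewrite linear_sum /=.
  rewrite -[LHS]mulmx1 -PtP mulmxA mulmx_sum_row; apply: eq_bigr => i _.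
  rewrite linearZ /= vec_mxK cip_mxvec vec_mxK; congr (_ *: _).
  by rewrite !mxE; apply: eq_bigr => k _; rewrite !mxE.
- move=> i; apply: (can_inj mxvecK); rewrite -ME linearZ /= vec_mxK spr.
  rewrite rowE -mulmxA {1}Meq invmx_unitary // !mulmxA.
  by rewrite -[_ *m P *m P^t*]mulmxA PPt mulmx1 -rowE row_diag_mx -scalemxAl -rowE.
Qed.

Section Basis.
Variables (p q : nat) (u : 'I_(p * q) -> 'M[C]_(p, q)).
Hypothesis u_onb : orthobasis u.

Definition comb (a : 'I_(p * q) -> C) : 'M[C]_(p, q) := \sum_i a i *: u i.

Lemma cip_comb a i : cip (comb a) (u i) = a i.
Proof.
rewrite cip_suml (bigD1 i) //= cipZl u_onb.1 eqxx mulr1 big1 ?addr0 // => j /negbTE ji.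
by rewrite cipZl u_onb.1 ji mulr0.
Qed.

Lemma comb_cip x : comb (fun i => cip x (u i)) = x.
Proof. by rewrite [RHS](u_onb.2 x). Qed.

Lemma rdot_comb a c : rdot (comb a) (comb c) = \sum_i complex.Re (a i * (c i)^*).
Proof.
rewrite {2}/comb rdot_sumr; apply: eq_bigr => i _.
by rewrite /rdot cipZr cip_comb mulrC.
Qed.

Lemma nsq_comb a : nsq (comb a) = \sum_i cabs (a i) ^+ 2.
Proof. by rewrite /nsq rdot_comb; apply: eq_bigr => i _; rewrite mulrC cabs_conjM. Qed.

Lemma parseval x : nsq x = \sum_i cabs (cip x (u i)) ^+ 2.
Proof. by rewrite -nsq_comb comb_cip. Qed.

Lemma combD a c : comb (fun i => a i + c i) = comb a + comb c.
Proof. by rewrite /comb -big_split; apply: eq_bigr => i _; rewrite scalerDl. Qed.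

Lemma combZ z a : comb (fun i => z * a i) = z *: comb a.
Proof. by rewrite /comb scaler_sumr; apply: eq_bigr => i _; rewrite scalerA. Qed.

End Basis.

Section Eigen.
Variables (p q : nat) (T : 'M[C]_(p, q) -> 'M[C]_(p, q)).
Variables (u : 'I_(p * q) -> 'M[C]_(p, q)) (lam : 'I_(p * q) -> R).
Hypotheses (TD : forall x y, T (x + y) = T x + T y) (TZ : forall c x, T (c *: x) = c *: T x).
Hypothesis Tu : eigbasis T u lam.

Let u_onb : orthobasis u. Proof. by have [] := Tu. Qed.

Lemma T0 : T 0 = 0.
Proof. by rewrite -(scale0r 0) TZ !scale0r. Qed.

Lemma T_comb a : T (comb u a) = comb u (fun i => (lam i)%:C%C * a i).
Proof.
rewrite /comb (big_morph T TD T0); apply: eq_bigr => i _.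
by rewrite TZ Tu.2 scalerA mulrC.
Qed.

Lemma rdot_T_comb a : rdot (T (comb u a)) (comb u a) = \sum_i lam i * cabs (a i) ^+ 2.
Proof.
rewrite T_comb rdot_comb //; apply: eq_bigr => i _.
by rewrite -mulrA ReMr [X in lam i * complex.Re X]mulrC cabs_conjM.
Qed.

Lemma rdot_T x : rdot (T x) x = \sum_i lam i * cabs (cip x (u i)) ^+ 2.
Proof. by rewrite -rdot_T_comb comb_cip. Qed.

Lemma iter_comb (r : R) j a :
  iter j (fun x => x - r%:C%C *: T x) (comb u a) =
  comb u (fun i => ((1 - r * lam i) ^+ j)%:C%C * a i).
Proof.
elim: j => [|j IH] /=.
  by apply: eq_bigr => i _; rewrite expr0 rmorph1 mul1r.
rewrite IH T_comb -combZ -scaleN1r -combZ -combD; apply: eq_bigr => i _.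
by congr (_ *: _); rewrite exprS !rmorphM rmorphB rmorphM /=; ring.
Qed.

(** The form of T is the squared norm of its square root, here [Q] in the eigenbasis, so the
    Cauchy-Schwarz bound [nsq_sum_le] applies. *)
Lemma psd_sum_le (I : finType) (F : I -> 'M[C]_(p, q)) : (forall i, 0 <= lam i) ->
  rdot (T (\sum_i F i)) (\sum_i F i) <= #|I|%:R * \sum_i rdot (T (F i)) (F i).
Proof.
move=> lam0.
pose Q x := comb u (fun i => (Num.sqrt (lam i))%:C%C * cip x (u i)).
have QE x : rdot (T x) x = nsq (Q x).
  rewrite rdot_T nsq_comb //; apply: eq_bigr => i _.
  by rewrite cabsM exprMn cabs_real ger0_norm ?sqrtr_ge0 // sqr_sqrtr.
have QD : {morph Q : x y / x + y}.
  move=> x y; rewrite /Q -combD; apply: eq_bigr => i _.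
  by rewrite cipDl mulrDr.
have Q0 : Q 0 = 0.
  rewrite /Q /comb big1 // => i _.
  by rewrite /cip mul0mx mxtrace0 mulr0 scale0r.
rewrite QE (big_morph Q QD Q0); apply: (le_trans (nsq_sum_le _)).
by rewrite ler_wpM2l //; apply: ler_sum => i _; rewrite QE.
Qed.

End Eigen.

(** There are more unknowns (indices in L) than equations (indices in L'), so a nonzero solution
    exists; it is extended by 0 outside L. *)
Lemma exists_kernel_vector (I K : finType) (L : {set I}) (L' : {set K}) (M : I -> K -> C) :
  (#|L'| < #|L|)%N ->
  exists a : I -> C, [/\ exists i, a i != 0, forall i, i \notin L -> a i = 0 &
    forall k, k \in L' -> \sum_i a i * M i k = 0].
Proof.
move=> lt.
pose A : 'M[C]_(#|L|, #|L'|) := \matrix_(i, k) M (enum_val i) (enum_val k).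
have /rowV0Pn[v /sub_kermxP vA v0] : kermx A != 0.
  rewrite kermx_eq0 /row_free; apply: contraL lt => /eqP <-.
  by rewrite -leqNgt rank_leq_col.
pose a i : C := \sum_(r : 'I_#|L| | enum_val r == i) v 0 r.
have aE r : a (enum_val r) = v 0 r.
  by rewrite /a (eq_bigl (pred1 r)) ?big_pred1_eq // => s; rewrite (inj_eq enum_val_inj).
exists a; split.
- have [r vr] : exists r, v 0 r != 0.
    apply/existsP; apply: contraNT v0; rewrite negb_exists => /forallP h.
    by apply/eqP/rowP => r; rewrite mxE; apply/eqP; have := h r; rewrite negbK.
  by exists (enum_val r); rewrite aE.
- move=> i iL; rewrite /a big1 // => r /eqP ri.
  by move: iL; rewrite -ri enum_valP.
- move=> k kL'; rewrite (bigID (fun i => i \in L)) /= [X in _ + X]big1 ?addr0; last first.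
    move=> i iL; rewrite /a big1 ?mul0r // => r /eqP ri.
    by move: iL; rewrite -ri enum_valP.
  rewrite big_enum_val /=.
  have /matrixP/(_ 0 (enum_rank_in kL' k)) := vA; rewrite !mxE => h.
  rewrite -[RHS]h; by apply: eq_bigr => r _; rewrite !mxE aE enum_rankK_in.
Qed.

End Spectral.

Section LowSpace.
Context {R : realType}.
Local Notation C := R[i].
Variables (p q : nat) (T : 'M[C]_(p, q) -> 'M[C]_(p, q)).
Variables (u : 'I_(p * q) -> 'M[C]_(p, q)) (lam : 'I_(p * q) -> R) (th d : R).
Hypotheses (TD : forall x y, T (x + y) = T x + T y) (TZ : forall c x, T (c *: x) = c *: T x).
Hypothesis Tu : eigbasis T u lam.

Definition low (I : finType) (l : I -> R) (t : R) : {set I} := [set i | l i <= t].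

Let u_onb : orthobasis u. Proof. by have [] := Tu. Qed.

Lemma rdot_high x : (forall i, i \in low lam th -> cip x (u i) = 0) ->
  th * nsq x <= rdot (T x) x.
Proof.
move=> x0; rewrite (rdot_T TD TZ Tu) (parseval u_onb) mulr_sumr; apply: ler_sum => i _.
have [il|il] := boolP (i \in low lam th).
  by rewrite x0 // cabs0 expr0n !mulr0.
by rewrite ler_wpM2r ?sqr_ge0 // ltW // ltNge; move: il; rewrite inE.
Qed.

Lemma rdot_low a : (forall i, i \notin low lam th -> a i = 0) ->
  (forall i, i \in low lam th -> lam i <= d) ->
  rdot (T (comb u a)) (comb u a) <= d * nsq (comb u a).
Proof.
move=> a0 ld; rewrite (rdot_T_comb TD TZ Tu) (nsq_comb u_onb) mulr_sumr.
apply: ler_sum => i _; have [il|il] := boolP (i \in low lam th).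
  by rewrite ler_wpM2r ?sqr_ge0 // ld.
by rewrite a0 // cabs0 expr0n !mulr0.
Qed.

(** 1 - T/L is diagonal with entries in [0, 1], below 1 - th/L outside the low set. Its powers
    therefore act almost like a map into the low space. *)
Lemma nsq_iter_low (L : R) j x : 0 <= th -> 0 < L -> th <= L ->
  (forall i, 0 <= lam i <= L) ->
  nsq (iter j (fun x => x - (L^-1)%:C%C *: T x) x) <=
    \sum_(i in low lam th) cabs (cip x (u i)) ^+ 2 + (1 - th / L) ^+ (2 * j) * nsq x.
Proof.
move=> th0 L0 thL lamL.
rewrite -{1}(comb_cip u_onb x) (iter_comb TD TZ Tu) (nsq_comb u_onb).
rewrite (parseval u_onb x) mulr_sumr (bigID (fun i => i \in low lam th)) /=; apply: lerD.
  apply: ler_sum => i _; rewrite cabsM exprMn cabs_real ler_piMl ?sqr_ge0 //.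
  have /andP[l0 lL] := lamL i; rewrite expr_le1 ?normr_ge0 // normrX.
  rewrite exprn_ile1 ?normr_ge0 // ger0_norm; first by rewrite gerBl mulrC divr_ge0 // ltW.
  by rewrite subr_ge0 mulrC ler_pdivrMr // mul1r.
rewrite [leRHS](bigID (fun i => i \in low lam th)) /= ler_wpDl //.
  by apply: sumr_ge0 => i _; rewrite mulr_ge0 ?sqr_ge0 // mulnC exprM sqr_ge0.
apply: ler_sum => i il; rewrite cabsM exprMn cabs_real ler_wpM2r ?sqr_ge0 //.
have /andP[l0 lL] := lamL i.
have k0 : 0 <= 1 - L^-1 * lam i by rewrite subr_ge0 mulrC ler_pdivrMr // mul1r.
have th1 : 0 <= 1 - th / L by rewrite subr_ge0 ler_pdivrMr // mul1r.
rewrite normrX -exprM mulnC ger0_norm //; apply: lerXn2r; rewrite ?nnegrE //.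
rewrite lerD2l lerN2 [leRHS]mulrC ler_pM2r ?invr_gt0 // ltW // ltNge.
by move: il; rewrite inE.
Qed.

End LowSpace.

(** * The descent step for abstract operators *)

Section StepArithmetic.
Variable R : realFieldType.
Implicit Types c K T d s t x z q r : R.

Lemma form_lower c K d d' T s x : K * T <= K * (d' * x) ->
  c * x - K * T - d * x <= s -> (c - (K * d' + d)) * x <= s.
Proof. lra. Qed.

Lemma form_upper K d d' T q x : K * T <= K * (d' * x) ->
  q <= K * T + d * x -> q <= (K * d' + d) * x.
Proof. lra. Qed.

Lemma cross_lower d r x z z' : d * z <= d * x -> d * z' <= d * x ->
  - (d * (z + z')) <= r -> - r <= 2 * d * x.
Proof. lra. Qed.

Lemma sum_lower c s t k x : c <= s + t -> t <= k + x -> c - x <= s + k.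
Proof. lra. Qed.

Lemma two_sums q s t k x : s <= x -> t <= k * (k * x) -> q <= 2 * (s + t) ->
  q <= 2 * (1 + k * k) * x.
Proof. lra. Qed.

Lemma quadratic_lower c k d' d x s t s' q z : c * s <= s -> c * t <= s' ->
  c * ((c - k) * x) <= c * (s + t) -> 0 <= d' * d' * d * x ->
  - (d' * (2 * d * x)) <= q -> s' - d' * (d' * (2 * d * x)) <= z ->
  (c * (c - k) - 4 * (d' + d' * d') * d) * x <= s + 2 * q + z.
Proof. lra. Qed.

End StepArithmetic.

Section Step.
Context {R : realType}.
Local Notation C := R[i].
Variables (N n n' b : nat).
Local Notation V := 'M[C]_(N, n).
Local Notation W := 'M[C]_(N, n').
Variables (T0 T1 : V -> V) (G0 G1 : W -> W).
Variables (u0 u1 : 'I_(N * n) -> V) (l0 l1 : 'I_(N * n) -> R).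
Variables (v0 v1 : 'I_(N * n') -> W) (m0 m1 : 'I_(N * n') -> R).
Variables (S : V -> V) (A : 'I_b -> V -> W) (D : 'I_b -> W -> V) (j : nat).
Variables (c K d d' th L : R).

Definition clinear (X Y : lmodType C) (f : X -> Y) : Prop :=
  (forall x y, f (x + y) = f x + f y) /\ (forall z x, f (z *: x) = z *: f x).

Hypotheses (T0L : clinear T0) (T1L : clinear T1) (G0L : clinear G0) (G1L : clinear G1).
Hypotheses (SL : clinear S) (AL : forall i, clinear (A i)) (DL : forall i, clinear (D i)).
Hypotheses (T0u : eigbasis T0 u0 l0) (T1u : eigbasis T1 u1 l1).
Hypotheses (G0v : eigbasis G0 v0 m0) (G1v : eigbasis G1 v1 m1).
Hypotheses (l0_low : forall i, i \in low l0 th -> l0 i <= d').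
Hypotheses (m1_low : forall i, i \in low m1 th -> m1 i <= d').
Hypotheses (l1_ge0 : forall i, 0 <= l1 i) (m0_bd : forall i, 0 <= m0 i <= L).
Hypotheses (th_gt0 : 0 < th) (thL : th <= L) (d_ge0 : 0 <= d) (d'_ge0 : 0 <= d') (K_ge0 : 0 <= K).
Hypothesis A_le : forall i x, nsq (A i x) <= nsq x.
(** Powers of 1 - G0/L replace the spectral projection onto the low space of G0: being polynomial,
    they can be expressed in the algebra, so that an inequality of the models can be transported to
    this one. *)
Hypothesis SA_ge : forall x, c * nsq x - K * rdot (T0 x) x - d * nsq x <=
  nsq (S x) + \sum_i nsq (iter j (fun y => y - (L^-1)%:C%C *: G0 y) (A i x)).
Hypothesis D_ge : forall i z,
  c * nsq z - K * rdot (G1 z) z - d * nsq z <= nsq (D i z).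
Hypothesis D_low : forall i z,
  rdot (T1 (D i z)) (D i z) <= K * rdot (G1 z) z + d * nsq z.
Hypothesis S_low : forall x, rdot (T1 (S x)) (S x) <= K * rdot (T0 x) x + d * nsq x.
Hypothesis SD_orth : forall i x z, `|rdot (S x) (D i z)| <= d * (nsq x + nsq z).
Hypothesis DD_orth : forall i k z w, i != k -> `|rdot (D i z) (D k w)| <= d * (nsq z + nsq w).

Let be := K * d' + d.
Let k2 := (1 - th / L) ^+ (2 * j).
Hypotheses (c_be : be <= c) (c_le1 : c - be <= 1).
Hypothesis num : 2 * (1 + b%:R * b%:R) * be <
  th * ((c - be) * (c - be - b%:R * k2) - 4 * (b%:R + b%:R * b%:R) * d).

Let clin0 (X Y : lmodType C) (f : X -> Y) : clinear f -> f 0 = 0.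
Proof. by move=> [_ fZ]; rewrite -(scale0r 0) fZ !scale0r. Qed.

(** In the application T0, T1 are the images of D_k(0), D_k(1), and G0, G1 those of D_(k+1)(0),
    D_(k+1)(1); S comes from s^*, A_i from T_i^0, D_i from the adjoint of T_i^1. By assumption the
    low space of G0 embeds isometrically into that of G1; extended by 0 this is [iota], and Y = S +
    sum_i D_i iota A_i. If T0 had more low eigenvalues than T1, some nonzero low vector x would have
    Y x orthogonal to the low space of T1, so that <T1 Y x, Y x> >= th |Y x|^2. But T1 almost
    annihilates Y x, while Y x is not short; [num] says that the two are incompatible. *)
Lemma low_step : (#|low m0 th| <= #|low m1 th|)%N -> (#|low l0 th| <= #|low l1 th|)%N.
Proof.
move=> mle; rewrite leqNgt; apply/negP => lt.
have L_gt0 : 0 < L by exact: lt_le_trans th_gt0 thL.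
have u0b : orthobasis u0 by have [] := T0u.
have v0b : orthobasis v0 by have [] := G0v.
have v1b : orthobasis v1 by have [] := G1v.
have be0 : 0 <= be by rewrite addr_ge0 // mulr_ge0.
pose h (r : 'I_#|low m0 th|) : 'I_(N * n') := enum_val (widen_ord mle r).
have h_inj : injective h by move=> r s /enum_val_inj /(congr1 val) /= /val_inj.
have h_low r : h r \in low m1 th by exact: enum_valP.
pose iota w : W := \sum_r cip w (v0 (enum_val r)) *: v1 (h r).
have iotaE w : iota w = comb v1 (fun k => \sum_(r | h r == k) cip w (v0 (enum_val r))).
  rewrite /comb /iota (partition_big h predT) //; apply: eq_big => // k _.
  by rewrite scaler_suml; apply: eq_big => // r /andP[_ /eqP ->].
have iota_nsq w : nsq (iota w) = \sum_(k in low m0 th) cabs (cip w (v0 k)) ^+ 2.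
  rewrite /nsq /iota rdot_suml [RHS]big_enum_val; apply: eq_bigr => r _.
  rewrite rdot_sumr (bigD1 r) //= big1 => [|s sr]; rewrite /rdot cipZl cipZr v1b.1.
    by rewrite eqxx mulr1 addr0 mulrC cabs_conjM.
  by rewrite (inj_eq h_inj) eq_sym (negbTE sr) !mulr0.
have iota_low w : rdot (G1 (iota w)) (iota w) <= d' * nsq (iota w).
  rewrite iotaE; apply: (rdot_low (th := th) G1L.1 G1L.2 G1v) => //.
  by move=> k kl; rewrite big1 // => r /eqP hr; move: kl; rewrite -hr h_low.
have iotaL : clinear iota.
  split=> [x y|z x]; rewrite /iota.
    by rewrite -big_split; apply: eq_bigr => r _; rewrite cipDl scalerDl.
  by rewrite scaler_sumr; apply: eq_bigr => r _; rewrite cipZl scalerA.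
pose Y x : V := S x + \sum_i D i (iota (A i x)).
have YL : clinear Y.
  split=> [x y|z x]; rewrite /Y.
    rewrite SL.1 addrACA -big_split; congr (_ + _); apply: eq_bigr => i _.
    by rewrite (AL i).1 iotaL.1 (DL i).1.
  rewrite SL.2 scalerDr scaler_sumr; congr (_ + _); apply: eq_bigr => i _.
  by rewrite (AL i).2 iotaL.2 (DL i).2.
have [a [[i0 a0] aL aK]] := exists_kernel_vector (fun i k => cip (Y (u0 i)) (u1 k)) lt.
pose x := comb u0 a.
have YxE k : cip (Y x) (u1 k) = \sum_i a i * cip (Y (u0 i)) (u1 k).
  rewrite /x /comb (big_morph Y YL.1 (clin0 YL)) cip_suml.
  by apply: eq_bigr => i _; rewrite YL.2 cipZl.
have Yhigh : th * nsq (Y x) <= rdot (T1 (Y x)) (Y x).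
  apply: (rdot_high T1L.1 T1L.2 T1u) => k kl; rewrite YxE; exact: aK.
have x_low : rdot (T0 x) x <= d' * nsq x.
  by apply: (rdot_low (th := th) T0L.1 T0L.2 T0u).
have x_gt0 : 0 < nsq x.
  rewrite (nsq_comb u0b) (bigD1 i0) //=; apply: ltr_wpDr.
    by apply: sumr_ge0 => i _; exact: sqr_ge0.
  rewrite exprn_gt0 // lt_def cabs_ge0 andbT; apply: contra_neq a0.
  exact: ComplexField.Normc.eq0_normc.
pose z i := iota (A i x).
have z_le i : nsq (z i) <= nsq x.
  apply: le_trans (A_le i x); rewrite iota_nsq [leRHS](parseval v0b).
  rewrite [leRHS](bigID (fun k => k \in low m0 th)) /= lerDl sumr_ge0 // => k _.
  exact: sqr_ge0.
have k2_ge0 : 0 <= k2 by rewrite /k2 mulnC exprM sqr_ge0.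
(* The filtered vector obtained from A_i x exceeds its low part in square norm by at most k2 |x|^2,
   and [iota] is isometric on low parts. *)
have SA_low : (c - be - b%:R * k2) * nsq x <= nsq (S x) + \sum_i nsq (z i).
  have := SA_ge x.
  have : \sum_i nsq (iter j (fun y => y - (L^-1)%:C%C *: G0 y) (A i x)) <=
      \sum_i nsq (z i) + b%:R * k2 * nsq x.
    apply: (@le_trans _ _ (\sum_(i < b) (nsq (z i) + k2 * nsq x))).
      apply: ler_sum => i _; apply: (le_trans (nsq_iter_low G0L.1 G0L.2 G0v j (A i x) (ltW th_gt0) L_gt0 thL m0_bd)).
      by rewrite -iota_nsq lerD2l ler_wpM2l.
    by rewrite big_split /= sumr_const card_ord -[in X in _ + X]mulr_natl mulrA.
  move=> h1 h2; have h3 := form_lower (ler_wpM2l K_ge0 x_low) h2.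
  by rewrite mulrBl; exact: sum_lower h3 h1.
have Dz_ge i : (c - be) * nsq (z i) <= nsq (D i (z i)).
  exact: form_lower (ler_wpM2l K_ge0 (iota_low (A i x))) (D_ge i (z i)).
have Dz_low i : rdot (T1 (D i (z i))) (D i (z i)) <= be * nsq x.
  apply: (@le_trans _ _ (be * nsq (z i))); last by rewrite ler_wpM2l.
  exact: form_upper (ler_wpM2l K_ge0 (iota_low (A i x))) (D_low i (z i)).
have S_le : rdot (T1 (S x)) (S x) <= be * nsq x.
  exact: form_upper (ler_wpM2l K_ge0 x_low) (S_low x).
(* The factor 2 separates S x from the sum, and b * b comes from a sum of b terms each bounded by
   the same quantity. *)
have Y_low : rdot (T1 (Y x)) (Y x) <= 2 * (1 + b%:R * b%:R) * be * nsq x.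
  have psd2 := psd_sum_le T1L.1 T1L.2 T1u (fun t : bool => if t then S x else \sum_i D i (z i)) l1_ge0.
  move: psd2; rewrite !big_bool card_bool /= => /le_trans; apply.
  have psdb := psd_sum_le T1L.1 T1L.2 T1u (fun i => D i (z i)) l1_ge0.
  rewrite card_ord in psdb.
  have : \sum_i rdot (T1 (D i (z i))) (D i (z i)) <= \sum_(i < b) be * nsq x.
    by apply: ler_sum => i _.
  rewrite sumr_const card_ord -[_ *+ b]mulr_natl => sb.
  move: (le_trans psdb (ler_wpM2l (ler0n R b) sb)) => sb2.
  rewrite -mulrA; apply: (two_sums S_le sb2); exact: lexx.
(* The summands of Y x are almost orthogonal, so |Y x|^2 is close to the sum of their square norms;
   the term with 4 (b + b^2) d pays for the cross terms. *)
have Y_ge : ((c - be) * (c - be - b%:R * k2) - 4 * (b%:R + b%:R * b%:R) * d) * nsq x <= nsq (Y x).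
  rewrite [nsq (Y x)]nsqD.
  have cross : - (b%:R * (2 * d * nsq x)) <= rdot (S x) (\sum_i D i (z i)).
    rewrite rdot_sumr lerNl -sumrN.
    apply: (@le_trans _ _ (\sum_(i < b) (2 * d * nsq x))); last first.
      by rewrite sumr_const card_ord -[leLHS]mulr_natl.
    apply: ler_sum => i _; have := SD_orth i x (z i); rewrite ler_norml => /andP[h1 _].
    exact: cross_lower (lexx _) (ler_wpM2l d_ge0 (z_le i)) h1.
  have diag : \sum_i nsq (D i (z i)) - b%:R * (b%:R * (2 * d * nsq x)) <= nsq (\sum_i D i (z i)).
    rewrite [leRHS]/nsq rdot_suml.
    have -> : b%:R * (b%:R * (2 * d * nsq x)) = \sum_(i < b) (b%:R * (2 * d * nsq x)).
      by rewrite sumr_const card_ord -[RHS]mulr_natl.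
    rewrite -sumrB; apply: ler_sum => i _; rewrite rdot_sumr (bigD1 i) //= lerD2l.
    rewrite lerNl -sumrN.
    apply: (@le_trans _ _ (\sum_(k < b) (2 * d * nsq x))); last first.
      by rewrite sumr_const card_ord -[leLHS]mulr_natl.
    have dx : 0 <= 2 * d * nsq x by rewrite !mulr_ge0 ?nsq_ge0.
    rewrite [leRHS](bigID (fun k => k != i)) /= ler_wpDr ?sumr_ge0 //.
    apply: ler_sum => k ki; rewrite eq_sym in ki; have := DD_orth (z i) (z k) ki.
    rewrite ler_norml => /andP[h1 _].
    exact: cross_lower (ler_wpM2l d_ge0 (z_le i)) (ler_wpM2l d_ge0 (z_le k)) h1.
  have Dsum : (c - be) * \sum_i nsq (z i) <= \sum_i nsq (D i (z i)).
    by rewrite mulr_sumr; apply: ler_sum => i _.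
  have cbe0 : 0 <= c - be by rewrite subr_ge0.
  have h1 := ler_wpM2l cbe0 SA_low.
  have h2 : (c - be) * nsq (S x) <= nsq (S x) by rewrite ler_piMl ?nsq_ge0.
  have h3 : 0 <= b%:R * b%:R * d * nsq x by rewrite !mulr_ge0 ?nsq_ge0.
  exact: quadratic_lower h2 Dsum h1 h3 cross diag.
have h1 := le_trans (le_trans (ler_wpM2l (ltW th_gt0) Y_ge) Yhigh) Y_low.
move: h1; rewrite mulrA ler_pM2r // leNgt => /negP; apply.
exact: num.
Qed.

End Step.

(** * Transport of the model inequalities through an almost multiplicative map *)

Lemma three_le (R : realFieldType) (a r p q : R) : r <= p -> a <= p ->
  a + 2 * r + q <= q + 3 * p.
Proof. lra. Qed.

Lemma form_transfer (R : realFieldType) (f g c K z s er d : R) : f <= s + er ->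
  er <= d * z -> 0 <= f + (K * g - c * z) -> c * z - K * g - d * z <= s.
Proof. lra. Qed.

Lemma form_transfer_upper (R : realFieldType) (f g q er d : R) : - er <= f - q ->
  er <= d -> f <= g -> q <= g + d.
Proof. lra. Qed.

Section PsiLevel.
Context {R : realType}.
Local Notation C := R[i].
Variables (B : cstarAlgType R) (e : nat -> nat) (phi : forall m, B -> 'M[C]_(e m)).
Hypothesis phiN : norming_reps phi.
Variables (N : nat) (psi : B -> 'M[C]_N).
Hypothesis psi_ucp : ucp psi.

Let lin m : forall (c : C) a a', phi m (c *: a + a') = c *: phi m a + phi m a'.
Proof. by have [/(_ m) []] := phiN. Qed.
Let mul m a a' : phi m (a * a') = phi m a *m phi m a'.
Proof. by have [/(_ m) []] := phiN. Qed.
Let phist m a : phi m (star a) = (phi m a)^t*.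
Proof. by have [/(_ m) []] := phiN. Qed.
Let phi1 m : phi m 1 = 1%:M.
Proof. by have [/(_ m) []] := phiN. Qed.
Let psi_lin := ucp_linear psi_ucp.
Let psi_1 := ucp1 psi_ucp.
Let psi_star := ucp_star psi_ucp.
Let psi_norm := ucp_opnorm phiN psi_ucp.

(** The equality is asked after evaluation, because the lists [fstar l] and [l] need only agree up
    to the order of their terms. *)
Definition selfadj n (l : seq ('M[C]_n * B)) : Prop :=
  forall e' (f : B -> 'M[C]_e'),
    (forall (c : C) a a', f (c *: a + a') = c *: f a + f a') ->
    (forall a, f (star a) = (f a)^t*) -> f 1 = 1%:M ->
    forall x, ev f (fstar l) x = ev f l x.

Lemma cip_ev e' (f : B -> 'M[C]_e') n1 n2 (l : seq ('M[C]_(n1, n2) * B)) x y :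
  (forall a, f (star a) = (f a)^t*) ->
  cip (ev f l x) y = cip x (ev f (fstar l) y).
Proof.
move=> st; rewrite /ev big_map cip_suml cip_sumr; apply: eq_bigr => t _ /=.
by rewrite cip_mulr cip_mull st mulmxA.
Qed.

Variables (eta L dl : R).
Hypotheses (eta0 : 0 < eta) (L0 : 0 < L) (dl0 : 0 <= dl).

(** For a self-adjoint list this says that in every model the spectrum lies in {0} together with
    [eta, L]. *)
Definition model_gap n (l : seq ('M[C]_n * B)) : Prop :=
  forall m x, [/\ 0 <= rdot (ev (phi m) l x) x, rdot (ev (phi m) l x) x <= L * nsq x &
    eta * rdot (ev (phi m) l x) x <= nsq (ev (phi m) l x)].

(** The last clause is the remainder of the gap after transport: no eigenvalue lies strictly between
    2 dl / eta and eta / 2, nor at eta / 2 unless the two bounds cross. *)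
Definition spectral_data n (l : seq ('M[C]_n * B)) u (lam : 'I_(N * n) -> R) : Prop :=
  [/\ eigbasis (ev psi l) u lam, forall i, 0 <= lam i <= L &
    forall i, i \in low lam (eta / 2) -> lam i <= 2 * dl / eta].

Lemma rdot_ev_const e' (f : B -> 'M[C]_e') n (r : R) (x : 'M[C]_(e', n)) : f 1 = 1%:M ->
  (forall (c : C) a a', f (c *: a + a') = c *: f a + f a') ->
  rdot (ev f [:: (1%:M : 'M[C]_n, r%:C%C *: (1 : B))] x) x = r * nsq x.
Proof. by move=> f1 fl; rewrite ev1 linZ // f1 -!scalemxAl mul1mx mulmx1 rdotZl. Qed.

(** D^2 - eta D >= 0 passes to [psi], and splitting the square costs [dl]. An eigenvalue thus
    satisfies eta lam <= lam^2 + dl, and lam <= eta / 2 then forces lam <= 2 dl / eta. *)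
Lemma spectral_data_exists n (l : seq ('M[C]_n * B)) : good l -> selfadj l -> model_gap l ->
  errs psi (shape l) (shape l) <= dl -> exists u lam, spectral_data l u lam.
Proof.
move=> gl sl gap err.
have [u [lam ul]] : exists u lam, eigbasis (ev psi l) u lam.
  apply: eigbasis_exists => [x y|c x|x y]; [exact: evD|exact: evZ|].
  by rewrite cip_ev // sl.
exists u, lam; split=> // [i|i].
  have uE : rdot (ev psi l (u i)) (u i) = lam i.
    by rewrite ul.2 rdotZl /rdot ul.1.1 eqxx mulr1.
  have u1 : nsq (u i) = 1 by rewrite /nsq /rdot ul.1.1 eqxx.
  apply/andP; split.
    rewrite -uE; apply: (ucp_form phiN psi_ucp) => m x.
    by have [] := gap m x.
  pose l' := [:: (1%:M : 'M[C]_n, L%:C%C *: (1 : B))] ++ fscale (- 1) l.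
  have := ucp_form phiN psi_ucp (l := l') _ (u i).
  rewrite ev_cat rdotDl rdot_ev_const // ev_fscale // rdotZl uE u1 mulr1 mulN1r subr_ge0.
  apply=> m x; rewrite ev_cat rdotDl rdot_ev_const // ev_fscale // rdotZl mulN1r subr_ge0.
  by have [] := gap m x.
rewrite inE => il.
have uE : rdot (ev psi l (u i)) (u i) = lam i.
  by rewrite ul.2 rdotZl /rdot ul.1.1 eqxx mulr1.
have u1 : nsq (u i) = 1 by rewrite /nsq /rdot ul.1.1 eqxx.
have lam0 : 0 <= lam i.
  rewrite -uE; apply: (ucp_form phiN psi_ucp) => m x.
  by have [] := gap m x.
pose l' := fmul l l ++ fscale (- eta) l.
have : 0 <= rdot (ev psi l' (u i)) (u i).
  apply: (ucp_form phiN psi_ucp) => m x.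
  rewrite ev_cat rdotDl ev_fscale // rdotZl ev_fmul // mulNr subr_ge0.
  have -> : rdot (ev (phi m) l (ev (phi m) l x)) x = nsq (ev (phi m) l x).
    by rewrite rdot_ev // sl.
  by have [] := gap m x.
rewrite ev_cat rdotDl ev_fscale // rdotZl uE mulNr.
have := ev_fmul_rdot psi (u i) (u i) gl gl.
have -> : rdot (ev psi l (ev psi l (u i))) (u i) = lam i ^+ 2.
  by rewrite ul.2 evZ rdotZl uE expr2.
rewrite -expr2 nrm_sqr u1 mulr1 ler_norml => /andP[_ h1] h2.
have h3 : lam i * lam i <= lam i * (eta / 2) by rewrite ler_wpM2l.
rewrite ler_pdivlMr //; move: h1 h2 h3 err il; rewrite expr2.
move: (errs _ _ _) (rdot _ _) => er rr; lra.
Qed.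

Lemma ev_clinear e' (f : B -> 'M[C]_e') n1 n2 (l : seq ('M[C]_(n1, n2) * B)) :
  clinear (ev f l).
Proof. by split=> [x y|z x]; [exact: evD|exact: evZ]. Qed.

Lemma sq_diff_le p q (x y : 'M[C]_(p, q)) (ep r : R) : 0 <= ep <= 1 -> 0 <= r ->
  nrm (x - y) <= ep * r -> nrm y <= r -> nsq x <= nsq y + 3 * ep * r ^+ 2.
Proof.
move=> /andP[e0 e1] r0 xy yr.
have -> : x = (x - y) + y by rewrite subrK.
rewrite nsqD.
have h1 : nrm (x - y) * nrm y <= ep * r ^+ 2.
  by rewrite expr2 mulrA ler_pM ?nrm_ge0.
have h2 : nsq (x - y) <= ep * r ^+ 2.
  rewrite -nrm_sqr; apply: (@le_trans _ _ ((ep * r) ^+ 2)).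
    by rewrite ler_pXn2r ?nnegrE ?nrm_ge0 ?mulr_ge0.
  by rewrite exprMn ler_wpM2r ?sqr_ge0 // expr2 ler_piMl.
rewrite -mulrA; exact: three_le (le_trans (rdot_cs _ _) h1) h2.
Qed.

(** The list of 1 - l / L, whose powers filter out everything away from the near-kernel. *)
Definition lf n (l : seq ('M[C]_n * B)) := [:: (1%:M : 'M[C]_n, 1 : B)] ++ fscale (- L^-1) l.

Lemma lfE e' (f : B -> 'M[C]_e') n (l : seq ('M[C]_n * B)) y : f 1 = 1%:M ->
  (forall (c : C) a a', f (c *: a + a') = c *: f a + f a') ->
  ev f (lf l) y = y - (L^-1)%:C%C *: ev f l y.
Proof.
move=> f1 fl; rewrite ev_cat ev1 f1 mul1mx mulmx1 ev_fscale //.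
by rewrite rmorphN scaleNr.
Qed.

Lemma lf_contr n (l : seq ('M[C]_n * B)) u lam : eigbasis (ev psi l) u lam ->
  (forall i, 0 <= lam i <= L) -> forall y, nrm (ev psi (lf l) y) <= nrm y.
Proof.
move=> ul lamL y; rewrite lfE //.
have := iter_comb (@evD _ _ _ psi _ _ l) (@evZ _ _ _ psi _ _ l) ul L^-1 1
   (fun i => cip y (u i)).
rewrite /= (comb_cip ul.1) => ->; rewrite -[in leRHS](comb_cip ul.1 y).
rewrite /nrm ler_wsqrtr // !(nsq_comb ul.1); apply: ler_sum => i _.
rewrite cabsM exprMn cabs_real ler_piMl ?sqr_ge0 // expr1.
have /andP[a1 a2] := lamL i.
rewrite expr_le1 ?normr_ge0 // ger0_norm; first by rewrite gerBl mulrC divr_ge0 // ltW.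
by rewrite subr_ge0 mulrC ler_pdivrMr // mul1r.
Qed.

Section OneStep.
Variables (n n' b j : nat).
Variables (lT0 lT1 : seq ('M[C]_n * B)) (lG0 lG1 : seq ('M[C]_n' * B)).
Variables (aS : B) (XA : 'M[C]_(n, n')) (aA : 'I_b -> B) (XD : 'M[C]_(n', n)) (aD : 'I_b -> B).
Local Notation wS := [:: (1%:M : 'M[C]_n, aS)].
Local Notation wA i := [:: (XA, aA i)].
Local Notation wD i := [:: (XD, aD i)].
Variables (c K : R).
Hypotheses (gT1 : good lT1) (gG0 : good lG0).
Hypotheses (cA : contr XA) (cD : contr XD).
Hypotheses (aS1 : cnorm aS <= 1) (aA1 : forall i, cnorm (aA i) <= 1) (aD1 : forall i, cnorm (aD i) <= 1).
Hypotheses (oS : forall i, star (aD i) * aS = 0) (oD : forall i k, i != k -> star (aD i) * aD k = 0).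
Hypothesis K_ge0 : 0 <= K.
Hypothesis mSA : forall m x, c * nsq x - K * rdot (ev (phi m) lT0 x) x <=
  nsq (ev (phi m) wS x) +
  \sum_i nsq (iter j (fun y => y - (L^-1)%:C%C *: ev (phi m) lG0 y) (ev (phi m) (wA i) x)).
Hypothesis mD : forall m i z,
  c * nsq z - K * rdot (ev (phi m) lG1 z) z <= nsq (ev (phi m) (wD i) z).
Hypothesis mDlow : forall m i z,
  rdot (ev (phi m) lT1 (ev (phi m) (wD i) z)) (ev (phi m) (wD i) z)
    <= K * rdot (ev (phi m) lG1 z) z.
Hypothesis mSlow : forall m x,
  rdot (ev (phi m) lT1 (ev (phi m) wS x)) (ev (phi m) wS x) <= K * rdot (ev (phi m) lT0 x) x.

Local Notation sf := (shape (lf lG0)).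
Hypothesis dl1 : 2 * dl <= 1.
Hypothesis eS : errs psi [:: star aS] [:: aS] <= dl.
Hypothesis eW : forall i, errs psi (map star (smul (spow sf j) [:: aA i]))
  (smul (spow sf j) [:: aA i]) <= dl.
Hypothesis eF : forall i, errs psi (spow sf j) [:: aA i] <= dl.
Hypothesis ePow : perrs psi sf j <= dl.
Hypothesis eD : forall i k, errs psi [:: star (aD i)] [:: aD k] <= dl.
Hypothesis eDS : forall i, errs psi [:: star (aD i)] [:: aS] <= dl.
Hypothesis eTD : forall i, errs psi [:: star (aD i)] (smul (shape lT1) [:: aD i]) <= dl.
Hypothesis eTD' : forall i, errs psi (shape lT1) [:: aD i] <= dl.
Hypothesis eTS : errs psi [:: star aS] (smul (shape lT1) [:: aS]) <= dl.
Hypothesis eTS' : errs psi (shape lT1) [:: aS] <= dl.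

Variables (u0 u1 : 'I_(N * n) -> 'M[C]_(N, n)) (l0 l1 : 'I_(N * n) -> R).
Variables (v0 v1 : 'I_(N * n') -> 'M[C]_(N, n')) (m0 m1 : 'I_(N * n') -> R).
Hypotheses (dT0 : spectral_data lT0 u0 l0) (dT1 : spectral_data lT1 u1 l1).
Hypotheses (dG0 : spectral_data lG0 v0 m0) (dG1 : spectral_data lG1 v1 m1).
Hypothesis eta_L : eta / 2 <= L.
(** Each of the b filtered terms costs 7 dl: one for its square and six for replacing the image of
    the filter power by the power of the image. A conjugated form costs 2 dl, one for each product
    that is split. *)
Let d := (2 + 7 * b%:R) * dl.
Let be := K * (2 * dl / eta) + d.
Hypotheses (c_be : be <= c) (c_le1 : c - be <= 1).
Hypothesis num : 2 * (1 + b%:R * b%:R) * be <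
  eta / 2 * ((c - be) * (c - be - b%:R * (1 - eta / 2 / L) ^+ (2 * j))
              - 4 * (b%:R + b%:R * b%:R) * d).

Let dl_d : dl <= d.
Proof. by rewrite /d ler_peMl // -[leLHS]addr0 lerD // ?mulr_ge0 // ler1n. Qed.
Let dl2_d : 2 * dl <= d.
Proof. by rewrite /d ler_wpM2r // lerDl mulr_ge0. Qed.

Let weight1 (a : B) : cnorm a <= 1 -> weight [:: a] <= 1.
Proof. by rewrite /weight big_seq1. Qed.

Let ev1_le n1 n2 (X : 'M[C]_(n1, n2)) (a : B) (x : 'M[C]_(N, n1)) : contr X -> cnorm a <= 1 ->
  nrm (ev psi [:: (X, a)] x) <= nrm x.
Proof.
move=> cX a1; have ga : good [:: (X, a)] by exact: good_cons cX (@good_nil _ _ _ _).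
apply: (le_trans (ev_bound psi_norm x ga)).
by rewrite ler_piMl ?nrm_ge0 // weight1.
Qed.

(** The product of the images of a'^* and a is within [dl] of the image of a'^* a = 0. *)
Let orth n1 n2 n3 (X : 'M[C]_(n1, n2)) (Y : 'M[C]_(n3, n2)) (a a' : B)
    (x : 'M[C]_(N, n1)) (z : 'M[C]_(N, n3)) :
  contr X -> contr Y -> star a' * a = 0 -> errs psi [:: star a'] [:: a] <= dl ->
  `|rdot (ev psi [:: (X, a)] x) (ev psi [:: (Y, a')] z)| <= d * (nsq x + nsq z).
Proof.
move=> cX cY a0 er.
have -> : rdot (ev psi [:: (X, a)] x) (ev psi [:: (Y, a')] z) =
    rdot (psi (star a') *m psi a *m (x *m X)) (z *m Y).
  by rewrite !ev1 -[psi a' *m z *m Y]mulmxA rdotC rdot_mull -psi_star rdotC !mulmxA.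
apply: (le_trans (rdot_cs_abs _ _)).
have h1 : nrm (psi (star a') *m psi a *m (x *m X)) <= dl * nrm x.
  apply: (le_trans (nrm_mull _ _)); rewrite ler_pM ?opnorm_ge0 ?nrm_ge0 //.
  move: er; rewrite /errs !big_seq1 a0 (lin0 psi_lin) sub0r -scaleN1r opnormZ.
  by rewrite normcN ComplexField.Normc.normc1 mul1r.
apply: (@le_trans _ _ (dl * nrm x * nrm z)).
  by apply: ler_pM; rewrite ?nrm_ge0 //; exact: cY.
have := sqr_ge0 (nrm x - nrm z); rewrite sqrrB !nrm_sqr => h2.
rewrite -mulrA; apply: (@le_trans _ _ (dl * (nsq x + nsq z))).
  rewrite ler_wpM2l //; move: h2 (mulr_ge0 (nrm_ge0 x) (nrm_ge0 z)) (nsq_ge0 x) (nsq_ge0 z).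
  by move: (nrm x * nrm z) (nsq x) (nsq z) => a1 a2 a3; lra.
by rewrite ler_wpM2r ?addr_ge0 ?nsq_ge0.
Qed.

(** Each inequality required by [low_step] is rewritten as positivity of one list, transported by
    [ucp_form], and then has its products split at a cost below [d]. *)
Lemma psi_step : (#|low m0 (eta / 2)| <= #|low m1 (eta / 2)|)%N ->
  (#|low l0 (eta / 2)| <= #|low l1 (eta / 2)|)%N.
Proof.
have [T0u l0bd l0low] := dT0; have [T1u l1bd l1low] := dT1.
have [G0v m0bd m0low] := dG0; have [G1v m1bd m1low] := dG1.
have gS : good wS by exact: good_cons (@contr1 _ n) (@good_nil _ _ _ _).
have gA i : good (wA i) by exact: good_cons cA (@good_nil _ _ _ _).
have gD i : good (wD i) by exact: good_cons cD (@good_nil _ _ _ _).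
have glf : good (lf lG0).
  by apply: good_cat; [apply: good_cons => //; exact: contr1|exact: good_fscale].
have d_ge0 : 0 <= d by rewrite /d mulr_ge0 // addr_ge0 // mulr_ge0.
have nsq_nrm p (x : 'M[C]_(N, p)) : nsq x = nrm x ^+ 2 by rewrite nrm_sqr.
have lf_le := lf_contr G0v m0bd.
apply: (@low_step R N n n' b (ev psi lT0) (ev psi lT1) (ev psi lG0) (ev psi lG1)
  u0 u1 l0 l1 v0 v1 m0 m1 (ev psi wS) (fun i => ev psi (wA i)) (fun i => ev psi (wD i)) j
  c K d (2 * dl / eta) (eta / 2) L) => //; try (by move=> *; exact: ev_clinear).
- by move=> i; have /andP[] := l1bd i.
- by rewrite divr_gt0.
- by rewrite divr_ge0 ?mulr_ge0 // ltW.
- move=> i x; rewrite !nsq_nrm ler_pXn2r ?nnegrE ?nrm_ge0 //.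
  exact: ev1_le.
- move=> x.
  pose w i := fmul (fpow (lf lG0) j) (wA i).
  have gw i : good (w i) by apply: good_fmul => //; exact: good_fpow.
  have sw i : shape (w i) = smul (spow sf j) [:: aA i] by rewrite shape_fmul shape_fpow.
  (* The inequality [mSA] as positivity of a single list: S^* S, plus the squares of the filtered
     A_i, plus K T0, minus c. *)
  pose l := fmul (fstar wS) wS ++ flatten [seq fmul (fstar (w i)) (w i) | i <- index_enum 'I_b]
     ++ fscale K lT0 ++ [:: (1%:M : 'M[C]_n, (- c)%:C%C *: (1 : B))].
  have lE e' (f : B -> 'M[C]_e') y : f 1 = 1%:M ->
    (forall (c : C) a a', f (c *: a + a') = c *: f a + f a') ->
     rdot (ev f l y) y = rdot (ev f (fmul (fstar wS) wS) y) y
       + \sum_i rdot (ev f (fmul (fstar (w i)) (w i)) y) y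
       + K * rdot (ev f lT0 y) y - c * nsq y.
    move=> f1 fl; rewrite !ev_cat !rdotDl rdot_ev_const // ev_fscale // rdotZl mulNr !addrA.
    congr (_ + _ + _ - _); elim: (index_enum _) => [|i s IH].
      by rewrite big_nil ev_nil rdot0l.
    by rewrite big_cons /= ev_cat rdotDl IH.
  have : 0 <= rdot (ev psi l x) x.
    apply: (ucp_form phiN psi_ucp) => m y; rewrite lE // ev_fmul // rdotC -rdot_ev //.
    have := @mSA m y.
    have -> : \sum_i rdot (ev (phi m) (fmul (fstar (w i)) (w i)) y) y =
      \sum_i nsq (iter j (fun y => y - (L^-1)%:C%C *: ev (phi m) lG0 y) (ev (phi m) (wA i) y)).
      apply: eq_bigr => i _; rewrite ev_fmul // rdotC -rdot_ev //; congr nsq.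
      rewrite ev_fmul //; move: (ev (phi m) (wA i) y) => z.
      elim: j => [|k IH] /=; first by rewrite ev1 phi1 mul1mx mulmx1.
      by rewrite ev_fmul // IH lfE.
    rewrite -/(nsq _); move: (nsq _) (rdot _ _) (\sum_i _) (nsq y) => q1 q2 q3 q4; lra.
  rewrite lE //.
  have h1 := ev_sq_rdot psi_star x gS.
  have h2 : rdot (ev psi (fmul (fstar wS) wS) x) x <= nsq (ev psi wS x) + dl * nsq x.
    move: h1; rewrite ler_norml => /andP[_]; rewrite lerBlDl => /le_trans; apply.
    by rewrite lerD2l ler_wpM2r ?nsq_ge0.
  have h3 i : rdot (ev psi (fmul (fstar (w i)) (w i)) x) x <=
     nsq (iter j (fun y => y - (L^-1)%:C%C *: ev psi lG0 y) (ev psi (wA i) x)) + 7 * dl * nsq x.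
    have h4 : rdot (ev psi (fmul (fstar (w i)) (w i)) x) x <= nsq (ev psi (w i) x) + dl * nsq x.
      have := ev_sq_rdot psi_star x (gw i).
      rewrite ler_norml => /andP[_]; rewrite lerBlDl => /le_trans; apply.
      by rewrite lerD2l ler_wpM2r ?nsq_ge0 // sw.
    apply: (le_trans h4).
    have Ax := ev1_le x cA (aA1 i).
    have it k y : iter k (ev psi (lf lG0)) y =
       iter k (fun y => y - (L^-1)%:C%C *: ev psi lG0 y) y.
      by elim: k => //= k ->; rewrite lfE.
    have it_le k y : nrm (iter k (ev psi (lf lG0)) y) <= nrm y.
      by elim: k => [|k IH] /=; [exact: lexx|exact: le_trans (lf_le _) IH].
    (* One [dl] for detaching A_i from the filter power, one for splitting the power itself into j
       factors. *)
    have dw : nrm (ev psi (w i) x - iter j (ev psi (lf lG0)) (ev psi (wA i) x)) <= 2 * dl * nrm x.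
      apply: (le_trans (nrmB_trans (ev psi (fpow (lf lG0) j) (ev psi (wA i) x)) _ _)).
      have -> : 2 * dl * nrm x = dl * nrm x + dl * nrm x by ring.
      apply: lerD.
        apply: (le_trans (ev_fmul_err psi x (good_fpow glf) (gA i))).
        rewrite shape_fpow ler_wpM2r ?nrm_ge0 //; exact: eF.
      apply: (le_trans (ev_fpow_err j (ev psi (wA i) x) glf psi_1 lf_le)).
      by rewrite ler_pM ?nrm_ge0 // sumr_ge0 // => k _; exact: errs_ge0.
    have := sq_diff_le _ (nrm_ge0 x) dw (le_trans (it_le j _) Ax).
    rewrite it nrm_sqr mulr_ge0 //= dl1 => /(_ isT).
    rewrite (_ : 3 * (2 * dl) * nsq x = 6 * (dl * nsq x)); last by ring.
    rewrite (_ : 7 * dl * nsq x = 7 * (dl * nsq x)); last by ring.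
    by move: (nsq (ev psi (w i) x)) (nsq (iter _ _ _)) (dl * nsq x) => *; lra.
  have h5 : \sum_i rdot (ev psi (fmul (fstar (w i)) (w i)) x) x <=
     \sum_i nsq (iter j (fun y => y - (L^-1)%:C%C *: ev psi lG0 y) (ev psi (wA i) x))
     + 7 * b%:R * dl * nsq x.
    have -> : 7 * b%:R * dl * nsq x = \sum_(i < b) (7 * dl * nsq x).
      by rewrite sumr_const card_ord -[RHS]mulr_natl; ring.
    by rewrite -big_split; apply: ler_sum => i _; exact: h3.
  have h6 : 0 <= dl * nsq x by rewrite mulr_ge0 ?nsq_ge0.
  move: h2 h5 h6; rewrite /d.
  move: (rdot (ev psi (fmul (fstar wS) wS) x) x) (\sum_i rdot _ _) (\sum_i nsq _) (rdot _ _).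
  move: (nsq (ev _ _ _)) (nsq x) => *; lra.
- move=> i z.
  pose l := fmul (fstar (wD i)) (wD i) ++ fscale K lG1 ++ [:: (1%:M : 'M[C]_n', (- c)%:C%C *: (1 : B))].
  have lE e' (f : B -> 'M[C]_e') y : f 1 = 1%:M ->
    (forall (c : C) a a', f (c *: a + a') = c *: f a + f a') ->
     rdot (ev f l y) y = rdot (ev f (fmul (fstar (wD i)) (wD i)) y) y
       + (K * rdot (ev f lG1 y) y - c * nsq y).
    by move=> f1 fl; rewrite !ev_cat !rdotDl rdot_ev_const // ev_fscale // rdotZl mulNr.
  have : 0 <= rdot (ev psi l z) z.
    apply: (ucp_form phiN psi_ucp) => m y; rewrite lE // ev_fmul // rdotC -rdot_ev //.
    by have := @mD m i y; rewrite -/(nsq _); move: (nsq _) (rdot _ _) (nsq y) => q1 q2 q3; lra.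
  rewrite lE //.
  have := ev_sq_rdot psi_star z (gD i).
  rewrite ler_norml => /andP[_]; rewrite lerBlDl => h1.
  have h2 : errs psi [:: star (aD i)] [:: aD i] * nsq z <= d * nsq z.
    by rewrite ler_wpM2r ?nsq_ge0 // (le_trans (eD i i)).
  exact: form_transfer h1 h2.
- move=> i z.
  pose l := fscale K lG1 ++ fscale (- 1) (fmul (fstar (wD i)) (fmul lT1 (wD i))).
  have : 0 <= rdot (ev psi l z) z.
    apply: (ucp_form phiN psi_ucp) => m y.
    rewrite ev_cat rdotDl !ev_fscale // !rdotZl mulN1r subr_ge0 !ev_fmul // rdotC -rdot_ev //.
    by rewrite rdotC; exact: mDlow.
  rewrite ev_cat rdotDl !ev_fscale // !rdotZl mulN1r subr_ge0.
  have := ev_conj_rdot psi_star psi_norm z (gD i) gT1.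
  rewrite ler_norml => /andP[h1 _].
  have h2 : (errs psi [:: star (aD i)] (smul (shape lT1) [:: aD i])
     + errs psi (shape lT1) [:: aD i] * weight [:: aD i]) * nsq z <= d * nsq z.
    rewrite ler_wpM2r ?nsq_ge0 // (le_trans _ dl2_d) // mulrDl !mul1r lerD //.
    apply: le_trans (eTD' i); rewrite ler_piMr ?errs_ge0 //; exact: weight1.
  exact: form_transfer_upper h1 h2.
- move=> z.
  pose l := fscale K lT0 ++ fscale (- 1) (fmul (fstar wS) (fmul lT1 wS)).
  have : 0 <= rdot (ev psi l z) z.
    apply: (ucp_form phiN psi_ucp) => m y.
    rewrite ev_cat rdotDl !ev_fscale // !rdotZl mulN1r subr_ge0 !ev_fmul // rdotC -rdot_ev //.
    by rewrite rdotC; exact: mSlow.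
  rewrite ev_cat rdotDl !ev_fscale // !rdotZl mulN1r subr_ge0.
  have := ev_conj_rdot psi_star psi_norm z gS gT1.
  rewrite ler_norml => /andP[h1 _].
  have h2 : (errs psi [:: star aS] (smul (shape lT1) [:: aS])
     + errs psi (shape lT1) [:: aS] * weight [:: aS]) * nsq z <= d * nsq z.
    rewrite ler_wpM2r ?nsq_ge0 // (le_trans _ dl2_d) // mulrDl !mul1r lerD //.
    apply: le_trans eTS'; rewrite ler_piMr ?errs_ge0 //; exact: weight1.
  exact: form_transfer_upper h1 h2.
- by move=> i x z; apply: orth => //; exact: contr1.
- move=> i k z w ik; apply: orth => //; apply: oD.
  by rewrite eq_sym.
Qed.

End OneStep.
End PsiLevel.

(** * Property (T) and spectral gaps *)

Section PerpSpace.
Context {R : realType}.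
Local Notation C := R[i].
Variables (p q : nat) (S : set 'M[C]_(p, q)).

Definition perp : pred 'M[C]_(p, q) := fun x => `[< forall y, S y -> cip x y = 0 >].

Lemma perpP x : reflect (forall y, S y -> cip x y = 0) (perp x).
Proof. exact: asboolP. Qed.

Fact perp_submod_closed : submod_closed (perp : {pred 'M[C]_(p, q)}).
Proof.
split=> [|c x y /perpP xS /perpP yS]; apply/perpP => z Sz.
  by rewrite /cip mul0mx mxtrace0.
by rewrite cipDl cipZl xS // yS // mulr0 addr0.
Qed.

(** Property (T) is stated for a Hilbert space that is a type of its own; this subtype will be the
    orthogonal complement of the invariant vectors. *)
Definition perp_space := {x : 'M[C]_(p, q) | perp x}.
HB.instance Definition _ := SubChoice.on perp_space.
HB.instance Definition _ :=
  GRing.SubChoice_isSubLmodule.Build C 'M[C]_(p, q) _ perp_space perp_submod_closed.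

Lemma perpZ (c : C) (u : perp_space) : val (c *: u) = c *: val u.
Proof. by []. Qed.

Lemma perpD (u v : perp_space) : val (u + v) = val u + val v.
Proof. by []. Qed.

Definition perp_form (u v : perp_space) : C := cip (val u) (val v).

Fact perp_form_bilinear : bilinear_for *%R (conjC \; *%R) perp_form.
Proof.
split=> [v c u u'|u c v v']; rewrite /perp_form perpD perpZ.
  by rewrite cipDl cipZl.
by rewrite cipDr cipZr.
Qed.

HB.instance Definition _ := bilinear_isBilinear.Build C perp_space perp_space C
  (GRing.Scale.Law.clone _ _ ( *%R ) _) (GRing.Scale.Law.clone _ _ (conjC \; *%R ) _)
  perp_form perp_form_bilinear.

Fact perp_form_herm (u v : perp_space) :
  perp_form u v = (-1) ^+ false * (perp_form v u)^*.
Proof. by rewrite expr0 mul1r -cipC. Qed.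

HB.instance Definition _ :=
  @isHermitianSesquilinear.Build _ _ _ _ perp_form perp_form_herm.

Fact perp_form_dot (u : perp_space) : u != 0 -> 0 < perp_form u u.
Proof.
move=> u0; rewrite /perp_form cip_nsq ltcR lt_def nsq_ge0 andbT.
apply: contra_neq u0 => /nsq_eq0 u0; apply: val_inj.
by rewrite u0 raddf0.
Qed.

HB.instance Definition _ := isDotProduct.Build _ _ perp_form perp_form_dot.

Lemma perp_hnormB (u v : perp_space) : hnorm perp_form (u - v) = nrm (val u - val v).
Proof. by []. Qed.

Lemma perp_hnormZ c (u : perp_space) : hnorm perp_form (c *: u) = nrm (c *: val u).
Proof. by []. Qed.

(** The factor 2 arises because the real and imaginary parts are bounded separately; the imaginary
    part of z is the real part of - i z. *)
Lemma cabs_cip (x y : 'M[C]_(p, q)) : cabs (cip x y) <= 2 * (nrm x * nrm y).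
Proof.
apply: (le_trans (cabs_le _)); rewrite mulrDl !mul1r; apply: lerD; first exact: rdot_cs_abs.
have -> : complex.Im (cip x y) = rdot (- 'i *: x) y.
  by rewrite /rdot cipZl; case: (cip x y) => a c; rewrite -complexiE /=; ring.
apply: (le_trans (rdot_cs_abs _ _)); rewrite nrmZ.
by rewrite normcN (_ : cabs 'i = 1) ?mul1r // -complexiE /= expr0n expr1n add0r sqrtr1.
Qed.

Lemma cabs_entry (x : 'M[C]_(p, q)) i j : cabs (x i j) <= nrm x.
Proof.
rewrite -[leLHS]ger0_norm ?cabs_ge0 // -sqrtr_sqr ler_wsqrtr // nsqE.
rewrite (bigD1 i) //= (bigD1 j) //= -addrA lerDl addr_ge0 //.
  by apply: sumr_ge0 => k _; exact: sqr_ge0.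
by do 2!(apply: sumr_ge0 => ? _); exact: sqr_ge0.
Qed.

Lemma nrm_le_sum (x : 'M[C]_(p, q)) : nrm x <= \sum_i \sum_j cabs (x i j).
Proof.
have {1}-> : x = \sum_i \sum_j x i j *: delta_mx i j by exact: matrix_sum_delta.
apply: (le_trans (nrm_sum _ _ _)); apply: ler_sum => i _.
apply: (le_trans (nrm_sum _ _ _)); apply: ler_sum => j _.
rewrite nrmZ ler_piMr ?cabs_ge0 // /nrm -[leRHS]sqrtr1 ler_wsqrtr //.
rewrite nsqE (bigD1 i) //= (bigD1 j) //= !mxE !eqxx ComplexField.Normc.normc1 expr1n.
rewrite [X in _ + X + _]big1 => [|k /negbTE kj]; last by rewrite !mxE eqxx kj cabs0 expr0n.
rewrite big1 ?addr0 // => k /negbTE ki; rewrite big1 // => l _.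
by rewrite !mxE ki cabs0 expr0n.
Qed.

Lemma perp_complete : hilbert_complete perp_form.
Proof.
move=> u uC.
have /choice[l ul] : forall k : 'I_p * 'I_q, exists l, forall eps : R, 0 < eps ->
    exists M, forall n, (M <= n)%N -> cabs (val (u n) k.1 k.2 - l) < eps.
  move=> k; apply: complex_cauchy => eps /uC[M uM]; exists M => s t Ms Mt.
  apply: le_lt_trans (uM s t Ms Mt).
  have := cabs_entry (val (u s) - val (u t)) k.1 k.2.
  by rewrite perp_hnormB !mxE.
pose x : 'M[C]_(p, q) := \matrix_(i, j) l (i, j).
have ux (eps : R) : 0 < eps -> exists M, forall n, (M <= n)%N -> nrm (val (u n) - x) < eps.
  move=> eps0; set c := #|{: 'I_p * 'I_q}|.
  have e0 : 0 < eps / c.+1%:R by rewrite divr_gt0 ?ltr0n.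
  have /choice[M uM] := fun k => ul k _ e0.
  exists (\max_k M k) => n Mn; apply: (le_lt_trans (nrm_le_sum _)).
  rewrite pair_bigA /=.
  apply: (@le_lt_trans _ _ (\sum_(k : 'I_p * 'I_q) eps / c.+1%:R)).
    apply: ler_sum => -[i j] _; rewrite !mxE ltW // (uM (i, j)) //.
    exact: leq_trans (leq_bigmax _) Mn.
  rewrite sumr_const -[ltLHS]mulr_natr mulrAC -mulrA gtr_pMr //.
  by rewrite ltr_pdivrMr ?ltr0n // mul1r ltr_nat.
have px : perp x.
  apply/perpP => y Sy; apply: ComplexField.Normc.eq0_normc; apply/eqP.
  rewrite eq_le cabs_ge0 andbT; apply/ler_addgt0Pr => eps eps0; rewrite add0r.
  have [|M uM] := ux (eps / (2 * (nrm y + 1))).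
    by rewrite divr_gt0 // mulr_gt0 // ltr_wpDl ?nrm_ge0.
  have /perpP/(_ _ Sy) uy := valP (u M).
  have -> : cip x y = - cip (val (u M) - x) y.
    by rewrite cipDl uy add0r -[- x]scaleN1r cipZl mulN1r opprK.
  rewrite normcN; apply: (le_trans (cabs_cip _ _)).
  have /ltW h := uM M (leqnn M).
  apply: (@le_trans _ _ (2 * (eps / (2 * (nrm y + 1)) * nrm y))).
    by rewrite ler_wpM2l // ler_wpM2r ?nrm_ge0.
  have y1 : 0 < nrm y + 1 by rewrite ltr_wpDl ?nrm_ge0.
  have -> : 2 * (eps / (2 * (nrm y + 1)) * nrm y) = eps * (nrm y / (nrm y + 1)).
    by field; rewrite gt_eqF.
  by rewrite ler_piMr ?(ltW eps0) // ler_pdivrMr // mul1r lerDl.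
exists (exist _ x px : perp_space).
apply/cvgrPdist_lt => eps eps0; have [M uM] := ux eps eps0.
exists M => // n /= Mn; rewrite sub0r normrN ger0_norm ?sqrtr_ge0 //.
by rewrite perp_hnormB; exact: uM.
Qed.

End PerpSpace.

Section Gap.
Context {R : realType} {G : groupType}.
Local Notation C := R[i].

Definition unitary_action p q (rho : G -> 'M[C]_(p, q) -> 'M[C]_(p, q)) : Prop :=
  [/\ forall g, linear (rho g), forall x, rho 1%g x = x,
      forall g h x, rho (g * h)%g x = rho g (rho h x) &
      forall g x y, cip (rho g x) (rho g y) = cip x y].

(** Otherwise x, normalised, would be moved by less than the Kazhdan constant by each element of K,
    inside the complement of the invariant vectors. Property (T) would produce a nonzero invariant
    vector there, orthogonal to itself. The constant returned is the square of the Kazhdan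
    constant. *)
Lemma property_T_gap : property_T R G -> exists (K : seq G) (eps : R), 0 < eps /\
  forall p q (rho : G -> 'M[C]_(p, q) -> 'M[C]_(p, q)), unitary_action rho ->
  forall x, (forall y, (forall g, rho g y = y) -> cip x y = 0) ->
  eps * nsq x <= \sum_(g <- K) nsq (rho g x - x).
Proof.
move=> [K [eps [eps0 KT]]]; exists K, (eps ^+ 2); rewrite exprn_gt0 //; split=> //.
move=> p q rho [rlin r1 rM rU] x xperp.
pose S : set 'M[C]_(p, q) := [set y | forall g, rho g y = y].
have rho_perp g y : perp S y -> perp S (rho g y).
  move=> /perpP yS; apply/perpP => z Sz; rewrite -(Sz g) rU; exact: yS.
pose r g (u : perp_space S) : perp_space S := exist _ (rho g (val u)) (rho_perp g _ (valP u)).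
have [x0|xn0] := eqVneq (nsq x) 0.
  by rewrite x0 mulr0 sumr_ge0 // => g _; exact: nsq_ge0.
have xp : 0 < nsq x by rewrite lt_def xn0 nsq_ge0.
have Sx : perp S x by apply/perpP.
rewrite leNgt; apply/negP => lt.
have small g : g \in K -> nrm (rho g x - x) < eps * nrm x.
  move=> gK; rewrite -(@ltr_pXn2r _ 2) ?nnegrE ?mulr_ge0 ?nrm_ge0 // ?(ltW eps0) //.
  rewrite exprMn !nrm_sqr; apply: le_lt_trans lt.
  rewrite (big_rem g) //= lerDl sumr_ge0 // => h _; exact: nsq_ge0.
have nx : 0 < nrm x by rewrite sqrtr_gt0.
pose c : C := ((nrm x)^-1)%:C%C.
have cE : cabs c = (nrm x)^-1 by rewrite cabs_real ger0_norm // invr_ge0 nrm_ge0.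
have r_unitary : unitary_rep (@perp_form R p q S) r.
  split=> [g a u v|u|g h u|g u v].
  - apply: val_inj.
    change (rho g (a *: val u + val v) = a *: rho g (val u) + rho g (val v)).
    exact: rlin.
  - by apply: val_inj; rewrite /= r1.
  - by apply: val_inj; rewrite /= rM.
  - exact: (rU g (val u) (val v)).
have [|v [v0 vinv]] := KT (perp_space S) (@perp_form R p q S) r (@perp_complete R p q S) r_unitary.
  exists (c *: (exist _ x Sx : perp_space S)); split.
    by rewrite perp_hnormZ nrmZ cE mulVf // gt_eqF.
  move=> g gK; rewrite perp_hnormB.
  change (nrm (rho g (c *: x) - c *: x) < eps).
  have := rlin g c x 0; rewrite !addr0 => ->.
  have -> : rho g 0 = 0 by have := rlin g (-1) 0 0; rewrite scaler0 addr0 scaleN1r addNr.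
  rewrite addr0 -scalerBr nrmZ cE mulrC ltr_pdivrMr //; exact: small.
apply: v0; apply: val_inj; rewrite raddf0; apply: nsq_eq0.
have vS : S (val v) by move=> g; have := congr1 val (vinv g).
have /perpP/(_ _ vS) := valP v.
by rewrite /nsq /rdot => ->.
Qed.

End Gap.

(** * The model spaces E_m *)

Section Blocks.
Context {R : realType} {G : groupType} {d : nat -> nat} {b : nat}.
Local Notation C := R[i].
Local Notation E m := (Eidx d b m).

Definition mkE m (c : bool) k (hk : (k < m.+1)%N) (a : 'I_(d k)) (w : seq 'I_b)
    (hw : size w == (m - k)%N) : E m :=
  (c, existT (fun k0 : 'I_m.+1 => ('I_(d k0) * (m - k0).-tuple 'I_b)%type)
        (Ordinal hk) (a, Tuple hw)).

(** Level and word are compared as a plain number and a plain sequence, which avoids casts between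
    the dependent index types. *)
Definition atE m (y : E m) (c : bool) (k : nat) (w : seq 'I_b) : bool :=
  [&& Ecopy y == c, Elevel y == k & Eword y == w].

(* The block of X over the summand conj H_k (x) delta_w of copy c, and 0 when
   there is no such summand. *)
Definition bk m n (X : 'M[C]_(#|E m|, n)) c k (w : seq 'I_b) : 'M[C]_(d k, n) :=
  \matrix_(a, j) \sum_(y : E m | atE y c k w && (val (Ehcoord y) == val a))
    X (enum_rank y) j.

Lemma atE_mkE m c k hk a w hw : atE (@mkE m c k hk a w hw) c k w.
Proof. by rewrite /atE /Ecopy /Elevel /Eword /= !eqxx. Qed.

Lemma atEP m (y : E m) c k w : atE y c k w ->
  exists hk hw a, y = @mkE m c k hk a w hw /\ val a = val (Ehcoord y).
Proof.
case: y => c' [[k' hk'] [a' [w' hw']]].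
rewrite /atE /Ecopy /Elevel /Eword /= => /and3P[/eqP-> /eqP kk /eqP ww].
subst k' w'; exists hk', hw', a'; split=> //.
Qed.

Lemma bk_mkE m n (X : 'M[C]_(#|E m|, n)) c k hk a w hw j :
  bk X c k w a j = X (enum_rank (@mkE m c k hk a w hw)) j.
Proof.
rewrite mxE (big_pred1 (@mkE m c k hk a w hw)) // => y /=.
apply/andP/eqP => [[/atEP [hk' [hw' [a' [-> e]]]] ea]|->]; last first.
  by rewrite atE_mkE.
have -> : a' = a by apply: val_inj; rewrite e; exact/eqP.
by rewrite (bool_irrelevance hk' hk) (bool_irrelevance hw' hw).
Qed.

Lemma bk_invalid m n (X : 'M[C]_(#|E m|, n)) c k w :
  ~~ ((k < m.+1)%N && (size w == (m - k)%N)) -> bk X c k w = 0.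
Proof.
move=> inv; apply/matrixP => a j; rewrite !mxE big1 // => y /andP[/atEP[hk [hw _]] _].
by rewrite hk hw in inv.
Qed.

Lemma bk_entry m n (X : 'M[C]_(#|E m|, n)) r j :
  X r j = bk X (Ecopy (enum_val r)) (Elevel (enum_val r)) (Eword (enum_val r))
    (Ehcoord (enum_val r)) j.
Proof.
rewrite -[in LHS](enum_valK r); case: (enum_val r) => c [[k hk] [a [w hw]]].
exact: esym (@bk_mkE m n X c k hk a w hw j).
Qed.

Lemma bk_ext m n (X Y : 'M[C]_(#|E m|, n)) : (forall c k w, bk X c k w = bk Y c k w) -> X = Y.
Proof. by move=> XY; apply/matrixP => r j; rewrite !bk_entry XY. Qed.

Lemma bkD m n (X Y : 'M[C]_(#|E m|, n)) c k w : bk (X + Y) c k w = bk X c k w + bk Y c k w.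
Proof.
apply/matrixP => a j; rewrite !mxE -big_split; apply: eq_bigr => y _.
by rewrite mxE.
Qed.

Lemma bkZ m n z (X : 'M[C]_(#|E m|, n)) c k w : bk (z *: X) c k w = z *: bk X c k w.
Proof.
apply/matrixP => a j; rewrite !mxE mulr_sumr; apply: eq_bigr => y _.
by rewrite mxE.
Qed.

Lemma bk0 m n c k w : bk (0 : 'M[C]_(#|E m|, n)) c k w = 0.
Proof. by rewrite -(scale0r 0) bkZ !scale0r. Qed.

Lemma bkB m n (X Y : 'M[C]_(#|E m|, n)) c k w : bk (X - Y) c k w = bk X c k w - bk Y c k w.
Proof. by rewrite bkD -scaleN1r bkZ scaleN1r. Qed.

Lemma bk_mulr m n n' (X : 'M[C]_(#|E m|, n)) (Y : 'M[C]_(n, n')) c k w :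
  bk (X *m Y) c k w = bk X c k w *m Y.
Proof.
apply/matrixP => a j; rewrite !mxE.
under eq_bigr => y _ do rewrite mxE.
rewrite exchange_big; apply: eq_bigr => s _.
by rewrite mxE mulr_suml.
Qed.

Lemma cip_bk m n (X Y : 'M[C]_(#|E m|, n)) :
  cip X Y = \sum_(c : bool) \sum_(k < m.+1) \sum_(w : (m - k).-tuple 'I_b)
    cip (bk X c k w) (bk Y c k w).
Proof.
rewrite cipE (reindex_onto enum_rank enum_val) /=; last by move=> r _; rewrite enum_valK.
rewrite (eq_bigl xpredT) => [|x]; last by rewrite enum_rankK eqxx.
rewrite (@sum_Eidx R d b); apply: eq_bigr => c _; apply: eq_bigr => -[k hk] _.
rewrite exchange_big; apply: eq_bigr => -[w hw] _ /=.
rewrite cipE; apply: eq_bigr => a _; apply: eq_bigr => j _.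
by rewrite !(@bk_mkE _ _ _ _ _ hk _ _ hw).
Qed.

Lemma rdot_bk m n (X Y : 'M[C]_(#|E m|, n)) :
  rdot X Y = \sum_(c : bool) \sum_(k < m.+1) \sum_(w : (m - k).-tuple 'I_b)
    rdot (bk X c k w) (bk Y c k w).
Proof.
rewrite /rdot cip_bk Re_sum; apply: eq_bigr => c _; rewrite Re_sum.
by apply: eq_bigr => k _; rewrite Re_sum.
Qed.

Lemma nsq_bk m n (X : 'M[C]_(#|E m|, n)) :
  nsq X = \sum_(c : bool) \sum_(k < m.+1) \sum_(w : (m - k).-tuple 'I_b)
    nsq (bk X c k w).
Proof. exact: rdot_bk. Qed.

Lemma Eop_adj m (f : E m -> E m -> C) : (Eop f)^t* = Eop (fun x y => (f y x)^*).
Proof. by apply/matrixP => i j; rewrite !mxE. Qed.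

Lemma Eop_entry m n (f : E m -> E m -> C) (X : 'M[C]_(#|E m|, n)) x j :
  (Eop f *m X) (enum_rank x) j = \sum_y f x y * X (enum_rank y) j.
Proof.
rewrite mxE (reindex_onto enum_rank enum_val) /=; last by move=> r _; rewrite enum_valK.
rewrite (eq_bigl xpredT) => [|y]; last by rewrite enum_rankK eqxx.
by apply: eq_bigr => y _; rewrite mxE !enum_rankK.
Qed.

Lemma sum_fiber m (F : E m -> C) c k w hk hw :
  (forall y, ~~ atE y c k w -> F y = 0) ->
  \sum_y F y = \sum_(a : 'I_(d k)) F (@mkE m c k hk a w hw).
Proof.
move=> F0; rewrite (bigID (fun y => atE y c k w)) /= [X in _ + X]big1 ?addr0 //.
pose h a := @mkE m c k hk a w hw.
have h_inj : injective h.
  by move=> a a' /(congr1 (fun y => val (Ehcoord y))) /= /val_inj.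
symmetry; rewrite -(big_map h xpredT F) -[RHS]big_filter.
apply: perm_big; apply: uniq_perm.
- by rewrite map_inj_uniq // index_enum_uniq.
- by rewrite filter_uniq // index_enum_uniq.
move=> y; rewrite mem_filter mem_index_enum andbT.
apply/mapP/idP => [[a _ ->]|/atEP[hk' [hw' [a [-> _]]]]]; first exact: atE_mkE.
exists a; first by rewrite mem_index_enum.
by rewrite /h (bool_irrelevance hk' hk) (bool_irrelevance hw' hw).
Qed.

(** When the rows over one summand are supported on a single summand, the operator acts on blocks as
    left multiplication by one matrix. The operators e, F, sigma, T, s and the adjoints used here
    are all computed in this way or give the block 0. *)
Lemma bk_Eop_block m n (f : E m -> E m -> C) (X : 'M[C]_(#|E m|, n)) c k w hk hw
    c' k' w' hk' hw' (M : 'M[C]_(d k, d k')) :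
  (forall a a', f (@mkE m c k hk a w hw) (@mkE m c' k' hk' a' w' hw') = M a a') ->
  (forall a y, ~~ atE y c' k' w' -> f (@mkE m c k hk a w hw) y = 0) ->
  bk (Eop f *m X) c k w = M *m bk X c' k' w'.
Proof.
move=> fM f0; apply/matrixP => a j; rewrite (@bk_mkE _ _ _ _ _ hk _ _ hw) Eop_entry.
rewrite (@sum_fiber m _ c' k' w' hk' hw') => [|y y0]; last by rewrite f0 // mul0r.
by rewrite mxE; apply: eq_bigr => a' _; rewrite fM (@bk_mkE _ _ _ _ _ hk' _ _ hw').
Qed.

Lemma bk_Eop_zero m n (f : E m -> E m -> C) (X : 'M[C]_(#|E m|, n)) c k w :
  (forall hk hw a y, f (@mkE m c k hk a w hw) y = 0) ->
  bk (Eop f *m X) c k w = 0.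
Proof.
move=> f0; have [/andP[hk hw]|inv] := boolP ((k < m.+1)%N && (size w == (m - k)%N)); last first.
  exact: bk_invalid.
apply/matrixP => a j; rewrite (@bk_mkE _ _ _ _ _ hk _ _ hw) Eop_entry mxE big1 // => y _.
by rewrite f0 mul0r.
Qed.

Variables (pi : forall k, G -> 'M[C]_(d k)) (J : forall k, 'M[C]_(d k.+1, d k)).

Lemma bk_e eps m n (X : 'M[C]_(#|E m|, n)) c k w :
  bk (e_op R d b eps m *m X) c k w = if c == eps then bk X c k w else 0.
Proof.
have [/andP[hk hw]|inv] := boolP ((k < m.+1)%N && (size w == (m - k)%N)); last first.
  by rewrite !bk_invalid // if_same.
have [->|ce] := eqVneq c eps; last first.
  apply: bk_Eop_zero => hk' hw' a y; case: eqP => //= <-.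
  by rewrite /Ecopy /= (negbTE ce).
rewrite -[RHS]mul1mx; apply: (@bk_Eop_block m n _ X _ _ _ hk hw _ _ _ hk hw).
  move=> a a'; rewrite mxE /Ecopy /= eqxx andbT; congr (nat_of_bool _)%:R.
  by apply/eqP/eqP => [/(congr1 (fun y => val (Ehcoord y))) /= /val_inj|->].
move=> a y ny; case: eqP => [e|_] //=.
by rewrite -e atE_mkE in ny.
Qed.

Lemma bk_sigma g m n (X : 'M[C]_(#|E m|, n)) c k w :
  bk (sigma_op pi b g m *m X) c k w = map_mx conjC (pi k g) *m bk X c k w.
Proof.
have [/andP[hk hw]|inv] := boolP ((k < m.+1)%N && (size w == (m - k)%N)); last first.
  by rewrite !bk_invalid // mulmx0.
apply: (@bk_Eop_block m n _ X _ _ _ hk hw _ _ _ hk hw).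
  by move=> a a'; rewrite /Ecopy /Elevel /Eword /= !eqxx /= conform_mx_id mxE.
move=> a y; rewrite /atE => ny.
case: ifP => // /and3P[/eqP h1 /eqP h2 /eqP h3].
by rewrite -h1 -h2 -h3 !eqxx in ny.
Qed.

Lemma bk_T eps i m n (X : 'M[C]_(#|E m|, n)) c k w :
  bk (T_op J eps i m *m X) c k.+1 w =
  if c == eps then map_mx conjC (J k) *m bk X c k (i :: w) else 0.
Proof.
have [/andP[hk hw]|inv] := boolP ((k.+1 < m.+1)%N && (size w == (m - k.+1)%N)); last first.
  rewrite bk_invalid // bk_invalid ?mulmx0 ?if_same //.
  apply: contra inv; rewrite /= => /andP[h1 /eqP h2].
  by rewrite ltnS -subn_gt0 -h2 /= subnS -h2 eqxx.
have [->|ce] := eqVneq c eps; last first.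
  by apply: bk_Eop_zero => hk' hw' a y; rewrite {1}/Ecopy /= (negbTE ce).
have hk' : (k < m.+1)%N by exact: ltnW.
have hw' : size (i :: w) == (m - k)%N.
  by rewrite /= (eqP hw) subnS prednK // subn_gt0.
apply: (@bk_Eop_block m n _ X _ _ _ hk hw _ _ _ hk' hw').
  by move=> a a'; rewrite /Ecopy /Elevel /Eword /= !eqxx /= conform_mx_id mxE.
move=> a y; rewrite /atE => ny.
case: ifP => // /and4P[/eqP h1 /eqP h2 /eqP [h3] /eqP h4].
by rewrite h2 -h3 h4 !eqxx in ny.
Qed.

Lemma bk_T0 eps i m n (X : 'M[C]_(#|E m|, n)) c w : bk (T_op J eps i m *m X) c 0 w = 0.
Proof.
apply: bk_Eop_zero => hk hw a y.
by case: ifP => // /and4P[_ _ /eqP].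
Qed.

Lemma bk_T_adj eps i m n (X : 'M[C]_(#|E m|, n)) c k i' w :
  bk ((T_op J eps i m)^t* *m X) c k (i' :: w) =
  if (c == eps) && (i == i') then (map_mx conjC (J k))^t* *m bk X c k.+1 w else 0.
Proof.
rewrite Eop_adj.
have [/andP[hk hw]|inv] := boolP ((k.+1 < m.+1)%N && (size w == (m - k.+1)%N)); last first.
  rewrite bk_invalid // ?bk_invalid ?mulmx0 ?if_same //.
  apply: contra inv; rewrite /= => /andP[h1 /eqP h2].
  by rewrite ltnS -subn_gt0 -h2 /= subnS -h2 eqxx.
have [/andP[/eqP-> /eqP->]|ce] := boolP ((c == eps) && (i == i')); last first.
  apply: bk_Eop_zero => hk' hw' a y; case: ifP; rewrite ?conjC0 //.
  move=> /and4P[_ /eqP h1 _ /eqP [h2 _]].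
  by case/negP: ce; rewrite -h1 h2 /Ecopy /= !eqxx.
have hk' : (k < m.+1)%N by exact: ltnW.
have hw' : size (i' :: w) == (m - k)%N.
  by rewrite /= (eqP hw) subnS prednK // subn_gt0.
apply: (@bk_Eop_block m n _ X _ _ _ hk' hw' _ _ _ hk hw).
  move=> a a'; rewrite /Ecopy /Elevel /Eword /= !eqxx /= conform_mx_id.
  by rewrite !mxE.
move=> a y; rewrite /atE => ny.
case: ifP => [/and4P[/eqP h1 /eqP h2 /eqP h3 /eqP [h4]]|_]; last by rewrite conjC0.
by rewrite h1 h3 -h4 !eqxx in ny.
Qed.

Lemma bk_T_adj0 eps i m n (X : 'M[C]_(#|E m|, n)) c k :
  bk ((T_op J eps i m)^t* *m X) c k [::] = 0.
Proof.
rewrite Eop_adj; apply: bk_Eop_zero => hk hw a y; case: ifP; rewrite ?conjC0 //.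
by move=> /and4P[_ _ _ /eqP].
Qed.

Lemma bk_s_adj m n (X : 'M[C]_(#|E m|, n)) c k w :
  bk ((s_op R d b m)^t* *m X) c k w = if c && (k == m) then bk X false k w else 0.
Proof.
rewrite Eop_adj.
have [/andP[hk hw]|inv] := boolP ((k < m.+1)%N && (size w == (m - k)%N)); last first.
  by rewrite !bk_invalid // if_same.
have [/andP[c1 km]|ce] := boolP (c && (k == m)); last first.
  apply: bk_Eop_zero => hk' hw' a y; rewrite conjC_nat.
  move: ce; rewrite {2}/Ecopy /Elevel /= => /negbTE ce.
  by rewrite andbA [X in _ && X]andbC; case: (_ == _) => //=; rewrite ?andbF // -?andbA ce ?andbF.
rewrite -[RHS]mul1mx; apply: (@bk_Eop_block m n _ X _ _ _ hk hw _ _ _ hk hw).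
  move=> a a'; rewrite conjC_nat mxE /Ecopy /Elevel /= c1 km /=; congr (nat_of_bool _)%:R.
  apply/eqP/eqP => [e|->] //.
  have := congr1 (fun z => val (Ehcoord ((false, z) : E m))) e.
  by move=> /= /val_inj.
move=> a [c' z] ny; rewrite conjC_nat /Ecopy /Elevel /=; case: (@eqP _ z _) => [e|_]; last by rewrite !andbF.
by case: c' ny => //=; rewrite e /atE /Ecopy /Elevel /Eword /= !eqxx.
Qed.

Lemma bk_s m n (X : 'M[C]_(#|E m|, n)) c k w :
  bk (s_op R d b m *m X) c k w = if ~~ c && (k == m) then bk X true k w else 0.
Proof.
have [/andP[hk hw]|inv] := boolP ((k < m.+1)%N && (size w == (m - k)%N)); last first.
  by rewrite !bk_invalid // if_same.
have [/andP[/negbTE c1 km]|ce] := boolP (~~ c && (k == m)); last first.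
  apply: bk_Eop_zero => hk' hw' a [c' z]; rewrite /Ecopy /Elevel /=.
  case: (@eqP _ _ z) => [<-|_]; last by rewrite !andbF.
  by rewrite andbT /=; move: ce; case: (c) => //=; rewrite ?andbF // => /negbTE ->; rewrite andbF.
rewrite -[RHS]mul1mx; apply: (@bk_Eop_block m n _ X _ _ _ hk hw _ _ _ hk hw).
  move=> a a'; rewrite mxE /Ecopy /Elevel /= c1 km /=; congr (nat_of_bool _)%:R.
  apply/eqP/eqP => [e|->] //.
  have := congr1 (fun z => val (Ehcoord ((false, z) : E m))) e.
  by move=> /= /val_inj.
move=> a [c' z] ny; rewrite /Ecopy /Elevel /=; case: (@eqP _ _ z) => [e|_]; last by rewrite !andbF.
by case: c' ny => //=; rewrite ?andbF // -e /atE /Ecopy /Elevel /Eword /= !eqxx.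
Qed.

End Blocks.

(** * Schur's lemma, invariant vectors and the uniform gap of D_k *)

Lemma two_sum_le (R : realFieldType) (e S a n q : R) : a <= e * S -> n <= q ->
  0 <= e * q -> 0 <= S -> 2 * a + 2 * n <= (2 * e + 2) * (S + q).
Proof. lra. Qed.

Lemma absorb_half (R : realFieldType) (c r n p : R) : 2 * c * r <= n + p ->
  p <= c * r -> c * r <= n.
Proof. lra. Qed.

Section Schur.
Context {R : realType} {G : groupType}.
Local Notation C := R[i].

Lemma adjZ p q (a : C) (M : 'M[C]_(p, q)) : (a *: M)^t* = a^* *: M^t*.
Proof. by apply/matrixP => i j; rewrite !mxE rmorphM. Qed.

(** A row eigenvector of M^T is, transposed, a column eigenvector of M. The kernel of M - a is then
    a nonzero subrepresentation, hence everything. *)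
Lemma schur_scalar n (pi : G -> 'M[C]_n) (M : 'M[C]_n) : irreducible_mxrep pi ->
  (forall g, pi g *m M = M *m pi g) -> exists a, M = a%:M.
Proof.
move=> [n0 irr] comm.
have [a /eigenvalueP[v vM v0]] := eigenvalue_closed M^T n0.
exists a; pose A := M - a%:M.
have Alin : linear (fun x : 'cV[C]_n => A *m x) by move=> c x y; rewrite mulmxDr -scalemxAr.
pose f : {linear 'cV[C]_n -> 'cV[C]_n} :=
  HB.pack (fun x : 'cV[C]_n => A *m x) (GRing.isLinear.Build _ _ _ _ _ Alin).
pose U := lker (linfun f).
have UE x : (x \in U) = (A *m x == 0) by rewrite memv_ker lfunE.
have [|U0|U1] := irr U.
- move=> g x; rewrite !UE => /eqP Ax; rewrite mulmxA.
  have -> : A *m pi g = pi g *m A by rewrite mulmxBl mulmxBr comm scalar_mxC.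
  by rewrite -mulmxA Ax mulmx0.
- have : v^T \in U.
    rewrite UE mulmxBl mul_scalar_mx subr_eq0; apply/eqP.
    by rewrite -[M]trmxK -trmx_mul vM linearZ.
  rewrite U0 memv0 => /eqP v00; case/eqP: v0.
  by rewrite -[v]trmxK v00 trmx0.
apply/eqP; rewrite -subr_eq0; apply/eqP/matrixP => i j.
have : (delta_mx j 0 : 'cV[C]_n) \in U by rewrite U1 memvf.
by rewrite UE -colE => /eqP/matrixP/(_ i 0); rewrite !mxE.
Qed.

Lemma unitary_mxrep_adj n (pi : G -> 'M[C]_n) g : unitary_mxrep pi ->
  (pi g)^t* *m pi g = 1%:M /\ pi g *m (pi g)^t* = 1%:M.
Proof. by move=> [/(_ g) /unitarymxP h _ _]; split=> //; exact: mulmx1C. Qed.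

(** Both M^* M and M M^* commute with an irreducible representation, so they are scalars. If M is
    nonzero the scalars agree and are positive, and M divided by the square root is a unitary
    equivalence. *)
Lemma schur_zero n1 n2 (pi1 : G -> 'M[C]_n1) (pi2 : G -> 'M[C]_n2) (M : 'M[C]_(n2, n1)) :
  unitary_mxrep pi1 -> unitary_mxrep pi2 -> irreducible_mxrep pi1 ->
  irreducible_mxrep pi2 -> ~ unitarily_equivalent pi1 pi2 ->
  (forall g, pi2 g *m M = M *m pi1 g) -> M = 0.
Proof.
move=> u1 u2 i1 i2 ne comm.
have comm' g : pi1 g *m M^t* = M^t* *m pi2 g.
  have /(congr1 (fun X => X^t*)) := comm g; rewrite !trmx_mul !map_mxM => h.
  have [_ p1] := unitary_mxrep_adj g u1; have [p2 _] := unitary_mxrep_adj g u2.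
  rewrite -[LHS]mulmx1 -p2 -!mulmxA [M^t* *m (_ *m _)]mulmxA h !mulmxA p1 mul1mx //.
have [a aE] : exists a, M^t* *m M = a%:M.
  by apply: (schur_scalar i1) => g; rewrite mulmxA comm' -!mulmxA comm.
have [a' aE'] : exists a, M *m M^t* = a%:M.
  by apply: (schur_scalar i2) => g; rewrite mulmxA comm -!mulmxA comm'.
have [//|M0] := eqVneq M 0; exfalso; apply: ne.
have n10 : (0 < n1)%N by case: i1.
have aa : a = a'.
  have : a *: M = a' *: M by rewrite -mul_mx_scalar -mul_scalar_mx -aE -aE' mulmxA.
  by move/eqP; rewrite -subr_eq0 -scalerBl scaler_eq0 (negbTE M0) orbF subr_eq0 => /eqP.
have an : a *+ n1 = (nsq M)%:C%C.
  by rewrite -cip_nsq /cip mxtrace_mulC aE mxtrace_scalar.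
have Mp : 0 < nsq M.
  by rewrite lt_def nsq_ge0 andbT; apply: contra_neq M0 => /nsq_eq0.
have nn0 : (n1%:R : R) != 0 by rewrite pnatr_eq0 -lt0n.
have ar : a = (nsq M / n1%:R)%:C%C.
  rewrite rmorphM fmorphV rmorph_nat /= -an -[a *+ n1]mulr_natr mulfK //.
  by rewrite pnatr_eq0 -lt0n.
pose s := Num.sqrt (nsq M / n1%:R).
have s0 : s != 0 by rewrite gt_eqF // sqrtr_gt0 divr_gt0 // ltr0n.
have ss : (s^-1)%:C%C * (s^-1)%:C%C * a = 1.
  rewrite ar -!rmorphM /= -invfM -expr2 sqr_sqrtr ?mulVf ?rmorph1 //.
    by rewrite mulf_neq0 ?invr_eq0 // gt_eqF.
  by rewrite divr_ge0 // ltW.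
exists ((s^-1)%:C%C *: M); split.
- rewrite adjZ conjR -scalemxAl -scalemxAr scalerA aE.
  by rewrite scale_scalar_mx ss.
- rewrite adjZ conjR -scalemxAl -scalemxAr scalerA aE' -aa.
  by rewrite scale_scalar_mx ss.
- by move=> g; rewrite -scalemxAl -scalemxAr comm.
Qed.

End Schur.

Section Model.
Context {R : realType} {G : groupType} {d : nat -> nat} {b : nat}.
Local Notation C := R[i].
Local Notation E m := (Eidx d b m).
Variable pi : forall k, G -> 'M[C]_(d k).
Hypothesis irr : lists_irreps pi.

Let pi_unitary k : unitary_mxrep (pi k). Proof. by have [/(_ k) []] := irr. Qed.
Let pi_irr k : irreducible_mxrep (pi k). Proof. by have [/(_ k) []] := irr. Qed.

Lemma d_gt0 k : (0 < d k)%N. Proof. by have [] := pi_irr k. Qed.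

Let dk0 k : ((d k)%:R : C) != 0. Proof. by rewrite pnatr_eq0 -lt0n d_gt0. Qed.

(** The vectors supported on level k whose blocks are the scalar matrices [v c w]; by Schur's lemma
    these are exactly the vectors fixed by all [rho g]. *)
Definition Einv m k (v : bool -> seq 'I_b -> C) : 'M[C]_(#|E m|, d k) :=
  \matrix_(r, j) let y := enum_val r in
    if (Elevel y == k) && (val (Ehcoord y) == val j) then v (Ecopy y) (Eword y) else 0.

Lemma bk_Einv m k v c w : bk (Einv m k v) c k w =
  (if (k < m.+1)%N && (size w == (m - k)%N) then v c w else 0)%:M.
Proof.
have [/andP[hk hw]|inv] := boolP (_ && _); last first.
  by rewrite bk_invalid // -scalemx1 scale0r.
apply/matrixP => a j; rewrite (@bk_mkE _ _ _ _ _ _ _ _ hk _ _ hw) !mxE enum_rankK.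
rewrite /Elevel /Ecopy /Eword /Ehcoord /= eqxx /= (inj_eq val_inj).
by case: (a == j); rewrite ?mulr1n ?mulr0n.
Qed.

Lemma bk_Einv_ne m k v c l w : l != k -> bk (Einv m k v) c l w = 0.
Proof.
move=> lk.
have [/andP[hk hw]|inv] := boolP ((l < m.+1)%N && (size w == (m - l)%N)); last first.
  by rewrite bk_invalid.
apply/matrixP => a j; rewrite (@bk_mkE _ _ _ _ _ _ _ _ hk _ _ hw) !mxE enum_rankK.
by rewrite /Elevel /= (negbTE lk).
Qed.

Definition avg m k (X : 'M[C]_(#|E m|, d k)) c w : C := \tr (bk X c k w) / (d k)%:R.

(** The orthogonal projection onto the invariant vectors: a block of level k is replaced by its
    normalised trace times the identity, all other blocks by 0. *)
Definition invproj m k (X : 'M[C]_(#|E m|, d k)) := Einv m k (avg X).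

Lemma cip_Einv m k (X : 'M[C]_(#|E m|, d k)) v : cip X (Einv m k v) =
  \sum_(c : bool) \sum_(l < m.+1 | l == k :> nat) \sum_(w : (m - l).-tuple 'I_b)
    \tr (bk X c k w) * (v c w)^*.
Proof.
rewrite cip_bk; apply: eq_bigr => c _; rewrite (bigID (fun l : 'I_m.+1 => l == k :> nat)) /=.
rewrite [X in _ + X]big1 ?addr0; last first.
  move=> l lk; rewrite big1 // => w _; rewrite bk_Einv_ne //.
  by rewrite /cip trmx0 map_mx0 mulmx0 mxtrace0.
apply: eq_bigr => l /eqP lk; subst k; apply: eq_bigr => w _; rewrite bk_Einv.
rewrite ltn_ord size_tuple eqxx /= /cip tr_scalar_mx map_scalar_mx.
by rewrite mul_mx_scalar mxtraceZ mulrC.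
Qed.

Lemma tr_bk_Einv m k v c w : (k < m.+1)%N -> size w = (m - k)%N ->
  \tr (bk (Einv m k v) c k w) = v c w * (d k)%:R.
Proof. by move=> hk hw; rewrite bk_Einv hk hw eqxx /= mxtrace_scalar mulr_natr. Qed.

Lemma cip_invproj m k (X : 'M[C]_(#|E m|, d k)) v :
  cip (invproj X) (Einv m k v) = cip X (Einv m k v).
Proof.
rewrite !cip_Einv; apply: eq_bigr => c _; apply: eq_bigr => l /eqP lk; subst k.
apply: eq_bigr => w _; rewrite tr_bk_Einv ?ltn_ord ?size_tuple //.
by rewrite /avg divfK.
Qed.

Lemma invproj_orth m k (X : 'M[C]_(#|E m|, d k)) v :
  cip (X - invproj X) (Einv m k v) = 0.
Proof. by rewrite cipDl -scaleN1r cipZl mulN1r cip_invproj subrr. Qed.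

Lemma invproj_rdot m k (X : 'M[C]_(#|E m|, d k)) v :
  rdot (X - invproj X) (Einv m k v) = 0.
Proof. by rewrite /rdot invproj_orth. Qed.

Lemma nsq_invproj m k (X : 'M[C]_(#|E m|, d k)) : nsq (invproj X) <= nsq X.
Proof.
rewrite -[X in leRHS](subrK (invproj X)) nsqD invproj_rdot mulr0 addr0.
by rewrite lerDr nsq_ge0.
Qed.

Definition rho m k g (X : 'M[C]_(#|E m|, d k)) := sigma_op pi b g m *m X *m (pi k g)^T.

Lemma bk_rho m k g (X : 'M[C]_(#|E m|, d k)) c l w :
  bk (rho g X) c l w = map_mx conjC (pi l g) *m bk X c l w *m (pi k g)^T.
Proof. by rewrite bk_mulr bk_sigma. Qed.

Lemma conj_unitary k g : (map_mx conjC (pi k g))^t* *m map_mx conjC (pi k g) = 1%:M.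
Proof.
have [h _] := unitary_mxrep_adj g (pi_unitary k).
have := congr1 (map_mx conjC) h; rewrite map_mxM map_mx1 => <-.
by rewrite map_trmx.
Qed.

Lemma tr_unitary k g : (pi k g)^T *m ((pi k g)^T)^t* = 1%:M.
Proof.
have [h _] := unitary_mxrep_adj g (pi_unitary k).
have := congr1 trmx h; rewrite trmx_mul trmx1 => <-.
by rewrite map_trmx trmxK.
Qed.

Lemma cip_rho m k g (X Y : 'M[C]_(#|E m|, d k)) : cip (rho g X) (rho g Y) = cip X Y.
Proof.
rewrite !cip_bk; apply: eq_bigr => c _; apply: eq_bigr => l _; apply: eq_bigr => w _.
by rewrite !bk_rho cip_mulr -[_ *m (pi k g)^T *m _]mulmxA tr_unitary mulmx1 cip_mull mulmxA conj_unitary mul1mx.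
Qed.

Lemma rho_action m k : unitary_action (@rho m k).
Proof.
split=> [g c X Y|X|g h X|g X Y].
- by rewrite /rho mulmxDr mulmxDl -scalemxAr -scalemxAl.
- apply: bk_ext => c l w; rewrite bk_rho.
  have [_ -> _] := pi_unitary k; have [_ -> _] := pi_unitary l.
  by rewrite map_mx1 mul1mx trmx1 mulmx1.
- apply: bk_ext => c l w; rewrite !bk_rho.
  have [_ _ ->] := pi_unitary k; have [_ _ ->] := pi_unitary l.
  by rewrite map_mxM trmx_mul !mulmxA.
- exact: cip_rho.
Qed.

Lemma rho_Einv m k g v : rho g (Einv m k v) = Einv m k v.
Proof.
apply: bk_ext => c l w; rewrite bk_rho.
have [->|lk] := eqVneq l k; last by rewrite bk_Einv_ne // mulmx0 mul0mx.
rewrite bk_Einv mul_mx_scalar -scalemxAl.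
have -> : map_mx conjC (pi k g) *m (pi k g)^T = 1%:M.
  have [_ h] := unitary_mxrep_adj g (pi_unitary k).
  have := congr1 (map_mx conjC) h; rewrite map_mxM map_mx1 => <-.
  by rewrite -map_mx_comp (map_mx_id (@conjCK _)).
by rewrite scalemx1.
Qed.

(** The conjugate of the block at level l intertwines pi_k and pi_l: it is 0 for l <> k and a scalar
    for l = k. *)
Lemma rho_invariant m k (Y : 'M[C]_(#|E m|, d k)) : (forall g, rho g Y = Y) ->
  Y = invproj Y.
Proof.
move=> Yinv; apply: bk_ext => c l w.
pose M := map_mx conjC (bk Y c l w).
have comm g : pi l g *m M = M *m pi k g.
  have := congr1 (fun X => map_mx conjC (bk X c l w)) (Yinv g).
  rewrite bk_rho !map_mxM -/M -map_mx_comp (map_mx_id (@conjCK _)) => h.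
  rewrite -[in RHS]h -mulmxA; have [-> _] := unitary_mxrep_adj g (pi_unitary k).
  by rewrite mulmx1.
have [lk|lk] := eqVneq l k; last first.
  rewrite bk_Einv_ne //.
  have M0 : M = 0.
    apply: (schur_zero (pi_unitary k) (pi_unitary l) (pi_irr k) (pi_irr l)) comm.
    by have [_ + _] := irr; apply; apply/eqP; rewrite eq_sym.
  have := congr1 (map_mx conjC) M0; rewrite map_mx0 => <-.
  by rewrite -map_mx_comp (map_mx_id (@conjCK _)).
subst l; have [a aE] := schur_scalar (pi_irr k) comm.
have YE : bk Y c k w = (a^*)%:M.
  have := congr1 (map_mx conjC) aE; rewrite map_scalar_mx => <-.
  by rewrite -map_mx_comp (map_mx_id (@conjCK _)).
rewrite bk_Einv; case: ifP => [_|/negbT inv]; last first.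
  by rewrite bk_invalid // -scalemx1 scale0r.
by rewrite /avg YE mxtrace_scalar -[X in X / _]mulr_natr mulfK.
Qed.

Variables (K : seq G) (ep : R).
Hypothesis ep0 : 0 < ep.
Hypothesis gap : forall p q (r : G -> 'M[C]_(p, q) -> 'M[C]_(p, q)), unitary_action r ->
  forall x, (forall y, (forall g, r g y = y) -> cip x y = 0) ->
  ep * nsq x <= \sum_(g <- K) nsq (r g x - x).

Lemma rhoD m k g (X Y : 'M[C]_(#|E m|, d k)) : rho g (X + Y) = rho g X + rho g Y.
Proof. by rewrite /rho mulmxDr mulmxDl. Qed.

Lemma rhoN m k g (X : 'M[C]_(#|E m|, d k)) : rho g (- X) = - rho g X.
Proof. by rewrite /rho mulmxN mulNmx. Qed.

Lemma invproj_gap m k (X : 'M[C]_(#|E m|, d k)) :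
  ep * nsq (X - invproj X) <= \sum_(g <- K) nsq (rho g X - X).
Proof.
have := gap (rho_action m k) (x := X - invproj X).
move=> /(_ _)/le_trans -> //.
  move=> y /rho_invariant ->; exact: invproj_orth.
apply: ler_sum => g _; rewrite rhoD rhoN rho_Einv.
by rewrite opprB addrA subrK.
Qed.

(** The adjoint of [rho g], which is also its inverse by unitarity. *)
Definition rhoV m k g (X : 'M[C]_(#|E m|, d k)) :=
  (sigma_op pi b g m)^t* *m X *m ((pi k g)^T)^t*.

Lemma rhoVK m k g (X : 'M[C]_(#|E m|, d k)) : rhoV g (rho g X) = X.
Proof.
have h : forall Y, cip (rhoV g (rho g X)) Y = cip X Y.
  by move=> Y; rewrite /rhoV cip_mulr cip_mull !trmxCK -[RHS](cip_rho g) mulmxA.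
have := h (rhoV g (rho g X) - X) => /eqP; rewrite -subr_eq0 -mulN1r -cipZl -cipDl scaleN1r.
by rewrite cip_nsq => /eqP/complexI/nsq_eq0/eqP; rewrite subr_eq0 => /eqP.
Qed.

(** D_k(eps) in the model E_m: a Laplacian over K, plus the penalty 1 - e^eps that confines the
    kernel to copy eps. *)
Definition Dop m k eps (X : 'M[C]_(#|E m|, d k)) : 'M[C]_(#|E m|, d k) :=
  \sum_(g <- K) (X + X - rho g X - rhoV g X) + (X - e_op R d b eps m *m X).

Lemma e_op_adj eps m : (e_op R d b eps m)^t* = e_op R d b eps m.
Proof.
rewrite /e_op Eop_adj; apply/matrixP => i j; rewrite !mxE conjC_nat eq_sym.
by case: eqP => [->|].
Qed.

Lemma e_op_idem eps m n (X : 'M[C]_(#|E m|, n)) :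
  e_op R d b eps m *m (e_op R d b eps m *m X) = e_op R d b eps m *m X.
Proof. by apply: bk_ext => c k w; rewrite !bk_e; case: (c == eps). Qed.

Lemma rdot_e eps m n (X : 'M[C]_(#|E m|, n)) :
  rdot (e_op R d b eps m *m X) X = nsq (e_op R d b eps m *m X).
Proof. by rewrite -{1}e_op_idem rdot_mull e_op_adj. Qed.

Lemma rdot_1e eps m n (X : 'M[C]_(#|E m|, n)) :
  rdot (X - e_op R d b eps m *m X) X = nsq (X - e_op R d b eps m *m X).
Proof.
rewrite nsqB rdotBl rdot_e [rdot X (_ *m _)]rdotC rdot_e -/(nsq X).
by rewrite mulrDl mul1r opprD addrA subrK.
Qed.

Lemma rdot_Dop m k eps (X : 'M[C]_(#|E m|, d k)) :
  rdot (Dop eps X) X = \sum_(g <- K) nsq (rho g X - X) + nsq (X - e_op R d b eps m *m X).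
Proof.
rewrite rdotDl rdot_1e rdot_suml; congr (_ + _); apply: eq_bigr => g _.
have h : rdot (rhoV g X) X = rdot (rho g X) X.
  by rewrite /rhoV rdot_mulr rdot_mull !trmxCK rdotC mulmxA.
have hn : nsq (rho g X) = nsq X by rewrite /nsq /rdot cip_rho.
rewrite !rdotBl rdotDl h nsqB hn -/(nsq X).
by rewrite mulrDl mul1r opprD [RHS]addrAC [RHS]addrA.
Qed.

Lemma Dop_sym m k eps (X Y : 'M[C]_(#|E m|, d k)) :
  rdot (Dop eps X) Y = rdot X (Dop eps Y).
Proof.
rewrite rdotDl rdotDr rdot_suml rdot_sumr rdotBl rdotBr rdot_mull e_op_adj.
congr (_ + _); apply: eq_bigr => g _.
rewrite !rdotBl !rdotBr rdotDl rdotDr.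
rewrite [rdot (rho g X) Y]rdot_mulr [rdot (_ *m X) _]rdot_mull mulmxA -/(rhoV g Y).
rewrite [rdot (rhoV g X) Y]rdot_mulr [rdot (_ *m X) _]rdot_mull !trmxCK mulmxA -/(rho g Y).
exact: addrAC.
Qed.

Lemma Dop_Einv m k eps v : (forall c w, c != eps -> v c w = 0) ->
  Dop eps (Einv m k v) = 0.
Proof.
move=> v0; rewrite /Dop big1 => [|g _]; last first.
  have e := rho_Einv m k g v.
  have e2 : rhoV g (Einv m k v) = Einv m k v by rewrite -{1}e rhoVK.
  by rewrite e e2 addrK subrr.
rewrite add0r (_ : _ *m _ = Einv m k v) ?subrr //.
apply: bk_ext => c l w; rewrite bk_e; case: eqP => // /eqP ce.
have [->|lk] := eqVneq l k; last by rewrite bk_Einv_ne.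
by rewrite bk_Einv v0 // if_same -scalemx1 scale0r.
Qed.

(** The component of X in the kernel of [Dop eps]. *)
Definition x0 m k eps (X : 'M[C]_(#|E m|, d k)) :=
  Einv m k (fun c w => if c == eps then avg X c w else 0).

(** Its inverse is the spectral gap, uniform in m and k. The part of X orthogonal to the invariant
    vectors contributes 2 / ep, the invariant part of X - e X contributes 2. *)
Definition C1 : R := 2 / ep + 2.

Lemma C1_gt0 : 0 < C1.
Proof. by rewrite /C1 addr_gt0 // divr_gt0. Qed.

Lemma Dop_x0 m k eps (X : 'M[C]_(#|E m|, d k)) : Dop eps (x0 eps X) = 0.
Proof. by apply: Dop_Einv => c w /negbTE ->. Qed.

Lemma sub_x0_le m k eps (X : 'M[C]_(#|E m|, d k)) :
  nsq (X - x0 eps X) <= C1 * rdot (Dop eps X) X.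
Proof.
set e := e_op R d b eps m.
(* [x0] is the invariant part of e X, so that X - x0 is the non-invariant part of X plus the
   invariant part of X - e X. *)
have h : x0 eps X = invproj X - invproj (X - e *m X).
  apply: bk_ext => c l w; rewrite bkB.
  have [->|lk] := eqVneq l k; last by rewrite !bk_Einv_ne // subrr.
  rewrite !bk_Einv -raddfB /=; congr _%:M; case: ifP => _; last by rewrite subrr.
  rewrite /avg bkB bk_e; case: ifP => _; first by rewrite subrr mxtrace0 mul0r subr0.
  by rewrite subr0 subrr.
have -> : X - x0 eps X = (X - invproj X) + invproj (X - e *m X).
  by rewrite h opprB addrCA addrC.
apply: (le_trans (nsqD_le _ _)).
have h1 := invproj_gap X; have h2 := nsq_invproj (X - e *m X).
rewrite rdot_Dop -/e; set S := \sum_(_ <- _) _ in h1 *.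
have S0 : 0 <= S by apply: sumr_ge0 => g _; exact: nsq_ge0.
have h3 : nsq (X - invproj X) <= ep^-1 * S by rewrite ler_pdivlMl.
have h4 : 0 <= ep^-1 * nsq (X - e *m X) by rewrite mulr_ge0 ?nsq_ge0 // invr_ge0 ltW.
exact: two_sum_le.
Qed.

Lemma Dop_ge0 m k eps (X : 'M[C]_(#|E m|, d k)) : 0 <= rdot (Dop eps X) X.
Proof.
by rewrite rdot_Dop addr_ge0 ?nsq_ge0 // sumr_ge0 // => g _; exact: nsq_ge0.
Qed.

(** Each term 2 - rho(g) - rho(g)^* is at most 4, and 1 - e is at most 1. *)
Definition Lmax : R := 4 * (size K)%:R + 1.

Lemma Dop_le m k eps (X : 'M[C]_(#|E m|, d k)) : rdot (Dop eps X) X <= Lmax * nsq X.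
Proof.
rewrite rdot_Dop /Lmax mulrDl mul1r; apply: lerD.
  have -> : 4 * (size K)%:R * nsq X = \sum_(g <- K) 4 * nsq X.
    by rewrite big_const_seq count_predT iter_addr_0 -[RHS]mulr_natl; ring.
  apply: ler_sum => g _; have := nsqD_le (rho g X) (- X).
  rewrite nsqN (_ : nsq (rho g X) = nsq X); last by rewrite /nsq /rdot cip_rho.
  by lra.
have := rdot_1e eps X; rewrite rdotBl rdot_e -/(nsq X) => <-.
by rewrite lerBlDr lerDl nsq_ge0.
Qed.

(** As D is symmetric and vanishes on x0, <D X, X> = <D X, X - x0>. The weighted
    arithmetic-geometric inequality with t = 1 / C1 and the bound on X - x0 absorb half of the left
    side. *)
Lemma Dop_gap m k eps (X : 'M[C]_(#|E m|, d k)) :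
  rdot (Dop eps X) X <= C1 * nsq (Dop eps X).
Proof.
have h : rdot (Dop eps X) X = rdot (Dop eps X) (X - x0 eps X).
  by rewrite rdotBr [rdot _ (x0 _ _)]Dop_sym Dop_x0 rdot0r subr0.
have h1 := rdot_amgm (C1^-1) (Dop eps X) (X - x0 eps X); rewrite -h in h1.
have h2 := sub_x0_le eps X.
have c0 := C1_gt0; have c1 : C1 != 0 by rewrite gt_eqF.
have h3 := ler_wpM2l (sqr_ge0 C1^-1) h2.
have e : C1^-1 ^+ 2 * (C1 * rdot (Dop eps X) X) = C1^-1 * rdot (Dop eps X) X by field.
by rewrite e in h3; rewrite -ler_pdivrMl // (absorb_half h1 h3).
Qed.

End Model.

(** * Passage between the levels k and k + 1 in the models *)

Lemma lower_bound_transfer (R : realFieldType) (r Z Z0 A A0 e cF : R) : 1 <= r ->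
  Z0 <= r * A0 -> A0 <= 2 * A + 2 * e -> Z <= 2 * Z0 + 2 * e -> 0 <= e -> e <= cF ->
  (4 * r)^-1 * Z - 2 * cF <= A.
Proof.
move=> r1 h1 h2 h3 e0 ecF; have r0 : 0 < r by exact: lt_le_trans ltr01 r1.
have h4 : 2 * (4 * r)^-1 * Z0 <= A0 / 2.
  rewrite ler_pdivlMr // (_ : _ * 2 = r^-1 * Z0); last by field; lra.
  by rewrite ler_pdivrMl.
have h5 : (4 * r)^-1 * Z <= 2 * (4 * r)^-1 * Z0 + 2 * (4 * r)^-1 * e.
  rewrite [2 * _]mulrC -!mulrA -mulrDr ler_wpM2l //.
  by rewrite invr_ge0 mulr_ge0 // ltW.
have h6 : 2 * (4 * r)^-1 * e <= e / 2.
  rewrite ler_pdivlMr // (_ : _ * 2 = r^-1 * e); last by field; lra.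
  by rewrite ler_piMl // invf_le1.
lra.
Qed.

Lemma amgm_drop (R : realFieldType) (t r x a y z : R) : 0 <= t -> t * r = 1 -> 1 <= r ->
  2 * t * x <= a + t ^+ 2 * y -> y <= r * z -> 2 * t * x - t * z <= a.
Proof.
move=> t0 tr r1 h1 h2; have := ler_wpM2l (sqr_ge0 t) h2.
rewrite (_ : t ^+ 2 * (r * z) = (t * r) * (t * z)); last by ring.
by rewrite tr mul1r; move: h1; lra.
Qed.

Lemma amgm_sum (R : realFieldType) (I : finType) (t n xs ns A : R) (xz nz az : I -> R) :
  n = ns + \sum_i nz i -> n = xs + \sum_i xz i -> 2 * t * xs - t * ns <= A ->
  (forall i, 2 * t * xz i - t * nz i <= az i) -> t * n <= A + \sum_i az i.
Proof.
move=> h1 h2 h3 h4; have h5 : \sum_i (2 * t * xz i - t * nz i) <= \sum_i az i by apply: ler_sum.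
move: h5; rewrite sumrB -!mulr_sumr => h5; have := lerD h3 h5.
move: h1 h2; move: (\sum_i nz i) (\sum_i xz i) (\sum_i az i) => a1 a2 a3 h1 h2.
rewrite (_ : 2 * t * xs - t * ns + (2 * t * a2 - t * a1) = 2 * t * n - t * n) //.
  by rewrite (_ : 2 * t * n - t * n = t * n) //; ring.
by rewrite {1}h2 h1; ring.
Qed.

Section ModelStep.
Context {R : realType} {G : groupType} {d : nat -> nat} {b : nat}.
Local Notation C := R[i].
Local Notation E m := (Eidx d b m).
Variable pi : forall k, G -> 'M[C]_(d k).
Hypothesis irr : lists_irreps pi.
Variables (K : seq G) (ep : R).
Hypothesis ep0 : 0 < ep.
Hypothesis gap : forall p q (r : G -> 'M[C]_(p, q) -> 'M[C]_(p, q)), unitary_action r ->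
  forall x, (forall y, (forall g, r g y = y) -> cip x y = 0) ->
  ep * nsq x <= \sum_(g <- K) nsq (r g x - x).
Variable J : forall k, 'M[C]_(d k.+1, d k).
Hypothesis J_isometry : forall k, (J k)^t* *m J k = 1%:M.
Variable R1 : R.
Hypothesis R1_ge1 : 1 <= R1.
Hypothesis dR : forall k, (d k.+1)%:R <= R1 * (d k)%:R :> R.

Local Notation D := (Dop pi K).
Local Notation C1 := (C1 ep).
Local Notation Jc k := (map_mx conjC (J k)).
Local Notation Einv := (@Einv R d b).

Lemma trJ_conjJ k : (J k)^T *m Jc k = 1%:M.
Proof.
have := congr1 trmx (J_isometry k).
by rewrite trmx_mul trmx1 map_trmx trmxK.
Qed.

Lemma conjJ_adj k : (Jc k)^t* = (J k)^T.
Proof. by rewrite -map_trmx -map_mx_comp (map_mx_id (@conjCK _)). Qed.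

Lemma trJ_adj k : ((J k)^T)^t* = Jc k.
Proof. by rewrite trmxK. Qed.

Lemma contr_trJ k : contr (J k)^T.
Proof. by apply: contr_coisometry; rewrite trJ_adj trJ_conjJ. Qed.

Lemma contr_conjJ k : contr (Jc k).
Proof. by rewrite -trJ_adj; exact: (contr_adj (@contr_trJ k)). Qed.

(** The adjoint of T_i, combined with conj(J_k) on the coefficient side: the level drops in both
    tensor factors at once. *)
Definition dJ m k eps i (z : 'M[C]_(#|E m|, d k.+1)) : 'M[C]_(#|E m|, d k) :=
  (T_op J eps i m)^t* *m z *m Jc k.

Definition tJ m k eps i (x : 'M[C]_(#|E m|, d k)) : 'M[C]_(#|E m|, d k.+1) :=
  T_op J eps i m *m x *m (J k)^T.

Lemma rdot_tJ m k eps i (x : 'M[C]_(#|E m|, d k)) z :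
  rdot (tJ eps i x) z = rdot x (dJ eps i z).
Proof. by rewrite /tJ rdot_mulr rdot_mull trJ_adj mulmxA. Qed.

Definition shift_word (eps : bool) i (v : bool -> seq 'I_b -> C) (c : bool) w : C :=
  if w is i' :: w' then if (c == eps) && (i == i') then v c w' else 0 else 0.

(** A scalar block a 1 becomes J^T (a 1) conj(J) = a 1 because J is isometric; hence invariant
    vectors go to invariant vectors although J is not an intertwiner. *)
Lemma dJ_Einv m k eps i v :
  dJ eps i (Einv m k.+1 v) = Einv m k (shift_word eps i v).
Proof.
apply: bk_ext => c l [|i' w]; rewrite bk_mulr.
  rewrite bk_T_adj0 mul0mx.
  have [->|lk] := eqVneq l k; last by rewrite bk_Einv_ne.
  by rewrite bk_Einv if_same -scalemx1 scale0r.
rewrite bk_T_adj.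
have [->|lk] := eqVneq l k; last first.
  by rewrite [bk (Einv _ k.+1 _) _ _ _]bk_Einv_ne ?eqSS // mulmx0 if_same mul0mx bk_Einv_ne.
rewrite !bk_Einv /=; case: ifP => [ci|_]; last by rewrite mul0mx if_same -scalemx1 scale0r.
rewrite conjJ_adj mul_mx_scalar -scalemxAl trJ_conjJ scalemx1; congr _%:M.
congr (if _ then _ else _); rewrite ltnS; apply/andP/andP => -[h1 /eqP h2].
  by rewrite ltnW // h2 subnS prednK // subn_gt0.
have : (0 < m - k)%N by rewrite -h2.
by rewrite subn_gt0 => h; rewrite h subnS -h2 /=.
Qed.

(** A block a 1 of size d_(k+1) has square norm |a|^2 d_(k+1), and its image has square norm |a|^2
    d_k. Here the ratio of consecutive dimensions enters. *)
Lemma nsq_dJ_Einv m k eps i v : (forall c w, c != eps -> v c w = 0) ->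
  (d k.+1)%:R * nsq (dJ eps i (Einv m k.+1 v)) = (d k)%:R * nsq (Einv m k.+1 v).
Proof.
move=> v0; rewrite {1}/nsq -rdot_tJ rdotC nsq_bk rdot_bk !mulr_sumr.
apply: eq_bigr => c _; rewrite !mulr_sumr; apply: eq_bigr => l _; rewrite !mulr_sumr.
apply: eq_bigr => w _ /=.
have [lk|lk] := eqVneq (val l) k.+1; last first.
  by rewrite bk_Einv_ne // nsq0 rdot0l !mulr0.
move: (tval w) => s; rewrite lk; set V := bk (Einv _ _ _) _ _ _.
have -> : bk (tJ eps i (dJ eps i (Einv m k.+1 v))) c k.+1 s = V *m (Jc k *m (J k)^T).
  rewrite bk_mulr bk_T /dJ bk_mulr bk_T_adj eqxx andbT -/V.
  case: (eqVneq c eps) => [ce|ce]; last first.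
    by rewrite /V bk_Einv v0 // if_same -scalemx1 scale0r !mul0mx.
  rewrite conjJ_adj /V bk_Einv !mul_mx_scalar -!scalemxAl trJ_conjJ.
  by rewrite scalemx1 mul_mx_scalar -scalemxAl mul_scalar_mx.
rewrite /V bk_Einv; set a := if _ then _ else _.
have dE n (M : 'M[C]_(d k.+1)) : cip 1%:M M = n%:R ->
    rdot a%:M (a%:M *m M) = cabs a ^+ 2 * n%:R.
  move=> Mn; rewrite mul_scalar_mx -scalemx1 /rdot cipZl cipZr Mn mulrA [a * _]mulrC.
  by rewrite cabs_conjM -(rmorph_nat (real_complex R)) -rmorphM.
have e1 : rdot a%:M (a%:M *m (Jc k *m (J k)^T)) = cabs a ^+ 2 * (d k)%:R.
  apply: dE; rewrite /cip mul1mx trmx_mul map_mxM trJ_adj conjJ_adj mxtrace_mulC.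
  by rewrite trJ_conjJ mxtrace1.
have e2 : nsq (a%:M : 'M[C]_(d k.+1)) = cabs a ^+ 2 * (d k.+1)%:R.
  have := dE (d k.+1) 1%:M; rewrite mulmx1; apply.
  by rewrite /cip trmx1 map_mx1 mulmx1 mxtrace1.
by rewrite e1 e2 mulrCA [in RHS]mulrCA [(d k.+1)%:R * _]mulrC.
Qed.

Lemma nsq_dJ_le m k eps i (z : 'M[C]_(#|E m|, d k.+1)) : nsq (dJ eps i z) <= nsq z.
Proof.
have h : nrm (dJ eps i z) <= nrm z.
  apply: (le_trans (contr_conjJ _)); apply: (le_trans (nrm_mull _ _)).
  by rewrite ler_piMl ?nrm_ge0 // opnorm_star T_op_le1.
by rewrite -!nrm_sqr ler_pXn2r ?nnegrE ?nrm_ge0.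
Qed.

Lemma nsq_dJ_Einv_ge m k eps i v : (forall c w, c != eps -> v c w = 0) ->
  nsq (Einv m k.+1 v) <= R1 * nsq (dJ eps i (Einv m k.+1 v)).
Proof.
move=> v0; have d0 : 0 < (d k)%:R :> R by rewrite ltr0n (d_gt0 irr).
rewrite -(ler_pM2l d0) -(nsq_dJ_Einv m k i v0) mulrA.
rewrite ler_wpM2r ?nsq_ge0 //; have := dR k.
by rewrite [R1 * _]mulrC.
Qed.

Lemma dJB m k eps i (x y : 'M[C]_(#|E m|, d k.+1)) :
  dJ eps i (x - y) = dJ eps i x - dJ eps i y.
Proof. by rewrite /dJ mulmxBr mulmxBl. Qed.

Local Notation K0 := (2 * (Lmax K * C1)).

Let form0 m k eps (x : 'M[C]_(#|E m|, d k)) : 0 <= C1 * rdot (D eps x) x.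
Proof. by rewrite mulr_ge0 ?(Dop_ge0 irr) // ltW // C1_gt0. Qed.

Let Lmax_ge1 : 1 <= Lmax K :> R. Proof. by rewrite lerDr mulr_ge0. Qed.

(** The constant 2 L C1 is large enough for two purposes: 2 C1 is what the lower bounds cost, L C1
    what the near-kernel bounds cost. *)
Let K0_ge m k eps (x : 'M[C]_(#|E m|, d k)) :
  2 * (C1 * rdot (D eps x) x) <= K0 * rdot (D eps x) x.
Proof. by rewrite -!mulrA ler_wpM2l // ler_peMl. Qed.

Let L_K0 m k eps (x : 'M[C]_(#|E m|, d k)) :
  Lmax K * (C1 * rdot (D eps x) x) <= K0 * rdot (D eps x) x.
Proof.
rewrite -!mulrA ler_peMl ?ler1n //; apply: mulr_ge0; last exact: form0.
exact: le_trans ler01 Lmax_ge1.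
Qed.

Let sub_x0 m k eps (x : 'M[C]_(#|E m|, d k)) := sub_x0_le irr ep0 gap eps x.

Let x0_supp m k eps (x : 'M[C]_(#|E m|, d k)) c w : c != eps ->
  (if c == eps then avg x c w else 0) = 0.
Proof. by move=> /negbTE ->. Qed.

Let nsq_x0 m k eps (x : 'M[C]_(#|E m|, d k)) :
  nsq x <= 2 * nsq (x0 eps x) + 2 * nsq (x - x0 eps x).
Proof. by have := nsqD_le (x0 eps x) (x - x0 eps x); rewrite addrC subrK. Qed.

(** On invariant vectors the bound holds with 1 / R1. Passing from z to x0 and from the image of x0
    back to that of z costs a factor 2 each, whence 4 R1, and a multiple of the form. *)
Lemma model_down m k i (z : 'M[C]_(#|E m|, d k.+1)) :
  (4 * R1)^-1 * nsq z - K0 * rdot (D true z) z <= nsq (dJ true i z).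
Proof.
apply: (@le_trans _ _ ((4 * R1)^-1 * nsq z - 2 * (C1 * rdot (D true z) z))).
  by rewrite lerD2l lerN2 K0_ge.
have h0 : nsq (x0 true z) <= R1 * nsq (dJ true i (x0 true z)).
  by apply: nsq_dJ_Einv_ge => c w; exact: x0_supp.
apply: (lower_bound_transfer R1_ge1 h0 _ (nsq_x0 true z) (nsq_ge0 _) (sub_x0 true z)).
have -> : dJ true i (x0 true z) =
   dJ true i z + - dJ true i (z - x0 true z) by rewrite dJB opprB addrCA subrr addr0.
apply: (le_trans (nsqD_le _ _)); rewrite nsqN lerD2l ler_wpM2l //.
exact: nsq_dJ_le.
Qed.

(** Since y0 lies in the kernel of the symmetric operator D, the form takes the same value at y and
    at y - y0. *)
Lemma form_shift m k eps (y y0 : 'M[C]_(#|E m|, d k)) r : D eps y0 = 0 ->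
  nsq (y - y0) <= r -> rdot (D eps y) y <= Lmax K * r.
Proof.
move=> y00 h; have e : rdot (D eps y) y = rdot (D eps (y - y0)) (y - y0).
  rewrite rdotBr [rdot _ y0](Dop_sym pi K) y00 rdot0r subr0.
  rewrite [RHS](Dop_sym pi K) [RHS]rdotBl -[rdot y0 _](Dop_sym pi K) y00 rdot0l subr0.
  exact: Dop_sym.
rewrite e; apply: (le_trans (Dop_le irr K _ _)).
by rewrite ler_wpM2l // (le_trans ler01).
Qed.

Lemma model_down_low m k i (z : 'M[C]_(#|E m|, d k.+1)) :
  rdot (D true (dJ true i z)) (dJ true i z) <= K0 * rdot (D true z) z.
Proof.
apply: le_trans (L_K0 true z).
apply: (@form_shift _ _ _ _ (dJ true i (x0 true z))).
  rewrite dJ_Einv; apply: (Dop_Einv irr) => c [|i' w] //= /negbTE -> //.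
rewrite -dJB; exact: (le_trans (@nsq_dJ_le _ _ _ _ _) (sub_x0 _ _)).
Qed.

Lemma s_adj_Einv m k v : (s_op R d b m)^t* *m Einv m k v =
  Einv m k (fun c w => if c && (k == m) then v false w else 0).
Proof.
apply: bk_ext => c l w; rewrite bk_s_adj.
have [->|lk] := eqVneq l k; last by rewrite !bk_Einv_ne // if_same.
by rewrite !bk_Einv; case: (c && _); rewrite // if_same -scalemx1 scale0r.
Qed.

Lemma nsq_s_adj_le m n (x : 'M[C]_(#|E m|, n)) : nsq ((s_op R d b m)^t* *m x) <= nsq x.
Proof.
have h : nrm ((s_op R d b m)^t* *m x) <= nrm x.
  apply: (le_trans (nrm_mull _ _)).
  by rewrite ler_piMl ?nrm_ge0 // opnorm_star s_op_le1.
by rewrite -!nrm_sqr ler_pXn2r ?nnegrE ?nrm_ge0.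
Qed.

Lemma model_top_low m k (x : 'M[C]_(#|E m|, d k)) :
  rdot (D true ((s_op R d b m)^t* *m x)) ((s_op R d b m)^t* *m x)
    <= K0 * rdot (D false x) x.
Proof.
apply: le_trans (L_K0 false x).
apply: (@form_shift _ _ _ _ ((s_op R d b m)^t* *m x0 false x)).
  by rewrite s_adj_Einv; apply: (Dop_Einv irr) => -[] w.
rewrite -mulmxBr; exact: (le_trans (@nsq_s_adj_le _ _ _) (sub_x0 _ _)).
Qed.

Lemma rdot_x0 m k eps (x : 'M[C]_(#|E m|, d k)) : rdot x (x0 eps x) = nsq (x0 eps x).
Proof.
rewrite /nsq /rdot !cip_Einv; congr complex.Re.
apply: eq_bigr => c _; apply: eq_bigr => l /eqP lk; apply: eq_bigr => w _.
case: eqP => [ce|_]; last by rewrite conjC0 !mulr0.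
rewrite tr_bk_Einv -?lk ?ltn_ord ?size_tuple // ce eqxx /avg.
by rewrite divfK // pnatr_eq0 -lt0n (d_gt0 irr).
Qed.

Lemma nsq_x0_le m k eps (x : 'M[C]_(#|E m|, d k)) : nsq (x0 eps x) <= nsq x.
Proof.
rewrite -[in leRHS](subrK (x0 eps x) x) nsqD rdotBl rdot_x0 -/(nsq _) subrr mulr0 addr0.
by rewrite lerDr nsq_ge0.
Qed.

Lemma rdot_iter_fix m k eps (r : R) j (y z : 'M[C]_(#|E m|, d k)) : D eps z = 0 ->
  rdot (iter j (fun y => y - r%:C%C *: D eps y) y) z = rdot y z.
Proof.
move=> z0; elim: j => //= j IH.
by rewrite rdotBl rdotZl [rdot (D _ _) z](Dop_sym pi K) z0 rdot0r mulr0 subr0.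
Qed.

(** In copy 0 the empty word occurs only when k = m and is seen by s; every other word is sorted by
    its first letter. Thus no invariant vector of copy 0 escapes both s^* and the T_i^0. *)
Lemma x0_decomp m k (v : bool -> seq 'I_b -> C) : (forall w, v true w = 0) ->
  Einv m k v = s_op R d b m *m ((s_op R d b m)^t* *m Einv m k v) +
  \sum_i Einv m k (shift_word false i (fun c w => v c (i :: w))).
Proof.
move=> v0; apply: bk_ext => c l w.
have sumE : bk (\sum_i Einv m k (shift_word false i (fun c w => v c (i :: w)))) c l w =
    if l == k then (if w is _ :: _ then bk (Einv m k v) c l w else 0) else 0.
  rewrite (big_morph (fun X => bk X c l w) (id1 := 0) (op1 := +%R)) ?bk0 //; last first.
    by move=> X Y; rewrite bkD.
  case: eqP => [->|/eqP lk]; last by rewrite big1 // => i _; rewrite bk_Einv_ne.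
  case: w => [|i w]; first by rewrite big1 // => i _; rewrite bk_Einv if_same -scalemx1 scale0r.
  rewrite (bigD1 i) //= big1 ?addr0 => [|i' /negbTE ii]; last first.
    by rewrite bk_Einv /= ii andbF if_same -scalemx1 scale0r.
  rewrite !bk_Einv /= eqxx andbT; congr (if _ then _ else _)%:M.
  by case: c => //=; rewrite v0.
rewrite bkD sumE bk_s bk_s_adj.
have [->|lk] := eqVneq l k; last by rewrite !bk_Einv_ne // !if_same addr0.
case: c {sumE} => /=.
  case: w => [|i w]; rewrite ?addr0 ?add0r // bk_Einv v0 if_same -scalemx1 scale0r //.
have [->|km] := eqVneq k m.
  case: w => [|i w]; rewrite ?addr0 //.
  by rewrite bk_Einv subnn /= andbF -scalemx1 scale0r addr0.
case: w => [|i w]; rewrite ?add0r // bk_Einv /=.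
case: ifP => [/andP[]|_]; last by rewrite -scalemx1 scale0r.
rewrite ltnS leq_eqVlt (negbTE km) /= => h /eqP h'.
by have := h; rewrite -subn_gt0 -h'.
Qed.

Lemma rdot_restrict m n (X Y : 'M[C]_(#|E m|, n)) :
  (forall c l w, bk Y c l w = bk X c l w \/ bk Y c l w = 0) -> rdot X Y = nsq Y.
Proof.
move=> XY; rewrite nsq_bk rdot_bk; apply: eq_bigr => c _; apply: eq_bigr => l _.
apply: eq_bigr => w _; case: (XY c l w) => [<-//|->].
by rewrite rdot0r nsq0.
Qed.

Let r0 : 0 < R1. Proof. exact: lt_le_trans ltr01 R1_ge1. Qed.
Let tr : R1^-1 * R1 = 1. Proof. by rewrite mulVf ?gt_eqF. Qed.
Let t0 : 0 <= R1^-1. Proof. by rewrite invr_ge0 ltW. Qed.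

(** The filtered vectors are estimated by duality. The part Z_i of x0 whose words begin with i is
    the image under [dJ] of an invariant vector Y_i. The filter is self-adjoint and fixes Y_i, so
    <x, Z_i> is also the inner product of Y_i with the filtered [tJ] image of x, while |Y_i|^2 <= R1
    |Z_i|^2. The weighted arithmetic-geometric inequality with t = 1 / R1, summed over i together
    with the s-part, bounds |x0|^2 / R1. *)
Lemma model_up m k j (x : 'M[C]_(#|E m|, d k)) :
  (4 * R1)^-1 * nsq x - K0 * rdot (D false x) x <=
  nsq ((s_op R d b m)^t* *m x) +
  \sum_i nsq (iter j (fun y => y - ((Lmax K)^-1)%:C%C *: D false y) (tJ false i x)).
Proof.
set A := nsq _ + _.
have A0 : 0 <= A by apply: addr_ge0; [exact: nsq_ge0|apply: sumr_ge0 => i _; exact: nsq_ge0].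
pose v c w : C := if c == false then avg x c w else 0.
pose Y i := Einv m k.+1 (fun c w => v c (i :: w)).
pose Z i := Einv m k (shift_word false i (fun c w => v c (i :: w))).
pose S := s_op R d b m *m ((s_op R d b m)^t* *m x0 false x).
have xS : rdot x S = rdot ((s_op R d b m)^t* *m x) ((s_op R d b m)^t* *m x0 false x).
  by rewrite rdotC [LHS]rdot_mull rdotC.
have YZ i : dJ false i (Y i) = Z i by exact: dJ_Einv.
have xE : x0 false x = S + \sum_i Z i by exact: x0_decomp.
have Y0 i : D false (Y i) = 0 by apply: (Dop_Einv irr) => c w /negbTE; rewrite /v => ->.
have Zn i : rdot (x0 false x) (Z i) = nsq (Z i).
  apply: rdot_restrict => c l w; have [->|lk] := eqVneq l k; last by right; rewrite bk_Einv_ne.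
  rewrite !bk_Einv /shift_word; case: w => [|i' w]; first by right; rewrite if_same -scalemx1 scale0r.
  have [/andP[_ /eqP <-]|_] := boolP ((c == false) && (i == i')); first by left.
  by right; rewrite if_same -scalemx1 scale0r.
have Sn : rdot (x0 false x) S = nsq ((s_op R d b m)^t* *m x0 false x).
  by rewrite rdotC /S rdot_mull.
have nE : nsq (x0 false x) = nsq ((s_op R d b m)^t* *m x0 false x) + \sum_i nsq (Z i).
  by rewrite {1}/nsq {2}xE rdotDr Sn rdot_sumr; congr (_ + _); apply: eq_bigr.
have hS : 2 * R1^-1 * rdot x S - R1^-1 * nsq ((s_op R d b m)^t* *m x0 false x)
    <= nsq ((s_op R d b m)^t* *m x).
  apply: (amgm_drop (y := nsq ((s_op R d b m)^t* *m x0 false x)) t0 tr R1_ge1).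
    rewrite xS; exact: rdot_amgm.
  by apply: ler_peMl R1_ge1; exact: nsq_ge0.
have hZ i : 2 * R1^-1 * rdot x (Z i) - R1^-1 * nsq (Z i) <=
    nsq (iter j (fun y => y - ((Lmax K)^-1)%:C%C *: D false y) (tJ false i x)).
  apply: (amgm_drop (y := nsq (Y i)) t0 tr R1_ge1).
    rewrite -YZ -rdot_tJ -(rdot_iter_fix (Lmax K)^-1 j (tJ false i x) (Y0 i)).
    exact: rdot_amgm.
  by rewrite -YZ; apply: nsq_dJ_Einv_ge => c w /negbTE; rewrite /v => ->.
have hsum : R1^-1 * nsq (x0 false x) <= A.
  apply: (amgm_sum nE _ hS hZ).
  by rewrite -rdot_x0 {1}xE rdotDr rdot_sumr.
clearbody A; clear hS hZ nE Sn Zn Y0 xE YZ xS S Z Y v.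
apply: (@le_trans _ _ ((4 * R1)^-1 * nsq x - 2 * (C1 * rdot (D false x) x))).
  by rewrite lerD2l lerN2 K0_ge.
apply: (lower_bound_transfer R1_ge1 (A0 := A) _ _ (nsq_x0 false x) (nsq_ge0 _) (sub_x0 false x)).
  by rewrite -(ler_pM2l (x := R1^-1)) ?invr_gt0 // mulrA tr mul1r.
by rewrite [2 * A]mulrDl mul1r -addrA lerDl addr_ge0 // mulr_ge0 // nsq_ge0.
Qed.

Lemma T_s_adj m (i : 'I_b) : T_op J true i m *m (s_op R d b m)^t* = 0.
Proof.
apply: bk_ext => c [|k] w; rewrite bk0; first exact: bk_T0.
rewrite bk_T; case: eqP => // ->; rewrite -[_^t*]mulmx1 bk_s_adj.
case: ifP => [/andP[_ /eqP ->]|_]; last by rewrite mulmx0.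
by rewrite bk_invalid ?mulmx0 // subnn andbF.
Qed.

Lemma T_T_adj m (i i' : 'I_b) : i != i' -> T_op J true i m *m (T_op J true i' m)^t* = 0.
Proof.
move=> ii; apply: bk_ext => c [|k] w; rewrite bk0; first exact: bk_T0.
rewrite bk_T; case: eqP => // ->; rewrite -[_^t*]mulmx1 bk_T_adj.
by rewrite [i' == i]eq_sym (negbTE ii) andbF mulmx0.
Qed.

(** The blocks of x0 are scalar, so a projection of rank r keeps exactly the proportion r / d_k <=
    1/4 of its square norm. A near-invariant vector therefore cannot have small rank. *)
Lemma model_compress m k (W : 'M[C]_(d k)) r (x : 'M[C]_(#|E m|, d k)) :
  W^t* = W -> W *m W = W -> \tr W = r%:R -> (4 * r <= d k)%N ->
  nsq (x *m W) <= 2^-1 * nsq x + 2 * (C1 * rdot (D false x) x).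
Proof.
move=> Wh WW Wr rd.
have cW (y : 'M[C]_(#|E m|, d k)) : nsq (y *m W) <= nsq y.
  rewrite -[in leRHS](subrK (y *m W) y) nsqD rdotBl.
  have -> : rdot y (y *m W) = nsq (y *m W).
    by rewrite rdotC -{1}WW mulmxA rdot_mulr Wh.
  by rewrite -/(nsq _) subrr mulr0 addr0 lerDr nsq_ge0.
have h0 : (d k)%:R * nsq (x0 false x *m W) = r%:R * nsq (x0 false x).
  rewrite !nsq_bk !mulr_sumr; apply: eq_bigr => c _; rewrite !mulr_sumr.
  apply: eq_bigr => l _; rewrite !mulr_sumr; apply: eq_bigr => w _.
  rewrite bk_mulr; have [lk|lk] := eqVneq (val l) k; last first.
    by rewrite bk_Einv_ne // mul0mx !nsq0 !mulr0.
  move: (tval w) => s; rewrite lk bk_Einv; set a := if _ then _ else _.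
  rewrite mul_scalar_mx -scalemx1 !nsqZ mulrCA [RHS]mulrCA; congr (_ * _).
  have -> : nsq W = r%:R.
    by rewrite /nsq /rdot /cip Wh WW Wr -(rmorph_nat (real_complex R)).
  have -> : nsq (1%:M : 'M[C]_(d k)) = (d k)%:R.
    by rewrite /nsq /rdot /cip trmx1 map_mx1 mulmx1 mxtrace1 -(rmorph_nat (real_complex R)).
  by rewrite mulrC.
have h1 : 4 * nsq (x0 false x *m W) <= nsq (x0 false x).
  have d0 : 0 < (d k)%:R :> R by rewrite ltr0n (d_gt0 irr).
  rewrite -(ler_pM2l d0) mulrCA h0 mulrA ler_wpM2r ?nsq_ge0 //.
  by rewrite -natrM ler_nat.
have h2 := nsqD_le (x0 false x *m W) ((x - x0 false x) *m W).
rewrite -mulmxDl addrC subrK in h2.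
have h3 := cW (x - x0 false x); have h4 := sub_x0 false x; have h5 := nsq_x0_le false x.
move: h1 h2 h3 h4 h5; move: (nsq _) (nsq _) (nsq _) (nsq _) (nsq _) (C1 * _) => *; lra.
Qed.

End ModelStep.

(** * Counting eigenvalues by traces *)

Section TraceBasis.
Context {R : realType}.
Local Notation C := R[i].

Lemma delta_expand p q (x : 'M[C]_(p, q)) :
  x = \sum_r \sum_s cip x (delta_mx r s) *: delta_mx r s.
Proof.
rewrite [LHS]matrix_sum_delta; apply: eq_bigr => r _; apply: eq_bigr => s _.
congr (_ *: _); rewrite cipE (bigD1 r) //= (bigD1 s) //= mxE !eqxx conjC1 mulr1.
rewrite [X in _ + X + _]big1 => [|s' /negbTE ss]; last by rewrite mxE ss andbF conjC0 mulr0.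
rewrite big1 ?addr0 // => r' /negbTE rr.
by rewrite big1 // => s' _; rewrite mxE rr conjC0 mulr0.
Qed.

Lemma sum_cip_delta p q (a : 'M[C]_p) (X : 'M[C]_q) :
  \sum_r \sum_s cip (a *m delta_mx r s *m X) (delta_mx r s) = \tr a * \tr X.
Proof.
rewrite /mxtrace mulr_suml; apply: eq_bigr => r _; rewrite mulr_sumr; apply: eq_bigr => s _.
rewrite cipE (bigD1 r) //= (bigD1 s) //= [X in _ + X + _]big1 => [|s' /negbTE ss]; last first.
  by rewrite [delta_mx _ _ _ _]mxE ss andbF conjC0 mulr0.
rewrite [X in _ + X]big1 => [|r' /negbTE rr]; last first.
  by rewrite big1 // => s' _; rewrite [delta_mx _ _ _ _]mxE rr conjC0 mulr0.
rewrite [delta_mx _ _ _ _]mxE !eqxx conjC1 mulr1 !addr0.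
rewrite mxE (bigD1 s) //= big1 ?addr0 => [|s' /negbTE ss]; last first.
  rewrite mxE big1 ?mul0r // => k _; by rewrite mxE ss andbF mulr0.
rewrite mxE (bigD1 r) //= big1 => [|k /negbTE kr].
  by rewrite mxE !eqxx mulr1 addr0.
by rewrite mxE kr mulr0.
Qed.

(** The trace of x |-> a x X may be computed in any orthonormal basis, in particular in the matrix
    units. *)
Lemma sum_cip_orthobasis p q (u : 'I_(p * q) -> 'M[C]_(p, q)) (a : 'M[C]_p) (X : 'M[C]_q) :
  orthobasis u -> \sum_i cip (a *m u i *m X) (u i) = \tr a * \tr X.
Proof.
move=> [_ ux]; rewrite -sum_cip_delta.
transitivity (\sum_i \sum_r \sum_s
  cip (u i) (delta_mx r s) * cip (a *m delta_mx r s *m X) (u i)).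
  apply: eq_bigr => i _; rewrite {1}[u i]delta_expand mulmx_sumr mulmx_suml cip_suml.
  apply: eq_bigr => r _; rewrite mulmx_sumr mulmx_suml cip_suml.
  by apply: eq_bigr => s _; rewrite -scalemxAr -scalemxAl cipZl.
rewrite exchange_big; apply: eq_bigr => r _; rewrite exchange_big; apply: eq_bigr => s _.
rewrite [X in _ = cip _ X]ux cip_sumr; apply: eq_bigr => i _.
by rewrite cipZr -cipC.
Qed.

Lemma row_projection p q (u : 'M[C]_(p, q)) :
  exists W : 'M[C]_q, [/\ W^t* = W, W *m W = W, \tr W = (\rank u)%:R & u *m W = u].
Proof.
(* The rows of S are an orthonormal basis of the row space of u, so S^* S is the projection onto
   it. *)
pose S := schmidt (row_base u).
have Su : S *m S^t* = 1%:M by apply/unitarymxP/schmidt_unitarymx; exact: rank_leq_col.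
have uS : (u <= S)%MS.
  by rewrite (eqmx_schmidt_free (row_base_free u)) eq_row_base.
exists (S^t* *m S); split.
- by rewrite trmx_mul map_mxM trmxCK.
- by rewrite mulmxA -[S^t* *m S *m _]mulmxA Su mulmx1.
- by rewrite mxtrace_mulC Su mxtrace1.
clearbody S; clear -Su uS; move: S Su uS; move: (\rank u) => k S Su /submxP[x ->].
by rewrite mulmxA -[_ *m S^t*]mulmxA Su mulmx1.
Qed.

End TraceBasis.

Section BaseCount.
Context {R : realType}.
Local Notation C := R[i].
Variables (B : cstarAlgType R) (e : nat -> nat) (phi : forall m, B -> 'M[C]_(e m)).
Hypothesis phiN : norming_reps phi.
Variables (N : nat) (psi : B -> 'M[C]_N).
Hypothesis psi_ucp : ucp psi.

(** The partial trace over the coefficient matrices. *)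
Definition collapse n (l : seq ('M[C]_n * B)) : B := \sum_(t <- l) \tr t.1 *: t.2.

Lemma sum_rdot_collapse n (l : seq ('M[C]_n * B)) e' (f : B -> 'M[C]_e') u :
  (forall (c : C) a a', f (c *: a + a') = c *: f a + f a') -> orthobasis u ->
  \sum_i rdot (ev f l (u i)) (u i) = complex.Re (\tr (f (collapse l))).
Proof.
move=> fl uo; rewrite /rdot -Re_sum; congr complex.Re.
rewrite (lin_sum fl) linear_sum /=.
under eq_bigr => i _ do rewrite cip_suml.
rewrite exchange_big; apply: eq_bigr => t _.
by rewrite (linZ fl) linearZ /= sum_cip_orthobasis // mulrC.
Qed.

Lemma sum_rdot_delta n (l : seq ('M[C]_n * B)) e' (f : B -> 'M[C]_e') :
  (forall (c : C) a a', f (c *: a + a') = c *: f a + f a') ->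
  \sum_r \sum_s rdot (ev f l (delta_mx r s)) (delta_mx r s) =
  complex.Re (\tr (f (collapse l))).
Proof.
move=> fl; rewrite /rdot; under eq_bigr => r _ do rewrite -Re_sum.
rewrite -Re_sum; congr complex.Re.
rewrite (lin_sum fl) linear_sum /=.
under eq_bigr => r _ do under eq_bigr => s _ do rewrite cip_suml.
under eq_bigr => r _ do rewrite exchange_big.
rewrite exchange_big; apply: eq_bigr => t _.
by rewrite (linZ fl) linearZ /= sum_cip_delta mulrC.
Qed.

Variables (eta L dl : R).
Hypotheses (eta0 : 0 < eta) (L0 : 0 < L) (dl0 : 0 <= dl) (dl1 : 2 * dl <= 1) (eta_L : eta / 2 <= L).

(** The left side is the trace of the image of the squared filter. A low eigenvector contributes at
    most 1, any other at most the filter factor, both up to 7 dl. *)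
Lemma low_count_ge n (l : seq ('M[C]_n * B)) u lam j : good l ->
  spectral_data psi eta L dl l u lam ->
  perrs psi (shape (lf L l)) j <= dl ->
  errs psi (map star (spow (shape (lf L l)) j)) (spow (shape (lf L l)) j) <= dl ->
  complex.Re (\tr (psi (collapse (fmul (fstar (fpow (lf L l) j)) (fpow (lf L l) j))))) <=
  #|low lam (eta / 2)|%:R + (N * n)%:R * ((1 - eta / 2 / L) ^+ (2 * j) + 7 * dl).
Proof.
move=> gl [ul lamL _] e1 e2.
have plin := ucp_linear psi_ucp; have p1 := ucp1 psi_ucp; have pst := ucp_star psi_ucp.
have glf : good (lf L l).
  by apply: good_cat; [apply: good_cons => //; exact: contr1|exact: good_fscale].
set g := fpow _ _; have gg : good g by exact: good_fpow.
rewrite -(sum_rdot_collapse _ plin ul.1).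
have h i : rdot (ev psi (fmul (fstar g) g) (u i)) (u i) <=
    (i \in low lam (eta / 2))%:R + ((1 - eta / 2 / L) ^+ (2 * j) + 7 * dl).
  have u1 : nsq (u i) = 1 by rewrite /nsq /rdot ul.1.1 eqxx.
  have n1 : nrm (u i) = 1 by rewrite /nrm u1 sqrtr1.
  have h1 : rdot (ev psi (fmul (fstar g) g) (u i)) (u i) <= nsq (ev psi g (u i)) + dl.
    have := ev_sq_rdot pst (u i) gg; rewrite u1 mulr1 shape_fpow => /ler_normlW.
    by rewrite lerBlDl => /le_trans; apply; rewrite lerD2l.
  have it_le k y : nrm (iter k (ev psi (lf L l)) y) <= nrm y.
    elim: k => [|k IH] /=; first exact: lexx.
    exact: le_trans (lf_contr psi_ucp L0 ul lamL _) IH.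
  have dw : nrm (ev psi g (u i) - iter j (ev psi (lf L l)) (u i)) <= 2 * dl * nrm (u i).
    apply: (le_trans (ev_fpow_err j (u i) glf p1 (lf_contr psi_ucp L0 ul lamL))).
    rewrite ler_wpM2r ?nrm_ge0 // (le_trans e1) //.
    by rewrite ler_peMl // ler1n.
  have dl01 : 0 <= 2 * dl <= 1 by rewrite mulr_ge0.
  have := sq_diff_le dl01 (nrm_ge0 (u i)) dw (it_le j _).
  rewrite n1 expr1n mulr1 => h2.
  have h3 : nsq (iter j (ev psi (lf L l)) (u i)) <=
      (i \in low lam (eta / 2))%:R + (1 - eta / 2 / L) ^+ (2 * j).
    have -> : iter j (ev psi (lf L l)) (u i) =
        iter j (fun x => x - (L^-1)%:C%C *: ev psi l x) (u i).
      by elim: j {e1 e2 g gg h1 it_le dw h2} => //= k ->; rewrite lfE.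
    have := nsq_iter_low (@evD _ _ _ psi _ _ l) (@evZ _ _ _ psi _ _ l) ul j (u i).
    move=> /(_ (eta / 2) L (divr_ge0 (ltW eta0) (ler0n _ _)) L0 eta_L lamL)/le_trans; apply.
    rewrite u1 mulr1 lerD2r.
    have [il|il] := boolP (i \in low _ _).
      rewrite (bigD1 i) //= big1 ?addr0 => [|k /andP[_ /negbTE ki]].
        by rewrite ul.1.1 eqxx ComplexField.Normc.normc1 expr1n.
      by rewrite ul.1.1 eq_sym ki cabs0 expr0n.
    rewrite big1 // => k kl; rewrite ul.1.1.
    by case: eqP => [ik|_]; [rewrite -ik (negbTE il) in kl|rewrite cabs0 expr0n].
  move: h1 h2 h3; move: (rdot _ _) (nsq (iter _ _ _)) (nsq (ev _ _ _)) (_ ^+ (2 * j)).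
  by move: ((i \in low lam (eta / 2))%:R : R) => a1 a2 a3 a4 a5 h1 h2 h3; lra.
apply: (@le_trans _ _ _ _ _ (ler_sum _ (fun i _ => h i))).
rewrite big_split /= sumr_const card_ord -[X in _ + X]mulr_natl.
rewrite lerD2r -natr_sum ler_nat -sum1_card [leqRHS]big_mkcond.
by apply: leq_sum => i _; case: (i \in _).
Qed.

(** On a low eigenvector u the inequality 1 - a <= l gives 1 - <a u, u> <= lam <= 1/2, so each one
    contributes at least 1/2 to the trace of a. *)
Lemma low_count_le n (l : seq ('M[C]_n * B)) u lam (a : B) :
  spectral_data psi eta L dl l u lam ->
  (forall m x, nsq x - rdot (ev (phi m) [:: (1%:M : 'M[C]_n, a)] x) x <= rdot (ev (phi m) l x) x) ->
  (forall m (x : 'M[C]_(e m, n)), 0 <= rdot (ev (phi m) [:: (1%:M : 'M[C]_n, a)] x) x) ->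
  2 * dl / eta <= 2^-1 ->
  #|low lam (eta / 2)|%:R <= 2 * n%:R * complex.Re (\tr (psi a)).
Proof.
move=> [ul lamL lamlow] h1 h2 h3.
have plin := ucp_linear psi_ucp; have p1 := ucp1 psi_ucp.
have -> : 2 * n%:R * complex.Re (\tr (psi a)) =
   2 * \sum_i rdot (ev psi [:: (1%:M : 'M[C]_n, a)] (u i)) (u i).
  rewrite (sum_rdot_collapse _ plin ul.1) /collapse big_seq1 /= mxtrace1 (linZ plin) linearZ /=.
  by rewrite -mulrA; congr (2 * _); rewrite -(rmorph_nat (real_complex R)) ReMr.
have h4 x : nsq x - rdot (ev psi [:: (1%:M : 'M[C]_n, a)] x) x <= rdot (ev psi l x) x.
  pose l' := l ++ [:: (1%:M : 'M[C]_n, a)] ++ [:: (1%:M : 'M[C]_n, (-1)%:C%C *: (1 : B))].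
  have lE e' (f : B -> 'M[C]_e') y : f 1 = 1%:M ->
    (forall (c : C) a a', f (c *: a + a') = c *: f a + f a') ->
     rdot (ev f l' y) y = rdot (ev f l y) y + (rdot (ev f [:: (1%:M : 'M[C]_n, a)] y) y - nsq y).
    by move=> f1 fl; rewrite !ev_cat !rdotDl rdot_ev_const // mulN1r.
  have : 0 <= rdot (ev psi l' x) x.
    apply: (ucp_form phiN psi_ucp) => m y; have [/(_ m) [pl _ _ pp1] _ _] := phiN.
    rewrite lE //.
    by have := h1 m y; move: (nsq _) (rdot _ _) (rdot _ _) => *; lra.
  by rewrite lE //; move: (nsq _) (rdot _ _) (rdot _ _) => *; lra.
have h5 x : 0 <= rdot (ev psi [:: (1%:M : 'M[C]_n, a)] x) x.
  by apply: (ucp_form phiN psi_ucp) => m y.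
rewrite mulr_sumr -sum1_card natr_sum big_mkcond /=; apply: ler_sum => i _.
case: ifP => [il|_]; last by rewrite mulr_ge0.
have := h4 (u i); rewrite ul.2 rdotZl.
have u1 : nsq (u i) = 1 by rewrite /nsq /rdot ul.1.1 eqxx.
rewrite -/(nsq _) u1 mulr1; have := lamlow i il; move: h3.
by move: (rdot _ _) (lam i) (2 * dl / eta) => *; lra.
Qed.

(** An eigenvector is an N x n matrix, so its row space has dimension at most N <= n / 4. The
    projection W onto it satisfies u W = u, whereas the compression bound allows u W only a square
    norm close to 1/2. *)
Lemma low_empty n (l : seq ('M[C]_n * B)) u lam c :
  spectral_data psi eta L dl l u lam -> 0 <= c -> (4 * N <= n)%N ->
  (forall m (x : 'M[C]_(e m, n)) W r, W^t* = W -> W *m W = W -> \tr W = r%:R -> (4 * r <= n)%N ->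
    nsq (x *m W) <= 2^-1 * nsq x + c * rdot (ev (phi m) l x) x) ->
  2 * (c * (2 * dl / eta)) < 1 -> #|low lam (eta / 2)| = 0%N.
Proof.
move=> [ul lamL lamlow] c0 Nn h small; apply: eq_card0 => i; apply/negP => il.
have plin := ucp_linear psi_ucp; have p1 := ucp1 psi_ucp.
have [W [Wh WW Wr uW]] := row_projection (u i).
pose l' := [:: (1%:M : 'M[C]_n, (2^-1)%:C%C *: (1 : B))] ++ fscale c l ++ fscale (- 1) [:: (W, 1 : B)].
have lE e' (f : B -> 'M[C]_e') y : f 1 = 1%:M ->
    (forall (c : C) a a', f (c *: a + a') = c *: f a + f a') ->
     rdot (ev f l' y) y = 2^-1 * nsq y + (c * rdot (ev f l y) y - nsq (y *m W)).
  move=> f1 fl; rewrite !ev_cat !rdotDl rdot_ev_const // !ev_fscale // !rdotZl mulN1r.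
  have -> : nsq (y *m W) = rdot (y *m W) y by rewrite -[in RHS]WW mulmxA [RHS]rdot_mulr Wh.
  by rewrite ev1 f1 mul1mx.
have : 0 <= rdot (ev psi l' (u i)) (u i).
  apply: (ucp_form phiN psi_ucp) => m y; have [/(_ m) [pl _ _ pp1] _ _] := phiN.
  rewrite lE //.
  have := h m y W _ Wh WW Wr.
  have -> : (4 * \rank (u i) <= n)%N.
    by apply: leq_trans Nn; rewrite leq_mul2l rank_leq_row.
  by move=> /(_ isT); move: (nsq _) (nsq _) (c * _) => *; lra.
rewrite lE // uW ul.2 rdotZl.
have u1 : nsq (u i) = 1 by rewrite /nsq /rdot ul.1.1 eqxx.
rewrite -/(nsq _) u1; have := ler_wpM2l c0 (lamlow i il); move: small.
by rewrite !mulr1; move: (c * lam i) (c * _) => *; lra.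
Qed.

End BaseCount.

(** * The operators D_k in the algebra and the descent over all levels *)

Lemma sum4A (V : zmodType) (x a c s : V) : x + (x + (a + (c + s))) = x + x + a + c + s.
Proof. by rewrite !addrA. Qed.

Lemma sum4CA (V : zmodType) (x a c s : V) : x + (x + (c + (a + s))) = x + x + a + c + s.
Proof. by rewrite sum4A [X in X + s]addrAC. Qed.

Section AlgebraLevel.
Context {R : realType} {G : groupType} {d : nat -> nat} {b : nat}.
Local Notation C := R[i].
Local Notation E m := (Eidx d b m).
Variable pi : forall k, G -> 'M[C]_(d k).
Hypothesis irr : lists_irreps pi.
Variables (K : seq G) (ep : R).
Hypothesis ep0 : 0 < ep.
Hypothesis gap : forall p q (r : G -> 'M[C]_(p, q) -> 'M[C]_(p, q)), unitary_action r ->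
  forall x, (forall y, (forall g, r g y = y) -> cip x y = 0) ->
  ep * nsq x <= \sum_(g <- K) nsq (r g x - x).
Variable J : forall k, 'M[C]_(d k.+1, d k).
Hypothesis J_isometry : forall k, (J k)^t* *m J k = 1%:M.
Variable R1 : R.
Hypothesis R1_ge1 : 1 <= R1.
Hypothesis dR : forall k, (d k.+1)%:R <= R1 * (d k)%:R :> R.
Variables (B : cstarAlgType R) (phi : forall m, B -> 'M[C]_#|E m|).
Hypothesis phiN : norming_reps phi.
Variables (eE : bool -> B) (sG : G -> B) (TE : bool -> 'I_b -> B) (sE : B).
Hypothesis phE : forall eps m, phi m (eE eps) = e_op R d b eps m.
Hypothesis phG : forall g m, phi m (sG g) = sigma_op pi b g m.
Hypothesis phT : forall eps i m, phi m (TE eps i) = T_op J eps i m.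
Hypothesis phs : forall m, phi m sE = s_op R d b m.

Local Notation C1 := (C1 ep).
Local Notation L := (Lmax K : R).
Local Notation eta := (C1^-1).

Let lin m : forall (c : C) a a', phi m (c *: a + a') = c *: phi m a + phi m a'.
Proof. by have [/(_ m) []] := phiN. Qed.
Let mul m a a' : phi m (a * a') = phi m a *m phi m a'.
Proof. by have [/(_ m) []] := phiN. Qed.
Let phist m a : phi m (star a) = (phi m a)^t*.
Proof. by have [/(_ m) []] := phiN. Qed.
Let phi1 m : phi m 1 = 1%:M.
Proof. by have [/(_ m) []] := phiN. Qed.

Lemma norming_inj a a' : (forall m, phi m a = phi m a') -> a = a'.
Proof.
move=> aa; apply/eqP; rewrite -subr_eq0; apply/eqP/cnorm_eq0/eqP.
rewrite eq_le cnorm_ge0 andbT; have [_ _] := phiN; apply=> m.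
rewrite (linB (lin m)) aa subrr -(scale0r 0) opnormZ.
by rewrite (_ : cabs 0 = 0) ?mul0r // cabs0.
Qed.

Let norm1 a : (forall m, opnorm (phi m a) <= 1) -> cnorm a <= 1.
Proof. by have [_ _] := phiN; apply. Qed.

Let eE_star eps : star (eE eps) = eE eps.
Proof. by apply: norming_inj => m; rewrite phist phE e_op_adj. Qed.

Definition Dlist k eps : seq ('M[C]_(d k) * B) :=
  flatten [seq [:: (1%:M, 1); (1%:M, 1); ((pi k g)^T, - sG g);
    (((pi k g)^T)^t*, - star (sG g))] | g <- K] ++ [:: (1%:M, 1); (1%:M, - eE eps)].

Definition Dshape eps : seq B :=
  flatten [seq [:: 1; 1; - sG g; - star (sG g)] | g <- K] ++ [:: 1; - eE eps].

Lemma shape_Dlist k eps : shape (Dlist k eps) = Dshape eps.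
Proof.
by rewrite /shape map_cat map_flatten -map_comp.
Qed.

Lemma ev_Dlist k eps e' (f : B -> 'M[C]_e') x : f 1 = 1%:M ->
  (forall (c : C) a a', f (c *: a + a') = c *: f a + f a') ->
  ev f (Dlist k eps) x = \sum_(g <- K) (x + x - f (sG g) *m x *m (pi k g)^T
    - f (star (sG g)) *m x *m ((pi k g)^T)^t*) + (x - f (eE eps) *m x).
Proof.
move=> f1 fl; rewrite ev_cat; congr (_ + _); last first.
  by rewrite !ev_cons ev_nil /= f1 !mulmx1 mul1mx addr0 (linN fl) mulNmx.
elim: K => [|g s IH] /=; first by rewrite big_nil ev_nil.
rewrite big_cons !ev_cons -IH /= f1 !mulmx1 mul1mx !(linN fl) !mulNmx; exact: sum4A.
Qed.

Lemma ev_phi_Dlist k eps m x : ev (phi m) (Dlist k eps) x = Dop pi K eps x.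
Proof.
rewrite (ev_Dlist eps x (phi1 m) (lin m)) phE.
by under eq_bigr => g _ do rewrite phist phG.
Qed.

Lemma good_Dlist k eps : good (Dlist k eps).
Proof.
have piU g : contr (pi k g)^T by apply: contr_coisometry; exact: tr_unitary.
apply: good_cat; last by do 2![apply: good_cons; first exact: contr1].
elim: K => [|g s IH]; first exact: good_nil.
do 2![apply: good_cons; first exact: contr1].
apply: good_cons; first exact: piU.
by apply: good_cons; first exact/contr_adj/piU.
Qed.

Lemma selfadj_Dlist k eps : selfadj (Dlist k eps).
Proof.
move=> e' f fl fs f1 x; rewrite (ev_Dlist eps x f1 fl).
have h1 (s : seq G) : ev f (fstar (flatten [seq [:: (1%:M, 1); (1%:M, 1); ((pi k g)^T, - sG g);
    (((pi k g)^T)^t*, - star (sG g))] | g <- s])) x =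
    \sum_(g <- s) (x + x - f (sG g) *m x *m (pi k g)^T
    - f (star (sG g)) *m x *m ((pi k g)^T)^t*).
  elim: s => [|g s IH] /=; first by rewrite big_nil ev_nil.
  rewrite big_cons !ev_cons IH /= star1 !starN starK f1 !trmx1 !map_mx1 !mulmx1 mul1mx.
  rewrite !(linN fl) !mulNmx trmxCK; exact: sum4CA.
have h2 : ev f (fstar [:: (1%:M, 1); (1%:M, - eE eps)]) x = x - f (eE eps) *m x.
  rewrite !ev_cons ev_nil /= star1 starN eE_star f1 !trmx1 !map_mx1 !mulmx1 mul1mx addr0.
  by rewrite (linN fl) mulNmx.
by rewrite /fstar map_cat ev_cat h1 h2.
Qed.

Let C1p : 0 < C1. Proof. exact: C1_gt0. Qed.
Let eta0 : 0 < eta. Proof. by rewrite invr_gt0. Qed.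
Let L_ge1 : 1 <= L. Proof. by rewrite lerDr mulr_ge0. Qed.
Let L0 : 0 < L. Proof. exact: lt_le_trans ltr01 L_ge1. Qed.
Lemma half_gap_le : eta / 2 <= L.
Proof.
apply: le_trans L_ge1; rewrite ler_pdivrMr // mul1r.
have h : 0 <= 2 / ep by rewrite divr_ge0 // ltW.
apply: (@le_trans _ _ (2^-1)); last by lra.
by rewrite ler_pV2 ?inE ?unitfE ?gt_eqF ?C1p //= /C1 lerDr.
Qed.

Lemma gap_Dlist k eps : model_gap phi eta L (Dlist k eps).
Proof.
move=> m x; rewrite ev_phi_Dlist; split; first exact: Dop_ge0.
  exact: Dop_le.
by rewrite mulrC ler_pdivrMr // mulrC; exact: Dop_gap.
Qed.

Local Notation aS := (star sE).
Local Notation aD i := (star (TE true i)).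
Local Notation aA i := (TE false i).
Definition fshape : seq B := [:: 1] ++ [seq (- L^-1)%:C%C *: a | a <- Dshape false].

Lemma shape_lf k : shape (lf L (Dlist k false)) = fshape.
Proof. by rewrite /lf {1}/shape map_cat -[X in _ ++ X]/(shape _) shape_fscale shape_Dlist. Qed.

(** The pairs of finite families on which [psi] must be nearly multiplicative. The level k does not
    occur, so one choice of [psi] serves the entire descent. *)
Definition tests j : seq (seq B * seq B) :=
  [:: ([:: star aS], [:: aS]); ([:: star aS], smul (Dshape true) [:: aS]);
      (Dshape true, [:: aS]); (Dshape false, Dshape false); (Dshape true, Dshape true);
      (map star (spow fshape j), spow fshape j)] ++
  [seq (fshape, spow fshape i) | i <- iota 0 j] ++
  flatten [seq [:: (map star (smul (spow fshape j) [:: aA i]), smul (spow fshape j) [:: aA i]);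
    (spow fshape j, [:: aA i]); ([:: star (aD i)], [:: aS]);
    ([:: star (aD i)], smul (Dshape true) [:: aD i]); (Dshape true, [:: aD i])] | i <- enum 'I_b] ++
  [seq ([:: star (aD p.1)], [:: aD p.2]) | p <- enum {: 'I_b * 'I_b}].

Lemma norm_gen : [/\ cnorm aS <= 1, forall i, cnorm (aA i) <= 1 & forall i, cnorm (aD i) <= 1].
Proof.
split=> [|i|i]; rewrite ?cnorm_starE; apply: norm1 => m.
- by rewrite phs s_op_le1.
- by rewrite phT T_op_le1.
- by rewrite phT T_op_le1.
Qed.

Lemma orth_S i : star (aD i) * aS = 0.
Proof.
by apply: norming_inj => m; rewrite starK mul phT phist phs T_s_adj (lin0 (lin m)).
Qed.

Lemma orth_D i k : i != k -> star (aD i) * aD k = 0.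
Proof.
move=> ik; apply: norming_inj => m.
by rewrite starK mul phist !phT T_T_adj // (lin0 (lin m)).
Qed.

Local Notation c := ((4 * R1)^-1).
Local Notation K0 := (2 * (L * C1)).

Variables (N : nat) (psi : B -> 'M[C]_N).
Hypothesis psi_ucp : ucp psi.
Variables (j : nat) (dl : R).
Hypothesis dl0 : 0 <= dl.
Let dd := (2 + 7 * b%:R) * dl.
Let be := K0 * (2 * dl / eta) + dd.
Hypothesis dl1 : 2 * dl <= 1.
Hypothesis be_c : be <= c.
Hypothesis num : 2 * (1 + b%:R * b%:R) * be <
  eta / 2 * ((c - be) * (c - be - b%:R * (1 - eta / 2 / L) ^+ (2 * j))
              - 4 * (b%:R + b%:R * b%:R) * dd).
Hypothesis pass : forall t, t \in tests j -> errs psi t.1 t.2 <= dl / j.+1%:R.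

Let pass_dl s1 s2 : (s1, s2) \in tests j -> errs psi s1 s2 <= dl.
Proof.
move=> /pass /le_trans; apply.
by rewrite ler_pdivrMr // ler_peMr // ler1n.
Qed.

Let pass_i i s1 s2 : (s1, s2) \in [:: (map star (smul (spow fshape j) [:: aA i]), smul (spow fshape j) [:: aA i]);
    (spow fshape j, [:: aA i]); ([:: star (aD i)], [:: aS]);
    ([:: star (aD i)], smul (Dshape true) [:: aD i]); (Dshape true, [:: aD i])] ->
  errs psi s1 s2 <= dl.
Proof.
move=> h; apply: pass_dl; rewrite /tests !mem_cat; apply/orP; right; apply/orP; right.
apply/orP; left; apply/flattenP; eexists; last exact: h.
by apply/mapP; exists i; rewrite ?mem_enum.
Qed.

(** The tolerance dl / (j + 1) imposed on each test leaves at most [dl] for the j products in a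
    filter power. *)
Let pass_pow : perrs psi fshape j <= dl.
Proof.
apply: (@le_trans _ _ (\sum_(i < j) dl / j.+1%:R)).
  apply: ler_sum => i _; apply: (pass (t := (fshape, spow fshape i))).
  rewrite /tests !mem_cat; apply/orP; right; apply/orP; left.
  by apply/mapP; exists (val i); rewrite // mem_iota /= ltn_ord.
rewrite sumr_const card_ord -[leLHS]mulr_natr mulrAC ler_pdivrMr //.
by rewrite ler_wpM2l // ler_nat.
Qed.

Let pass_D i k : errs psi [:: star (aD i)] [:: aD k] <= dl.
Proof.
apply: pass_dl; rewrite /tests !mem_cat; apply/orP; right; apply/orP; right.
by apply/orP; right; apply/mapP; exists (i, k); rewrite ?mem_enum.
Qed.

Let c_be1 : c - be <= 1.
Proof.
have h : c <= 1.
  have r0 : 0 < R1 by exact: lt_le_trans ltr01 R1_ge1.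
  rewrite invf_le1 ?mulr_gt0 //; have := R1_ge1; lra.
apply: le_trans h; rewrite gerBl; apply: addr_ge0; apply: mulr_ge0 => //.
- by rewrite mulr_ge0 // mulr_ge0 // ltW.
- by rewrite divr_ge0 ?mulr_ge0 // ltW.
Qed.

Definition low_le k := forall u0 l0 u1 l1,
  spectral_data psi eta L dl (Dlist k false) u0 l0 ->
  spectral_data psi eta L dl (Dlist k true) u1 l1 ->
  (#|low l0 (eta / 2)| <= #|low l1 (eta / 2)|)%N.

Let data k eps : exists u lam, spectral_data psi eta L dl (Dlist k eps) u lam.
Proof.
apply: (spectral_data_exists phiN psi_ucp eta0 (@good_Dlist k eps) (@selfadj_Dlist k eps)).
  exact: gap_Dlist.
rewrite shape_Dlist; apply: pass_dl; rewrite /tests mem_cat !inE.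
by case: eps; rewrite eqxx !orbT.
Qed.

Lemma low_le_step k : low_le k.+1 -> low_le k.
Proof.
move=> IH u0 l0 u1 l1 dT0 dT1.
have [v0 [m0 dG0]] := data k.+1 false; have [v1 [m1 dG1]] := data k.+1 true.
have [nS nA nD] := norm_gen.
have cJt : contr (J k)^T by exact: contr_trJ.
have cJc : contr (map_mx conjC (J k)) by exact: contr_conjJ.
refine (@psi_step R B (fun m => #|E m|) phi phiN N psi psi_ucp eta L dl eta0 L0 dl0 (d k) (d k.+1) b j
  (Dlist k false) (Dlist k true) (Dlist k.+1 false) (Dlist k.+1 true) aS (J k)^T
  (fun i => aA i) (map_mx conjC (J k)) (fun i => aD i) c K0 (@good_Dlist k true) (@good_Dlist k.+1 false)
  cJt cJc nS nA nD orth_S orth_D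
  _ _ _ _ _ dl1 _ _ _ _ pass_D _ _ _ _ _ u0 u1 l0 l1 v0 v1 m0 m1 dT0 dT1 dG0 dG1 half_gap_le be_c c_be1 num
  (IH _ _ _ _ dG0 dG1)).
- by rewrite !mulr_ge0 // ltW.
- move=> m x; rewrite !ev1 mulmx1 phist phs ev_phi_Dlist.
  apply: (le_trans (model_up irr ep0 gap J_isometry R1_ge1 dR j x)); rewrite lerD2l.
  apply: ler_sum => i _; rewrite ev1 phT /tJ.
  have -> : forall y, iter j (fun y => y - (L^-1)%:C%C *: ev (phi m) (Dlist k.+1 false) y) y =
     iter j (fun y => y - (L^-1)%:C%C *: Dop pi K false y) y.
    by move=> y; elim: j => //= k' ->; rewrite ev_phi_Dlist.
  exact: lexx.
- move=> m i z; rewrite ev1 phist phT ev_phi_Dlist.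
  exact: (model_down irr ep0 gap J_isometry R1_ge1 dR).
- move=> m i z; rewrite ev1 phist phT !ev_phi_Dlist.
  exact: (model_down_low irr ep0 gap J_isometry).
- move=> m x; rewrite ev1 phist phs mulmx1 !ev_phi_Dlist.
  exact: (model_top_low irr ep0 gap).
- by apply: pass_dl; rewrite !inE eqxx.
- move=> i; rewrite shape_lf; apply: (pass_i (i := i)); by rewrite inE eqxx.
- move=> i; rewrite shape_lf; apply: (pass_i (i := i)); by rewrite !inE eqxx orbT.
- by rewrite shape_lf; exact: pass_pow.
- move=> i; apply: (pass_i (i := i)); by rewrite !inE eqxx !orbT.
- move=> i; rewrite shape_Dlist; apply: (pass_i (i := i)); by rewrite !inE eqxx !orbT.
- move=> i; rewrite shape_Dlist; apply: (pass_i (i := i)); by rewrite !inE eqxx !orbT.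
- by rewrite shape_Dlist; apply: pass_dl; rewrite !inE eqxx !orbT.
- by rewrite shape_Dlist; apply: pass_dl; rewrite !inE eqxx !orbT.
Qed.

Hypothesis small1 : 2 * (2 * C1 * (2 * dl / eta)) < 1.
Hypothesis d_unbounded : forall n, exists k, (n <= d k)%N.

Lemma low_le_large k : (4 * N <= d k)%N -> low_le k.
Proof.
move=> Nd u0 l0 u1 l1 dT0 dT1.
rewrite (low_empty phiN psi_ucp (c := 2 * C1) dT0) // ?mulr_ge0 ?ltW // => m x W r Wh WW Wr rd.
rewrite ev_phi_Dlist -mulrA; exact: (model_compress irr ep0 gap x Wh WW Wr rd).
Qed.

(** Only now, with N fixed, is a level with d_k >= 4 N selected; there the low space of copy 0 is
    empty, and the comparison descends to level 0. *)
Lemma low_le0 : low_le 0.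
Proof.
have [k Nk] := d_unbounded (4 * N).
have : low_le k by exact: low_le_large.
by elim: k {Nk} => [//|k IH] /low_le_step.
Qed.

(** For d_0 = 1 the coefficients are 1 x 1, and this is the element (1 - D_0(0) / L)^(2j) of the
    algebra. *)
Definition fixed_power : B :=
  collapse (fmul (fstar (fpow (lf L (Dlist 0 false)) j)) (fpow (lf L (Dlist 0 false)) j)).

(** The inequality between the two low counts at level 0 is placed between the lower bound for copy
    0 and the upper bound for copy 1. *)
Lemma trace_bound : d 0%N = 1%N ->
  complex.Re (\tr (psi fixed_power)) <= 2 * complex.Re (\tr (psi (eE true))) +
    N%:R * ((1 - eta / 2 / L) ^+ (2 * j) + 7 * dl).
Proof.
move=> d01; have [u0 [l0 d0]] := data 0 false; have [u1 [l1 d1]] := data 0 true.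
have h0 := low_count_ge psi_ucp eta0 L0 dl0 dl1 half_gap_le (@good_Dlist 0 false) d0.
have h1 : 2 * dl / eta <= 2^-1.
  have c1 : 1 <= C1 by rewrite /C1 (le_trans (_ : _ <= 2)) ?ler1n // lerDr divr_ge0 // ltW.
  have t0 : 0 <= 2 * dl / eta by rewrite divr_ge0 ?mulr_ge0 // ltW.
  have := ler_peMl t0 c1; move: small1; rewrite -[2 * C1 * _]mulrA.
  by move: (2 * dl / eta) => t; move: (C1 * t) => *; lra.
have h2 := low_count_le phiN psi_ucp d1 (a := eE true).
have /h0 : perrs psi (shape (lf L (Dlist 0 false))) j <= dl by rewrite shape_lf.
rewrite shape_lf => /(_ _)/le_trans; apply.
  by apply: pass_dl; rewrite !inE eqxx !orbT.
rewrite [in X in _ + X]d01 muln1 lerD2r.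
have h3 : #|low l0 (eta / 2)|%:R <= #|low l1 (eta / 2)|%:R :> R by rewrite ler_nat; exact: low_le0 d0 d1.
have e1 : (d 0)%:R = 1 :> R by rewrite d01.
apply: (le_trans h3); rewrite e1 mulr1 in h2; apply: h2 => // m x.
  rewrite ev1 mulmx1 phE ev_phi_Dlist rdot_Dop //.
  have := rdot_1e true x; rewrite rdotBl -/(nsq x) => ->.
  by rewrite lerDr sumr_ge0 // => g _; exact: nsq_ge0.
by rewrite ev1 mulmx1 phE rdot_e nsq_ge0.
Qed.

End AlgebraLevel.

(** * The limiting corner trace is not quasidiagonal *)

(** Provides one [dl] that meets several linear smallness conditions at once. *)
Lemma ex_small_multiple (R : realFieldType) (s : seq (R * R)) :
  (forall t, t \in s -> 0 < t.2) ->
  exists2 r, 0 < r & forall t, t \in s -> t.1 * r <= t.2.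
Proof.
elim: s => [|[x y] s IH] h; first by exists 1.
have [|r r0 rs] := IH; first by move=> t ts; apply: h; rewrite inE ts orbT.
have y0 : 0 < y by apply: (h (x, y)); rewrite inE eqxx.
have x0 : 0 < `|x| + 1 by rewrite addrC ltr_pwDl.
exists (Num.min r (y / (`|x| + 1))); first by rewrite lt_min r0 divr_gt0.
move=> t; rewrite inE => /orP[/eqP -> /=|ts].
  apply: (@le_trans _ _ (`|x| * (y / (`|x| + 1)))).
    apply: (@le_trans _ _ (`|x| * Num.min r (y / (`|x| + 1)))).
      by rewrite ler_wpM2r ?ler_norm // le_min !ltW // divr_gt0.
    by rewrite ler_wpM2l // ge_min lexx orbT.
  by rewrite mulrCA ler_piMr ?ltW // ltr_pdivrMr // mul1r ltrDl.
have [t0|t0] := leP 0 t.1.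
  by apply: le_trans (rs t ts); rewrite ler_wpM2l // ge_min lexx.
apply: (@le_trans _ _ 0); last by apply/ltW/h; rewrite inE ts orbT.
by rewrite nmulr_rle0 // le_min !ltW // divr_gt0.
Qed.

Lemma num_bound (R : realFieldType) (c be k dd eta b : R) : 0 < c -> 0 < eta -> be <= c / 4 ->
  k <= c / 4 -> 2 * (1 + b * b) * be + 2 * eta * (b + b * b) * dd <= eta * (c * c) / 8 ->
  2 * (1 + b * b) * be <
  eta / 2 * ((c - be) * (c - be - k) - 4 * (b + b * b) * dd).
Proof.
move=> c0 eta0 h1 h2 h3.
have h4 : (3 / 4 * c) * (c / 2) <= (c - be) * (c - be - k) by apply: ler_pM; lra.
have e1 : (3 / 4 * c) * (c / 2) = 3 / 8 * (c * c) by field.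
rewrite e1 in h4; have := ler_wpM2l (ltW eta0) h4.
have p : 0 < eta * (c * c) by rewrite !mulr_gt0.
rewrite (_ : eta / 2 * ((c - be) * (c - be - k) - 4 * (b + b * b) * dd) =
  eta * ((c - be) * (c - be - k)) / 2 - 2 * eta * (b + b * b) * dd); last by field.
rewrite (_ : eta * (3 / 8 * (c * c)) = 3 / 8 * (eta * (c * c))); last by ring.
move: h3 p; move: (eta * (c * c)) (eta * (_ * _)) (2 * eta * _ * dd) (2 * _ * be) => *; lra.
Qed.

Lemma trace_contradiction (R : realFieldType) (g e m l Z : R) : g <= 2 * e + l ->
  `|g - m| <= Z / 16 -> `|e| <= Z / 16 -> Z <= m -> l <= Z / 4 -> 0 < Z -> False.
Proof. by move=> h1; rewrite !ler_norml => /andP[h2 _] /andP[_ h3]; lra. Qed.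

Lemma ex_power_small (R : realType) (k e : R) : 0 <= k < 1 -> 0 < e ->
  exists j, k ^+ (2 * j) <= e.
Proof.
move=> /andP[k0 k1] e0.
have /cvgrPdist_le/(_ e e0)[j _ /(_ j (leqnn j))] : k ^+ n @[n --> \oo] --> (0 : R).
  by apply: cvg_expr; rewrite ger0_norm.
rewrite sub0r normrN ger0_norm ?exprn_ge0 // => h; exists j; apply: le_trans h.
by apply: (ler_wiXn2l k0 (ltW k1)); rewrite mulSn leq_addr.
Qed.

(** First j makes the filter factor small against Z and against c / (b + 1). All remaining
    conditions then have the form constant times dl <= positive number, with constants independent
    of j. *)
Lemma constants_exist (R : realType) (c eta L K0 C Z : R) (b : nat) :
  0 < c -> 0 < eta -> 0 < L -> eta / 2 <= L -> 0 < Z ->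
  exists (j : nat) (dl : R), [/\ 0 < dl, 2 * dl <= 1 /\ 2 * (2 * C * (2 * dl / eta)) < 1,
    K0 * (2 * dl / eta) + (2 + 7 * b%:R) * dl <= c,
    2 * (1 + b%:R * b%:R) * (K0 * (2 * dl / eta) + (2 + 7 * b%:R) * dl) <
    eta / 2 * ((c - (K0 * (2 * dl / eta) + (2 + 7 * b%:R) * dl)) *
      (c - (K0 * (2 * dl / eta) + (2 + 7 * b%:R) * dl)
         - b%:R * (1 - eta / 2 / L) ^+ (2 * j))
      - 4 * (b%:R + b%:R * b%:R) * ((2 + 7 * b%:R) * dl)) &
    (1 - eta / 2 / L) ^+ (2 * j) + 7 * dl <= Z].
Proof.
move=> c0 eta0 L0 etaL Z0.
have h1 : 0 <= 1 - eta / 2 / L < 1.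
  rewrite subr_ge0 ler_pdivrMr // mul1r etaL /= ltrBlDr ltrDl.
  by rewrite !divr_gt0.
have b0 : 0 <= b%:R :> R by [].
have e0 : 0 < Num.min (Z / 2) (c / 4 / (b%:R + 1)).
  by rewrite lt_min !divr_gt0 // ltr_wpDl.
have [j] := ex_power_small h1 e0; rewrite le_min => /andP[j1 j2].
(* M1 dl is the quantity [be] of the descent step, and M2 dl is the left side of the smallness
   condition in [num_bound]. *)
pose M1 := K0 * (2 / eta) + (2 + 7 * b%:R).
pose M2 := 2 * (1 + b%:R * b%:R) * M1 + 2 * eta * (b%:R + b%:R * b%:R) * (2 + 7 * b%:R).
have [t|dl dl0 dlP] := @ex_small_multiple R [:: (2, 1); (M1, c / 4); (M2, eta * (c * c) / 8);
    (2 * (2 * C * (2 / eta)), 2^-1); (7, Z / 2)].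
  by   rewrite !inE => /orP[|/orP[|/orP[|/orP[]]]] /eqP -> /=; rewrite ?divr_gt0 ?mulr_gt0 //.
have P1 := dlP (2, 1) (mem_head _ _).
have P2 : M1 * dl <= c / 4 by apply: (dlP (M1, c / 4)); rewrite !inE eqxx orbT.
have P3 : M2 * dl <= eta * (c * c) / 8.
  by apply: (dlP (M2, eta * (c * c) / 8)); rewrite !inE eqxx !orbT.
have P4 : 2 * (2 * C * (2 / eta)) * dl <= 2^-1.
  by apply: (dlP (2 * (2 * C * (2 / eta)), 2^-1)); rewrite !inE eqxx !orbT.
have P5 : 7 * dl <= Z / 2 by apply: (dlP (7, Z / 2)); rewrite !inE eqxx !orbT.
have beE : K0 * (2 * dl / eta) + (2 + 7 * b%:R) * dl = M1 * dl by rewrite /M1; ring.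
exists j, dl; split=> //.
- split=> //; rewrite (_ : 2 * _ = 2 * (2 * C * (2 / eta)) * dl); last by ring.
  by apply: le_lt_trans P4 _; rewrite invf_lt1 // ltr1n.
- by rewrite beE (le_trans P2) // ler_pdivrMr // ler_peMr ?ltW // ltr1n.
- rewrite beE; apply: num_bound => //.
    apply: (@le_trans _ _ (b%:R * (c / 4 / (b%:R + 1)))); first by rewrite ler_wpM2l.
    rewrite mulrCA ler_piMr ?divr_ge0 ?ltW // ltr_pdivrMr ?ltr_wpDl // mul1r ltrDl.
    by rewrite ltr01.
  by apply: le_trans P3; rewrite /M2 le_eqVlt; apply/orP; left; apply/eqP; ring.
by rewrite [leRHS]splitr lerD.
Qed.

Section NotQd.
Context {R : realType} {G : groupType} {d : nat -> nat} {b : nat}.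
Local Notation C := R[i].
Local Notation E m := (Eidx d b m).
Variable pi : forall k, G -> 'M[C]_(d k).
Hypothesis irr : lists_irreps pi.
Hypothesis T_G : property_T R G.
Variable J : forall k, 'M[C]_(d k.+1, d k).
Hypothesis J_isometry : forall k, (J k)^t* *m J k = 1%:M.
Variable R1 : R.
Hypothesis R1_ge1 : 1 <= R1.
Hypothesis dR : forall k, (d k.+1)%:R <= R1 * (d k)%:R :> R.
Hypothesis d_unbounded : forall n, exists k, (n <= d k)%N.
Hypothesis d01 : d 0%N = 1%N.
Variables (B : cstarAlgType R) (phi : forall m, B -> 'M[C]_#|E m|).
Hypothesis phiN : norming_reps phi.
Variables (eE : bool -> B) (sG : G -> B) (TE : bool -> 'I_b -> B) (sE : B).
Hypothesis phE : forall eps m, phi m (eE eps) = e_op R d b eps m.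
Hypothesis phG : forall g m, phi m (sG g) = sigma_op pi b g m.
Hypothesis phT : forall eps i m, phi m (TE eps i) = T_op J eps i m.
Hypothesis phs : forall m, phi m sE = s_op R d b m.

Lemma errs_cvg0 (N : nat -> nat) (psi : forall n, B -> 'M[C]_(N n)) (s1 s2 : seq B) :
  (forall a c, cnorm (psi n (a * c) - psi n a * psi n c) @[n --> \oo] --> (0 : R)) ->
  errs (psi n) s1 s2 @[n --> \oo] --> (0 : R).
Proof.
move=> h; rewrite /errs.
have c0 (f : B -> nat -> R) (s : seq B) : (forall a, f a n @[n --> \oo] --> (0 : R)) ->
    (\sum_(a <- s) f a n) @[n --> \oo] --> (0 : R).
  move=> f0; elim: s => [|a s IH].
    by under eq_fun => n do rewrite big_nil; exact: cvg_cst.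
  under eq_fun => n do rewrite big_cons.
  have := cvgD (f0 a) IH; rewrite addr0; exact.
apply: (c0 (fun a n => \sum_(c <- s2) opnorm (psi n (a * c) - psi n a *m psi n c))) => a.
apply: (c0 (fun c n => opnorm (psi n (a * c) - psi n a *m psi n c))) => c.
exact: h.
Qed.

Lemma errs_small (N : nat -> nat) (psi : forall n, B -> 'M[C]_(N n)) (s : seq (seq B * seq B)) r :
  0 < r -> (forall a c, cnorm (psi n (a * c) - psi n a * psi n c) @[n --> \oo] --> (0 : R)) ->
  \forall n \near \oo, forall t, t \in s -> errs (psi n) t.1 t.2 <= r.
Proof.
move=> r0 h; elim: s => [|t s IH]; first by near=> n.
have ht : \forall n \near \oo, errs (psi n) t.1 t.2 <= r.
  have /cvgrPdist_le/(_ r r0) := errs_cvg0 t.1 t.2 h.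
  by apply: filterS => n; rewrite sub0r normrN ger0_norm // errs_ge0.
apply: filterS2 IH ht => n IH ht t'; rewrite inE => /orP[/eqP -> //|]; exact: IH.
Unshelve. all: by end_near.
Qed.

(** The order of the choices matters: K and ep come from property (T), then j and dl, then the
    tests, and only then the index n and with it the matrix size. *)
Lemma not_qd (mu : B -> C) (Z : R) : 0 < Z ->
  (forall K j, Z <= complex.Re (mu (fixed_power pi K eE sG j))) ->
  mu (eE true) = 0 -> ~ qd_trace mu.
Proof.
move=> Z0 muf mue [_ [N [psi [N0 psi_ucp psiM psi_mu]]]].
have [K [ep [ep0 gap]]] := property_T_gap T_G.
have c0 : 0 < (4 * R1)^-1 by rewrite invr_gt0 mulr_gt0 // (lt_le_trans ltr01).
have C0 := C1_gt0 ep0.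
have L1 : 1 <= Lmax K :> R by rewrite lerDr mulr_ge0.
have L0 : 0 < Lmax K :> R by exact: lt_le_trans ltr01 L1.
have eta0 : 0 < (C1 ep)^-1 by rewrite invr_gt0.
have etaL := half_gap_le K ep0.
(* These shares give Z - Z/16 <= 2 Z/16 + Z/4 after normalising [trace_bound], which is absurd. *)
have Z4 : 0 < Z / 4 by rewrite divr_gt0.
have Z16 : 0 < Z / 16 by rewrite divr_gt0.
have [j [dl [dl0 [dl1 small1] be_c num last]]] :=
  @constants_exist R _ _ _ (2 * (Lmax K * C1 ep)) (C1 ep) (Z / 4) b c0 eta0 L0 etaL Z4.
set g := fixed_power pi K eE sG j.
have small a : \forall n \near \oo, cabs (ntr (psi n a) - mu a) <= Z / 16.
  have /cvgrPdist_le/(_ (Z / 16) Z16) := psi_mu a.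
  by apply: filterS => n; rewrite sub0r normrN ger0_norm // cabs_ge0.
have dlj : 0 < dl / j.+1%:R by rewrite divr_gt0.
have [n [[h1 h2] h3]] := filter_ex (filterI (filterI (small g) (small (eE true)))
   (errs_small (tests K eE sG TE sE j) dlj psiM)).
have := trace_bound irr ep0 gap J_isometry R1_ge1 dR phiN phE phG phT phs (psi_ucp n)
  (ltW dl0) dl1 be_c num h3 small1 d_unbounded d01.
have NR : 0 < (N n)%:R :> R by rewrite ltr0n.
rewrite -/g -(ler_pM2l (x := (N n)%:R^-1)) ?invr_gt0 // mulrDr mulKf ?gt_eqF // => h4.
have ReE (M : 'M[C]_(N n)) : complex.Re (ntr M) = (N n)%:R^-1 * complex.Re (\tr M).
  by rewrite /ntr -(rmorph_nat (real_complex R)) -fmorphV ReMr.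
rewrite mulrCA -!ReE in h4.
have ReB (x y : C) : `|complex.Re x - complex.Re y| <= cabs (x - y).
  by apply: le_trans (Re_le_cabs _); case: x; case: y.
have h5 := le_trans (ReB _ _) h1; have h6 := le_trans (ReB _ _) h2.
rewrite mue subr0 in h6.
exact: trace_contradiction h4 h5 h6 (muf K j) last Z0.
Qed.

End NotQd.

(** * Dimensions and traces in the model spaces *)

Section ModelTraces.
Context {R : realType} {G : groupType} {d : nat -> nat} {b : nat}.
Local Notation C := R[i].
Local Notation E m := (Eidx d b m).

Definition dimL m : nat := \sum_(k < m.+1) d k * b ^ (m - k).

Lemma sum_copy_level m (P : bool -> nat -> bool) :
  \sum_(y : E m) (P (Ecopy y) (Elevel y))%:R =
  (\sum_(c : bool) \sum_(k < m.+1) P c k * (d k * b ^ (m - k)))%:R :> C.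
Proof.
rewrite sum_Eidx natr_sum; apply: eq_bigr => c _; rewrite natr_sum; apply: eq_bigr => k _.
under eq_bigr => a _ do rewrite /Ecopy /Elevel /= sumr_const card_tuple card_ord.
rewrite sumr_const card_ord -mulrnA -[LHS]mulr_natr -natrM.
by rewrite [(d k * _)%N]mulnC.
Qed.

Lemma sum_rank_copy_level m (P : bool -> nat -> bool) :
  \sum_(r < #|E m|) (P (Ecopy (enum_val r)) (Elevel (enum_val r)))%:R =
  (\sum_(c : bool) \sum_(k < m.+1) P c k * (d k * b ^ (m - k)))%:R :> R.
Proof.
have ReN n : complex.Re (n%:R : C) = n%:R by rewrite -(rmorph_nat (real_complex R)).
have := sum_copy_level m P.
rewrite (reindex_onto enum_val enum_rank) /=; last by move=> r _; rewrite enum_rankK.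
rewrite (eq_bigl xpredT) => [|y]; last by rewrite enum_valK eqxx.
move=> /(congr1 (@complex.Re R)); rewrite Re_sum.
by rewrite ReN (eq_bigr _ (fun r _ => ReN _)).
Qed.

Lemma tr_e_op m eps : \tr (e_op R d b eps m) = (dimL m)%:R.
Proof.
rewrite /mxtrace; under eq_bigr => r _ do rewrite mxE eqxx /=.
rewrite (reindex_onto enum_rank enum_val) /=; last by move=> r _; rewrite enum_valK.
under eq_bigr => y _ do rewrite enum_rankK.
rewrite (eq_bigl xpredT) => [|y]; last by rewrite enum_rankK eqxx.
rewrite (@sum_copy_level m (fun c _ => c == eps)); congr (_%:R).
rewrite (bigD1 eps) //= [X in (_ + X)%N]big1 => [|c /negbTE ce].
  by rewrite addn0; apply: eq_bigr => k _; rewrite eqxx mul1n.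
by rewrite big1 // => k _; rewrite ce mul0n.
Qed.

(** From d_k <= R1^k the quotient of dim L_m by b^m is at most a geometric series of ratio R1 / b <
    1. Here b^m is the dimension of level 0 of copy 0, all of which is invariant, so invariant
    vectors fill a fixed proportion of that copy. *)
Lemma dimL_bound (R1 : R) m : 0 <= R1 < b%:R -> d 0%N = 1%N ->
  (forall k, (d k.+1)%:R <= R1 * (d k)%:R :> R) ->
  (1 - R1 / b%:R) * (dimL m)%:R <= (b ^ m)%:R.
Proof.
move=> /andP[R0 Rb] d01 dR.
have b0 : 0 < b%:R :> R by exact: le_lt_trans R0 Rb.
pose x := R1 / b%:R.
have dk k : (d k)%:R <= R1 ^+ k.
  elim: k => [|k IH]; first by rewrite d01.
  by apply: (le_trans (dR k)); rewrite exprS ler_wpM2l.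
have h : (dimL m)%:R <= (b ^ m)%:R * \sum_(k < m.+1) x ^+ k.
  rewrite natr_sum mulr_sumr; apply: ler_sum => k _.
  rewrite natrM !natrX; apply: (@le_trans _ _ (R1 ^+ k * b%:R ^+ (m - k))).
    by rewrite ler_wpM2r // exprn_ge0 // ltW.
  have km : (k <= m)%N by rewrite -ltnS.
  have -> : b%:R ^+ m * x ^+ k = R1 ^+ k * b%:R ^+ (m - k).
    have e : b%:R ^+ m = b%:R ^+ (m - k) * b%:R ^+ k :> R by rewrite -exprD subnK.
    by rewrite e /x expr_div_n -mulrA [_ ^+ k * (_ / _)]mulrC divfK ?expf_neq0 ?gt_eqF // mulrC.
  exact: lexx.
have x1 : x < 1 by rewrite ltr_pdivrMr // mul1r.
have x0 : 0 <= x by rewrite divr_ge0 // ltW.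
apply: (@le_trans _ _ ((1 - x) * ((b ^ m)%:R * \sum_(k < m.+1) x ^+ k))).
  by rewrite ler_wpM2l // subr_ge0 ltW.
rewrite mulrCA ler_piMr // -[1 - x]opprB mulNr -subrX1 opprB.
by rewrite gerBl exprn_ge0.
Qed.

Lemma dimL_gt0 m : (0 < b)%N -> d 0%N = 1%N -> (0 < dimL m)%N.
Proof.
move=> b0 d01; rewrite /dimL big_ord_recl d01 mul1n subn0 ltn_addr //.
by rewrite expn_gt0 b0.
Qed.

Lemma mx11_scalar n (M : 'M[C]_n) : n = 1%N -> M = (\tr M / n%:R)%:M.
Proof.
move=> n1; subst n; apply/matrixP => i j; rewrite !ord1 mxE eqxx mulr1n divr1.
by rewrite /mxtrace big_ord1.
Qed.

Lemma e_op_delta m n eps r (s : 'I_n) :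
  e_op R d b eps m *m delta_mx r s = (Ecopy (enum_val r) == eps)%:R *: delta_mx r s.
Proof.
apply/matrixP => i j; rewrite mxE (bigD1 r) //= big1 ?addr0 => [|k /negbTE kr]; last first.
  by rewrite [delta_mx _ _ _ _]mxE kr mulr0.
rewrite !mxE eqxx /= (inj_eq enum_val_inj).
by case: (i == r); rewrite /= ?mul0r ?mulr0 // mulr0.
Qed.

Variable pi : forall k, G -> 'M[C]_(d k).
Hypothesis irr : lists_irreps pi.
Hypothesis d01 : d 0%N = 1%N.
Variable K : seq G.

(** Since d_0 = 1, every block at level 0 is a scalar and hence invariant. *)
Lemma Dop_delta m r s : Ecopy (enum_val r) = false -> Elevel (enum_val r) = 0%N ->
  Dop pi K false (delta_mx r s : 'M[C]_(#|E m|, d 0%N)) = 0.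
Proof.
move=> cr lr; set X := delta_mx r s.
suff -> : X = x0 false X by exact: Dop_x0.
have bk0' c l w : ~~ atE (enum_val r) c l w -> bk X c l w = 0.
  move=> nr; apply/matrixP => a j; rewrite !mxE big1 // => y /andP[yc _].
  rewrite mxE; case: eqP => // yr.
  by move: nr; rewrite -yr enum_rankK yc.
apply: bk_ext => c l w; have [->|ln] := eqVneq l 0%N; last first.
  by rewrite bk_Einv_ne // bk0' // /atE lr [0%N == l]eq_sym (negbTE ln) andbF.
rewrite bk_Einv; have [->|cn] := eqVneq c false; last first.
  by rewrite if_same -scalemx1 scale0r bk0' // /atE cr [false == c]eq_sym (negbTE cn).
case: ifP => [_|/negbT inv]; first by rewrite -mx11_scalar.
by rewrite bk_invalid // -scalemx1 scale0r.
Qed.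

End ModelTraces.

Section FixedPower.
Context {R : realType} {G : groupType} {d : nat -> nat} {b : nat}.
Local Notation C := R[i].
Local Notation E m := (Eidx d b m).
Variable pi : forall k, G -> 'M[C]_(d k).
Hypothesis irr : lists_irreps pi.
Hypothesis d01 : d 0%N = 1%N.
Variables (B : cstarAlgType R) (phi : forall m, B -> 'M[C]_#|E m|).
Hypothesis phiN : norming_reps phi.
Variables (eE : bool -> B) (sG : G -> B).
Hypothesis phE : forall eps m, phi m (eE eps) = e_op R d b eps m.
Hypothesis phG : forall g m, phi m (sG g) = sigma_op pi b g m.

Lemma nsq_delta p q r s : nsq (delta_mx r s : 'M[C]_(p, q)) = 1.
Proof.
rewrite /nsq /rdot cipE (bigD1 r) //= (bigD1 s) //= !mxE !eqxx conjC1 mulr1.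
rewrite big1 => [|s' /negbTE ss]; last by rewrite mxE ss andbF mul0r.
rewrite big1 => [|r' /negbTE rr]; last by rewrite big1 // => s' _; rewrite mxE rr mul0r.
by rewrite !addr0.
Qed.

(** The filter fixes the b^m basis vectors at level 0 of copy 0, each of which contributes 1. Other
    vectors of copy 0 contribute squared norms, and those of copy 1 contribute nothing. *)
Lemma tr_fixed_power m K j :
  (b ^ m)%:R <= complex.Re (\tr (e_op R d b false m *m phi m (fixed_power pi K eE sG j))).
Proof.
have [/(_ m) [lin mul phist phi1] _ _] := phiN.
set g := fpow (lf (Lmax K) (Dlist pi K eE sG 0 false)) j.
pose f a := e_op R d b false m *m phi m a.
have fl (c : C) a a' : f (c *: a + a') = c *: f a + f a'.
  by rewrite /f lin mulmxDr -scalemxAr.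
rewrite -/(f _) -(sum_rdot_delta _ fl).
have evf l (x : 'M[C]_(#|E m|, d 0%N)) : ev f l x = e_op R d b false m *m ev (phi m) l x.
  by rewrite /ev mulmx_sumr; apply: eq_bigr => t _; rewrite /f !mulmxA.
have gE x : Dop pi K false x = 0 -> ev (phi m) g x = x.
  move=> x0; rewrite /g; elim: j {g} => [|j' IH] /=; first by rewrite ev1 phi1 mul1mx mulmx1.
  rewrite ev_fmul // IH lfE // (ev_phi_Dlist K phiN phE phG) x0.
  by rewrite scaler0 subr0.
have term r s : (if ~~ Ecopy (enum_val r) && (Elevel (enum_val r) == 0%N) then 1 else 0) <=
    rdot (ev f (fmul (fstar g) g) (delta_mx r s)) (delta_mx r s).
  rewrite evf rdot_mull e_op_adj e_op_delta.
  case: (boolP (Ecopy (enum_val r))) => cr /=.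
    by rewrite scale0r rdot0r.
  rewrite scale1r ev_fmul // rdotC -rdot_ev // -/(nsq _).
  case: eqP => lr; last exact: nsq_ge0.
  rewrite gE; first by rewrite nsq_delta.
  by apply: Dop_delta => //; exact: negbTE.
apply: (@le_trans _ _ (\sum_r \sum_(s < d 0%N)
    (if ~~ Ecopy (enum_val r : E m) && (Elevel (enum_val r) == 0%N) then 1 else 0))); last first.
  by apply: ler_sum => r _; apply: ler_sum => s _; exact: term.
under eq_bigr => r _ do rewrite sumr_const card_ord d01 mulr1n.
have := @sum_rank_copy_level R d b m (fun c k => ~~ c && (k == 0%N)).
move=> e; apply: (@le_trans _ _ (\sum_(r < #|E m|)
    (~~ Ecopy (enum_val r) && (Elevel (enum_val r) == 0%N))%:R)); last first.
  by apply: ler_sum => r _; case: (_ && _).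
rewrite e ler_nat big_bool /= [X in (_ <= X + _)%N]big1 // add0n.
by rewrite big_ord_recl /= d01 !mul1n subn0 leq_addr.
Qed.

End FixedPower.

(** * Limits along filters *)

Section FilterLimits.
Context {R : realType}.
Local Notation C := R[i].
Variable F : set_system nat.

Definition flim (x : nat -> C) (l : C) : Prop :=
  forall eps : R, 0 < eps -> F [set m | cabs (x m - l) < eps].

(** Compactness of [-M, M] provides a cluster point of the real and of the imaginary part, and an
    ultrafilter converges to its cluster points. *)
Lemma ultra_flim (x : nat -> C) (M : R) : UltraFilter F -> (forall m, cabs (x m) <= M) ->
  exists l, flim x l.
Proof.
move=> UF xM.
have real_lim (y : nat -> R) : (forall m, `|y m| <= M) ->
    exists l, forall eps : R, 0 < eps -> F [set m | `|y m - l| < eps].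
  move=> yM.
  have PF : ProperFilter (y @ F) by exact: fmap_proper_filter.
  have FM : (y @ F) `[- M, M]%classic.
    change (F [set m | y m \in `[- M, M]]); apply: (@filterS _ F _ setT); last exact: filterT.
    by move=> m _ /=; rewrite in_itv /= -ler_norml yM.
  have [l [_ lc]] := @segment_compact R (- M) M _ PF FM.
  exists l => eps eps0.
  have [//|FC] := @in_ultra_setVsetC _ F [set m | `|y m - l| < eps] UF.
  have FC' : (y @ F) (~` ball l eps).
    change (F [set m | ~ `|l - y m| < eps]).
    by apply: filterS FC => m /= h lb; apply: h; rewrite distrC.
  have [z [/= zB zl]] := lc _ _ FC' (nbhsx_ballx l eps eps0).
  by [].
have [|a aP] := real_lim (fun m => complex.Re (x m)).
  by move=> m; apply: le_trans (Re_le_cabs _) (xM m).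
have [|c cP] := real_lim (fun m => complex.Im (x m)).
  by move=> m; apply: le_trans (Im_le_cabs _) (xM m).
exists (a +i* c)%C => eps eps0.
have e2 : 0 < eps / 2 by rewrite divr_gt0.
apply: filterS2 (aP _ e2) (cP _ e2) => m /= h1 h2.
apply: le_lt_trans (cabs_le _) _; rewrite [ltRHS]splitr.
have -> : complex.Re (x m - (a +i* c)%C) = complex.Re (x m) - a by case: (x m).
have -> : complex.Im (x m - (a +i* c)%C) = complex.Im (x m) - c by case: (x m).
exact: ltrD.
Qed.

Hypothesis PF : ProperFilter F.

Lemma cabsN (z : C) : cabs (- z) = cabs z.
Proof. by rewrite normcN. Qed.

Lemma cabs_eq0 (z : C) : (forall eps : R, 0 < eps -> cabs z < eps) -> z = 0.
Proof.
move=> h; apply: ComplexField.Normc.eq0_normc; apply/eqP.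
rewrite eq_le cabs_ge0 andbT; apply/ler_addgt0Pr => e e0.
by rewrite add0r ltW // h.
Qed.

Lemma flim_unique x l l' : flim x l -> flim x l' -> l = l'.
Proof.
move=> xl xl'; apply/eqP; rewrite -subr_eq0; apply/eqP/cabs_eq0 => eps e0.
have e2 : 0 < eps / 2 by rewrite divr_gt0.
have [m [/= h1 h2]] := filter_ex (filterI (xl _ e2) (xl' _ e2)).
rewrite (_ : l - l' = (x m - l') - (x m - l)); last by ring.
apply: le_lt_trans (le_normcD _ _) _; rewrite cabsN [ltRHS]splitr.
by rewrite ltrD.
Qed.

Lemma flim_const l : flim (fun=> l) l.
Proof.
move=> eps e0; apply: (@filterS _ _ _ setT) => [m _ /=|]; last exact: filterT.
by rewrite subrr cabs0.
Qed.

Lemma flimD x y l l' : flim x l -> flim y l' -> flim (fun m => x m + y m) (l + l').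
Proof.
move=> xl yl eps e0; have e2 : 0 < eps / 2 by rewrite divr_gt0.
apply: filterS2 (xl _ e2) (yl _ e2) => m /= h1 h2.
rewrite opprD addrACA; apply: le_lt_trans (le_normcD _ _) _.
by rewrite [ltRHS]splitr ltrD.
Qed.

Lemma flimZ c x l : flim x l -> flim (fun m => c * x m) (c * l).
Proof.
move=> xl eps e0.
have c0 : 0 < cabs c + 1 by rewrite ltr_wpDl // cabs_ge0.
have e1 : 0 < eps / (cabs c + 1) by rewrite divr_gt0.
apply: filterS (xl _ e1) => m /=; rewrite ltr_pdivlMr // => h.
rewrite -mulrBr cabsM; apply: le_lt_trans h.
by rewrite mulrDr mulr1 mulrC lerDl cabs_ge0.
Qed.

Lemma flimB x y l l' : flim x l -> flim y l' -> flim (fun m => x m - y m) (l - l').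
Proof.
move=> xl yl; have := flimD xl (flimZ (-1) yl); rewrite mulN1r.
by under eq_fun => m do rewrite mulN1r.
Qed.

Lemma flim_sub0 x y l : flim x l -> flim (fun m => y m - x m) 0 -> flim y l.
Proof.
move=> xl yl; have := flimD xl yl; rewrite addr0.
by under eq_fun => m do rewrite [_ + (_ - _)]addrC subrK.
Qed.

Lemma flim_Re_ge x l (r : R) : flim x l -> (\forall m \near F, r <= complex.Re (x m)) ->
  r <= complex.Re l.
Proof.
move=> xl h; apply/ler_addgt0Pr => e e0.
have [m [/= h1 h2]] := filter_ex (filterI h (xl _ e0)).
rewrite -lerBlDl; apply: le_trans (ltW h2).
apply: le_trans (Re_le_cabs _); apply: le_trans (ler_norm _).
by move: h1; case: (x m) => a a'; case: l {xl h2} => c c' /=; lra.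
Qed.

Lemma flim_ge0 x l : flim x l -> (forall m, 0 <= x m) -> 0 <= l.
Proof.
move=> xl x0.
have Ri : 0 <= complex.Re l.
  apply: (flim_Re_ge xl); apply: filterS (@filterT _ F _) => m _.
  by have := x0 m; case: (x m) => a c /=; rewrite lecE /= => /andP[].
have Im0 : complex.Im l = 0.
  apply/eqP; rewrite -normr_eq0 eq_le normr_ge0 andbT; apply/ler_addgt0Pr => e e0.
  have [m /= h] := filter_ex (xl _ e0); rewrite add0r.
  apply: le_trans (ltW h); apply: le_trans (Im_le_cabs _).
  have := x0 m; case: (x m) => a c /=; rewrite lecE /= => /andP[/eqP -> _].
  by case: l {xl Ri h} => u v /=; rewrite sub0r normrN.
by move: Ri Im0; case: l {xl} => u v /= u0 ->; rewrite lecE /= eqxx u0.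
Qed.

Lemma flim_cabs_le x l (r : R) : flim x l -> (forall m, cabs (x m) <= r) -> cabs l <= r.
Proof.
move=> xl xr; apply/ler_addgt0Pr => e e0.
have [m /= h] := filter_ex (xl _ e0).
have -> : l = x m - (x m - l) by ring.
apply: le_trans (le_normcD _ _) _; rewrite cabsN; apply: lerD => //; exact: ltW.
Qed.

Variables (B : cstarAlgType R) (t : nat -> B -> C) (mu : B -> C).
Hypothesis t_mu : forall a, flim (fun m => t m a) (mu a).

(** Traciality is required only in the limit, as the corner functionals are not traces at a finite
    stage. *)
Lemma flim_tracial : (forall m, scalar (t m)) -> (forall m a, 0 <= t m (star a * a)) ->
  (forall m, t m 1 = 1) -> (forall a c, flim (fun m => t m (a * c) - t m (c * a)) 0) ->
  tracial_state mu.
Proof.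
move=> t_lin t_pos t_1 t_tr; split=> [c x y|a||a c].
- apply: (flim_unique (t_mu _)).
  under [X in flim X _]eq_fun => m do rewrite t_lin.
  by apply: flimD => //; apply: flimZ.
- exact: flim_ge0 (t_mu _) _.
- apply: (flim_unique (t_mu _)).
  by under [X in flim X _]eq_fun => m do rewrite t_1; exact: flim_const.
- by apply: (flim_unique (t_mu _)); apply: flim_sub0 (t_mu _) (t_tr _ _).
Qed.

End FilterLimits.

(** * Quasidiagonality of limits of finite-dimensional traces *)

Lemma three_thirds (R : realFieldType) (p q r s j e : R) : p < e / 3 -> q < j -> j < e / 3 ->
  s <= q + r -> r < e / 3 -> p + s < e.
Proof. lra. Qed.

Section FdTraces.
Context {R : realType}.
Local Notation C := R[i].
Variable B : cstarAlgType R.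

Definition fd_trace (t : B -> C) : Prop :=
  exists N (rho : B -> 'M[C]_N), [/\ (0 < N)%N, matrix_rep rho & forall a, t a = ntr (rho a)].

Lemma matrix_rep_ucp N (rho : B -> 'M[C]_N) : matrix_rep rho -> ucp rho.
Proof.
move=> [lin mul st one]; split=> [c a a'|//|n a [y ->]]; first exact: lin.
exists (map_mx rho y); apply/matrixP => i j; rewrite !mxE (lin_sum lin).
by apply: eq_bigr => k _; rewrite !mxE mul st.
Qed.

Lemma rep_sum N1 N2 (r1 : B -> 'M[C]_N1) (r2 : B -> 'M[C]_N2) :
  matrix_rep r1 -> matrix_rep r2 ->
  exists r : B -> 'M[C]_(N1 + N2), matrix_rep r /\ forall a, \tr (r a) = \tr (r1 a) + \tr (r2 a).
Proof.
move=> [l1 m1 s1 u1] [l2 m2 s2 u2]; exists (fun a => block_mx (r1 a) 0 0 (r2 a)); split.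
  split=> [c a a'|a a'|a|].
  - by rewrite l1 l2 scale_block_mx add_block_mx !scaler0 !addr0.
  - by rewrite m1 m2 mulmx_block !mul0mx !mulmx0 !addr0 !add0r.
  - by rewrite s1 s2 tr_block_mx map_block_mx !trmx0 !map_mx0.
  - by rewrite u1 u2 -scalar_mx_block.
by move=> a; rewrite mxtrace_block.
Qed.

Lemma rep_power N (r : B -> 'M[C]_N) k : matrix_rep r ->
  exists rk : B -> 'M[C]_(k * N), matrix_rep rk /\ forall a, \tr (rk a) = k%:R * \tr (r a).
Proof.
move=> rr; elim: k => [|k [rk [rkr rkt]]].
  exists (fun=> 0); split; last by move=> a; rewrite mxtrace0 mul0r.
  by split=> *; apply/matrixP => -[].
have [s [sr st]] := rep_sum rr rkr; exists s; split=> // a.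
by rewrite st rkt -add1n natrD mulrDl mul1r.
Qed.

(** Taking N2 copies of the first representation and N1 copies of the second equalises their
    dimensions, so the normalised trace of the sum weights both equally. *)
Lemma fd_trace_avg t1 t2 : fd_trace t1 -> fd_trace t2 ->
  fd_trace (fun a => 2^-1 * t1 a + 2^-1 * t2 a).
Proof.
move=> [N1 [r1 [N10 rr1 tE1]]] [N2 [r2 [N20 rr2 tE2]]].
have [s1 [sr1 st1]] := rep_power N2 rr1; have [s2 [sr2 st2]] := rep_power N1 rr2.
have [s [sr st]] := rep_sum sr1 sr2.
exists (N2 * N1 + N1 * N2)%N, s; split=> // [|a]; first by rewrite addn_gt0 muln_gt0 N10 N20.
rewrite tE1 tE2 /ntr st st1 st2 [(N2 * N1)%N]mulnC addnn -mul2n !natrM.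
have n1 : N1%:R != 0 :> C by rewrite pnatr_eq0 -lt0n.
have n2 : N2%:R != 0 :> C by rewrite pnatr_eq0 -lt0n.
by field; rewrite n1 n2.
Qed.

Lemma ntr_scale N (rho : B -> 'M[C]_N) : matrix_rep rho -> scalar (fun a => ntr (rho a)).
Proof.
by move=> [lin _ _ _] c a a'; rewrite /ntr lin linearD linearZ /= mulrDr mulrCA.
Qed.

Lemma fd_trace_tracial t : fd_trace t -> tracial_state t.
Proof.
move=> [N [r [N0 rr tE]]]; have rs := ntr_scale rr; case: rr => lin mul st one.
split=> [c a a'|a||a a'].
- by rewrite !tE rs.
- rewrite tE /ntr mul st mulr_ge0 ?invr_ge0 ?ler0n // sumr_ge0 // => i _.
  by rewrite mxE sumr_ge0 // => k _; rewrite !mxE mulrC mul_conjC_ge0.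
- by rewrite tE one /ntr mxtrace1 mulVf // pnatr_eq0 -lt0n.
- by rewrite !tE /ntr !mul mxtrace_mulC.
Qed.

Lemma fd_trace_mix (f : nat -> B -> C) (g : B -> C) j : (forall i, fd_trace (f i)) ->
  fd_trace g -> fd_trace (fun a => \sum_(i < j) 2^-1 ^+ i.+1 * f i a + 2^-1 ^+ j * g a).
Proof.
move=> + gt; elim: j f => [|j IH] f ft.
  by have [N [r [N0 rr gE]]] := gt; exists N, r; split=> // a; rewrite big_ord0 add0r expr0 mul1r.
have [N [r [N0 rr tE]]] := fd_trace_avg (ft 0%N) (IH (fun i => f i.+1) (fun i => ft i.+1)).
exists N, r; split=> // a; rewrite -tE big_ord_recl expr1 -addrA; congr (_ + _).
rewrite mulrDr mulr_sumr exprS mulrA; congr (_ + _).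
by apply: eq_bigr => i _; rewrite exprS mulrA.
Qed.

Variables (e : nat -> nat) (phi : forall m, B -> 'M[C]_(e m)).
Hypothesis phiN : norming_reps phi.

Lemma ntr_le N (M : 'M[C]_N) : (0 < N)%N -> cabs (ntr M) <= opnorm M.
Proof.
move=> N0; rewrite /ntr cabsM ComplexField.Normc.normcV.
have -> : cabs (N%:R : C) = N%:R by rewrite -(rmorph_nat (real_complex R)) cabs_real ger0_norm.
rewrite mulrC ler_pdivrMr ?ltr0n //.
apply: (le_trans (cabs_sum _ _ _)).
apply: (@le_trans _ _ (\sum_(i < N) opnorm M)).
  by apply: ler_sum => i _; exact: entry_le_opnorm.
by rewrite sumr_const card_ord mulr_natr.
Qed.

Lemma fd_trace_le t a : fd_trace t -> cabs (t a) <= cnorm a.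
Proof.
move=> [N [r [N0 rr ->]]]; apply: (le_trans (ntr_le _ N0)).
have ru := matrix_rep_ucp rr; exact: (ucp_opnorm phiN ru).
Qed.

Lemma fd_traceB t a a' : fd_trace t -> t (a - a') = t a - t a'.
Proof.
move=> /fd_trace_tracial[tl _ _ _].
have : t (-1 *: a' + a) = -1 * t a' + t a := tl _ _ _.
by rewrite scaleN1r mulN1r addrC [RHS]addrC.
Qed.

(** The representations behind [t m] are exactly multiplicative, so only convergence of the traces
    is at stake; separability allows a sequence to be extracted from the filter. *)
Lemma qd_limit (U : set_system nat) (t : nat -> B -> C) (tau : B -> C) : ProperFilter U ->
  norm_separable B -> (forall m, fd_trace (t m)) -> (forall a, flim U (fun m => t m a) (tau a)) ->
  qd_trace tau.
Proof.
move=> PU [D Dc Dd] t_fd t_tau.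
have tt m := fd_trace_tracial (t_fd m).
split.
  apply: (flim_tracial PU t_tau) => [m|m|m|a c]; try by have [] := tt m.
  rewrite (_ : (fun m => _) = fun=> 0); first exact: flim_const.
  by apply/funext => m; have [_ _ _ ->] := tt m; rewrite subrr.
have [f fD] : exists f : nat -> B, forall x, D x -> exists n, f n = x.
  have [D0|/set0P[x0 Dx0]] := eqVneq D set0.
    by exists (fun=> 0) => x; rewrite D0.
  have /pfcard_geP[D0|[h]] := Dc; first by move: Dx0; rewrite D0.
  by exists h => x Dx; have [n _ <-] := @surj _ _ _ _ h x Dx; exists n.
(* A stage at which the first j elements of a dense sequence are approximated within 1 / (j + 1). *)
have ex_m j : exists m, forall i, (i < j)%N -> cabs (t m (f i) - tau (f i)) < j.+1%:R^-1.
  suff : U [set m | forall i, (i < j)%N -> cabs (t m (f i) - tau (f i)) < j.+1%:R^-1].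
    by move=> /filter_ex.
  have j0 : 0 < j.+1%:R^-1 :> R by rewrite invr_gt0.
  move: (j.+1%:R^-1) j0 => r r0; elim: j => [|j IH].
    by apply: (@filterS _ U _ setT); last exact: filterT.
  apply: filterS2 IH (t_tau (f j) _ r0) => m /= h1 h2 i.
  by rewrite ltnS leq_eqVlt => /orP[/eqP -> //|]; exact: h1.
have [m mP] := choice ex_m.
have ex_rep j : exists N (rho : B -> 'M[C]_N), [/\ (0 < N)%N, matrix_rep rho & forall a, t (m j) a = ntr (rho a)].
  exact: t_fd.
have tB m' a a' : cabs (t m' a - t m' a') <= cnorm (a - a').
  by rewrite -fd_traceB //; exact: fd_trace_le.
have tauB a a' : cabs (tau a - tau a') <= cnorm (a - a').
  apply: (flim_cabs_le PU (x := fun m => t m a - t m a')) => [|m'] //.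
  exact: flimB.
exists (fun j => projT1 (cid (ex_rep j))), (fun j => projT1 (cid (projT2 (cid (ex_rep j))))).
have repP j : [/\ (0 < projT1 (cid (ex_rep j)))%N,
   matrix_rep (projT1 (cid (projT2 (cid (ex_rep j))))) &
   forall a, t (m j) a = ntr (projT1 (cid (projT2 (cid (ex_rep j)))) a)].
  by case: (cid (projT2 (cid (ex_rep j)))).
split=> [j|j|a c|a].
- by have [] := repP j.
- by have [_ rr _] := repP j; exact: matrix_rep_ucp.
- rewrite (_ : (fun j => _) = fun=> 0); first exact: cvg_cst.
  by apply/funext => j; have [_ [_ rM _ _] _] := repP j; rewrite rM subrr cnorm0.
apply/cvgrPdist_lt => eps eps0; have e3 : 0 < eps / 3 by rewrite divr_gt0.
have [x Dx ax] := Dd a _ e3; have [i fi] := fD x Dx.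
have [k k3] : exists k : nat, (eps / 3)^-1 < k%:R.
  by exists (Num.bound (eps / 3)^-1); apply: archi_boundP; rewrite invr_ge0 ltW.
exists (maxn i.+1 k) => // j /=; rewrite geq_max => /andP[ij kj].
rewrite sub0r normrN ger0_norm ?cabs_ge0 //.
have [_ _ <-] := repP j.
have h1 := mP j i ij; rewrite fi in h1.
have h2 : j.+1%:R^-1 < eps / 3.
  rewrite -[ltRHS]invrK ltf_pV2 ?posrE ?invr_gt0 //.
  by apply: (lt_le_trans k3); rewrite ler_nat (leq_trans kj).
have -> : t (m j) a - tau a = (t (m j) a - t (m j) x) + ((t (m j) x - tau x) + (tau x - tau a)) by ring.
apply: le_lt_trans (le_normcD _ _) _.
have h3 := le_lt_trans (tB (m j) a x) ax.
have h4 := le_normcD (t (m j) x - tau x) (tau x - tau a).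
have h5 : cabs (tau x - tau a) < eps / 3 by apply: le_lt_trans (tauB _ _) _; rewrite cnormB.
exact: three_thirds h3 h1 h2 h4 h5.
Qed.

End FdTraces.

(** * Traciality of the corner limits *)

Lemma subBB (V : zmodType) (a c a' c' : V) : (a - a') - (c - c') = (a - c) + - (a' - c').
Proof. by rewrite opprD addrACA -opprD. Qed.

Lemma div_bound (R : realFieldType) (D x y z p q : R) : 0 < D -> x <= p * y + q * z ->
  x / D <= p * (y / D) + q * (z / D).
Proof. by move=> D0 h; rewrite !mulrA -mulrDl ler_wpM2r // invr_ge0 ltW. Qed.

Lemma four_bound (R : realFieldType) (p q r : R) : p <= r -> q <= r -> 2 * p + 2 * q <= 4 * r.
Proof. lra. Qed.

Lemma defect_bound (R : realFieldType) (z x y o D : R) : 0 < D -> 0 <= x -> z <= 4 * (x * y) ->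
  y <= o * (2 * D) -> z / D ^+ 2 <= 8 * o * (x / D).
Proof.
move=> D0 x0 h1 h2; rewrite ler_pdivrMr ?exprn_gt0 //.
apply: (le_trans h1); apply: (@le_trans _ _ (4 * (x * (o * (2 * D))))).
  by rewrite ler_wpM2l // ler_wpM2l.
by rewrite le_eqVlt; apply/orP; left; apply/eqP; field; rewrite gt_eqF.
Qed.

Section Vanishing.
Context {R : realType}.

Definition vanishes (f : nat -> R) : Prop :=
  forall eps, 0 < eps -> \forall m \near \oo, f m <= eps.

Lemma vanishes_le (f g : nat -> R) k : 0 <= k -> (forall m, f m <= k * g m) ->
  vanishes g -> vanishes f.
Proof.
move=> k0 fg g0 eps e0; have k1 : 0 < k + 1 by rewrite ltr_wpDl.
have e1 : 0 < eps / (k + 1) by rewrite divr_gt0.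
apply: filterS (g0 _ e1) => m h; apply: le_trans (fg m) _.
apply: (@le_trans _ _ (k * (eps / (k + 1)))); first by rewrite ler_wpM2l.
by rewrite mulrCA ler_piMr ?ltW // ltr_pdivrMr // mul1r ltrDl.
Qed.

Lemma vanishesD (f g h : nat -> R) : (forall m, h m <= f m + g m) -> vanishes f ->
  vanishes g -> vanishes h.
Proof.
move=> hfg f0 g0 eps e0; have e2 : 0 < eps / 2 by rewrite divr_gt0.
apply: filterS2 (f0 _ e2) (g0 _ e2) => m h1 h2.
by apply: le_trans (hfg m) _; rewrite [leRHS]splitr lerD.
Qed.

Lemma vanishes_sqr (x y : nat -> R) (k : R) : 0 <= k -> (forall m, 0 <= x m) ->
  (forall m, 0 <= y m) -> (forall m, x m ^+ 2 <= k * y m) -> vanishes y ->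
  forall r, 0 < r -> \forall m \near \oo, x m < r.
Proof.
move=> k0 x0 y0 xy y_v r r0; have k1 : 0 < k + 1 by rewrite ltr_wpDl.
have e0 : 0 < (r / 2) ^+ 2 / (k + 1) by rewrite divr_gt0 // exprn_gt0 // divr_gt0.
apply: filterS (y_v _ e0) => m h.
apply: (@le_lt_trans _ _ (r / 2)); last by rewrite ltr_pdivrMr // ltr_pMr // ltr1n.
rewrite -(@ler_pXn2r _ 2) ?nnegrE ?divr_ge0 ?(ltW r0) //.
apply: (le_trans (xy m)); apply: (@le_trans _ _ ((k + 1) * y m)).
  by rewrite ler_wpM2r // lerDl.
by rewrite mulrC -ler_pdivlMr.
Qed.

End Vanishing.

Section Defect.
Context {R : realType} {G : groupType} {d : nat -> nat} {b : nat}.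
Local Notation C := R[i].
Local Notation E m := (Eidx d b m).
Variable pi : forall k, G -> 'M[C]_(d k).
Variable J : forall k, 'M[C]_(d k.+1, d k).
Variable R1 : R.
Hypothesis R1_b : 0 <= R1 < b%:R.
Hypothesis d01 : d 0%N = 1%N.
Hypothesis dR : forall k, (d k.+1)%:R <= R1 * (d k)%:R :> R.
Variable eps : bool.
Local Notation e m := (e_op R d b eps m).

Let dim0 m : 0 < (dimL (d := d) (b := b) m)%:R :> R.
Proof.
rewrite ltr0n dimL_gt0 //; rewrite -(ltr0n R); have /andP[] := R1_b; exact: le_lt_trans.
Qed.

(** The failure of M to commute with e^eps in the normalised Hilbert-Schmidt norm. It controls the
    failure of the corner functional to be tracial and behaves well under algebra operations and
    norm limits. *)
Definition comm_defect m (M : 'M[C]_#|E m|) : R :=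
  nsq (e m *m M - M *m e m) / (dimL (d := d) (b := b) m)%:R.

Lemma nsq_e_op m eps' : nsq (e_op R d b eps' m) = (dimL (d := d) (b := b) m)%:R.
Proof.
rewrite /nsq /rdot /cip e_op_adj -[_ *m _]mulmx1 -mulmxA e_op_idem mulmx1 tr_e_op.
by rewrite -(rmorph_nat (real_complex R)).
Qed.

Lemma comm_defect_le m (M : 'M[C]_#|E m|) : comm_defect M <= 4 * opnorm M ^+ 2.
Proof.
rewrite /comm_defect ler_pdivrMr // -(nsq_e_op m eps).
have h1 : nsq (e m *m M) <= opnorm M ^+ 2 * nsq (e m).
  by rewrite -nrm_le ?opnorm_ge0 // -(opnorm_star M) nrm_mulr.
have h2 : nsq (M *m e m) <= opnorm M ^+ 2 * nsq (e m).
  by rewrite -nrm_le ?opnorm_ge0 // nrm_mull.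
apply: (le_trans (nsqD_le _ _)); rewrite nsqN -mulrA.
exact: four_bound h1 h2.
Qed.

Lemma comm_defect_ge0 m (M : 'M[C]_#|E m|) : 0 <= comm_defect M.
Proof. by rewrite divr_ge0 ?nsq_ge0 // ltW. Qed.

Lemma comm_defectB m (M M' : 'M[C]_#|E m|) :
  comm_defect (M - M') <= 2 * comm_defect M + 2 * comm_defect M'.
Proof.
apply: div_bound => //.
have -> : e m *m (M - M') - (M - M') *m e m =
    (e m *m M - M *m e m) + - (e m *m M' - M' *m e m).
  by rewrite mulmxBr mulmxBl subBB.
by apply: (le_trans (nsqD_le _ _)); rewrite nsqN.
Qed.

Lemma comm_defectM m (M M' : 'M[C]_#|E m|) : comm_defect (M *m M') <=
  2 * opnorm M' ^+ 2 * comm_defect M + 2 * opnorm M ^+ 2 * comm_defect M'.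
Proof.
apply: div_bound => //.
have -> : e m *m (M *m M') - (M *m M') *m e m =
    (e m *m M - M *m e m) *m M' + M *m (e m *m M' - M' *m e m).
  by rewrite mulmxBl mulmxBr !mulmxA addrA subrK.
apply: (le_trans (nsqD_le _ _)); apply: lerD; rewrite -[leRHS]mulrA ler_wpM2l //.
  by rewrite -nrm_le ?opnorm_ge0 // -(opnorm_star M') nrm_mulr.
by rewrite -nrm_le ?opnorm_ge0 // nrm_mull.
Qed.

Lemma comm_defectZ m c (M : 'M[C]_#|E m|) : comm_defect (c *: M) = cabs c ^+ 2 * comm_defect M.
Proof. by rewrite /comm_defect -scalemxAr -scalemxAl -scalerBr nsqZ mulrA. Qed.

Lemma comm_defect_adj m (M : 'M[C]_#|E m|) : comm_defect (M^t*) = comm_defect M.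
Proof.
have h : e m *m M^t* - M^t* *m e m = - (e m *m M - M *m e m)^t*.
  by rewrite linearB map_mxB /= !trmx_mul !map_mxM e_op_adj opprB.
by rewrite /comm_defect h nsqN -nrm_sqr nrm_adj nrm_sqr.
Qed.

Lemma comm_defect_comm m (M : 'M[C]_#|E m|) : e m *m M = M *m e m -> comm_defect M = 0.
Proof. by rewrite /comm_defect => ->; rewrite subrr nsq0 mul0r. Qed.

(** The difference of traces equals tr((e M - M e) M'), and Cauchy-Schwarz applies. The 8 combines
    the square of the factor 2 in [cabs_cip] with dim E_m = 2 dim L_m. *)
Lemma comm_defect_trace m (M M' : 'M[C]_#|E m|) :
  cabs (\tr (e m *m (M *m M')) / (dimL (d := d) (b := b) m)%:R -
        \tr (e m *m (M' *m M)) / (dimL (d := d) (b := b) m)%:R) ^+ 2 <=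
  8 * opnorm M' ^+ 2 * comm_defect M.
Proof.
set D := dimL m; have D0 : 0 < D%:R :> R := dim0 m.
have -> : \tr (e m *m (M *m M')) / D%:R - \tr (e m *m (M' *m M)) / D%:R =
    cip (e m *m M - M *m e m) (M'^t*) / D%:R.
  rewrite -mulrBl; congr (_ / _); rewrite /cip trmxCK mulmxBl linearB /= mulmxA; congr (_ - _).
  by rewrite [LHS]mxtrace_mulC [RHS]mxtrace_mulC mulmxA.
rewrite cabsM exprMn.
have -> : cabs (D%:R^-1 : C) = D%:R^-1.
  by rewrite ComplexField.Normc.normcV -(rmorph_nat (real_complex R)) cabs_real ger0_norm.
have h1 : nsq M' <= opnorm M' ^+ 2 * (2 * D%:R).
  have -> : 2 * D%:R = nsq (1%:M : 'M[C]_#|E m|).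
    have -> : (1%:M : 'M[C]_#|E m|) = e m + e_op R d b (~~ eps) m.
      apply: bk_ext => c k w; rewrite bkD -[e m]mulmx1 -[e_op _ _ _ (~~ _) _]mulmx1 !bk_e.
      by case: (c) (eps) => -[]; rewrite ?addr0 ?add0r.
    have eo : rdot (e m) (e_op R d b (~~ eps) m) = 0.
      rewrite rdot_bk big1 // => c _; rewrite big1 // => k _; rewrite big1 // => w _.
      rewrite -[e m]mulmx1 -[e_op _ _ _ (~~ _) _]mulmx1 !bk_e.
      by case: (c) (eps) => -[]; rewrite ?rdot0l ?rdot0r.
    by rewrite nsqD eo mulr0 addr0 !nsq_e_op mulrDl mul1r.
  by rewrite -nrm_le ?opnorm_ge0 // -{1}[M']mulmx1 nrm_mull.
have h2 : cabs (cip (e m *m M - M *m e m) (M'^t*)) ^+ 2 <=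
    4 * (nsq (e m *m M - M *m e m) * nsq M').
  have -> : 4 * (nsq (e m *m M - M *m e m) * nsq M') =
     (2 * (nrm (e m *m M - M *m e m) * nrm (M'^t*))) ^+ 2.
    by rewrite nrm_adj !exprMn !nrm_sqr -natrX.
  by rewrite ler_pXn2r ?nnegrE ?cabs_ge0 ?mulr_ge0 ?nrm_ge0 // cabs_cip.
rewrite exprVn; exact: defect_bound D0 (nsq_ge0 _) h2 h1.
Qed.

End Defect.

Lemma closure_bound (R : realFieldType) (p q o r : R) : p <= r / 4 -> q <= 4 * o -> o <= r / 16 ->
  2 * p + 2 * q <= r.
Proof. lra. Qed.

Section Generators.
Context {R : realType} {G : groupType} {d : nat -> nat} {b : nat}.
Local Notation C := R[i].
Local Notation E m := (Eidx d b m).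
Variable pi : forall k, G -> 'M[C]_(d k).
Variable J : forall k, 'M[C]_(d k.+1, d k).

Lemma bk_F eps m n (X : 'M[C]_(#|E m|, n)) c k w :
  bk (F_op R d b eps m *m X) c k w = if (c == eps) && (k == m) then bk X c k w else 0.
Proof.
have [/andP[hk hw]|inv] := boolP ((k < m.+1)%N && (size w == (m - k)%N)); last first.
  by rewrite !bk_invalid // if_same.
have [/andP[/eqP -> km]|ce] := boolP ((c == eps) && (k == m)); last first.
  apply: bk_Eop_zero => hk' hw' a y; case: eqP => //= <-.
  by rewrite /Ecopy /Elevel /= (negbTE ce).
rewrite -[RHS]mul1mx; apply: (@bk_Eop_block R d b m n _ X _ _ _ hk hw _ _ _ hk hw).
  move=> a a'; rewrite mxE /Ecopy /Elevel /= eqxx km !andbT; congr (nat_of_bool _)%:R.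
  by apply/eqP/eqP => [/(congr1 (fun y => val (Ehcoord y))) /= /val_inj|->].
move=> a y ny; case: eqP => [e|_] //=.
by rewrite -e atE_mkE in ny.
Qed.

Lemma eq_mul m (M M' : 'M[C]_#|E m|) : (forall n (X : 'M[C]_(#|E m|, n)), M *m X = M' *m X) -> M = M'.
Proof. by move=> h; rewrite -[M]mulmx1 h mulmx1. Qed.

Lemma e_F_comm eps eps' m : e_op R d b eps m *m F_op R d b eps' m = F_op R d b eps' m *m e_op R d b eps m.
Proof.
apply: eq_mul => n X; rewrite -!mulmxA; apply: bk_ext => c k w.
by rewrite bk_e !bk_F bk_e; case: (c == eps) (c == eps') (k == m) => -[] -[].
Qed.

Lemma e_e_comm eps eps' m : e_op R d b eps m *m e_op R d b eps' m = e_op R d b eps' m *m e_op R d b eps m.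
Proof.
apply: eq_mul => n X; rewrite -!mulmxA; apply: bk_ext => c k w.
by rewrite !bk_e; case: (c == eps) (c == eps') => -[].
Qed.

Lemma e_sigma_comm eps g m : e_op R d b eps m *m sigma_op pi b g m = sigma_op pi b g m *m e_op R d b eps m.
Proof.
apply: eq_mul => n X; rewrite -!mulmxA; apply: bk_ext => c k w.
by rewrite bk_e !bk_sigma bk_e; case: (c == eps); rewrite ?mulmx0.
Qed.

Lemma e_T_comm eps eps' i m : e_op R d b eps m *m T_op J eps' i m = T_op J eps' i m *m e_op R d b eps m.
Proof.
apply: eq_mul => n X; rewrite -!mulmxA; apply: bk_ext => c [|k] w.
  by rewrite bk_e !bk_T0 if_same.
by rewrite bk_e !bk_T bk_e; case: (c == eps) (c == eps') => -[]; rewrite ?mulmx0.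
Qed.

Lemma nsq_s_op m : nsq (s_op R d b m) = (d m)%:R.
Proof.
rewrite nsqE exchange_big /=.
transitivity (\sum_(r < #|E m|) (Ecopy (enum_val r) && (Elevel (enum_val r) == m))%:R : R).
  apply: eq_bigr => r _; rewrite (bigD1 (enum_rank (false, (enum_val r).2))) //= big1 => [|k kr].
    rewrite mxE enum_rankK /= eqxx andbT addr0.
    by case: (_ && _); rewrite ?ComplexField.Normc.normc1 ?cabs0 ?expr1n ?expr0n.
  rewrite mxE [X in (nat_of_bool X)%:R](_ : _ = false) ?cabs0 ?expr0n //.
  apply/negP => /and4P[h1 _ _ /eqP h4]; case/negP: kr; apply/eqP.
  rewrite -[k]enum_valK; congr enum_rank; rewrite -h4.
  by move: h1; rewrite /Ecopy; case: (enum_val k) => -[].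
rewrite (sum_rank_copy_level m (fun c k => c && (k == m))); congr _%:R.
rewrite big_bool /= [X in (_ + X)%N]big1 // addn0 big_ord_recr /= eqxx subnn muln1 mul1n.
by rewrite big1 // => k _; rewrite ltn_eqF //.
Qed.

Variable R1 : R.
Hypothesis R1_b : 0 <= R1 < b%:R.
Hypothesis d01 : d 0%N = 1%N.
Hypothesis dR : forall k, (d k.+1)%:R <= R1 * (d k)%:R :> R.
Variable eps : bool.

Let prodE' := prodE R d b.

Let b0 : 0 < b%:R :> R.
Proof. by have /andP[] := R1_b; exact: le_lt_trans. Qed.

Lemma vanishes_dim_ratio : vanishes (fun m => (d m)%:R / (dimL (d := d) (b := b) m)%:R : R).
Proof.
have /andP[R0 Rb] := R1_b.
have x0 : 0 <= R1 / b%:R by rewrite divr_ge0 // ltW.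
have x1 : R1 / b%:R < 1 by rewrite ltr_pdivrMr // mul1r.
apply: (vanishes_le ler01 (g := fun m => (R1 / b%:R) ^+ m)) => [m|eps' e0].
  have dm : (d m)%:R <= R1 ^+ m.
    elim: m => [|m IH]; first by rewrite d01.
    by apply: (le_trans (dR m)); rewrite exprS ler_wpM2l.
  have Lb : b%:R ^+ m <= (dimL (d := d) (b := b) m)%:R :> R.
    by rewrite -natrX ler_nat /dimL big_ord_recl d01 mul1n subn0 leq_addr.
  rewrite mul1r expr_div_n ler_pM ?invr_ge0 ?ler0n //.
  by rewrite lef_pV2 ?posrE ?exprn_gt0 // (lt_le_trans _ Lb) ?exprn_gt0.
have /cvgrPdist_le/(_ _ e0) : (R1 / b%:R) ^+ n @[n --> \oo] --> (0 : R).
  by apply: cvg_expr; rewrite ger0_norm.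
by apply: filterS => n; rewrite sub0r normrN ger0_norm // exprn_ge0.
Qed.

(** Vanishing defect defines a norm-closed *-subalgebra, so generators suffice. Sequences in the c_0
    sum tend to 0 in norm; e, F, T and sigma commute with e^eps; s has square Hilbert-Schmidt norm
    d_m, negligible against dim L_m. *)
Lemma defect_vanishes (a : prodE') : cstar_gen (@generators R G d pi J b) a ->
  vanishes (fun m => comm_defect eps (a m)).
Proof.
have zero (x : prodE') : (forall m, e_op R d b eps m *m x m = x m *m e_op R d b eps m) ->
    vanishes (fun m => comm_defect eps (x m)).
  by move=> h r r0; near=> m; rewrite comm_defect_comm // ltW.
have opn (x : prodE') m : opnorm (x m) ^+ 2 <= cnorm x ^+ 2.
  by rewrite ler_pXn2r ?nnegrE ?opnorm_ge0 ?cnorm_ge0 //; exact: (lnorm_ge x m).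
move=> /(_ (fun a => vanishes (fun m => comm_defect eps (a m)))); apply.
  split=> [|x y vx vy|x y vx vy|c x vx|].
  - by apply: zero => m; rewrite mulmx1 mul1mx.
  - apply: (vanishesD (f := fun m => 2 * comm_defect eps (x m)) (g := fun m => 2 * comm_defect eps (y m))).
    + by move=> m; exact: (comm_defectB R1_b d01).
    + by apply: (vanishes_le _ _ vx) => [|m]; [|exact: lexx].
    + by apply: (vanishes_le _ _ vy) => [|m]; [|exact: lexx].
  - apply: (vanishesD (f := fun m => 2 * opnorm (y m) ^+ 2 * comm_defect eps (x m))
      (g := fun m => 2 * opnorm (x m) ^+ 2 * comm_defect eps (y m))).
    + by move=> m; exact: (comm_defectM R1_b d01).
    + apply: (vanishes_le (k := 2 * cnorm y ^+ 2) _ _ vx) => [|m]; first by rewrite mulr_ge0 ?sqr_ge0.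
      apply: ler_wpM2r; first exact: comm_defect_ge0.
      by apply: ler_wpM2l => //; exact: opn.
    + apply: (vanishes_le (k := 2 * cnorm x ^+ 2) _ _ vy) => [|m]; first by rewrite mulr_ge0 ?sqr_ge0.
      apply: ler_wpM2r; first exact: comm_defect_ge0.
      by apply: ler_wpM2l => //; exact: opn.
  - apply: (vanishes_le (k := cabs c ^+ 2) _ _ vx) => [|m]; first exact: sqr_ge0.
    by rewrite -comm_defectZ.
  - split=> [x vx|u l vu ul r r0].
      apply: (vanishes_le ler01 _ vx) => m.
      by rewrite mul1r -(comm_defect_adj eps (x m)).
    have r2 : 0 < r / 2 by rewrite divr_gt0.
    (* The minimum with 1 lets the square of the approximation error be bounded by the error
       itself. *)
    have e0 : 0 < Num.min 1 (r / 16) by rewrite lt_min ltr01 divr_gt0.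
    have /cvgrPdist_lt/(_ _ e0)[n _ /(_ n (leqnn n))] := ul.
    rewrite sub0r normrN ger0_norm ?cnorm_ge0 // lt_min => /andP[n1 nr].
    have r4 : 0 < r / 4 by rewrite divr_gt0.
    apply: filterS (vu n _ r4) => m h.
    have -> : l m = u n m - (u n - l) m by rewrite [(u n - l) m]/= opprB addrC subrK.
    apply: (le_trans (comm_defectB R1_b d01 _ _ _)).
    have h2 := comm_defect_le R1_b d01 eps ((u n - l) m).
    have h3 : opnorm ((u n - l) m) ^+ 2 <= r / 16.
      apply: (le_trans (opn _ _)); apply: le_trans (ltW nr).
      by rewrite expr2 ler_piMl ?cnorm_ge0 // ltW.
    exact: closure_bound h h2 h3.
move=> x [[[[[x0|[e' xE]]|[e' xE]]|[e' [i xE]]]|[g xE]]|xE].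
- move=> r r0.
  have e0 : 0 < Num.min 1 (r / 4) by rewrite lt_min ltr01 divr_gt0.
  have /cvgrPdist_lt/(_ _ e0) := x0.
  apply: filterS => m; rewrite sub0r normrN ger0_norm ?cnorm_ge0 // lt_min => /andP[m1 mr].
  apply: (le_trans (comm_defect_le R1_b d01 _ _)).
  rewrite mulrC -ler_pdivlMr //; apply: le_trans (ltW mr).
  by rewrite expr2 ler_piMl ?opnorm_ge0 // ltW.
- by apply: zero => m; rewrite xE e_e_comm.
- by apply: zero => m; rewrite xE e_F_comm.
- by apply: zero => m; rewrite xE e_T_comm.
- by apply: zero => m; rewrite xE e_sigma_comm.
apply: (vanishes_le (k := 4) _ _ vanishes_dim_ratio) => // m.
rewrite /comm_defect mulrA ler_wpM2r ?invr_ge0 ?ler0n // xE -nsq_s_op.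
apply: (le_trans (nsqD_le _ _)); rewrite nsqN.
have h1 : nsq (e_op R d b eps m *m s_op R d b m) <= nsq (s_op R d b m).
  rewrite -[leRHS]mul1r -[1](expr1n _ 2) -nrm_le // (le_trans (nrm_mull _ _)) //.
  by rewrite ler_wpM2r ?nrm_ge0 // e_op_le1.
have h2 : nsq (s_op R d b m *m e_op R d b eps m) <= nsq (s_op R d b m).
  rewrite -[leRHS]mul1r -[1](expr1n _ 2) -nrm_le // (le_trans (nrm_mulr _ _)) //.
  by rewrite ler_wpM2r ?nrm_ge0 // e_op_adj e_op_le1.
exact: four_bound h1 h2.
Unshelve. all: by end_near.
Qed.

End Generators.

(** * Separability and residual finite-dimensionality *)

Lemma countableU T (A B : set T) : countable A -> countable B -> countable (A `|` B).
Proof.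
move=> Ac Bc; rewrite -bigcup2E; apply: bigcup_countable => // -[|[|i]] _ //=.
Qed.

Section Separable.
Context {R : realType}.
Local Notation C := R[i].
Variable B : cstarAlgType R.

Definition gauss (q : rat * rat) : C := ((ratr q.1 : R) +i* (ratr q.2 : R))%C.

Lemma gauss_dense (k : C) (r : R) : 0 < r -> exists q, cabs (k - gauss q) < r.
Proof.
move=> r0; case: k => a c; have r2 : 0 < r / 2 by rewrite divr_gt0.
have near_rat (x : R) : exists q : rat, `|x - ratr q| < r / 2.
  have xr : x < x + r / 2 by rewrite ltrDl.
  have [q h] := rat_in_itvoo xr; exists q; move: h; rewrite in_itv /= => /andP[h1 h2].
  by rewrite distrC gtr0_norm ?subr_gt0 // ltrBlDl.
have [p pa] := near_rat a; have [q qc] := near_rat c; exists (p, q).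
by apply: le_lt_trans (cabs_le _) _; rewrite [ltRHS]splitr ltrD.
Qed.

Definition approximable (D : set B) : set B :=
  [set a | forall r : R, 0 < r -> exists2 x, D x & cnorm (a - x) < r].

Variable G0 : set B.

(** Closure of a set under the *-algebra operations with Gaussian rational scalars, one round at a
    time; every stage stays countable. *)
Fixpoint stage (n : nat) : set B :=
  if n is n'.+1 then
    stage n' `|` \bigcup_(x in stage n') \bigcup_(y in stage n') [set x - y] `|`
    \bigcup_(x in stage n') \bigcup_(y in stage n') [set x * y] `|`
    \bigcup_(q in [set: rat * rat]) \bigcup_(x in stage n') [set gauss q *: x] `|`
    \bigcup_(x in stage n') [set star x]
  else G0 `|` [set 1].

Definition stages : set B := \bigcup_n stage n.

Lemma countable_stages : countable G0 -> countable stages.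
Proof.
move=> G0c; apply: bigcup_countable => // n _; elim: n => [|n IH] /=.
  exact: countableU.
apply: countableU; last exact: bigcup_countable.
apply: countableU; last by apply: bigcup_countable => // q _; exact: bigcup_countable.
apply: countableU; last by apply: bigcup_countable => // x _; exact: bigcup_countable.
by apply: countableU => //; apply: bigcup_countable => // x _; exact: bigcup_countable.
Qed.

Lemma stage_le m n : (m <= n)%N -> stage m `<=` stage n.
Proof.
move=> /subnK <-; elim: (n - m)%N => [|k IH] // x /IH h.
by rewrite addSn /=; do 4!left.
Qed.

Lemma stages_op2 (op : B -> B -> B) x y : (forall n, stage n x -> stage n y -> stage n.+1 (op x y)) ->
  stages x -> stages y -> stages (op x y).
Proof.
move=> h [m _ mx] [n _ ny]; exists (maxn m n).+1 => //; apply: h.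
  exact: stage_le (leq_maxl _ _) _ mx.
exact: stage_le (leq_maxr _ _) _ ny.
Qed.

Lemma stagesB x y : stages x -> stages y -> stages (x - y).
Proof.
apply: (stages_op2 (op := fun x y => x - y)) => n nx ny /=.
by left; left; left; right; exists x => //; exists y.
Qed.

Lemma stagesM x y : stages x -> stages y -> stages (x * y).
Proof.
apply: (stages_op2 (op := fun x y => x * y)) => n nx ny /=.
by left; left; right; exists x => //; exists y.
Qed.

Lemma stagesZ q x : stages x -> stages (gauss q *: x).
Proof. by move=> [n _ nx]; exists n.+1 => //; left; right; exists q => //; exists x. Qed.

Lemma stagesS x : stages x -> stages (star x).
Proof. by move=> [n _ nx]; exists n.+1 => //; right; exists x. Qed.

(** Norm limits of the countable algebra [stages] form a closed *-subalgebra over the complex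
    scalars, hence contain everything generated by G0. *)
Lemma approximable_subalg : cstar_subalg (approximable stages).
Proof.
have small (r k : R) : 0 < r -> 0 <= k -> 0 < r / 2 / (k + 1).
  by move=> r0 k0; rewrite !divr_gt0 // ltr_wpDl.
have small_mul (r k s : R) : 0 <= k -> s < r / 2 / (k + 1) -> 0 <= s -> k * s < r / 2.
  move=> k0 h s0; apply: (@le_lt_trans _ _ ((k + 1) * s)); first by rewrite ler_wpM2r // lerDl.
  by rewrite mulrC -ltr_pdivlMr ?ltr_wpDl.
split=> [r r0|a c aS cS r r0|a c aS cS r r0|k a aS r r0|].
- by exists 1; [exists 0%N => //; right|rewrite subrr cnorm0].
- have r2 : 0 < r / 2 by rewrite divr_gt0.
  have [x Dx ax] := aS _ r2; have [y Dy cy] := cS _ r2; exists (x - y); first exact: stagesB.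
  have -> : a - c - (x - y) = (a - x) - (c - y) by rewrite !opprD !opprK addrACA.
  by apply: le_lt_trans (cnormD _ _) _; rewrite cnormN [ltRHS]splitr ltrD.
- have [x Dx ax] := aS _ (small _ _ r0 (cnorm_ge0 c)).
  have [y Dy cy] := cS _ (small _ _ r0 (cnorm_ge0 x)).
  exists (x * y); first exact: stagesM.
  have -> : a * c - x * y = (a - x) * c + x * (c - y) by rewrite mulrBl mulrBr addrA subrK.
  apply: le_lt_trans (cnormD _ _) _; rewrite [ltRHS]splitr.
  apply: ltrD; apply: le_lt_trans (cnormM _ _) _; last by apply: small_mul; rewrite ?cnorm_ge0.
  by rewrite mulrC; apply: small_mul; rewrite ?cnorm_ge0.
- have [x Dx ax] := aS _ (small _ _ r0 (cabs_ge0 k)).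
  have [q kq] := gauss_dense k (small _ _ r0 (cnorm_ge0 x)).
  exists (gauss q *: x); first exact: stagesZ.
  have -> : k *: a - gauss q *: x = k *: (a - x) + (k - gauss q) *: x.
    by rewrite scalerBr scalerBl addrA subrK.
  apply: le_lt_trans (cnormD _ _) _; rewrite [ltRHS]splitr.
  apply: ltrD; rewrite [cnorm _]cnormZ; first by apply: small_mul; rewrite ?cabs_ge0 ?cnorm_ge0.
  by rewrite mulrC; apply: small_mul; rewrite ?cabs_ge0 ?cnorm_ge0.
split=> [a aS r r0|u l uS ul r r0].
  have [x Dx ax] := aS r r0; exists (star x); first exact: stagesS.
  by rewrite -starN -starD cnorm_starE.
have r2 : 0 < r / 2 by rewrite divr_gt0.
have /cvgrPdist_lt/(_ _ r2)[n _ /(_ n (leqnn n))] := ul.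
rewrite sub0r normrN ger0_norm ?cnorm_ge0 // => h.
have [x Dx ax] := uS n _ r2; exists x => //.
by apply: le_lt_trans (cnormBD (u n) _ _) _; rewrite [ltRHS]splitr ltrD // cnormB.
Qed.

Lemma approximable_gen : G0 `<=` approximable stages.
Proof. by move=> x Gx r r0; exists x; [exists 0%N => //; left|rewrite subrr cnorm0]. Qed.

End Separable.

Lemma countable_union_of T I (A : I -> set T) : countable [set: I] -> (forall i, countable (A i)) ->
  countable [set x | exists i, A i x].
Proof.
move=> Ic Ac; rewrite (_ : [set x | _] = \bigcup_i A i); first exact: bigcup_countable.
by apply/seteqP; split=> x [n]; [exists n|move=> _ nx; exists n].
Qed.

Lemma countable_subsingleton T (A : set T) : (forall x y, A x -> A y -> x = y) -> countable A.
Proof.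
move=> h; apply/countable_injP; exists (fun=> 0%N) => x y.
by rewrite !inE => xA yA _; exact: h.
Qed.

Section AlgA.
Context {R : realType} {G : groupType} {d : nat -> nat} {b : nat}.
Local Notation C := R[i].
Local Notation E m := (Eidx d b m).
Variable pi : forall k, G -> 'M[C]_(d k).
Variable J : forall k, 'M[C]_(d k.+1, d k).
Local Notation A := (algA pi J b).
Local Notation P := (prodE R d b : cstarAlgType R).
Local Notation gens := (@generators R G d pi J b).

Definition coord m (a : A) : 'M[C]_#|E m| := (val a : P) m.

Lemma coord_norming : norming_reps coord.
Proof.
split=> [m|m a|a c h].
- by split.
- exact: (lnorm_ge (val a) m).
- exact: (lnorm_le h).
Qed.

Lemma lift_gen (x : P) : cstar_gen gens x -> exists a : A, val a = x.
Proof. by move=> gx; exists (Sub x (mem_set gx)); rewrite SubK. Qed.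

Lemma val_gen (a : A) : cstar_gen gens (val a).
Proof. exact: set_mem (valP a). Qed.

Lemma lift_generator (x : P) : gens x -> exists a : A, forall m, coord m a = x m.
Proof.
move=> gx; have [|a aE] := @lift_gen x; first by move=> S _ gS; exact: gS.
by exists a => m; rewrite /coord aE.
Qed.

Lemma algA_generators : (forall k, unitary_mxrep (pi k)) -> (forall k, (J k)^t* *m J k = 1%:M) ->
  exists (eE : bool -> A) (sG : G -> A) (TE : bool -> 'I_b -> A) (sE : A),
  [/\ forall eps m, coord m (eE eps) = e_op R d b eps m,
      forall g m, coord m (sG g) = sigma_op pi b g m,
      forall eps i m, coord m (TE eps i) = T_op J eps i m &
      forall m, coord m sE = s_op R d b m].
Proof.
move=> piU JJ; have [he _ hT hs hS] := generators_bounded b piU JJ.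
have /choice[eE eP] : forall eps, exists a : A, forall m, coord m a = e_op R d b eps m.
  move=> eps; have [x xE] := he eps; have [|a aE] := @lift_generator x.
    by do 4!left; right; exists eps.
  by exists a => m; rewrite aE xE.
have /choice[sG sP] : forall g, exists a : A, forall m, coord m a = sigma_op pi b g m.
  move=> g; have [x xE] := hs g; have [|a aE] := @lift_generator x.
    by left; right; exists g.
  by exists a => m; rewrite aE xE.
have /choice[TE TP] : forall t : bool * 'I_b, exists a : A, forall m, coord m a = T_op J t.1 t.2 m.
  move=> t; have [x xE] := hT t.1 t.2; have [|a aE] := @lift_generator x.
    by do 2!left; right; exists t.1, t.2.
  by exists a => m; rewrite aE xE.
have [x xE] := hS; have [|sE sEP] := @lift_generator x; first by right.
exists eE, sG, (fun eps i => TE (eps, i)), sE; split; [exact: eP|exact: sP| |].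
  by move=> eps i m; exact: (TP (eps, i)).
by move=> m; rewrite sEP xE.
Qed.

Lemma algA_unital : exists u : A, forall a : A, u * a = a /\ a * u = a.
Proof. by exists 1 => a; rewrite mul1r mulr1. Qed.

Lemma algA_rfd : residually_finite_dimensional A.
Proof.
move=> a c ac.
have [m mac] : exists m, coord m a <> coord m c.
  apply: contrapT => h; apply: ac; apply: val_inj; apply: linftyP => m.
  by apply: contrapT => h'; apply: h; exists m.
have [/(_ m) [lin mul st _] _ _] := coord_norming.
exists #|E m|, (coord m); split; last exact: mac.
by split=> [k x y|x y|x]; [exact: lin|exact: mul|exact: st].
Qed.

(** Row and column are plain numbers, so that triples of naturals index the matrix units of all E_m
    together; out of range the value is 0. *)
Definition unit_at m i j m' : 'M[C]_#|E m'| :=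
  \matrix_(r, s) [&& m' == m, val r == i & val s == j]%:R.

Lemma unit_at_ne m i j m' : m' != m -> unit_at m i j m' = 0.
Proof. by move=> /negbTE h; apply/matrixP => r s; rewrite !mxE h. Qed.

Let unit_bound m i j : exists c : R, forall m', cnorm (unit_at m i j m') <= c.
Proof.
exists (opnorm (unit_at m i j m)) => m'; have [->|h] := eqVneq m' m; first exact: lexx.
by rewrite unit_at_ne // cnorm0 opnorm_ge0.
Qed.

Definition unit_seq m i j : P := Linfty (unit_bound m i j).

(** The c_0 sum is replaced among the generators by its matrix units, whose linear span is dense in
    it. *)
Lemma algA_separable : countable [set: G] -> norm_separable A.
Proof.
move=> Gc.
pose G0 : set P := [set x | exists t : nat * nat * nat, x = unit_seq t.1.1 t.1.2 t.2] `|`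
  [set x | exists eps, forall m, x m = e_op R d b eps m] `|`
  [set x | exists eps, forall m, x m = F_op R d b eps m] `|`
  [set x | exists t : bool * 'I_b, forall m, x m = T_op J t.1 t.2 m] `|`
  [set x | exists g, forall m, x m = sigma_op pi b g m] `|`
  [set x | forall m, x m = s_op R d b m].
have one (F : forall m, 'M[C]_#|E m|) : countable [set x : P | forall m, x m = F m].
  by apply: countable_subsingleton => x y xF yF; apply: linftyP => m; rewrite xF yF.
have G0c : countable G0.
  apply: countableU; last exact: one.
  apply: countableU; last by apply: countable_union_of => // g; exact: one.
  apply: countableU; last by apply: countable_union_of => // t; exact: one.
  apply: countableU; last by apply: countable_union_of => // eps; exact: one.
  apply: countableU; last by apply: countable_union_of => // eps; exact: one.
  by apply: countable_union_of => // t; apply: countable_subsingleton => x y -> ->.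
pose GA : set A := [set a | G0 (val a)].
have GAc : countable GA.
  have /countable_injP[f fi] := G0c; apply/countable_injP; exists (f \o val) => x y.
  rewrite !inE => xG yG fxy; apply: val_inj; apply: fi fxy; rewrite inE //.
exists (stages GA); first exact: countable_stages.
have SA := approximable_subalg GA.
(* The elements of the product that come from approximable elements of A; once S' is a closed
   *-subalgebra containing the generators, it contains all of A. *)
pose S' : set P := [set x | exists2 a : A, val a = x & approximable (stages GA) a].
suff h : forall a : A, S' (val a) by move=> a r r0; have [a' /val_inj -> aS] := h a; exact: aS.
have [S1 SB SM SZ [SS SL]] := SA.
have S'A : cstar_subalg S'.
  split=> [|x y [a <- aS] [c <- cS]|x y [a <- aS] [c <- cS]|k x [a <- aS]|].
  - by exists 1.
  - exists (a - c); [exact: rmorphB|exact: SB].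
  - exists (a * c); [exact: rmorphM|exact: SM].
  - by exists (k *: a); [|exact: SZ].
  split=> [x [a <- aS]|u l uS ul].
    by exists (star a); [|exact: SS].
  have /choice[v vP] : forall n, exists a : A, val a = u n /\ approximable (stages GA) a.
    by move=> n; have [a aE aS] := uS n; exists a.
  have [|a aE] := @lift_gen l.
    have [_ _ _ _ [_ cl]] := cstar_gen_subalg gens.
    by apply: (cl u); [move=> n; have [<- _] := vP n; exact: val_gen|exact: ul].
  exists a; first exact: aE.
  apply: (SL v) => [n|]; first by have [] := vP n.
  have e : (fun n => cnorm (v n - a)) = (fun n => cnorm (u n - l)).
    apply/funext => n; have [vn _] := vP n.
    rewrite -vn -aE; change (cnorm (val (v n - a)) = cnorm (val (v n) - val a)).
    by congr cnorm; exact: rmorphB.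
  by rewrite e; exact: ul.
have G0S x : gens x -> G0 x -> S' x.
  move=> gx Gx; have [|a aE] := @lift_gen x; first by move=> S _ gS; exact: gS.
  exists a; first exact: aE.
  by apply: approximable_gen; change (G0 (val a)); rewrite aE; exact: Gx.
have S'0 : S' 0 by have [S'1 S'B _ _ _] := S'A; rewrite -(subrr 1); exact: (S'B _ _ S'1 S'1).
have S'D x y : S' x -> S' y -> S' (x + y).
  move=> xS yS; have [_ S'B _ _ _] := S'A.
  by rewrite -[y]opprK -[- y]sub0r; exact: (S'B _ _ xS (S'B _ _ S'0 yS)).
have S'sum (I : finType) (F : I -> P) : (forall i, S' (F i)) -> S' (\sum_i F i).
  by move=> FS; apply: (big_ind S' S'0 S'D) => i _; exact: FS.
have unitS m i j : S' (unit_seq m i j).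
  apply: G0S; last by do 5!left; exists (m, i, j).
  do 5!left; rewrite /c0_sum /=; apply/cvgrPdist_lt => r r0; exists m.+1 => // m' /= mm.
  by rewrite unit_at_ne ?cnorm0 ?subrr ?normr0 // gtn_eqF.
have atD m : {morph (fun x : P => x m) : x y / x + y} by [].
have singleS (x : P) m : S' (\sum_(i < #|E m|) \sum_(j < #|E m|) x m i j *: unit_seq m i j).
  have [_ _ _ S'Z _] := S'A.
  by apply: (S'sum) => i; apply: (S'sum) => j; exact: S'Z.
have singleE (x : P) m m' :
    (\sum_(i < #|E m|) \sum_(j < #|E m|) x m i j *: unit_seq m i j : P) m' =
    if m' == m then x m' else 0.
  rewrite (big_morph _ (atD m') (erefl _)).
  under eq_bigr => i _ do rewrite (big_morph _ (atD m') (erefl _)).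
  case: eqP => [->|/eqP mm]; last first.
    rewrite big1 // => i _; rewrite big1 // => j _.
    change (x m i j *: unit_at m i j m' = 0).
    by rewrite unit_at_ne // scaler0.
  rewrite [RHS]matrix_sum_delta; apply: eq_bigr => i _; apply: eq_bigr => j _.
  change (x m i j *: unit_at m i j m = x m i j *: delta_mx i j); congr (_ *: _).
  by apply/matrixP => r s; rewrite !mxE eqxx.
move=> a; apply: (val_gen a) => // x gx.
have [x0|nx0] := pselect (c0_sum x); last first.
  apply: G0S => //; case: gx => [[[[[//|h]|h]|[e [i h]]]|h]|h].
  - by do 4!left; right.
  - by do 3!left; right.
  - by do 2!left; right; exists (e, i).
  - by left; right.
  - by right.
(* Finite truncations are combinations of matrix units, and they converge in norm because the
   coordinates tend to 0. *)
pose trunc n : P := \sum_(m < n) \sum_(i < #|E m|) \sum_(j < #|E m|) x m i j *: unit_seq m i j.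
have truncE n m : trunc n m = if (m < n)%N then x m else 0.
  rewrite /trunc (big_morph _ (atD m) (erefl _)).
  under eq_bigr => i _ do rewrite singleE.
  case: ltnP => mn.
    by rewrite (bigD1 (Ordinal mn)) //= eqxx big1 ?addr0 // => i im; case: eqP => // mi;
      case/eqP: im; exact: val_inj.
  rewrite big1 // => i _; case: eqP => // mi.
  by have := ltn_ord i; rewrite -mi ltnNge mn.
have [_ _ _ _ [_ cl]] := S'A; apply: (cl trunc) => [n|].
  by apply: S'sum => m; exact: singleS.
apply/cvgrPdist_le => r r0.
have /cvgrPdist_le/(_ _ r0)[N _ xN] := x0.
exists N => // n /= Nn; rewrite sub0r normrN ger0_norm ?cnorm_ge0 //.
apply: lnorm_le => m; change (cnorm (trunc n m - x m) <= r); rewrite truncE.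
case: ltnP => mn; first by rewrite subrr cnorm0 ltW.
rewrite sub0r cnormN; have := xN m (leq_trans Nn mn).
by rewrite sub0r normrN ger0_norm ?cnorm_ge0.
Qed.

End AlgA.

(** * The traces mu1, mu2 and tau *)

Section CornerTraces.
Context {R : realType} {G : groupType} {d : nat -> nat} {b : nat}.
Local Notation C := R[i].
Local Notation E m := (Eidx d b m).
Variable pi : forall k, G -> 'M[C]_(d k).
Variable J : forall k, 'M[C]_(d k.+1, d k).
Local Notation A := (algA pi J b).
Variable R1 : R.
Hypothesis R1_b : 0 <= R1 < b%:R.
Hypothesis d01 : d 0%N = 1%N.
Hypothesis dR : forall k, (d k.+1)%:R <= R1 * (d k)%:R :> R.
Local Notation dL m := (dimL (d := d) (b := b) m).

Let dim0 m : (0 < dL m)%N.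
Proof. by apply: dimL_gt0 => //; rewrite -(ltr0n R); have /andP[] := R1_b; exact: le_lt_trans. Qed.

Let dimC m : (dL m)%:R != 0 :> C.
Proof. by rewrite pnatr_eq0 -lt0n. Qed.

Definition corner eps m (M : 'M[C]_#|E m|) : C := \tr (e_op R d b eps m *m M) / (dL m)%:R.

Lemma corner_scalar eps m (c : C) (M M' : 'M[C]_#|E m|) : corner eps (c *: M + M') = c * corner eps M + corner eps M'.
Proof. by rewrite /corner mulmxDr -scalemxAr linearD linearZ /= mulrDl mulrA. Qed.

Lemma corner_pos eps m (M : 'M[C]_#|E m|) :
  corner eps (m := m) (M^t* *m M) = (nsq (M *m e_op R d b eps m) / (dL m)%:R)%:C%C.
Proof.
rewrite /corner rmorphM fmorphV rmorph_nat; congr (_ / _).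
set e := e_op R d b eps m.
transitivity (cip (M *m e) (M *m e)); last exact: cip_nsq.
have ee : e *m e = e by have := e_op_idem eps (1%:M : 'M[C]_#|E m|); rewrite !mulmx1.
rewrite /cip trmx_mul map_mxM e_op_adj -/e.
by rewrite [RHS]mxtrace_mulC -[in LHS]ee -!mulmxA [LHS]mxtrace_mulC !mulmxA.
Qed.

Lemma corner1 eps m : corner eps (m := m) 1%:M = 1.
Proof. by rewrite /corner mulmx1 tr_e_op mulfV. Qed.

Lemma corner_le eps m (M : 'M[C]_#|E m|) : cabs (corner eps (m := m) M) <= opnorm M.
Proof.
rewrite /corner cabsM ComplexField.Normc.normcV.
have -> : cabs ((dL m)%:R : C) = (dL m)%:R.
  by rewrite -(rmorph_nat (real_complex R)) cabs_real ger0_norm.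
rewrite ler_pdivrMr ?ltr0n //.
have eM r : (e_op R d b eps m *m M) r r = (Ecopy (enum_val r) == eps)%:R * M r r.
  rewrite mxE (bigD1 r) //= mxE eqxx big1 ?addr0 // => k /negbTE kr.
  by rewrite mxE (inj_eq enum_val_inj) eq_sym kr mul0r.
rewrite /mxtrace (eq_bigr _ (fun r _ => eM r)).
apply: (le_trans (cabs_sum _ _ _)).
apply: (@le_trans _ _ (\sum_(r < #|E m|) opnorm M * (Ecopy (enum_val r) == eps)%:R)).
  apply: ler_sum => r _; rewrite cabsM mulrC ler_pM ?cabs_ge0 ?entry_le_opnorm //.
  by case: (_ == _); rewrite ?ComplexField.Normc.normc1 ?cabs0.
rewrite -mulr_sumr (sum_rank_copy_level m (fun c _ => c == eps)) ler_wpM2l ?opnorm_ge0 //.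
rewrite ler_nat (bigD1 eps) //= [X in (_ + X)%N]big1 => [|c /negbTE ce].
  by rewrite addn0 leq_sum // => k _; rewrite eqxx mul1n.
by rewrite big1 // => k _; rewrite ce mul0n.
Qed.

Lemma corner_e_other m : corner false (m := m) (e_op R d b true m) = 0.
Proof.
rewrite /corner (_ : _ *m _ = 0) ?mxtrace0 ?mul0r //.
by apply: bk_ext => c k w; rewrite bk0 bk_e -[e_op _ _ _ true _]mulmx1 bk_e; case: c.
Qed.

Lemma e_op_sum m : e_op R d b false m + e_op R d b true m = 1%:M.
Proof.
apply: bk_ext => c k w; rewrite bkD -[e_op _ _ _ false _]mulmx1 -[e_op _ _ _ true _]mulmx1 !bk_e.
by case: c; rewrite ?addr0 ?add0r.
Qed.

Lemma ntr_corner m (M : 'M[C]_#|E m|) :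
  ntr M = 2^-1 * corner false (m := m) M + 2^-1 * corner true (m := m) M.
Proof.
have dE : #|E m|%:R = (dL m)%:R + (dL m)%:R :> C.
  by rewrite -mxtrace1 -e_op_sum linearD /= !tr_e_op.
rewrite /ntr dE /corner -{1}[M]mul1mx -e_op_sum mulmxDl linearD /=.
move: (\tr _) (\tr _) ((dL m)%:R : C) (dimC m) => x y D D0.
by field; rewrite D0 -mulr2n mulrn_eq0.
Qed.

Lemma Eidx_gt0 m : (0 < #|E m|)%N.
Proof.
rewrite -(ltr0n R).
have dE : #|E m|%:R = (dL m)%:R + (dL m)%:R :> C.
  by rewrite -mxtrace1 -e_op_sum linearD /= !tr_e_op.
by rewrite ltr0n lt0n -(pnatr_eq0 C) dE -natrD pnatr_eq0 -lt0n addn_gt0 dim0.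
Qed.

Variable U : set_system nat.
Hypothesis ultraU : UltraFilter U.
Hypothesis Uoo : \oo `<=` U.
Let PU : ProperFilter U := @ultra_proper _ _ ultraU.

Lemma corner_limit_exists eps : exists mu : A -> C,
  forall a, flim U (fun m => corner eps (m := m) (coord m a)) (mu a).
Proof.
have /choice[mu muP] : forall a : A, exists l, flim U (fun m => corner eps (coord m a)) l.
  move=> a; apply: (@ultra_flim R U _ (cnorm a)) => m; apply: le_trans (corner_le _ _) _.
  exact: (lnorm_ge (val a) m).
by exists mu.
Qed.

Lemma corner_asym_trace eps (a c : A) :
  flim U (fun m => corner eps (m := m) (coord m (a * c)) - corner eps (m := m) (coord m (c * a))) 0.
Proof.
move=> r r0; apply: Uoo.
have [k k0 ck] : exists2 k : R, 0 <= k & forall m, opnorm (coord m c) <= k.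
  by exists (cnorm c); [exact: cnorm_ge0|move=> m; exact: (lnorm_ge (val c) m)].
have v := @defect_vanishes R G d b pi J R1 R1_b d01 dR eps (val a) (val_gen a).
have k8 : 0 <= 8 * k ^+ 2 := mulr_ge0 (ler0n _ _) (sqr_ge0 k).
apply: filterS (vanishes_sqr k8 _ (fun m => comm_defect_ge0 eps (coord m a)) _ v r0) => [m /=|m|m].
- by rewrite subr0; apply.
- exact: cabs_ge0.
have [/(_ m) [_ mul _ _] _ _] := @coord_norming R G d b pi J.
rewrite !mul; apply: (le_trans (comm_defect_trace R1_b d01 eps (coord m a) (coord m c))).
apply: ler_wpM2r; first exact: comm_defect_ge0.
apply: ler_wpM2l; first exact: ler0n.
by rewrite ler_pXn2r ?nnegrE ?opnorm_ge0 //; exact: ck.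
Qed.

End CornerTraces.

Section TauTraces.
Context {R : realType} {d : nat -> nat} {b : nat}.
Local Notation C := R[i].
Local Notation E m := (Eidx d b m).
Variable R1 : R.
Hypothesis R1_b : 0 <= R1 < b%:R.
Hypothesis d01 : d 0%N = 1%N.
Variables (B : cstarAlgType R) (phi : forall m, B -> 'M[C]_#|E m|).
Hypothesis phiN : norming_reps phi.
Hypothesis B_sep : norm_separable B.
Variable U : set_system nat.
Hypothesis ultraU : UltraFilter U.
Hypothesis Uoo : \oo `<=` U.
Let PU : ProperFilter U := @ultra_proper _ _ ultraU.
Variable mu1 : B -> C.
Hypothesis mu1_lim : forall a, flim U (fun m => corner false (phi m a)) (mu1 a).
Hypothesis mu1_asym : forall a c,
  flim U (fun m => corner false (phi m (a * c)) - corner false (phi m (c * a))) 0.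

Let rep m : matrix_rep (@phi m). Proof. by have [] := phiN. Qed.
Let fd m : fd_trace (fun a => ntr (phi m a)).
Proof. by exists #|E m|, (@phi m); split=> //; exact: Eidx_gt0 R1_b d01 m. Qed.

(** Each coordinate i < m keeps the fixed weight 2^-(i+1), which makes the limit faithful; the
    leftover weight 2^-m goes to coordinate 0 so that the total mass is 1. *)
Definition spread m a : C := \sum_(i < m) 2^-1 ^+ i.+1 * ntr (phi i a) + 2^-1 ^+ m * ntr (phi 0 a).

(** The normalised trace on B(E_m) is the mean of the two corners, so this functional dominates a
    quarter of the copy-0 corner on positive elements: the origin of the coefficient 1/4. *)
Definition tmix m a : C := 2^-1 * ntr (phi m a) + 2^-1 * spread m a.

Lemma spread_fd m : fd_trace (spread m).
Proof. exact: (fd_trace_mix m fd (fd 0)). Qed.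

Lemma tmix_fd m : fd_trace (tmix m).
Proof. exact: fd_trace_avg (fd m) (spread_fd m). Qed.

Lemma half_expr_ge0 k : 0 <= 2^-1 ^+ k :> C.
Proof. by rewrite exprn_ge0 // invr_ge0. Qed.

Lemma spread_ge m i x : (i < m)%N -> (forall k, 0 <= ntr (phi k x)) ->
  2^-1 ^+ i.+1 * ntr (phi i x) <= spread m x.
Proof.
move=> im x0; rewrite /spread (bigD1 (Ordinal im)) //= -addrA lerDl.
apply: addr_ge0; last by apply: mulr_ge0; [exact: half_expr_ge0|exact: x0].
by apply: sumr_ge0 => k _; apply: mulr_ge0; [exact: half_expr_ge0|exact: x0].
Qed.

Lemma Re_le (x y : C) : x <= y -> complex.Re x <= complex.Re y.
Proof. by case: x y => ? ? [? ?]; rewrite lecE /= => /andP[]. Qed.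

Lemma ntr_gram n (M : 'M[C]_n) : complex.Re (ntr (M^t* *m M)) = n%:R^-1 * nsq M.
Proof.
rewrite /ntr mxtrace_mulC -/(cip M M) cip_nsq -(rmorph_nat (real_complex R)) -fmorphV.
by rewrite -rmorphM.
Qed.

Lemma third_trace_pos (t x0 x1 s : C) : 4 * t = x0 + x1 + 2 * s -> 0 <= x1 -> 0 <= s ->
  0 <= 3^-1 * (4 * t - x0).
Proof.
move=> -> h1 h2; rewrite mulr_ge0 ?invr_ge0 // addrAC [x0 + x1]addrC addrK.
by rewrite addr_ge0 // mulr_ge0.
Qed.

Lemma third_scalar (c t t' x x' : C) :
  3^-1 * (4 * (c * t + t') - (c * x + x')) = c * (3^-1 * (4 * t - x)) + 3^-1 * (4 * t' - x').
Proof. by ring. Qed.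

Lemma four_mix (x y s : C) : 4 * (2^-1 * (2^-1 * x + 2^-1 * y) + 2^-1 * s) = x + y + 2 * s.
Proof. by field. Qed.

Lemma qd_decomposition : exists tau mu2 : B -> C,
  [/\ qd_trace tau /\ faithful_trace tau, tracial_state mu2 &
      forall a, tau a = 1 / 4 * mu1 a + 3 / 4 * mu2 a].
Proof.
have /choice[tau tauP] : forall a, exists l, flim U (fun m => tmix m a) l.
  move=> a; apply: (@ultra_flim R U _ (cnorm a)) => m.
  by apply: (fd_trace_le phiN); exact: tmix_fd.
(* mu2 is forced to be (4 tau - mu1) / 3. It is positive since 4 [tmix] minus the copy-0 corner
   equals the copy-1 corner plus 2 [spread]. *)
exists tau, (fun a => 3^-1 * (4 * tau a - mu1 a)).
have pos m a : 0 <= ntr (phi m (star a * a)).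
  by have [_ + _ _] := fd_trace_tracial (fd m); apply.
split; first split.
- exact: (qd_limit phiN PU B_sep tmix_fd tauP).
- move=> a ta; apply/cnorm_eq0/eqP; rewrite eq_le cnorm_ge0 andbT.
  have [_ _] := phiN; apply=> i.
  have [lin mul st _] := rep i.
  suff -> : phi i a = 0 by rewrite -(scale0r (0 : 'M[C]_#|E i|)) opnormZ (_ : cabs 0 = 0) ?mul0r // cabs0.
  apply: nsq_eq0; apply/eqP; rewrite eq_le nsq_ge0 andbT.
  (* From stage i + 1 on, coordinate i has a constant positive weight, so tau(a^* a) = 0 annihilates
     the Hilbert-Schmidt norm of [phi i a]. *)
  have h : complex.Re (2^-1 * (2^-1 ^+ i.+1 * ntr (phi i (star a * a)))) <= complex.Re (tau (star a * a)).
    apply: (flim_Re_ge PU (tauP _)); apply: Uoo; exists i.+1 => // m /= im.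
    apply: Re_le; rewrite /tmix -[leLHS]add0r; apply: lerD.
      by rewrite mulr_ge0 // invr_ge0.
    by rewrite ler_wpM2l ?invr_ge0 //; exact: spread_ge.
  move: h; rewrite ta mul st mulrA -exprS.
  have -> : (2^-1 ^+ i.+2 : C) = (2^-1 ^+ i.+2)%:C%C by rewrite rmorphXn fmorphV rmorph_nat.
  rewrite ReMr ntr_gram mulrA pmulr_rle0 // mulr_gt0 ?invr_gt0 ?exprn_gt0 ?invr_gt0 //.
  by rewrite ltr0n (Eidx_gt0 R1_b d01).
- have tt m := fd_trace_tracial (tmix_fd m).
  apply: (flim_tracial PU (t := fun m a => 3^-1 * (4 * tmix m a - corner false (phi m a)))).
  + by move=> a; apply: flimZ; apply: flimB => //; apply: flimZ; exact: tauP.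
  + move=> m c a a'; have [tl _ _ _] := tt m; have [lin _ _ _] := rep m.
    rewrite tl lin corner_scalar; exact: third_scalar.
  + move=> m a; have [lin mul st _] := rep m.
    apply: (third_trace_pos (x1 := corner true (phi m (star a * a))) (s := spread m (star a * a))).
    * by rewrite /tmix (ntr_corner R1_b d01); exact: four_mix.
    * by rewrite mul st corner_pos lecE /= eqxx divr_ge0 ?nsq_ge0.
    * by have [_ + _ _] := fd_trace_tracial (spread_fd m); apply.
  + move=> m; have [_ _ t1 _] := tt m; have [_ _ _ p1] := rep m.
    by rewrite t1 p1 (corner1 R1_b d01); field.
  + move=> a c; have h := flimZ PU (- 3^-1) (mu1_asym a c); rewrite mulr0 in h.
    apply: (eq_ind _ (fun f => flim U f 0) h); apply/funext => m.
    by have [_ _ _ ->] := tt m; ring.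
by move=> a; field.
Qed.

End TauTraces.

Theorem theorem1p1 (R : realType) (G : groupType)
    (d : nat -> nat) (pi : forall k, G -> 'M[R[i]]_(d k)) :
  infinite_set [set: G] ->
  countable [set: G] ->
  residually_finite G ->
  property_T R G ->
  lists_irreps pi ->
  d 0%N = 1%N ->
  (forall g, pi 0%N g = 1%:M) ->
  (forall k, (d k <= d k.+1)%N) ->
  (forall n, exists k0, forall k, (k0 <= k)%N -> (n <= d k)%N) ->
  let R0 := ereal_sup (range (fun k => ((d k.+1)%:R / (d k)%:R : R)%:E)) in
  (R0 < +oo)%E ->
  forall (b : nat) (J : forall k, 'M[R[i]]_(d k.+1, d k)),
  (R0 < (b%:R : R)%:E)%E ->
  (forall k, (J k)^t* *m J k = 1%:M) ->
  let A := algA pi J b in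
  [/\ norm_separable A,
      (exists u : A, forall a : A, u * a = a /\ a * u = a),
      residually_finite_dimensional A,
      (exists tau mu1 mu2 : A -> R[i],
         [/\ qd_trace tau /\ faithful_trace tau,
             tracial_state mu1,
             tracial_state mu2,
             (forall a, tau a = 1 / 4 * mu1 a + 3 / 4 * mu2 a) &
             ~ qd_trace mu1]) &
      ~ is_face (@qd_trace R A)].
Proof.
move=> _ G_countable _ T_G irr d01 _ d_mono d_large R0 _ b J R0b JJ A.
pose R1 := fine R0.
have ratio_le k : (((d k.+1)%:R / (d k)%:R : R)%:E <= R0)%E.
  by apply: ereal_sup_ubound; exists k.
(* The supremum is finite: it lies above the first ratio and below b. *)
have R0E : R0 = R1%:E.
  rewrite fineK // fin_numE; apply/andP; split; apply/eqP => R0inf.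
    by have := ratio_le 0%N; rewrite R0inf leeNy_eq.
  by move: R0b; rewrite R0inf.
have R1b : R1 < b%:R by rewrite -lte_fin -R0E.
have d_pos k : 0 < (d k)%:R :> R by rewrite ltr0n (d_gt0 irr).
have dR k : (d k.+1)%:R <= R1 * (d k)%:R :> R.
  by rewrite -ler_pdivrMr // -lee_fin -R0E.
have R1_ge1 : 1 <= R1.
  rewrite -lee_fin -R0E; apply: le_trans (ratio_le 0%N).
  by rewrite lee_fin ler_pdivlMr // mul1r ler_nat.
have R1_b : 0 <= R1 < b%:R by rewrite R1b (le_trans ler01).
have piU k : unitary_mxrep (pi k) by have [/(_ k) []] := irr.
have phiN := @coord_norming R G d b pi J.
have [eE [sG [TE [sE [phE phG phT phs]]]]] := @algA_generators R G d b pi J piU JJ.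
have [U [ultraU Uoo]] := @ultraFilterLemma _ (\oo : set_system nat) _.
have A_sep : norm_separable A by exact: algA_separable.
have [mu1 mu1_lim] := @corner_limit_exists R G d b pi J R1 R1_b d01 U ultraU false.
have mu1_asym (a c : A) :
    flim U (fun m => corner false (coord m (a * c)) - corner false (coord m (c * a))) 0.
  exact: (corner_asym_trace R1_b d01 dR Uoo).
have [tau [mu2 [[tau_qd tau_faithful] mu2_tr tauE]]] :=
  qd_decomposition R1_b d01 phiN A_sep ultraU Uoo mu1_lim mu1_asym.
have PU : ProperFilter U := @ultra_proper _ _ ultraU.
have mu1_tr : tracial_state mu1.
  apply: (flim_tracial PU mu1_lim) => [m c a a'|m a|m|].
  - have [/(_ m) [lin _ _ _] _ _] := phiN; rewrite lin; exact: corner_scalar.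
  - have [/(_ m) [_ mul phist _] _ _] := phiN.
    by rewrite mul phist corner_pos lecE /= eqxx divr_ge0 ?nsq_ge0.
  - have [/(_ m) [_ _ _ one] _ _] := phiN; rewrite one; exact: corner1 R1_b d01 _ _.
  - exact: mu1_asym.
(* This is the lower bound for the proportion of invariant vectors in copy 0, and the only place
   where R0 < b must be strict for the contradiction. *)
have Z0 : 0 < 1 - R1 / b%:R.
  by rewrite subr_gt0 ltr_pdivrMr ?mul1r // (le_lt_trans _ R1b) // (le_trans ler01).
have mu1_nqd : ~ qd_trace mu1.
  apply: (not_qd irr T_G JJ R1_ge1 dR _ d01 phiN phE phG phT phs Z0).
  - by move=> n; have [k0 /(_ k0 (leqnn k0)) h] := d_large n; exists k0.
  - move=> K j; apply: (flim_Re_ge PU (mu1_lim _)); apply: (@filterS _ U _ setT); last exact: filterT.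
    move=> m _ /=.
    have D0 : 0 < (dimL (d := d) (b := b) m)%:R :> R.
      by rewrite ltr0n dimL_gt0 // -(ltr0n R) (le_lt_trans _ R1b) // (le_trans ler01).
    have -> : complex.Re (corner false (coord m (fixed_power pi K eE sG j))) =
      (dimL (d := d) (b := b) m)%:R^-1 * complex.Re (\tr (e_op R d b false m *m coord m (fixed_power pi K eE sG j))).
      by rewrite /corner mulrC -(rmorph_nat (real_complex R)) -fmorphV ReMr.
    rewrite ler_pdivlMl // mulrC; apply: le_trans (dimL_bound m R1_b d01 dR) _.
    exact: tr_fixed_power.
  - apply: (flim_unique PU (mu1_lim _)).
    rewrite (_ : (fun m => _) = fun=> 0); first exact: flim_const.
    by apply/funext => m; rewrite phE corner_e_other.
split=> //.
- exact: algA_unital.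
- exact: algA_rfd.
- by exists tau, mu1, mu2; split.
(* Applied to tau with t = 1/4, the face property would make mu1 quasidiagonal. *)
move=> [_ _ face].
have t01 : 0 < (4^-1 : R) < 1 by rewrite invr_gt0 ltr0n /= invf_lt1 ?ltr1n.
have [] := face 4^-1 mu1 mu2 t01 mu1_tr mu2_tr; last by move/mu1_nqd.
rewrite (_ : (fun a => _) = tau) //; apply/funext => a; rewrite tauE.
by rewrite rmorphB rmorph1 fmorphV rmorph_nat; field.
Qed.
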